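(* Let $M:\mathbf{SymplGpd}_{\mathrm{mic}}^{\mathrm{ext}}\to\mathbf{Mon}(\mathbf{Sympl}_{\mathrm{mic}}^{\mathrm{ext}})$ be the functor from the category of symplectic microgroupoids and lagrangian submicrogroupoids to the category of monoids in the microsymplectic category which sends a symplectic microgroupoid $[G,A]\rightrightarrows A$ with product $m$ to the monoid object $([G,A],\operatorname{gr}[m],e_A)$ and a morphism $([L],\phi)$ to the symplectic micromorphism $([L],\phi)$ regarded as a monoid morphism. Then $M$ is an equivalence of symmetric monoidal categories.
   Context: Notation. $\overline{M}$ is the symplectic manifold $M$ with the opposite symplectic form. For a smooth map $\phi:B\to A$, $\operatorname{gr}\phi=\{(\phi(b),b): b\in B\}\subset A\times B$. Microsymplectic category. A symplectic microfold $[M,A]$ is a germ of a symplectic manifold $M$ around a lagrangian submanifold $A\subset M$ (the core). A symplectic micromorphism $([V],\phi):[M,A]\to[N,B]$ consists of a smooth map $\phi:B\to A$ (the core map) and a germ $[V,\operatorname{gr}\phi]$ around $\operatorname{gr}\phi$ of a lagrangian submanifold $V\subset\overline{M}\times N$ such that, for a suitable representative, $V\cap(A\times B)=\operatorname{gr}\phi$ and the intersection is clean ($TV\cap T(A\times B)=T\operatorname{gr}\phi$ along $\operatorname{gr}\phi$). Composition of $([V],\phi):[M,A]\to[N,B]$ and $([W],\psi):[N,B]\to[P,C]$ is $([W\circ V],\phi\circ\psi)$, with $W\circ V=\{(m,p):\exists\, n,\ (m,n)\in V,\ (n,p)\in W\}$ computed on suitable representatives near the cores (known to be well defined). This category, $\mathbf{Sympl}_{\mathrm{mic}}^{\mathrm{ext}}$,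 is symmetric monoidal with $[M,A]\otimes[N,B]=[M\times N,A\times B]$ and $([V],\phi)\otimes([W],\psi)=([V\otimes W],\phi\times\psi)$, where $V\otimes W$ is $V\times W$ with the two middle factors permuted; the symmetries are the germs of graphs of the factor permutations; the unit $E$ is the one-point symplectic manifold $T^*\{\star\}$. For every $[M,A]$ there is exactly one symplectic micromorphism $E\to[M,A]$, namely $([\{\star\}\times A],pr_A)$ with $pr_A:A\to\{\star\}$. Symplectic microgroupoids. A local groupoid $G\rightrightarrows A$ is a manifold $G$ containing $A$ as a submanifold (the units) with groupoid structure maps defined only near $A$: smooth submersions $s,t:G\to A$ restricting to the identity on $A$, a smooth product $m$ defined on an open neighborhood of $\{(a,a):a\in A\}$ in $\{(g,h):t(g)=s(h)\}$, and a smooth inverse $i$ defined near $A$, satisfying the groupoid axioms for elements sufficiently close to $A$: $s(m(g,h))=s(g)$, $t(m(g,h))=t(h)$, $m(s(g),g)=g=m(g,t(g))$, associativity, $s(i(g))=t(g)$, $t(i(g))=s(g)$, $m(g,i(g))=s(g)$, $m(i(g),g)=t(g)$. It is symplectic if $G$ is a symplectic manifold and the graph of $m$ is a lagrangian submanifold of $\overline{G}\times\overline{G}\times G$; then $A$ is lagrangian in $G$. A (symplectic) microgroupoid $[G,A]\rightrightarrows A$ is an equivalence class of local (symplectic) groupoids over $A$, two being equivalent if they coincide on a neighborhood of $A$. A lagrangian submicrogroupoid $[L,C]\rightrightarrows C$ of $[G,A]\rightrightarrows A$ is a germ around a submanifold $C\subset A$ of a lagrangian submanifold $L\subset G$ containing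 $C$ that is a local subgroupoid with unit space $C$: for a suitable representative, $s(L)\subset C$, $t(L)\subset C$, and $L$ is closed under product and inverse near $C$. Products and the dual $[\overline{G},A]\rightrightarrows A$ (same structure maps, opposite symplectic form) are the evident ones. The category $\mathbf{SymplGpd}_{\mathrm{mic}}^{\mathrm{ext}}$ has symplectic microgroupoids as objects; a morphism from $[G,A]\rightrightarrows A$ to $[H,B]\rightrightarrows B$ is a symplectic micromorphism $([L],\phi):[G,A]\to[H,B]$ such that $[L,\operatorname{gr}\phi]\rightrightarrows\operatorname{gr}\phi$ is a lagrangian submicrogroupoid of $[\overline{G}\times H,A\times B]\rightrightarrows A\times B$. Composition is that of symplectic micromorphisms. It is symmetric monoidal under the product of microgroupoids and the tensor product of symplectic micromorphisms, with the symmetries given by factor permutations and unit the trivial microgroupoid $E\rightrightarrows\{\star\}$. Monoids. A monoid object in a monoidal category with unit $E$ is $(C,\mu,e)$ with $\mu:C\otimes C\to C$ and $e:E\to C$ satisfying $\mu\circ(\mu\otimes\mathrm{id})=\mu\circ(\mathrm{id}\otimes\mu)$ and $\mu\circ(e\otimes\mathrm{id})=\mathrm{id}=\mu\circ(\mathrm{id}\otimes e)$. A monoid morphism $T:(C,\mu_C,e_C)\to(D,\mu_D,e_D)$ is a morphism $T:C\to D$ with $T\circ\mu_C=\mu_D\circ(T\otimes T)$ and $T\circ e_C=e_D$. In a symmetric monoidal category $\mathcal{C}$ with symmetries $\epsilon$, the monoids form a symmetric monoidal category $\mathbf{Mon}(\mathcal{C})$ with $(C,\mu_C,e_C)\otimes(D,\mu_D,e_D)=(C\otimes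 D,(\mu_C\otimes\mu_D)\circ(\mathrm{id}_C\otimes\epsilon_{D,C}\otimes\mathrm{id}_D),e_C\otimes e_D)$, where $\epsilon_{D,C}:D\otimes C\to C\otimes D$, and with the tensor product of underlying morphisms. The monoid of a microgroupoid. For a symplectic microgroupoid $[G,A]\rightrightarrows A$ with product $m$, $\operatorname{gr}[m]:=([\operatorname{gr}m],\Delta_A):[G,A]\otimes[G,A]\to[G,A]$, where $\operatorname{gr}m=\{(g,h,m(g,h))\}\subset\overline{G}\times\overline{G}\times G$ and $\Delta_A:A\to A\times A$ is the diagonal map; $e_A=([\{\star\}\times A],pr_A):E\to[G,A]$ is the unique symplectic micromorphism from the unit object. *)

(* Defs.v *)
From HB Require Import structures.
From mathcomp Require Import all_boot all_order all_algebra.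
From mathcomp Require Import all_classical all_reals all_analysis.

Set Implicit Arguments.
Unset Strict Implicit.
Unset Printing Implicit Defensive.

Import Order.TTheory GRing.Theory Num.Theory numFieldNormedType.Exports.
Local Open Scope classical_set_scope.
Local Open Scope ring_scope.

(* Manifolds and monoidal categories are set up here from scratch.  Every
   structure is split into raw data (a record whose name starts with "pre")
   and a predicate saying that these data form a manifold, a microfold, a
   category, and so on.  Operations (products, composites, etc) are defined on
   all raw data, and the fact that they preserve validity is part of
   predicates such as [is_smc]. *)

Definition partial {R : realType} {m : nat} (j : 'I_m) (f : 'rV[R]_m -> R) :
  'rV[R]_m -> R := fun x => 'D_(delta_mx 0 j) f x.

Fixpoint Ck {R : realType} {m : nat} (k : nat) (O : set 'rV[R]_m)
    (f : 'rV[R]_m -> R) : Prop :=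
  (forall x, O x -> {for x, continuous f}) /\
  if k is k'.+1 then
    forall j, (forall x, O x -> derivable f x (delta_mx 0 j)) /\
              Ck k' O (partial j f)
  else True.

Definition smooth_on {R : realType} {m n : nat} (O : set 'rV[R]_m)
    (F : 'rV[R]_m -> 'rV[R]_n) : Prop :=
  forall (j : 'I_n) k, Ck k O (fun x => F x 0 j).

Definition smooth_at {R : realType} {m n : nat} (x : 'rV[R]_m)
    (F : 'rV[R]_m -> 'rV[R]_n) : Prop :=
  exists O : set 'rV[R]_m, [/\ open O, O x & smooth_on O F].

Definition smooth_curve {R : realType} {n : nat} (c : R -> 'rV[R]_n) : Prop :=
  exists2 e : R, 0 < e &
    forall k (t : R), `|t| < e -> derivable (derive1n k c) t 1.

(* Coordinates are row vectors; [mcoord i] is meaningful on [mdom i] only. *)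
Record premanifold (R : realType) := PreManifold {
  mcar :> topologicalType;
  mdim : nat;
  mchart : Type;
  mdom : mchart -> set mcar;
  mcoord : mchart -> mcar -> 'rV[R]_mdim }.
Arguments mdom {R M} _ : rename.
Arguments mcoord {R M} _ _ : rename.

(* The last clause applies to (i, j) and (j, i), so transition maps are
   diffeomorphisms. *)
Definition is_manifold {R : realType} (M : premanifold R) : Prop :=
  [/\ hausdorff_space M /\ @second_countable M,
      forall x : M, exists i : mchart M, mdom i x,
      forall i : mchart M, open (mdom i),
      forall i : mchart M,
        [/\ {in mdom i &, injective (mcoord i)},
            forall x, mdom i x -> {for x, continuous (mcoord i)} &
            forall U, open U -> U `<=` mdom i -> open (mcoord i @` U)] &
      forall (i j : mchart M) (x : M), mdom i x -> mdom j x ->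
        exists T, smooth_at (mcoord i x) T /\
          \forall y \near x, mcoord j y = T (mcoord i y)].

(* Smoothness of a map defined on an arbitrary subset S: it extends locally to
   a smooth map of the ambient manifolds. *)
Definition smooth_map {R : realType} {M N : premanifold R} (S : set M)
    (f : S -> N) : Prop :=
  forall (x : S) (i : mchart M) (j : mchart N),
    mdom i (val x) -> mdom j (f x) ->
    exists F, smooth_at (mcoord i (val x)) F /\
      \forall z \near val x, forall y : S, val y = z ->
        mdom j (f y) /\ mcoord j (f y) = F (mcoord i z).

(* Embedded submanifold of dimension k: near each of its points, S is the
   common zero set of dim M - k coordinates in a local chart F (with inverse
   Finv) compatible with the atlas. *)
Definition is_submanifold {R : realType} {M : premanifold R} (k : nat)
    (S : set M) : Prop :=
  forall (x : M) (i : mchart M), S x -> mdom i x ->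
  exists (O : set 'rV[R]_(mdim M)) (F Finv : 'rV[R]_(mdim M) -> 'rV[R]_(mdim M))
         (J : {set 'I_(mdim M)}),
    [/\ open O /\ O (mcoord i x),
        smooth_on O F,
        open (F @` O) /\ smooth_on (F @` O) Finv,
        forall u, O u -> Finv (F u) = u &
        #|J| = k /\
        \forall y \near x,
          S y <-> forall j, j \notin J -> F (mcoord i y) 0 j = 0].

(* T_x S, read in the chart i: the velocities at x of the smooth curves
   running in S. *)
Definition tangent {R : realType} {M : premanifold R} (i : mchart M)
    (S : set M) (x : M) : set 'rV[R]_(mdim M) :=
  [set v | exists c : R -> 'rV[R]_(mdim M),
    [/\ smooth_curve c, c 0 = mcoord i x, 'D_1 c 0 = v &
        \forall t \near (0 : R),
          exists y, [/\ S y, mdom i y & mcoord i y = c t]]].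

Definition clean_along {R : realType} {M : premanifold R} (V Z C : set M) :
  Prop :=
  forall (x : M) (i : mchart M), C x -> mdom i x ->
    tangent i V x `&` tangent i Z x = tangent i C x.

(* f, with values in the submanifold B, is a submersion as a map to B:
   T_x M -> T_(f x) B is onto at every x. *)
Definition submersion_to {R : realType} {M N : premanifold R} (f : M -> N)
    (B : set N) : Prop :=
  forall (x : M) (i : mchart M) (j : mchart N), mdom i x -> mdom j (f x) ->
  forall F, smooth_at (mcoord i x) F ->
    (\forall y \near x, mcoord j (f y) = F (mcoord i y)) ->
    forall v, tangent j B (f x) v -> exists u, 'D_u F (mcoord i x) = v.

Definition mprod {R : realType} (M N : premanifold R) : premanifold R :=
  @PreManifold R (mcar M * mcar N)%type (mdim M + mdim N)
    (mchart M * mchart N)%type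
    (fun i => mdom i.1 `*` mdom i.2)
    (fun i x => row_mx (mcoord i.1 x.1) (mcoord i.2 x.2)).

Definition mpoint (R : realType) : premanifold R :=
  @PreManifold R 'rV[R]_0 0 unit (fun _ => setT) (fun _ x => x).

(* [form i x] is the matrix of the 2-form at x in the chart i: it maps a pair
   (u, v) of tangent vectors to the 1x1 matrix u *m form i x *m v^T. *)
Record presymplectic (R : realType) := PreSymplectic {
  smfd :> premanifold R;
  form : mchart smfd -> smfd -> 'M[R]_(mdim smfd) }.
Arguments form {R M} _ _ : rename.

Definition is_symplectic {R : realType} (M : presymplectic R) : Prop :=
  [/\ is_manifold M,
      forall (i : mchart M) x, mdom i x ->
        (form i x)^T = - form i x /\ form i x \in unitmx,
      forall (i j : mchart M) x T, mdom i x -> mdom j x ->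
        smooth_at (mcoord i x) T ->
        (\forall y \near x, mcoord j y = T (mcoord i y)) ->
        forall u v, u *m form i x *m v^T =
          'D_u T (mcoord i x) *m form j x *m ('D_v T (mcoord i x))^T &
      forall (i : mchart M) x, mdom i x ->
        exists w : 'rV[R]_(mdim M) -> 'M[R]_(mdim M),
          [/\ forall a, smooth_at (mcoord i x) (fun z => row a (w z)),
              \forall y \near x, form i y = w (mcoord i y) &
              forall a b c,
                partial a (fun z => w z b c) (mcoord i x) +
                partial b (fun z => w z c a) (mcoord i x) +
                partial c (fun z => w z a b) (mcoord i x) = 0]].

Definition is_lagrangian {R : realType} {M : presymplectic R} (L : set M) :
  Prop :=
  exists2 k, mdim M = k.*2 & is_submanifold k L /\
    forall (x : M) (i : mchart M) u v, L x -> mdom i x ->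
      tangent i L x u -> tangent i L x v -> u *m form i x *m v^T = 0.

Definition sopp {R : realType} (M : presymplectic R) : presymplectic R :=
  @PreSymplectic R (smfd M) (fun i x => - form i x).

Definition sprod {R : realType} (M N : presymplectic R) : presymplectic R :=
  @PreSymplectic R (mprod M N)
    (fun i x => block_mx (form i.1 x.1) 0 0 (form i.2 x.2)).

Definition spoint (R : realType) : presymplectic R :=
  @PreSymplectic R (mpoint R) (fun _ _ => 0).

Definition onbhd {T : topologicalType} (X U : set T) : Prop :=
  open U /\ X `<=` U.

Definition germ_eq {T : topologicalType} (X V W : set T) : Prop :=
  exists2 U, onbhd X U & V `&` U = W `&` U.

(* The germ of V around X, as the class of all its representatives. *)
Definition germ {T : topologicalType} (X V : set T) : set (set T) :=
  [set W | germ_eq X V W].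

(* W o V for relations V from S to T and W from T to U. *)
Definition rel_comp {S T U : Type} (W : set (T * U)) (V : set (S * T)) :
  set (S * U) := [set p | exists n, V (p.1, n) /\ W (n, p.2)].

Definition rel_prod {S T S' T' : Type} (V : set (S * T)) (V' : set (S' * T')) :
  set ((S * S') * (T * T')) :=
  [set p | V (p.1.1, p.2.1) /\ V' (p.1.2, p.2.2)].

(* Objects are representatives (M, A) of microfolds [M, A].  Morphisms are germs
   around subsets of the cores, so that two representatives of the same
   microfold are canonically isomorphic. *)
Record premicrofold (R : realType) := PreMicrofold {
  mfspace :> presymplectic R;
  core : set mfspace }.
Arguments core {R} _ _.

Definition is_microfold {R : realType} (X : premicrofold R) : Prop :=
  is_symplectic X /\ is_lagrangian (core X).

Record premicro {R : realType} (X Y : premicrofold R) := PreMicro {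
  coremap : core Y -> core X;
  mgerm : set (set (X * Y)) }.
Arguments coremap {R X Y} _ _.
Arguments mgerm {R X Y} _.

Definition gr {R : realType} {X Y : premicrofold R} (phi : core Y -> core X) :
  set (X * Y) := [set p | exists b : core Y, p = (val (phi b), val b)].

Definition is_micro {R : realType} {X Y : premicrofold R} (f : premicro X Y) :
  Prop :=
  @smooth_map R Y X (core Y) (fun b => val (coremap f b)) /\
  exists V : set (X * Y),
    [/\ @is_lagrangian R (sprod (sopp X) Y) V,
        mgerm f = germ (gr (coremap f)) V,
        V `&` (core X `*` core Y) = gr (coremap f) &
        @clean_along R (mprod X Y) V (core X `*` core Y) (gr (coremap f))].

Definition micro_id {R : realType} (X : premicrofold R) : premicro X X :=
  PreMicro id (germ (gr id) [set p | p.1 = p.2]).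

(* The composite germ is the common germ of the relational composites of all
   sufficiently small restrictions of representatives. *)
Definition micro_comp {R : realType} {X Y Z : premicrofold R}
    (g : premicro Y Z) (f : premicro X Y) : premicro X Z :=
  let phi := coremap f \o coremap g in
  PreMicro phi
    [set L | exists V W, mgerm f V /\ mgerm g W /\
       exists U0 U0', onbhd (gr (coremap f)) U0 /\ onbhd (gr (coremap g)) U0' /\
       forall U U', onbhd (gr (coremap f)) U -> onbhd (gr (coremap g)) U' ->
         U `<=` U0 -> U' `<=` U0' ->
         germ_eq (gr phi) L (rel_comp (W `&` U') (V `&` U))].

Definition mfprod {R : realType} (X Y : premicrofold R) : premicrofold R :=
  @PreMicrofold R (sprod X Y) (core X `*` core Y).

Definition mfunit (R : realType) : premicrofold R :=
  @PreMicrofold R (spoint R) setT.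

Definition subset_map {S T : Type} {A : set S} {B : set T} (f : S -> T)
    (fAB : forall x, A x -> B (f x)) (a : A) : B :=
  exist _ (f (val a)) (mem_set (fAB _ (set_mem (valP a)))).

Definition core_fst {R : realType} {X Y : premicrofold R}
  (b : core (mfprod X Y)) : core X :=
  @subset_map (X * Y)%type X (core X `*` core Y) (core X) fst
    (fun _ h => proj1 h) b.

Definition core_snd {R : realType} {X Y : premicrofold R}
  (b : core (mfprod X Y)) : core Y :=
  @subset_map (X * Y)%type Y (core X `*` core Y) (core Y) snd
    (fun _ h => proj2 h) b.

Definition core_pair {R : realType} {X Y : premicrofold R}
    (a : core X) (b : core Y) : core (mfprod X Y) :=
  exist _ (val a, val b)
    (mem_set (conj (set_mem (valP a)) (set_mem (valP b)))).

Definition micro_tens {R : realType} {X Y X' Y' : premicrofold R}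
    (f : premicro X Y) (f' : premicro X' Y') :
    premicro (mfprod X X') (mfprod Y Y') :=
  let phi := fun b : core (mfprod Y Y') =>
    core_pair (coremap f (core_fst b)) (coremap f' (core_snd b)) in
  @PreMicro R (mfprod X X') (mfprod Y Y') phi
    [set L | exists V V', [/\ mgerm f V, mgerm f' V' &
       germ_eq (gr phi) L (rel_prod V V')]].

(* The germ of the graph of a symplectomorphism F whose inverse G maps the
   core of Y to the core of X. *)
Definition micro_graph {R : realType} {X Y : premicrofold R}
    (F : X -> Y) (G : Y -> X) (GA : forall y, core Y y -> core X (G y)) :
    premicro X Y :=
  let phi := @subset_map Y X (core Y) (core X) G GA in
  PreMicro phi (germ (gr phi) [set p | p.2 = F p.1]).

Definition micro_assoc {R : realType} (X Y Z : premicrofold R) :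
    premicro (mfprod (mfprod X Y) Z) (mfprod X (mfprod Y Z)) :=
  @micro_graph R (mfprod (mfprod X Y) Z) (mfprod X (mfprod Y Z))
    (fun p => (p.1.1, (p.1.2, p.2))) (fun p => ((p.1, p.2.1), p.2.2))
    (fun _ h => conj (conj (proj1 h) (proj1 (proj2 h))) (proj2 (proj2 h))).

Definition micro_assocV {R : realType} (X Y Z : premicrofold R) :
    premicro (mfprod X (mfprod Y Z)) (mfprod (mfprod X Y) Z) :=
  @micro_graph R (mfprod X (mfprod Y Z)) (mfprod (mfprod X Y) Z)
    (fun p => ((p.1, p.2.1), p.2.2)) (fun p => (p.1.1, (p.1.2, p.2)))
    (fun _ h => conj (proj1 (proj1 h)) (conj (proj2 (proj1 h)) (proj2 h))).

Definition micro_lunit {R : realType} (X : premicrofold R) :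
    premicro (mfprod (mfunit R) X) X :=
  @micro_graph R (mfprod (mfunit R) X) X snd (fun x => (0, x))
    (fun _ h => conj I h).

Definition micro_lunitV {R : realType} (X : premicrofold R) :
    premicro X (mfprod (mfunit R) X) :=
  @micro_graph R X (mfprod (mfunit R) X) (fun x => (0, x)) snd
    (fun _ h => proj2 h).

Definition micro_runit {R : realType} (X : premicrofold R) :
    premicro (mfprod X (mfunit R)) X :=
  @micro_graph R (mfprod X (mfunit R)) X fst (fun x => (x, 0))
    (fun _ h => conj h I).

Definition micro_runitV {R : realType} (X : premicrofold R) :
    premicro X (mfprod X (mfunit R)) :=
  @micro_graph R X (mfprod X (mfunit R)) (fun x => (x, 0)) fst
    (fun _ h => proj1 h).

Definition micro_braid {R : realType} (X Y : premicrofold R) :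
    premicro (mfprod X Y) (mfprod Y X) :=
  @micro_graph R (mfprod X Y) (mfprod Y X)
    (fun p => (p.2, p.1)) (fun p => (p.2, p.1))
    (fun _ h => conj (proj2 h) (proj1 h)).

Definition micro_e {R : realType} (X : premicrofold R) :
    premicro (mfunit R) X :=
  let pr := fun _ : core X =>
    exist _ 0 (mem_set I) : core (mfunit R) in
  PreMicro pr (germ (gr pr) (setT `*` core X)).

(* The objects of the category are the x with [isob x], its morphisms the f
   with [ishom f].  [comp g f] is "g after f". *)
Record presmc := PreSMC {
  ob : Type;
  isob : ob -> Prop;
  hom : ob -> ob -> Type;
  ishom : forall x y, hom x y -> Prop;
  idm : forall x, hom x x;
  comp : forall x y z, hom y z -> hom x y -> hom x z;
  unit_ob : ob;
  tens : ob -> ob -> ob;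
  tensm : forall x y x' y', hom x y -> hom x' y' ->
    hom (tens x x') (tens y y');
  assoc : forall x y z, hom (tens (tens x y) z) (tens x (tens y z));
  assocV : forall x y z, hom (tens x (tens y z)) (tens (tens x y) z);
  lunit : forall x, hom (tens unit_ob x) x;
  lunitV : forall x, hom x (tens unit_ob x);
  runit : forall x, hom (tens x unit_ob) x;
  runitV : forall x, hom x (tens x unit_ob);
  braid : forall x y, hom (tens x y) (tens y x) }.
Arguments isob {C} _ : rename.
Arguments hom {C} _ _ : rename.
Arguments ishom {C x y} _ : rename.
Arguments idm {C} x : rename.
Arguments comp {C x y z} _ _ : rename.
Arguments unit_ob {C} : rename.
Arguments tens {C} _ _ : rename.
Arguments tensm {C x y x' y'} _ _ : rename.
Arguments assoc {C} x y z : rename.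
Arguments assocV {C} x y z : rename.
Arguments lunit {C} x : rename.
Arguments lunitV {C} x : rename.
Arguments runit {C} x : rename.
Arguments runitV {C} x : rename.
Arguments braid {C} x y : rename.

Declare Scope smc_scope.
Delimit Scope smc_scope with smc.
Notation "g \oc f" := (comp g f) (at level 50, left associativity) : smc_scope.
Notation "x \ox y" := (tens x y) (at level 40, left associativity) : smc_scope.
Notation "f \om g" := (tensm f g) (at level 40, left associativity) : smc_scope.
Local Open Scope smc_scope.

Definition inverses {C : presmc} {x y : ob C} (f : hom x y) (g : hom y x) :
  Prop := [/\ ishom f, ishom g, g \oc f = idm x & f \oc g = idm y].

Definition is_iso {C : presmc} {x y : ob C} (f : hom x y) : Prop :=
  exists g, inverses f g.

Definition is_category (C : presmc) : Prop :=
  [/\ forall x : ob C, isob x -> ishom (idm x),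
      forall (x y z : ob C) (g : hom y z) (f : hom x y),
        isob x -> isob y -> isob z -> ishom g -> ishom f -> ishom (g \oc f),
      forall (x y : ob C) (f : hom x y), isob x -> isob y -> ishom f ->
        idm y \oc f = f /\ f \oc idm x = f &
      forall (w x y z : ob C) (h : hom y z) (g : hom x y) (f : hom w x),
        isob w -> isob x -> isob y -> isob z -> ishom h -> ishom g -> ishom f ->
        h \oc (g \oc f) = (h \oc g) \oc f].

Definition is_tensor (C : presmc) : Prop :=
  [/\ isob (@unit_ob C) /\
        (forall x y : ob C, isob x -> isob y -> isob (x \ox y)),
      forall (x y x' y' : ob C) (f : hom x y) (f' : hom x' y'),
        isob x -> isob y -> isob x' -> isob y' -> ishom f -> ishom f' ->
        ishom (f \om f'),
      forall x y : ob C, isob x -> isob y -> idm x \om idm y = idm (x \ox y) &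
      forall (x y z x' y' z' : ob C) (g : hom y z) (f : hom x y)
        (g' : hom y' z') (f' : hom x' y'),
        isob x -> isob y -> isob z -> isob x' -> isob y' -> isob z' ->
        ishom g -> ishom f -> ishom g' -> ishom f' ->
        (g \oc f) \om (g' \oc f') = (g \om g') \oc (f \om f')].

Definition has_natural_constraints (C : presmc) : Prop :=
  [/\ forall x y z : ob C, isob x -> isob y -> isob z ->
        inverses (assoc x y z) (assocV x y z),
      (forall x : ob C, isob x ->
        inverses (lunit x) (lunitV x) /\ inverses (runit x) (runitV x)) /\
      (forall x y : ob C, isob x -> isob y ->
        inverses (braid x y) (braid y x)),
      forall (x y z x' y' z' : ob C) (f : hom x x') (g : hom y y')
        (h : hom z z'),
        isob x -> isob y -> isob z -> isob x' -> isob y' -> isob z' ->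
        ishom f -> ishom g -> ishom h ->
        assoc x' y' z' \oc ((f \om g) \om h) =
        (f \om (g \om h)) \oc assoc x y z,
      forall (x y : ob C) (f : hom x y), isob x -> isob y -> ishom f ->
        lunit y \oc (idm unit_ob \om f) = f \oc lunit x /\
        runit y \oc (f \om idm unit_ob) = f \oc runit x &
      forall (x y x' y' : ob C) (f : hom x x') (g : hom y y'),
        isob x -> isob y -> isob x' -> isob y' -> ishom f -> ishom g ->
        braid x' y' \oc (f \om g) = (g \om f) \oc braid x y].

Definition is_coherent (C : presmc) : Prop :=
  [/\ forall w x y z : ob C, isob w -> isob x -> isob y -> isob z ->
        assoc w x (y \ox z) \oc assoc (w \ox x) y z =
        ((idm w \om assoc x y z) \oc assoc w (x \ox y) z)
          \oc (assoc w x y \om idm z),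
      forall x y : ob C, isob x -> isob y ->
        (idm x \om lunit y) \oc assoc x unit_ob y = runit x \om idm y &
      forall x y z : ob C, isob x -> isob y -> isob z ->
        (assoc y z x \oc braid x (y \ox z)) \oc assoc x y z =
        ((idm y \om braid x z) \oc assoc y x z) \oc (braid x y \om idm z)].

Definition is_smc (C : presmc) : Prop :=
  [/\ is_category C, is_tensor C, has_natural_constraints C & is_coherent C].

(* Raw functors with comparison morphisms F x (x) F y -> F (x (x) y) and
   1 -> F 1. *)
Record prefunctor (C D : presmc) := PreFunctor {
  fob :> ob C -> ob D;
  fmor : forall x y, hom x y -> hom (fob x) (fob y);
  ftens : forall x y, hom (fob x \ox fob y) (fob (x \ox y));
  funit : hom unit_ob (fob unit_ob) }.
Arguments fmor {C D} F {x y} _ : rename.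
Arguments ftens {C D} F x y : rename.
Arguments funit {C D} F : rename.

Definition is_functor {C D : presmc} (F : prefunctor C D) : Prop :=
  [/\ forall x, isob x -> isob (F x),
      forall x y (f : hom x y), isob x -> isob y -> ishom f -> ishom (fmor F f),
      forall x, isob x -> fmor F (idm x) = idm (F x) &
      forall x y z (g : hom y z) (f : hom x y),
        isob x -> isob y -> isob z -> ishom g -> ishom f ->
        fmor F (g \oc f) = fmor F g \oc fmor F f].

Definition is_sm_functor {C D : presmc} (F : prefunctor C D) : Prop :=
  [/\ is_functor F,
      is_iso (funit F) /\
        (forall x y, isob x -> isob y -> is_iso (ftens F x y)),
      forall x y x' y' (f : hom x x') (g : hom y y'),
        isob x -> isob y -> isob x' -> isob y' -> ishom f -> ishom g ->
        ftens F x' y' \oc (fmor F f \om fmor F g) =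
        fmor F (f \om g) \oc ftens F x y,
      (forall x y z, isob x -> isob y -> isob z ->
        (fmor F (assoc x y z) \oc ftens F (x \ox y) z)
          \oc (ftens F x y \om idm (F z)) =
        (ftens F x (y \ox z) \oc (idm (F x) \om ftens F y z))
          \oc assoc (F x) (F y) (F z)) /\
      (forall x, isob x ->
        (fmor F (lunit x) \oc ftens F unit_ob x)
          \oc (funit F \om idm (F x)) = lunit (F x) /\
        (fmor F (runit x) \oc ftens F x unit_ob)
          \oc (idm (F x) \om funit F) = runit (F x)) &
      forall x y, isob x -> isob y ->
        fmor F (braid x y) \oc ftens F x y =
        ftens F y x \oc braid (F x) (F y)].

Definition functor_id (C : presmc) : prefunctor C C :=
  @PreFunctor C C id (fun _ _ f => f) (fun x y => idm (x \ox y)) (idm unit_ob).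

Definition functor_comp {C D E : presmc} (G : prefunctor D E)
    (F : prefunctor C D) : prefunctor C E :=
  @PreFunctor C E (fun x => G (F x)) (fun _ _ f => fmor G (fmor F f))
    (fun x y => fmor G (ftens F x y) \oc ftens G (F x) (F y))
    (fmor G (funit F) \oc funit G).

Definition is_monoidal_natural_iso {C D : presmc} (F G : prefunctor C D)
    (tau : forall x, hom (F x) (G x)) : Prop :=
  [/\ forall x, isob x -> is_iso (tau x),
      forall x y (f : hom x y), isob x -> isob y -> ishom f ->
        tau y \oc fmor F f = fmor G f \oc tau x,
      forall x y, isob x -> isob y ->
        tau (x \ox y) \oc ftens F x y = ftens G x y \oc (tau x \om tau y) &
      tau unit_ob \oc funit F = funit G].

Definition is_sm_equivalence {C D : presmc} (F : prefunctor C D) : Prop :=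
  [/\ is_smc C, is_smc D, is_sm_functor F &
      exists G : prefunctor D C, is_sm_functor G /\
        (exists eta, is_monoidal_natural_iso
           (F := functor_id C) (G := functor_comp G F) eta) /\
        (exists eps, is_monoidal_natural_iso
           (F := functor_comp F G) (G := functor_id D) eps)].

Record premonoid (C : presmc) := PreMonoid {
  mon_ob :> ob C;
  mon_mul : hom (mon_ob \ox mon_ob) mon_ob;
  mon_one : hom unit_ob mon_ob }.
Arguments mon_mul {C} X : rename.
Arguments mon_one {C} X : rename.

Definition is_monoid {C : presmc} (X : premonoid C) : Prop :=
  [/\ isob (mon_ob X), ishom (mon_mul X), ishom (mon_one X),
      mon_mul X \oc (mon_mul X \om idm (mon_ob X)) =
        (mon_mul X \oc (idm (mon_ob X) \om mon_mul X)) \oc assoc _ _ _ &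
      mon_mul X \oc (mon_one X \om idm (mon_ob X)) = lunit (mon_ob X) /\
      mon_mul X \oc (idm (mon_ob X) \om mon_one X) = runit (mon_ob X)].

Definition is_monoid_mor {C : presmc} {X Y : premonoid C}
    (T : hom (mon_ob X) (mon_ob Y)) : Prop :=
  [/\ ishom T, T \oc mon_mul X = mon_mul Y \oc (T \om T) &
      T \oc mon_one X = mon_one Y].

(* id (x) braid (x) id, with the associativity constraints made explicit *)
Definition middle_swap {C : presmc} (x y x' y' : ob C) :
    hom ((x \ox y) \ox (x' \ox y')) ((x \ox x') \ox (y \ox y')) :=
  assocV x x' (y \ox y')
  \oc (idm x \om (assoc x' y y' \oc (braid y x' \om idm y') \oc assocV y x' y'))
  \oc assoc x y (x' \ox y').

Definition mon_unit (C : presmc) : premonoid C :=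
  @PreMonoid C unit_ob (lunit unit_ob) (idm unit_ob).

Definition mon_tens {C : presmc} (X Y : premonoid C) : premonoid C :=
  @PreMonoid C (mon_ob X \ox mon_ob Y)
    ((mon_mul X \om mon_mul Y) \oc middle_swap _ _ _ _)
    ((mon_one X \om mon_one Y) \oc lunitV unit_ob).

Definition Mon (C : presmc) : presmc :=
  @PreSMC (premonoid C) is_monoid
    (fun X Y => hom (mon_ob X) (mon_ob Y)) (@is_monoid_mor C)
    (fun X => idm (mon_ob X)) (fun X Y Z g f => g \oc f)
    (mon_unit C) mon_tens
    (fun X Y X' Y' f g => f \om g)
    (fun X Y Z => assoc (mon_ob X) (mon_ob Y) (mon_ob Z))
    (fun X Y Z => assocV (mon_ob X) (mon_ob Y) (mon_ob Z))
    (fun X => lunit (mon_ob X)) (fun X => lunitV (mon_ob X))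
    (fun X => runit (mon_ob X)) (fun X => runitV (mon_ob X))
    (fun X Y => braid (mon_ob X) (mon_ob Y)).

Definition SymplMic (R : realType) : presmc :=
  @PreSMC (premicrofold R) is_microfold (@premicro R) (@is_micro R)
    micro_id (@micro_comp R) (mfunit R) mfprod (@micro_tens R)
    micro_assoc micro_assocV micro_lunit micro_lunitV micro_runit micro_runitV
    micro_braid.

(* A representative of a microgroupoid; as for microfolds, equivalent
   representatives are canonically isomorphic.  [gmul] and [ginv] are meaningful on
   [gmul_dom] and [ginv_dom] only; source and target are global. *)
Record pregroupoid (R : realType) := PreGroupoid {
  gmf :> premicrofold R;
  gsrc : gmf -> gmf;
  gtgt : gmf -> gmf;
  gmul_dom : set (gmf * gmf);
  gmul : gmf * gmf -> gmf;
  ginv_dom : set gmf;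
  ginv : gmf -> gmf }.
Arguments gsrc {R G} _ : rename.
Arguments gtgt {R G} _ : rename.
Arguments gmul_dom {R} G _ : rename.
Arguments gmul {R G} _ : rename.
Arguments ginv_dom {R} G _ : rename.
Arguments ginv {R G} _ : rename.

Definition gmul_graph {R : realType} (G : pregroupoid R) :
  set ((G * G) * G) := [set p | gmul_dom G p.1 /\ p.2 = gmul p.1].
Arguments gmul_graph {R} G _.

(* The axioms are required on a neighborhood U of the units; that the products
   involved are defined is no restriction, as it holds for U small enough. *)
Definition groupoid_axioms_near_units {R : realType} (G : pregroupoid R) :
  Prop :=
  exists U : set G, [/\ onbhd (core G) U,
    forall g, U g ->
      [/\ gmul_dom G (gsrc g, g), gmul (gsrc g, g) = g,
          gmul_dom G (g, gtgt g) & gmul (g, gtgt g) = g],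
    forall g h, U g -> U h -> gtgt g = gsrc h ->
      [/\ gmul_dom G (g, h), gsrc (gmul (g, h)) = gsrc g &
          gtgt (gmul (g, h)) = gtgt h],
    forall g h k, U g -> U h -> U k -> gtgt g = gsrc h -> gtgt h = gsrc k ->
      [/\ gmul_dom G (gmul (g, h), k), gmul_dom G (g, gmul (h, k)) &
          gmul (gmul (g, h), k) = gmul (g, gmul (h, k))] &
    forall g, U g ->
      [/\ ginv_dom G g, gsrc (ginv g) = gtgt g /\ gtgt (ginv g) = gsrc g,
          gmul_dom G (g, ginv g) /\ gmul (g, ginv g) = gsrc g &
          gmul_dom G (ginv g, g) /\ gmul (ginv g, g) = gtgt g]].

Definition is_local_groupoid {R : realType} (G : pregroupoid R) : Prop :=
  [/\ is_manifold G /\ (exists k, is_submanifold k (core G)),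
      (forall g : G, core G (gsrc g) /\ core G (gtgt g)) /\
        (forall a : G, core G a -> gsrc a = a /\ gtgt a = a),
      [/\ @smooth_map R G G setT (fun x => gsrc (val x)),
          @smooth_map R G G setT (fun x => gtgt (val x)),
          submersion_to (@gsrc R G) (core G) &
          submersion_to (@gtgt R G) (core G)],
      (exists2 O : set (G * G), onbhd [set p | core G p.1 /\ p.2 = p.1] O &
        gmul_dom G = O `&` [set p | gtgt p.1 = gsrc p.2]) /\
      [/\ @smooth_map R (mprod G G) G (gmul_dom G) (fun p => gmul (val p)),
          onbhd (core G) (ginv_dom G) &
          @smooth_map R G G (ginv_dom G) (fun x => ginv (val x))] &
      groupoid_axioms_near_units G].

Definition is_symplectic_groupoid {R : realType} (G : pregroupoid R) : Prop :=
  [/\ is_local_groupoid G, is_symplectic G &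
      @is_lagrangian R (sprod (sopp (sprod G G)) G) (gmul_graph G)].

Definition gopp {R : realType} (G : pregroupoid R) : pregroupoid R :=
  @PreGroupoid R (@PreMicrofold R (sopp G) (core G))
    (@gsrc R G) (@gtgt R G) (gmul_dom G) (@gmul R G) (ginv_dom G) (@ginv R G).

Definition gprod {R : realType} (G H : pregroupoid R) : pregroupoid R :=
  @PreGroupoid R (mfprod G H)
    (fun x => (gsrc x.1, gsrc x.2)) (fun x => (gtgt x.1, gtgt x.2))
    [set p | gmul_dom G (p.1.1, p.2.1) /\ gmul_dom H (p.1.2, p.2.2)]
    (fun p => (gmul (p.1.1, p.2.1), gmul (p.1.2, p.2.2)))
    (ginv_dom G `*` ginv_dom H)
    (fun x => (ginv x.1, ginv x.2)).

Definition gunit (R : realType) : pregroupoid R :=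
  @PreGroupoid R (mfunit R) id id setT fst setT id.

(* [L] is the germ around C of a lagrangian local subgroupoid over C. *)
Definition is_lag_submicrogroupoid {R : realType} (G : pregroupoid R)
    (C : set G) (L : set (set G)) : Prop :=
  [/\ exists k, is_submanifold k C, C `<=` core G &
      exists V : set G, L = germ C V /\
        [/\ is_lagrangian V, C `<=` V,
            forall g, V g -> C (gsrc g) /\ C (gtgt g) &
            exists U, [/\ onbhd C U,
              forall g h, V g -> V h -> U g -> U h -> gmul_dom G (g, h) ->
                V (gmul (g, h)) &
              forall g, V g -> U g -> ginv_dom G g -> V (ginv g)]]].

Definition is_groupoid_mor {R : realType} {G H : pregroupoid R}
    (f : premicro G H) : Prop :=
  is_micro f /\
  @is_lag_submicrogroupoid R (gprod (gopp G) H) (gr (coremap f)) (mgerm f).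

Definition SymplGpdMic (R : realType) : presmc :=
  @PreSMC (pregroupoid R) is_symplectic_groupoid
    (fun G H => premicro G H) (@is_groupoid_mor R)
    (fun G => micro_id G) (fun G H K g f => micro_comp g f)
    (gunit R) gprod
    (fun G H G' H' f f' => micro_tens f f')
    (fun G H K => micro_assoc G H K) (fun G H K => micro_assocV G H K)
    (fun G => micro_lunit G) (fun G => micro_lunitV G)
    (fun G => micro_runit G) (fun G => micro_runitV G)
    (fun G H => micro_braid G H).

Definition gr_mul {R : realType} (G : pregroupoid R) : premicro (mfprod G G) G :=
  let diag := fun a : core G => core_pair a a : core (mfprod G G) in
  @PreMicro R (mfprod G G) G diag (germ (gr diag) (gmul_graph G)).

Definition groupoid_monoid {R : realType} (G : pregroupoid R) :
    premonoid (SymplMic R) :=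
  @PreMonoid (SymplMic R) (gmf G) (gr_mul G) (micro_e G).

(* The comparison morphisms are identities: the monoids of G x H and of the
   unit groupoid live on the same microfolds as the tensor products. *)
Definition functorM (R : realType) :
    prefunctor (SymplGpdMic R) (Mon (SymplMic R)) :=
  @PreFunctor (SymplGpdMic R) (Mon (SymplMic R)) groupoid_monoid
    (fun _ _ f => f) (fun G H => micro_id (mfprod G H)) (micro_id (mfunit R)).

(* Main.v *)
(* In local charts, the lagrangian germ of a micromorphism over phi : B -> A is
   a graph-like germ transverse to the cores, so that composites are computed
   by projecting a zero set and every equation between micromorphisms can be
   checked near each point of the graph of the core map.

   M is fully faithful: commuting with the multiplications says that the germ
   of T is closed under products, and conversely, because products can be
   factored near the units.  Applied to factorizations of units, this also
   gives closure under inversion.  Since the chosen inverse of a unit need not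
   be close to it, the representative closed under inversion is V together with
   its image under the inversion.

   M is essentially surjective: let V represent the multiplication of a monoid
   (X, mu, e).  The unit laws force the core map of mu to be the diagonal and
   show that V((x, g), g) with x in the core determines x = s g smoothly;
   similarly for t, for the product and for the inverse.  Associativity gives
   the groupoid laws near the core, and thin neighborhoods of the core turn
   these local facts into a groupoid structure on an open U containing the
   core; the inclusion of U is an isomorphism of monoids. *)
From HB Require Import structures.
From mathcomp Require Import all_boot all_order all_algebra.
From mathcomp Require Import all_classical all_reals all_analysis.
From mathcomp Require Import ring lra zify.
Require Import Defs.
Set Implicit Arguments.
Unset Strict Implicit.
Unset Printing Implicit Defensive.
Import Order.TTheory GRing.Theory Num.Theory numFieldNormedType.Exports.
Local Open Scope classical_set_scope.
Local Open Scope ring_scope.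

(** Germs live along noncompact cores, and a relational composite of two representatives may pass
    through intermediate points far from the core. The proof therefore works with [lcomp], a
    statement at one triple of points that pins down the germ of a composite, and turns pointwise
    statements into a neighbourhood of the whole core by one covering lemma, [thin]: the fibres of
    the neighbourhood stay in boxes on which the local statement holds. Transversality always comes
    from linear duality: a covector killing the image of a system of defining functions is
    represented, through the symplectic forms, by vectors tangent to the lagrangians, and cleanness
    along the cores makes these vanish. The axioms of a symplectic groupoid used here do not say
    that the units are lagrangian or of half dimension; both are derived from the graph of the
    product ([gpd_core_cut]). The laws of the category of microgroupoids are read off from
    multiplicativity of morphisms ([gpd_morE]), as for monoids. The quasi-inverse is chosen
    objectwise, and its comparison morphisms are transported along the chosen isomorphisms. *)

Local Notation "i :@ x" := (mcoord i x) (at level 5, right associativity).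
Local Notation near_pt := nbhs_singleton.
Local Notation topT := topologicalType.
Local Notation is_mf := is_microfold.
Local Notation gp := is_symplectic_groupoid.
Local Notation i_ := micro_id.
Local Notation "X =>> Y" := (premicro X Y) (at level 70).
Local Notation "X :~ Y" := (mfprod X Y) (at level 6, left associativity).
Local Notation "g \o' f" := (micro_comp g f) (at level 50, left associativity).
Local Notation "f \x g" := (micro_tens f g) (at level 40, left associativity).
Local Notation "u :| v" := (row_mx u v) (at level 6, left associativity).
(** * Smooth maps and Jacobians *)
Section Calculus.
Variable R : realType.
Lemma nearO {T : topT} (x : T) (P : T -> Prop) :
 (\forall y \near x, P y) -> exists O, [/\ open O, O x & O `<=` P].
Proof. move=> h; have : nbhs x P by exact: h.
by rewrite nbhsE => -[U [oU Ux] UP]; exists U. Qed.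
Lemma near_near {T : topT} (x : T) (P : T -> Prop) :
 (\forall y \near x, P y) -> \forall y \near x, \forall z \near y, P z.
Proof. by move=> /nbhs_interior. Qed.
Lemma near_forallI {T : topT} {I : finType} (x : T) (P : I -> T -> Prop) :
 (forall i, \forall y \near x, P i y) -> \forall y \near x, forall i, P i y.
Proof. by move=> h; apply: filter_forall. Qed.
Lemma nearI {T : topT} (x : T) (P Q : T -> Prop) :
 (\forall y \near x, P y) -> (\forall y \near x, Q y) -> \forall y \near x, P y /\ Q y.
Proof. exact: filterI. Qed.
Local Notation "A &n B" := (nearI A B) (at level 60, right associativity).
Lemma nearT {T : topT} (x : T) (P : T -> Prop) : (forall y, P y) -> \forall y \near x, P y.
Proof. exact: nearW. Qed.
Lemma near_pre {T U : topT} (f : T -> U) x (P : U -> Prop) : {for x, continuous f} ->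
 (\forall y \near f x, P y) -> \forall y \near x, P (f y).
Proof. by move=> c; apply: c. Qed.
Lemma nearS {T : topT} (x : T) (P Q : T -> Prop) : (forall y, P y -> Q y) ->
 (\forall y \near x, P y) -> \forall y \near x, Q y.
Proof. exact: filterS. Qed.
Lemma open_near {T : topT} (O : set T) x : open O -> O x -> \forall y \near x, O y.
Proof. by move=> oO Ox; apply: open_nbhs_nbhs. Qed.
Lemma coord_le_norm {m n} (M : 'M[R]_(m, n)) i j : `|M i j| <= `|M|.
Proof.
have -> : `|M| = mx_norm M by [].
rewrite mx_normrE; exact: (le_bigmax_cond (j := (i, j)) _ (fun ij => `|M ij.1 ij.2|)).
Qed.
Lemma norm_le_coord {m n} (M : 'M[R]_(m, n)) e : 0 <= e ->
 (forall i j, `|M i j| <= e) -> `|M| <= e.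
Proof.
move=> e0 h; have -> : `|M| = mx_norm M by [].
by rewrite mx_normrE; apply: bigmax_le => // -[i j] _; apply: h.
Qed.
Lemma mulmx_norm {m n p} (B : 'M[R]_(n, p)) :
 exists2 C : R, 0 < C & forall A : 'M[R]_(m, n), `|A *m B| <= C * `|A|.
Proof.
exists (n%:R * `|B| + 1); first by rewrite ltr_wpDl // mulr_ge0.
move=> A; apply: norm_le_coord => [|i j].
 by rewrite mulr_ge0 // addr_ge0 mulr_ge0.
rewrite mxE; apply: (le_trans (ler_norm_sum _ _ _)).
apply: (@le_trans _ _ (\sum_(k < n) `|A| * `|B|)).
 by apply: ler_sum => k _; rewrite normrM ler_pM // coord_le_norm.
rewrite sumr_const card_ord -mulr_natr mulrDl mul1r -[X in X <= _]addr0 lerD //.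
by rewrite -mulr_natl; rewrite le_eqVlt; apply/orP; left; apply/eqP; ring.
Qed.
Lemma mulmxr_continuous {m n p} (B : 'M[R]_(n, p)) :
 continuous (fun A : 'M[R]_(m, n) => A *m B).
Proof.
move=> A; suff: (fun A' : 'M[R]_(m, n) => A' *m B) @ nbhs A --> A *m B by [].
apply/cvgrPdist_le => e e0.
have [C C0 CB] := @mulmx_norm m n p B.
near=> A'; rewrite -mulmxBl (le_trans (CB _)) // mulrC -ler_pdivlMr.
near: A'; apply: cvgr_dist_le => //; exact: divr_gt0.
Unshelve. all: by end_near. Qed.
Lemma rowcv {m} {T : Type} {F : set_system T} {FF : Filter F} (f : T -> 'rV[R]_m) (l : 'rV[R]_m) :
 (forall j, (fun x => f x 0 j) @ F --> l 0 j) -> f @ F --> l.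
Proof.
move=> h; apply/cvgrPdist_le => e e0.
have : \forall x \near F, forall j, `|l 0 j - f x 0 j| <= e.
 by apply: filter_forall => j; apply: cvgr_dist_le => //; apply: h.
apply: filterS => x hx; apply: norm_le_coord => [|i j]; first exact: ltW.
by rewrite !mxE ord1.
Qed.
Lemma cont_dist {T : topT} {V : normedModType R} (f : T -> V) x :
 (forall e, 0 < e -> \forall y \near x, `|f x - f y| <= e) -> {for x, continuous f}.
Proof. by move=> h; apply/cvgrPdist_le. Qed.
Lemma contI {T : topT} {m} (f : T -> 'rV[R]_m) x :
 (forall j, {for x, continuous (fun y => f y 0 j)}) -> {for x, continuous f}.
Proof. by move=> h; apply: rowcv => j; apply: h. Qed.
Lemma Ck_cont m k (O : set 'rV[R]_m) f x : Ck k O f -> O x -> {for x, continuous f}.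
Proof. by case: k => [|k] [h _]; apply: h. Qed.
Lemma Ck_sub m k (O O' : set 'rV[R]_m) f : O' `<=` O -> Ck k O f -> Ck k O' f.
Proof.
elim: k f => [|k IH] f s [h1 h2]; split=> //; first by move=> x /s; apply: h1.
- by move=> x /s; apply: h1.
- move=> j; have [a b] := h2 j; split; first by move=> x /s; apply: a.
 exact: IH.
Qed.
Lemma Ck_S m k (O : set 'rV[R]_m) f : Ck k.+1 O f -> Ck k O f.
Proof.
elim: k f => [|k IH] f; first by case=> h _; split.
by case=> h1 h2; split=> // j; have [a b] := h2 j; split => //; apply: IH.
Qed.
Lemma near_cont {T U : topT} (f g : T -> U) x : (\forall y \near x, f y = g y) ->
 {for x, continuous f} -> {for x, continuous g}.
Proof.
move=> h; have fg := near_pt h.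
by rewrite /prop_for /continuous_at -fg => c; apply: cvg_trans c; apply: near_eq_cvg; apply: filterS h => y ->.
Qed.
Lemma Ck_ext m k (O : set 'rV[R]_m) f g : open O -> (forall x, O x -> f x = g x) ->
 Ck k O f -> Ck k O g.
Proof.
move=> oO; elim: k f g => [|k IH] f g fg [h1 h2].
 split=> // x Ox; apply: (@near_cont _ _ f); last exact: h1.
 by apply: filterS (open_near oO Ox) => y; apply: fg.
have nfg x : O x -> \forall y \near x, f y = g y.
 by move=> Ox; apply: filterS (open_near oO Ox) => y; apply: fg.
split; first by move=> x Ox; apply: (@near_cont _ _ f); [exact: nfg|exact: h1].
move=> j; have [a b] := h2 j; split.
 by move=> x Ox; apply: (@near_eq_derivable _ _ _ f); [exact: nfg|exact: a].
apply: IH b => x Ox; rewrite /partial; exact/near_eq_derive/nfg.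
Qed.
Lemma Ck_local m k (O : set 'rV[R]_m) f : (forall x, O x -> exists2 U, U x & Ck k U f) -> Ck k O f.
Proof.
elim: k f => [|k IH] f h.
 by split=> // x Ox; have [U Ux hU] := h x Ox; apply: (Ck_cont hU Ux).
split; first by move=> x Ox; have [U Ux hU] := h x Ox; apply: (Ck_cont hU Ux).
move=> j; split; first by move=> x Ox; have [U Ux [_ /(_ j)[d _]]] := h x Ox; apply: d.
by apply: IH => x Ox; have [U Ux [_ /(_ j)[_ d]]] := h x Ox; exists U.
Qed.
Lemma Ck_cst m k (O : set 'rV[R]_m) c : Ck k O (fun=> c).
Proof.
elim: k c => [|k IH] c; split=> //; try by move=> x _; apply: cst_continuous.
move=> j; split; first by move=> x _; apply: derivable_cst.
have -> : partial j (fun=> c) = (fun=> 0 : R); last exact: IH.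
by apply/funext => x; rewrite /partial derive_cst.
Qed.
Lemma Ck_add m k (O : set 'rV[R]_m) f g : open O -> Ck k O f -> Ck k O g -> Ck k O (fun x => f x + g x).
Proof.
move=> oO; elim: k f g => [|k IH] f g [f1 f2] [g1 g2]; split=> //; try by move=> x Ox; exact: (cvgD (f1 x Ox) (g1 x Ox)).
move=> j; have [fa fb] := f2 j; have [ga gb] := g2 j; split.
 by move=> x Ox; apply: derivableD; [apply: fa|apply: ga].
apply: (@Ck_ext _ _ _ (fun x => partial j f x + partial j g x)) => //; last exact: IH.
by move=> x Ox; rewrite /partial deriveD //; [apply: fa|apply: ga].
Qed.
Lemma Ck_mul m k (O : set 'rV[R]_m) f g : open O -> Ck k O f -> Ck k O g -> Ck k O (fun x => f x * g x).
Proof.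
move=> oO; elim: k f g => [|k IH] f g F G; have [f1 f2] := F; have [g1 g2] := G; split=> //; try by move=> x Ox; exact: (cvgM (f1 x Ox) (g1 x Ox)).
move=> j; have [fa fb] := f2 j; have [ga gb] := g2 j; split.
 by move=> x Ox; apply: derivableM; [apply: fa|apply: ga].
apply: (@Ck_ext _ _ _ (fun x => f x * partial j g x + g x * partial j f x)) => //; last first.
 by apply: Ck_add => //; apply: IH => //; apply: Ck_S.
by move=> x Ox; rewrite /partial deriveM //; [apply: fa|apply: ga].
Qed.
Lemma Ck_sum m k (O : set 'rV[R]_m) I (r : seq I) (P : pred I) (f : I -> _) : open O ->
 (forall i, P i -> Ck k O (f i)) -> Ck k O (fun x => \sum_(i <- r | P i) f i x).
Proof.
move=> oO h; elim: r => [|i r IH].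
 by apply: (@Ck_ext _ _ _ (fun=> 0)) => //; [move=> x _; rewrite big_nil|exact: Ck_cst].
case Pi : (P i); last first.
 by apply: Ck_ext IH => // x _; rewrite big_cons Pi.
apply: (@Ck_ext _ _ _ (fun x => f i x + \sum_(i <- r | P i) f i x)) => //.
 by move=> x _; rewrite big_cons Pi.
by apply: Ck_add => //; apply: h.
Qed.
Lemma Ck_prod m k (O : set 'rV[R]_m) I (r : seq I) (P : pred I) (f : I -> _) : open O ->
 (forall i, P i -> Ck k O (f i)) -> Ck k O (fun x => \prod_(i <- r | P i) f i x).
Proof.
move=> oO h; elim: r => [|i r IH].
 by apply: (@Ck_ext _ _ _ (fun=> 1)) => //; [move=> x _; rewrite big_nil|exact: Ck_cst].
case Pi : (P i); last first.
 by apply: Ck_ext IH => // x _; rewrite big_cons Pi.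
apply: (@Ck_ext _ _ _ (fun x => f i x * \prod_(i <- r | P i) f i x)) => //.
 by move=> x _; rewrite big_cons Pi.
by apply: Ck_mul => //; apply: h.
Qed.
Lemma Ck_coord m k (O : set 'rV[R]_m) i : open O -> Ck k O (fun x => x 0 i).
Proof.
move=> oO; case: k => [|k]; split=> //; try by move=> x _; exact: coord_continuous.
move=> j; split.
 move=> x _; apply/diff_derivable; exact: differentiable_coord.
have -> : partial j (fun x : 'rV[R]_m => x 0 i) = fun=> (delta_mx 0 j : 'rV[R]_m) 0 i; last exact: Ck_cst.
apply/funext => x; rewrite /partial.
have d : derivable (id : 'rV[R]_m -> 'rV[R]_m) x (delta_mx 0 j) by apply: derivable_id.
have := derive_mx d; rewrite derive_id => /matrixP/(_ 0 i) ->.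
by rewrite mxE.
Qed.
Lemma Ck_inv m k (O : set 'rV[R]_m) f : open O -> (forall x, O x -> f x != 0) ->
 Ck k O f -> Ck k O (fun x => (f x)^-1).
Proof.
move=> oO n0; elim: k => [|k IH] F; have [f1 f2] := F; split=> //; try by move=> x Ox; exact: (cvgV (n0 x Ox) (f1 x Ox)).
move=> j; have [fa fb] := f2 j; split.
 by move=> x Ox; apply: derivableV; [apply: n0|apply: fa].
have ki := IH (Ck_S F).
apply: (@Ck_ext _ _ _ (fun x => (-1) * ((f x)^-1 * (f x)^-1) * partial j f x)) => //; last first.
 by apply: Ck_mul => //; apply: Ck_mul; [| apply: Ck_cst|apply: Ck_mul].
move=> x Ox; rewrite /partial deriveV; [|exact: n0|exact: fa].
by rewrite -[_ *: _]/(_ * _) expr2 invfM mulN1r.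
Qed.
Lemma Ck_det m k (O : set 'rV[R]_m) n (A : 'rV[R]_m -> 'M[R]_n) : open O ->
 (forall i j, Ck k O (fun x => A x i j)) -> Ck k O (fun x => \det (A x)).
Proof.
move=> oO h; apply: Ck_sum => // s _; apply: Ck_mul => //; first exact: Ck_cst.
by apply: Ck_prod => // i _; apply: h.
Qed.
Lemma derive_line m (W : normedModType R) (f : 'rV[R]_m -> W) p v t : derivable f (p + t *: v) v ->
 derivable (fun s : R => f (p + s *: v)) t 1 /\ 'D_1 (fun s : R => f (p + s *: v)) t = 'D_v f (p + t *: v).
Proof.
have E : (fun h : R => h^-1 *: (((fun s : R => f (p + s *: v)) \o shift t) (h *: 1) - f (p + t *: v))) =
 (fun h : R => h^-1 *: ((f \o shift (p + t *: v)) (h *: v) - f (p + t *: v))).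
 apply/funext => h; congr (_ *: (f _ - _)).
 by rewrite scalerDl -[h *: 1]/(h * 1) mulr1 addrCA.
by move=> d; split; rewrite /derivable /derive E.
Qed.
(** Mean value theorem along a line, compared with a slope [c]. With [c] a partial derivative at the
    base point it yields differentiability; with [c = 0] it yields a Lipschitz bound. The estimate
    is asked for all [|t| <= |s|] so that both signs of [s] are covered at once. *)
Lemma mvt_line m (f : 'rV[R]_m -> R) p v c e s :
 (forall t, `|t| <= `|s| -> derivable f (p + t *: v) v /\ `|'D_v f (p + t *: v) - c| <= e) ->
 `|f (p + s *: v) - f p - s * c| <= `|s| * e.
Proof.
move=> h.
have ok (a b : R) (g := fun t : R => f (p + t *: v)) : a <= b -> `|a| <= `|s| -> `|b| <= `|s| -> `|g b - g a - (b - a) * c| <= `|b - a| * e.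
 move=> ab sa sb.
 have st t : t \in `[a, b] -> `|t| <= `|s|.
  rewrite in_itv => /andP[h1 h2]; rewrite ler_norml; apply/andP; split.
   by rewrite (le_trans _ h1) // lerNl (le_trans _ sa) // -normrN ler_norm.
  by rewrite (le_trans h2) // (le_trans _ sb) // ler_norm.
 have [||t tab E] := @MVT_segment R g (fun t : R => 'D_v f (p + t *: v)) a b ab.
 - move=> t tab; have [] := derive_line (p := p) (v := v) (t := t) (f := f).
   by apply: (h t _).1; apply: st; apply: subset_itvW tab.
  by move=> d1 d2; apply: DeriveDef.
 - apply: derivable_within_continuous => t tab.
  by apply: (derive_line _).1; apply: (h t _).1; apply: st.
 rewrite E [_ * (b - a)]mulrC -mulrBr normrM ler_wpM2l //.
 by apply: (h t _).2; apply: st.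
have [s0|s0] := leP 0 s.
 by have := ok 0 s s0; rewrite subr0 scale0r addr0; apply; rewrite // normr0.
have := ok s 0 (ltW s0); rewrite scale0r addr0 sub0r normrN mulNr opprK.
move=> H; rewrite -normrN.
have -> : - (f (p + s *: v) - f p - s * c) = f p - f (p + s *: v) + s * c by ring.
by apply: H; rewrite ?normr0.
Qed.
Lemma diff_of_partial m (f : 'rV[R]_m -> R) (x D : 'rV[R]_m) :
 (forall e, 0 < e -> \forall y \near x, `|f y - f x - \sum_j (y - x : 'rV[R]_m) 0 j * D 0 j| <= e * `|y - x|) ->
 differentiable (f : 'rV[R]_m -> R) x /\ 'd f x = (fun v : 'rV[R]_m => \sum_j v 0 j * D 0 j) :> (_ -> _).
Proof.
move=> h.
pose L0 (v : 'rV[R]_m) : R := \sum_j v 0 j * D 0 j.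
have lL : linear L0.
 move=> a u v; rewrite /L0 scaler_sumr -big_split; apply: eq_bigr => j _.
 by rewrite !mxE mulrDl -[_ *: _]/(_ * _) mulrA.
pose LM := GRing.isLinear.Build _ _ _ _ _ lL.
pose L : {linear 'rV[R]_m -> R} := HB.pack L0 LM.
have cL : continuous L.
 have -> : (L : _ -> _) = (fun v => \sum_j v 0 j * D 0 j) by [].
 have := @Ck_sum m 0 setT _ (index_enum 'I_m) predT (fun j v => v 0 j * D 0 j) openT.
 case=> [j _|c _ v]; last exact: c.
 by apply: Ck_mul; [exact: openT|apply: Ck_coord; exact: openT|exact: Ck_cst].
have E : f \o shift x = cst (f x) + L +o_ (0 : 'rV[R]_m) id.
 apply/eqaddoP => e e0; have := h e e0.
 rewrite (near_shift 0 x) => H.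
 near=> v; have : `|f (v + x) - f x - \sum_j (v + x - x) 0 j * D 0 j| <= e * `|v + x - x|.
  by near: v; move: H; rewrite subr0; apply: filterS => v.
 by rewrite addrK => H1; rewrite /cst opprD addrA.
have := diff_unique cL E => dE.
split; last by rewrite dE.
by apply/diff_locallyP; rewrite dE.
Unshelve. all: by end_near. Qed.
(** Continuous partial derivatives give the differential: go from [x] to [y] changing one coordinate
    at a time and apply [mvt_line] to each step. *)
Lemma Ck1_diff m (O : set 'rV[R]_m) f x : open O -> Ck 1 O f -> O x ->
 differentiable f x /\ 'd f x = (fun v : 'rV[R]_m => \sum_j v 0 j * partial j f x) :> (_ -> _).
Proof.
move=> oO [_ h2] Ox.
have [] := @diff_of_partial m f x (\row_j partial j f x); last first.
 by move=> d ->; split=> //; apply/funext => v; apply: eq_bigr => j _; rewrite mxE.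
move=> e e0.
(* There are [m] steps, each with error at most [e'] times the distance; dividing by [m.+1] also
   covers [m = 0]. *)
pose e' := e / m.+1%:R.
have e'0 : 0 < e' by rewrite divr_gt0.
have : \forall y \near x, forall j, O y /\ `|partial j f y - partial j f x| <= e'.
 apply: near_forallI => j; apply: (nearI (open_near oO Ox)).
 have [_ [c _]] := h2 j; have cc : partial j f @ x --> partial j f x := c x Ox.
 move/cvgrPdist_le: cc => /(_ _ e'0).
 by apply: filterS => y; rewrite distrC.
move=> /nbhs_ballP[r r0 hr].
near=> y.
have yr : `|y - x| < r.
 near: y; apply/nbhs_ballP; exists r => //= y; by rewrite mx_norm_ball /ball_ distrC.
(* [p k] has the first [k] coordinates of [y] and the remaining ones of [x]. *)
pose p k := x + \sum_(j < m | (j < k)%N) (y - x) 0 j *: delta_mx 0 j.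
have pE k i : (p k) 0 i = x 0 i + (if (i < k)%N then (y - x) 0 i else 0).
 rewrite /p mxE summxE; congr (_ + _); case: ifP => ik.
  rewrite (bigD1 i) //= big1 ?addr0 => [|j /andP[_ ji]]; rewrite !mxE ?eqxx ?mulr1 //.
  by rewrite eq_sym (negPf ji) andbF mulr0.
 rewrite big1 // => j jk; rewrite !mxE /=; case: eqP => [ij|_]; last by rewrite mulr0.
 by move: jk; rewrite -ij ik.
move: p pE => p pE.
have p0 : p 0%N = x by apply/rowP => i; rewrite pE ltn0 addr0.
have pm : p m = y by rewrite -[RHS](subrK x) addrC; apply/rowP => i; rewrite pE ltn_ord [in RHS]mxE.
have pS (j : 'I_m) : p j.+1 = p j + (y - x) 0 j *: delta_mx 0 j.
 apply/rowP => i; rewrite [RHS]mxE !pE -addrA; congr (_ + _); rewrite [X in _ = _ + X]mxE [delta_mx _ _ _ _]mxE /=.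
 rewrite ltnS leq_eqVlt; case: eqVneq => [/val_inj ->|ij].
  by rewrite ltnn eqxx mulr1 add0r.
 by rewrite (_ : (i == j) = false) ?mulr0 ?addr0 //; apply/eqP => /(congr1 val)/eqP; rewrite (negPf ij).
have step (j : 'I_m) : `|f (p j.+1) - f (p j) - (y - x) 0 j * partial j f x| <= `|y - x| * e'.
 rewrite pS; apply: (le_trans (@mvt_line _ _ _ _ _ e' _ _)); last first.
  by rewrite ler_wpM2r ?(ltW e'0) // coord_le_norm.
 move=> t ts.
 have zr : ball x r (p j + t *: delta_mx 0 j).
  rewrite mx_norm_ball /ball_; apply: le_lt_trans yr.
  apply: norm_le_coord => // i' i; rewrite ord1 !mxE pE.
  have -> : x 0 i - (x 0 i + (if (i < j)%N then (y - x) 0 i else 0) + t * ((0 == 0 :> 'I_1) && (i == j))%:R) =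
    - ((if (i < j)%N then (y - x) 0 i else 0) + t * (i == j)%:R) by rewrite eqxx opprD opprD !addrA subrr add0r opprD.
  rewrite normrN; case: eqVneq => [->|ij].
   by rewrite ltnn add0r mulr1 (le_trans ts) // coord_le_norm.
  by rewrite mulr0 addr0; case: ifP => _; rewrite ?normr0 // coord_le_norm.
 have [] := hr _ zr j; have [dj _] := h2 j => Oz hz; split => //; exact: dj.
have T : f y - f x = \sum_(j < m) (f (p j.+1) - f (p j)).
 by rewrite -pm -{1}p0 -(big_mkord xpredT (fun j => f (p j.+1) - f (p j))) telescope_sumr.
rewrite T; under [X in _ - X]eq_bigr => j _ do rewrite mxE.
rewrite -sumrB (le_trans (ler_norm_sum _ _ _)) //.
apply: (@le_trans _ _ (\sum_(j < m) `|y - x| * e')); first by apply: ler_sum => j _; apply: step.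
rewrite sumr_const card_ord -mulr_natl mulrCA mulrC ler_wpM2r //.
by rewrite /e' mulrA ler_pdivrMr // [m%:R * e]mulrC ler_wpM2l ?(ltW e0) // ler_nat.
Unshelve. all: by end_near. Qed.
Lemma diff_comp_coord m n (F : 'rV[R]_m -> 'rV[R]_n) x :
 (forall j, differentiable (fun y => F y 0 j : R) x) -> differentiable F x.
Proof.
move=> h.
have -> : F = \sum_(j < n) (fun y => F y 0 j *: (delta_mx 0 j)).
 apply/funext => y; rewrite fct_sumE; apply/rowP => i; rewrite summxE (bigD1 i) //= big1.
  by rewrite !mxE !eqxx mulr1 addr0.
 by move=> j ji; rewrite !mxE eq_sym (negPf ji) mulr0.
by apply: differentiable_sum => j; apply: differentiableZl.
Qed.
Lemma diff_coordE m n (F : 'rV[R]_m -> 'rV[R]_n) x v j : differentiable F x ->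
 ('d F x v) 0 j = 'D_v (fun y => F y 0 j : R) x.
Proof.
move=> d; have dv := @diff_derivable _ _ _ _ _ v d.
by rewrite -deriveE // (derive_mx dv) mxE.
Qed.
Lemma smooth_on_diff m n (O : set 'rV[R]_m) (F : 'rV[R]_m -> 'rV[R]_n) x : open O ->
 (forall j, Ck 1 O (fun y => F y 0 j)) -> O x -> differentiable F x.
Proof. by move=> oO h Ox; apply: diff_comp_coord => j; case: (Ck1_diff oO (h j) Ox). Qed.
(** Induction on the order: by the chain rule each partial derivative of [g \o F] is a sum of
    products of a partial derivative of [F] with a partial derivative of [g] composed with [F], and
    both factors have order one less. *)
Lemma Ck_comp m n k (O : set 'rV[R]_m) (O' : set 'rV[R]_n) (F : 'rV[R]_m -> 'rV[R]_n) g :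
 open O -> open O' -> (forall x, O x -> O' (F x)) -> Ck k O' g ->
 (forall j, Ck k O (fun x => F x 0 j)) -> Ck k O (g \o F).
Proof.
move=> oO oO' FO; elim: k g => [|k IH] g G H.
 split=> // x Ox; apply: continuous_comp; last exact: (Ck_cont G (FO _ Ox)).
 by apply: contI => j; exact: (Ck_cont (H j) Ox).
have cF x : O x -> {for x, continuous F}.
 by move=> Ox; apply: contI => j; exact: (Ck_cont (H j) Ox).
have C1 l (f : 'rV[R]_l -> R) U : Ck k.+1 U f -> Ck 1 U f.
 by elim: (k) => // k' IHk /Ck_S.
have dF x : O x -> differentiable F x.
 by move=> Ox; apply: smooth_on_diff Ox => // j; apply/C1/H.
have dg x : O' x -> differentiable g x /\ 'd g x = (fun v : 'rV[R]_n => \sum_j v 0 j * partial j g x) :> (_ -> _).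
 by move=> Ox; apply: Ck1_diff Ox => //; apply: C1.
have E j x : O x -> partial j (g \o F) x = \sum_i partial j (fun y => F y 0 i) x * partial i g (F x).
 move=> Ox; rewrite /partial deriveE; last first.
  by apply: differentiable_comp; [apply: dF|apply: (dg _ _).1; apply: FO].
 rewrite diff_comp; [|exact: dF|by apply: (dg _ _).1; apply: FO].
 rewrite (dg _ (FO _ Ox)).2; apply: eq_bigr => i _.
 by rewrite diff_coordE //; apply: dF.
split.
 move=> x Ox; apply: continuous_comp; first exact: cF.
 exact: (Ck_cont G (FO _ Ox)).
move=> j; split.
 move=> x Ox; apply: diff_derivable; apply: differentiable_comp; first exact: dF.
 by apply: (dg _ _).1; apply: FO.
apply: (@Ck_ext _ _ _ (fun x => \sum_i partial j (fun y => F y 0 i) x * partial i g (F x))) => //.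
 by move=> x Ox; rewrite E.
apply: Ck_sum => // i _; apply: Ck_mul => //.
 by have [_ /(_ j) []] := H i.
apply: (IH (partial i g)); first by have [_ /(_ i) []] := G.
by move=> l; apply: Ck_S.
Qed.
Lemma smooth_on_ext m n (O : set 'rV[R]_m) (F G : 'rV[R]_m -> 'rV[R]_n) : open O ->
 (forall x, O x -> F x = G x) -> smooth_on O F -> smooth_on O G.
Proof. by move=> oO h H j k; apply: Ck_ext (H j k) => // x Ox; rewrite h. Qed.
Lemma smooth_on_sub m n (O O' : set 'rV[R]_m) (F : 'rV[R]_m -> 'rV[R]_n) :
 O' `<=` O -> smooth_on O F -> smooth_on O' F.
Proof. by move=> h H j k; apply: Ck_sub (H j k). Qed.
Lemma smooth_on_comp m n p (O : set 'rV[R]_m) (O' : set 'rV[R]_n) (F : 'rV[R]_m -> 'rV[R]_n)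
 (G : 'rV[R]_n -> 'rV[R]_p) : open O -> open O' -> (forall x, O x -> O' (F x)) ->
 smooth_on O F -> smooth_on O' G -> smooth_on O (G \o F).
Proof.
by move=> oO oO' h HF HG j k; apply: (@Ck_comp _ _ _ _ O' F (fun y => G y 0 j)).
Qed.
Lemma smooth_on_mulmx m n (O : set 'rV[R]_m) (A : 'M[R]_(m, n)) : open O -> smooth_on O (mulmx^~ A).
Proof.
move=> oO j k; apply: (@Ck_ext _ _ _ (fun x => \sum_i x 0 i * A i j)) => //.
 by move=> x _; rewrite mxE.
by apply: Ck_sum => // i _; apply: Ck_mul => //; [exact: Ck_coord|exact: Ck_cst].
Qed.
Lemma sm_near m n x (F : 'rV[R]_m -> 'rV[R]_n) : smooth_at x F ->
 \forall y \near x, smooth_at y F.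
Proof. by case=> U [oU Ux h]; apply: filterS (open_near oU Ux) => y Uy; exists U. Qed.
Lemma sm_diff m n x (F : 'rV[R]_m -> 'rV[R]_n) : smooth_at x F -> differentiable F x.
Proof. by case=> U [oU Ux h]; apply: smooth_on_diff Ux. Qed.
Lemma sm_cont m n x (F : 'rV[R]_m -> 'rV[R]_n) : smooth_at x F -> {for x, continuous F}.
Proof. by move=> /sm_diff/differentiable_continuous. Qed.
Lemma sm_ext m n x (F G : 'rV[R]_m -> 'rV[R]_n) : (\forall y \near x, F y = G y) ->
 smooth_at x F -> smooth_at x G.
Proof.
move=> /nearO[V [oV Vx FG]] [U [oU Ux h]]; exists (V `&` U); split => //; first exact: openI.
apply: (@smooth_on_ext _ _ _ F); first exact: openI.
 by move=> y [] /FG.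
by apply: smooth_on_sub h => y [].
Qed.
Lemma sm_comp m n p x (F : 'rV[R]_m -> 'rV[R]_n) (G : 'rV[R]_n -> 'rV[R]_p) :
 smooth_at x F -> smooth_at (F x) G -> smooth_at x (G \o F).
Proof.
move=> sF [V [oV Vx hG]]; have cF := sm_cont sF; case: sF => U [oU Ux hF].
have : \forall y \near x, U y /\ V (F y).
 by apply: (nearI (open_near oU Ux)); apply: (near_pre cF); apply: open_near.
move=> /nearO[W [oW Wx WUV]]; exists W; split => //.
apply: (@smooth_on_comp _ _ _ _ V) => //; first by move=> y /WUV[].
by apply: smooth_on_sub hF => y /WUV[].
Qed.
Lemma sm_comp' m n p x y (F : 'rV[R]_m -> 'rV[R]_n) (G : 'rV[R]_n -> 'rV[R]_p) :
 F x = y -> smooth_at x F -> smooth_at y G -> smooth_at x (fun z => G (F z)).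
Proof. by move=> <-; apply: sm_comp. Qed.
Lemma sm_mulmx m n x (A : 'M[R]_(m, n)) : smooth_at x (mulmx^~ A).
Proof. exists setT; split=> //; first exact: openT. apply: smooth_on_mulmx; exact: openT. Qed.
Lemma sm_cst m n (x : 'rV[R]_m) (c : 'rV[R]_n) : smooth_at x (fun=> c).
Proof. by exists setT; split=> //; [exact: openT|move=> j k; apply: Ck_cst]. Qed.
Lemma sm_coordP m n x (F : 'rV[R]_m -> 'rV[R]_n) :
 smooth_at x F <-> forall j, exists O, [/\ open O, O x & forall k, Ck k O (fun y => F y 0 j)].
Proof.
split=> [[U [oU Ux h]] j|h]; first by exists U; split => // k; apply: h.
have [U hU] := choice h.
have : \forall y \near x, forall j, U j y.
 by apply: near_forallI => j; have [oU Ux _] := hU j; apply: open_near.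
move=> /nearO[V [oV Vx VU]]; exists V; split=> // j k.
have [_ _ /(_ k)] := hU j; apply: Ck_sub => y Vy; exact: VU.
Qed.
Lemma sm_row_mx m n p x (F : 'rV[R]_m -> 'rV[R]_n) (G : 'rV[R]_m -> 'rV[R]_p) :
 smooth_at x F -> smooth_at x G -> smooth_at x (fun y => (F y):|(G y)).
Proof.
move=> /sm_coordP hF /sm_coordP hG; apply/sm_coordP => j.
case: (split_ordP j) => i ->.
 have [U [oU Ux h]] := hF i; exists U; split => // k.
 by apply: Ck_ext (h k) => // y _; rewrite row_mxEl.
have [U [oU Ux h]] := hG i; exists U; split => // k.
by apply: Ck_ext (h k) => // y _; rewrite row_mxEr.
Qed.
Lemma sm_add m n x (F G : 'rV[R]_m -> 'rV[R]_n) :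
 smooth_at x F -> smooth_at x G -> smooth_at x (fun y => F y + G y).
Proof.
move=> hF hG.
have -> : (fun y => F y + G y) = (fun y => (F y):|(G y) *m col_mx 1%:M 1%:M).
 by apply/funext => y; rewrite mul_row_col !mulmx1.
apply: (@sm_comp _ _ _ _ (fun y => (F y):|(G y)) (mulmx^~ (col_mx 1%:M 1%:M))).
 exact: sm_row_mx.
exact: sm_mulmx.
Qed.
Lemma sm_id m (x : 'rV[R]_m) : smooth_at x id.
Proof. by apply: sm_ext (sm_mulmx x 1%:M); apply: nearT => y; rewrite mulmx1. Qed.
(** Tangent vectors are row vectors acting from the left, so row [i] holds the derivatives in
    direction [i] and the chain rule multiplies in the order [jac F *m jac G]. The body is locked to
    keep terms from unfolding. *)
Definition jac m n (F : 'rV[R]_m -> 'rV[R]_n) (x : 'rV[R]_m) : 'M[R]_(m, n) :=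
 locked (\matrix_(i, j) partial i (fun y => F y 0 j) x).
Lemma jacE m n (F : 'rV[R]_m -> 'rV[R]_n) x i j : jac F x i j = partial i (fun y => F y 0 j) x.
Proof. by rewrite /jac -lock mxE. Qed.
Lemma deriveJ m n x v (F : 'rV[R]_m -> 'rV[R]_n) : smooth_at x F -> 'D_v F x = v *m jac F x.
Proof.
move=> [U [oU Ux sF]]; have d : differentiable F x by apply: smooth_on_diff Ux.
apply/rowP => j; rewrite deriveE // diff_coordE // deriveE; last first.
 by have [] := Ck1_diff oU (sF j 1%N) Ux.
have [_ ->] := Ck1_diff oU (sF j 1%N) Ux.
by rewrite mxE; apply: eq_bigr => i _; rewrite jacE.
Qed.
Lemma eq_rowmul m n (A B : 'M[R]_(m, n)) : (forall v : 'rV_m, v *m A = v *m B) -> A = B.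
Proof. by move=> h; apply/row_matrixP => i; rewrite !rowE. Qed.
Lemma jac_comp m n p x (F : 'rV[R]_m -> 'rV[R]_n) (G : 'rV[R]_n -> 'rV[R]_p) :
 smooth_at x F -> smooth_at (F x) G -> jac (G \o F) x = jac F x *m jac G (F x).
Proof.
move=> sF sG; apply: eq_rowmul => v; rewrite mulmxA.
have dF := sm_diff sF; have dG := sm_diff sG.
rewrite -(deriveJ _ sF) -(deriveJ _ sG) -(deriveJ _ (sm_comp sF sG)).
rewrite !deriveE //; last exact: differentiable_comp.
by rewrite diff_comp.
Qed.
Lemma jac_ext m n x (F G : 'rV[R]_m -> 'rV[R]_n) : (\forall y \near x, F y = G y) ->
 smooth_at x F -> jac F x = jac G x.
Proof.
move=> h sF; have sG := sm_ext h sF; apply: eq_rowmul => v.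
rewrite -(deriveJ _ sF) -(deriveJ _ sG).
exact: (@near_eq_derive R _ _ F G x v h).
Qed.
Lemma jac_mulmx m n x (A : 'M[R]_(m, n)) : jac (mulmx^~ A) x = A.
Proof.
apply: eq_rowmul => v; rewrite -(deriveJ _ (sm_mulmx x A)).
have d : differentiable (mulmx^~ A : 'rV[R]_m -> _) x by apply: sm_diff; apply: sm_mulmx.
rewrite deriveE //.
have -> : (mulmx^~ A : 'rV[R]_m -> _) = mulmxr A by [].
rewrite diff_lin //; exact: mulmxr_continuous.
Qed.
Lemma jac_cst m n (x : 'rV[R]_m) (c : 'rV[R]_n) : jac (fun=> c) x = 0.
Proof.
apply: eq_rowmul => v; rewrite -(deriveJ _ (sm_cst x c)) mulmx0.
exact: derive_cst.
Qed.
Lemma jac_id m (x : 'rV[R]_m) : jac id x = 1%:M.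
Proof. by rewrite -[RHS](jac_mulmx x); congr (jac _ x); apply/funext => y; rewrite mulmx1. Qed.
Lemma jac_lsub m n p x (F : 'rV[R]_m -> 'rV[R]_n) (A : 'M[R]_(n, p)) : smooth_at x F ->
 jac (fun y => F y *m A) x = jac F x *m A.
Proof.
move=> sF; rewrite (jac_comp sF (sm_mulmx _ _)).
by rewrite jac_mulmx.
Qed.
Lemma jac_row_mx m n p x (F : 'rV[R]_m -> 'rV[R]_n) (G : 'rV[R]_m -> 'rV[R]_p) :
 smooth_at x F -> smooth_at x G -> jac (fun y => (F y):|(G y)) x = (jac F x):|(jac G x).
Proof.
move=> sF sG; have sR := sm_row_mx sF sG.
set J := jac _ x.
have e1 : lsubmx J = jac F x.
 have -> : lsubmx J = J *m col_mx 1%:M 0 by rewrite -[J in RHS]hsubmxK mul_row_col mulmx1 mulmx0 addr0.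
 rewrite -jac_lsub //; congr (jac _ x); apply/funext => y.
 by rewrite mul_row_col mulmx1 mulmx0 addr0.
have e2 : rsubmx J = jac G x.
 have -> : rsubmx J = J *m col_mx 0 1%:M by rewrite -[J in RHS]hsubmxK mul_row_col mulmx1 mulmx0 add0r.
 rewrite -jac_lsub //; congr (jac _ x); apply/funext => y.
 by rewrite mul_row_col mulmx1 mulmx0 add0r.
by rewrite -e1 -e2 hsubmxK.
Qed.
Lemma jac_add m n x (F G : 'rV[R]_m -> 'rV[R]_n) :
 smooth_at x F -> smooth_at x G -> jac (fun y => F y + G y) x = jac F x + jac G x.
Proof.
move=> sF sG; have sR := sm_row_mx sF sG.
have -> : (fun y => F y + G y) = (fun y => (F y):|(G y) *m col_mx 1%:M 1%:M).
 by apply/funext => y; rewrite mul_row_col !mulmx1.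
by rewrite jac_lsub // jac_row_mx // mul_row_col !mulmx1.
Qed.
Lemma sm_opp m n x (F : 'rV[R]_m -> 'rV[R]_n) : smooth_at x F -> smooth_at x (fun y => - F y).
Proof.
move=> sF; have -> : (fun y => - F y) = (fun y => F y *m (- 1%:M)) by apply/funext => y; rewrite mulmxN mulmx1.
exact: (sm_comp sF (sm_mulmx _ _)).
Qed.
Lemma jac_opp m n x (F : 'rV[R]_m -> 'rV[R]_n) : smooth_at x F -> jac (fun y => - F y) x = - jac F x.
Proof.
move=> sF; have -> : (fun y => - F y) = (fun y => F y *m (- 1%:M)) by apply/funext => y; rewrite mulmxN mulmx1.
by rewrite jac_lsub // mulmxN mulmx1.
Qed.
Lemma smooth_on_jac m n (O : set 'rV[R]_m) (F : 'rV[R]_m -> 'rV[R]_n) i j k : open O ->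
 smooth_on O F -> Ck k O (fun x => jac F x i j).
Proof.
move=> oO sF; apply: (@Ck_ext _ _ _ (partial i (fun y => F y 0 j))) => //; first by move=> x _; rewrite jacE.
by have [_ /(_ i)[]] := sF j k.+1.
Qed.
Lemma det_near m n x (F : 'rV[R]_m -> 'rV[R]_n) (A : 'M[R]_(n, m)) : smooth_at x F ->
 \det (jac F x *m A) != 0 -> \forall y \near x, \det (jac F y *m A) != 0.
Proof.
move=> [U [oU Ux sF]] n0.
have C : Ck 0 U (fun y => \det (jac F y *m A)).
 apply: Ck_det => // i j.
 apply: (@Ck_ext _ _ _ (fun y => \sum_k jac F y i k * A k j)) => //; first by move=> y _; rewrite mxE.
 by apply: Ck_sum => // k _; apply: Ck_mul => //; [exact: smooth_on_jac|exact: Ck_cst].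
have c := Ck_cont C Ux.
have : \forall d \near \det (jac F x *m A), d != 0 by apply: open_near => //; exact: open_neq.
exact: (@near_pre _ _ (fun y => \det (jac F y *m A)) x (fun d => d != 0) c).
Qed.
End Calculus.
Local Notation "A &n B" := (nearI A B) (at level 60, right associativity).
Arguments nearO {T x P}.
HB.instance Definition _ (R : realType) m n := Complete.on 'M[R]_(m, n).
(** * The inverse function theorem *)
Section IFT.
Variable R : realType.
Lemma mx_complete_check m : (forall (U : set 'rV[R]_m) (f : {fun U >-> U}),
 is_contraction f -> closed U -> U !=set0 -> exists2 p, U p & p = f p).
Proof. by move=> U f; apply: banach_fixed_point. Qed.
Lemma diff_bound m n x (F : 'rV[R]_m -> 'rV[R]_n) e : smooth_at x F -> 0 < e ->
 \forall y \near x, `|F y - F x - (y - x) *m jac F x| <= e * `|y - x|.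
Proof.
move=> sF e0; have d := sm_diff sF.
have [_ /eqaddoP/(_ _ e0)] := (diff_locallyP x F).1 d.
move=> H; rewrite (near_shift 0 x) subr0.
have H' : \forall v \near (0), `|(F \o shift x - (cst (F x) + 'd F x)) v| <= e * `|v| by exact: H.
apply: nearS H' => v /=; rewrite addrK => H1.
move: H1; rewrite -[X in `|X|]/(F (v + x) - (F x + 'd F x v)) opprD addrA.
by rewrite -(deriveE v d) (deriveJ _ sF).
Qed.
(** [mvt_line] runs over all [|t| <= 1], negative ones included, so [z + t *: (y - z)] stays only in
    the ball of radius [3 r]; this is why the derivatives are bounded there. *)
Lemma small_jac_lip m n (g : 'rV[R]_m -> 'rV[R]_n) (x0 : 'rV[R]_m) (r e : R) : 0 <= e ->
 (forall y, `|y - x0| <= r * 3%:R -> smooth_at y g /\ forall i j, `|jac g y i j| <= e) ->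
 forall y z, `|y - x0| <= r -> `|z - x0| <= r -> `|g y - g z| <= m%:R * e * `|y - z|.
Proof.
move=> e0 h y z hy hz; apply: norm_le_coord => [|i j]; first by rewrite !mulr_ge0.
rewrite ord1 => {i}.
have -> : (g y - g z) 0 j = g (z + 1 *: (y - z)) 0 j - g z 0 j - 1 * 0.
 have -> : z + 1 *: (y - z) = y by rewrite scale1r addrC subrK.
 by rewrite mulr0 subr0 !mxE.
rewrite -[X in _ <= X]mul1r -[X in _ <= X * _](@normr1 R).
apply: (@mvt_line R m (fun x => g x 0 j) z (y - z) 0 (m%:R * e * `|y - z|) 1) => t.
rewrite normr1 => t1.
have zt : `|z + t *: (y - z) - x0| <= r * 3%:R.
 have -> : z + t *: (y - z) - x0 = (z - x0) + t *: ((y - x0) - (z - x0)).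
  by rewrite opprB addrA subrK addrAC.
 apply: (le_trans (ler_normD _ _)); rewrite normrZ.
 have : `|y - x0 - (z - x0)| <= r + r by apply: (le_trans (ler_normB _ _)); exact: lerD.
 move=> h2; have : `|t| * `|y - x0 - (z - x0)| <= r + r.
  by apply: (le_trans _ h2); rewrite ler_piMl.
 by move=> h3; move: hz; lra.
have [s hj] := h _ zt.
have [U [oU Ux sU]] := s.
have [d1 d2] := Ck1_diff oU (sU j 1%N) Ux.
split; first exact: diff_derivable.
rewrite subr0 deriveE // d2 (le_trans (ler_norm_sum _ _ _)) //.
apply: (@le_trans _ _ (\sum_(i < m) (e * `|y - z|))).
 apply: ler_sum => i _; rewrite normrM mulrC ler_pM //; last exact: coord_le_norm.
 by have := hj i j; rewrite jacE.
by rewrite sumr_const card_ord -[X in X <= _]mulr_natl mulrA.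
Qed.
(** Cramer's rule: the entries of the inverse are cofactors divided by the determinant. *)
Lemma Ck_invmx m k (O : set 'rV[R]_m) n (A : 'rV[R]_m -> 'M[R]_n) i j : open O ->
 (forall x, O x -> A x \in unitmx) ->
 (forall i j, Ck k O (fun x => A x i j)) -> Ck k O (fun x => invmx (A x) i j).
Proof.
move=> oO u h.
apply: (@Ck_ext _ _ _ _ (fun x => (\det (A x))^-1 * ((-1) ^+ (j + i) * \det (row' j (col' i (A x)))))) => //.
 by move=> x Ox; rewrite /invmx u // !mxE.
apply: Ck_mul => //.
 apply: Ck_inv => //; last exact: Ck_det.
 by move=> x Ox; have := u _ Ox; rewrite unitmxE unitfE.
apply: Ck_mul => //; first exact: Ck_cst.
apply: Ck_det => // a b; apply: Ck_ext (h (lift j a) (lift i b)) => // x _.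
by rewrite !mxE.
Qed.
Lemma jac_near m n x (F : 'rV[R]_m -> 'rV[R]_n) e : smooth_at x F -> 0 < e ->
 \forall y \near x, forall i j, `|jac F y i j - jac F x i j| <= e.
Proof.
move=> [U [oU Ux sF]] e0.
apply: near_forallI => i; apply: near_forallI => j.
have c : {for x, continuous (fun y => jac F y i j)} := Ck_cont (smooth_on_jac i j 0 oU sF) Ux.
have cc : jac F y i j @[y --> x] --> jac F x i j := c.
by move/cvgrPdist_le: cc => /(_ _ e0); apply: nearS => y; rewrite distrC.
Qed.
Lemma near_ball m (x : 'rV[R]_m) (P : 'rV[R]_m -> Prop) : (\forall y \near x, P y) ->
 exists2 r, 0 < r & forall y, `|y - x| < r -> P y.
Proof.
move=> /nbhs_ballP[r r0 h]; exists r => // y yr; apply: h.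
by rewrite mx_norm_ball /ball_ /= distrC.
Qed.
Lemma ball_near m (x : 'rV[R]_m) (P : 'rV[R]_m -> Prop) r : 0 < r ->
 (forall y, `|y - x| < r -> P y) -> \forall y \near x, P y.
Proof.
move=> r0 h; apply/nbhs_ballP; exists r => //= y.
by rewrite mx_norm_ball /ball_ /= distrC; apply: h.
Qed.
Lemma norm_sub_cont m (x0 : 'rV[R]_m) : continuous (fun y : 'rV[R]_m => `|y - x0|).
Proof.
move=> y; apply: cont_dist => e e0; apply: (ball_near e0) => z zy.
rewrite (le_trans (ler_dist_dist _ _)) // opprB addrA subrK distrC ltW //.
Qed.
Lemma cball_closed m (x0 : 'rV[R]_m) r : closed [set y : 'rV[R]_m | `|y - x0| <= r].
Proof.
have -> : [set y : 'rV[R]_m | `|y - x0| <= r] = (fun y => `|y - x0|) @^-1` [set t | t <= r] by [].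
apply: closed_comp; last exact: closed_le.
move=> y _; exact: norm_sub_cont.
Qed.
(** Let [P] be the inverse Jacobian at [x0]. The map [g y = y - F y *m P] has zero derivative at
    [x0], hence is a contraction with factor 1/2 nearby, and the fixed points of [v *m P + g y] are
    the solutions of [F y = v]. *)
Lemma ift_bij m (F : 'rV[R]_m -> 'rV[R]_m) x0 : smooth_at x0 F -> jac F x0 \in unitmx ->
 exists r C (G : 'rV[R]_m -> 'rV[R]_m) (W : set 'rV[R]_m),
 [/\ [/\ 0 < r, 0 < C, open W & W (F x0)],
  forall y, `|y - x0| <= r -> smooth_at y F /\ jac F y \in unitmx,
  forall v, W v -> `|G v - x0| <= r /\ F (G v) = v,
  forall y z, `|y - x0| <= r -> `|z - x0| <= r -> `|y - z| <= C * `|F y - F z| &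
  True].
Proof.
move=> sF u; set P := invmx (jac F x0).
pose g y := y - F y *m P.
have sPhi y : smooth_at y F -> smooth_at y (fun z => F z *m P).
 by move=> s; apply: (sm_comp (G := mulmx^~ P) s); exact: sm_mulmx.
have sg y : smooth_at y F -> smooth_at y g.
 by move=> s; apply: sm_add; [exact: sm_id|apply: sm_opp; exact: sPhi].
have jg : jac g x0 = 0.
 rewrite /g jac_add; [|exact: sm_id|by apply: sm_opp; exact: sPhi].
 by rewrite jac_id jac_opp ?jac_lsub //; [rewrite mulmxV // subrr|exact: sPhi].
(* With this bound on the entries of [jac g], [small_jac_lip] gives a Lipschitz constant
   [m * e <= 1/2]. *)
pose e := (2 * m.+1%:R)^-1 : R.
have e0 : 0 < e by rewrite invr_gt0 mulr_gt0.
have [rho rho0 hrho] : exists2 rho, 0 < rho & forall y, `|y - x0| < rho ->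
  [/\ smooth_at y F, \det (jac F y *m P) != 0 & forall i j, `|jac g y i j| <= e].
 apply: near_ball.
 have n1 := sm_near sF.
 have n2 : \forall y \near x0, \det (jac F y *m P) != 0.
  by apply: det_near => //; rewrite mulmxV // det1 oner_neq0.
 have n3 := jac_near (sg _ sF) e0.
 apply: nearS (n1 &n n2 &n n3) => y [a [b c]]; split => // i j.
 by have := c i j; rewrite jg mxE subr0.
(* Any [r] with [3 r < rho] serves, as [small_jac_lip] looks at the ball of radius [3 r]. *)
pose r := rho / 4%:R.
have r0 : 0 < r by rewrite divr_gt0.
have r3 : r * 3%:R < rho by rewrite /r; lra.
have lip y z : `|y - x0| <= r -> `|z - x0| <= r -> `|g y - g z| <= 2^-1 * `|y - z|.
 move=> hy hz; have := @small_jac_lip m m g x0 r e (ltW e0) _ y z hy hz.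
 move=> H; apply: (le_trans (H _)); last first.
  rewrite ler_wpM2r // /e invfM mulrCA ler_piMr // ler_pdivrMr // mul1r ler_nat //.
 move=> w hw; have [a b c] := hrho w (le_lt_trans hw r3); split => //; exact: sg.
have gE y : y = F y *m P + g y by rewrite /g addrC subrK.
have lip2 y z : `|y - x0| <= r -> `|z - x0| <= r -> `|y - z| <= 2 * `|F y *m P - F z *m P|.
 move=> hy hz; have L := lip _ _ hy hz.
 have : `|y - z| <= `|F y *m P - F z *m P| + `|g y - g z|.
  rewrite {1}(gE y) {1}(gE z) opprD addrACA; exact: ler_normD.
 by move=> h; lra.
have [C0 C00 hC0] := @mulmx_norm R 1 m m P.
(* Half of [r] is spent on moving the target value and the other half by the contraction, so the
   closed ball of radius [r] is mapped to itself. *)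
pose W := [set v : 'rV[R]_m | `|v *m P - F x0 *m P| < r / 2].
have ex v : W v -> exists y, `|y - x0| <= r /\ F y = v.
 move=> Wv; pose B := [set y : 'rV[R]_m | `|y - x0| <= r].
 pose f y := v *m P + g y.
 have fB : set_fun B B f.
  move=> y By; rewrite /B /= /f.
  have -> : v *m P + g y - x0 = (v *m P - F x0 *m P) + (g y - g x0).
   by rewrite {1}(gE x0) opprD addrACA.
  apply: (le_trans (ler_normD _ _)).
  have L := lip y x0 By (_ : `|x0 - x0| <= r).
  have : `|g y - g x0| <= 2^-1 * `|y - x0| by apply: L; rewrite subrr normr0 ltW.
  move: By Wv; rewrite /B /W /= => By Wv L2; lra.
 pose f' := HB.pack_for {fun B >-> B} f (isFun.Build _ _ B B f fB).
 have ctr : is_contraction f'.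
  exists (2^-1)%:nng; split; first by rewrite invf_lt1 // ltr1n.
  move=> [y z] [/= By Bz].
  rewrite /f opprD addrACA subrr add0r; exact: lip.
 have [|y By yf] := mx_complete_check ctr (@cball_closed m x0 r).
  by exists x0; rewrite /B /= subrr normr0 ltW.
 exists y; split => //.
 have : F y *m P = v *m P.
  have : y = f y by exact: yf.
  by rewrite {1}(gE y) /f => /addIr.
 by move=> /(congr1 (mulmx^~ (jac F x0))); rewrite -!mulmxA mulVmx // !mulmx1.
have [G hG] : exists G, forall v, W v -> `|G v - x0| <= r /\ F (G v) = v.
 have : forall v, exists y, W v -> `|y - x0| <= r /\ F y = v.
  by move=> v; have [/ex[y hy]|nW] := pselect (W v); [exists y | exists 0].
 by move=> /choice[G hG]; exists G.
exists r, (2 * C0), G, W; split => //.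
- split => //; first by rewrite mulr_gt0.
  have c : continuous (fun v : 'rV[R]_m => `|v *m P - F x0 *m P|).
   move=> v; apply: (@continuous_comp _ _ _ (mulmx^~ P : 'rV[R]_m -> 'rV[R]_m) (fun y : 'rV[R]_m => `|y - F x0 *m P|)).
    exact: mulmxr_continuous.
   exact: norm_sub_cont.
  have -> : W = (fun v : 'rV[R]_m => `|v *m P - F x0 *m P|) @^-1` [set t | t < r / 2] by [].
  by apply: open_comp => [v _|]; [exact: c|exact: open_lt].
 by rewrite /W /= subrr normr0 divr_gt0.
- move=> y hy; have [|a b _] := hrho y; first by apply: le_lt_trans r3; apply: (le_trans hy); lra.
 split => //; rewrite unitmxE unitfE; move: b; rewrite det_mulmx mulf_eq0 negb_or; by case/andP.
- move=> y z hy hz; apply: (le_trans (lip2 _ _ hy hz)).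
 by rewrite -mulrA ler_pM2l // -mulmxBl.
Qed.
(** The Lipschitz estimate of [ift_bij] makes the local inverse [G] continuous, and the first-order
    expansion of [F] at [G v] then gives its partial derivatives as rows of the inverse Jacobian.
    Smoothness follows by induction on the order, these entries being smooth functions of [G v]. *)
Theorem inverse_function m (F : 'rV[R]_m -> 'rV[R]_m) x0 : smooth_at x0 F -> jac F x0 \in unitmx ->
 exists G, [/\ smooth_at (F x0) G, \forall y \near x0, G (F y) = y & \forall v \near F x0, F (G v) = v].
Proof.
move=> sF u; have [r [C [G [W [[r0 C0 oW Wx0] hB hG lip _]]]]] := ift_bij sF u.
have nW : \forall v \near F x0, F (G v) = v by apply: nearS (open_near oW Wx0) => v /hG[].
exists G; split => //; last first.
 have c := sm_cont sF.
 have n1 : \forall y \near x0, W (F y) by apply: (near_pre c); apply: open_near.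
 have n2 : \forall y \near x0, `|y - x0| <= r by apply: (ball_near r0) => y /ltW.
 apply: nearS (n1 &n n2) => y [Wy By].
 have [a b] := hG _ Wy.
 have := lip _ _ a By; rewrite b subrr normr0 mulr0 normr_le0 subr_eq0 => /eqP //.
have lipG v w : W v -> W w -> `|G v - G w| <= C * `|v - w|.
 by move=> /hG[a b] /hG[c d]; have := lip _ _ a c; rewrite b d.
have cG v : W v -> {for v, continuous G}.
 move=> Wv; apply: cont_dist => e e0.
 have n2 : \forall w \near v, `|w - v| < e / C by apply: (ball_near (divr_gt0 e0 C0)).
 apply: nearS ((open_near oW Wv) &n n2) => w [Ww wv].
 apply: (le_trans (lipG _ _ Wv Ww)); rewrite mulrC -ler_pdivlMr // distrC ltW //.
pose JG v := invmx (jac F (G v)).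
have dG v (j : 'I_m) : W v -> derivable G v (delta_mx 0 j) /\ 'D_(delta_mx 0 j) G v = delta_mx 0 j *m JG v.
 move=> Wv; have [Bv FG] := hG _ Wv; have [sv uv] := hB _ Bv.
 set ej : 'rV[R]_m := delta_mx 0 j.
 have L : (fun h : R => h^-1 *: ((G \o shift v) (h *: ej) - G v)) @ 0^' --> ej *m JG v.
  apply/cvgrPdist_le => e e0.
  have [C1 C10 hC1] := @mulmx_norm R 1 m m (JG v).
  (* Chosen so that the linearization error of [F], multiplied by the norm bound [C1] of [JG v] and
     the Lipschitz constant [C] of [G], stays below [e]. *)
  pose e1 := e / (C1 * (C * `|ej| + 1)).
  have K0 : 0 < C * `|ej| + 1 by rewrite ltr_wpDl // mulr_ge0 // ltW.
  have e10 : 0 < e1 by rewrite divr_gt0 // mulr_gt0.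
  have cs : {for (0 : R), continuous (fun h : R => h *: ej + v)}.
   apply: cvgD; last exact: cvg_cst.
   by apply: cvgZr_tmp; exact: cvg_id.
  have N1 : \forall h \near (0 : R), W (h *: ej + v).
   apply: (@near_pre _ _ (fun h : R => h *: ej + v) 0 W cs).
   by rewrite scale0r add0r; apply: open_near.
  have N2 : \forall h \near (0 : R), `|F (G (h *: ej + v)) - F (G v) - (G (h *: ej + v) - G v) *m jac F (G v)| <= e1 * `|G (h *: ej + v) - G v|.
   have D := diff_bound sv e10.
   have cGh : {for (0 : R), continuous (fun h : R => G (h *: ej + v))}.
    apply: (@continuous_comp _ _ _ (fun h : R => h *: ej + v) G 0 cs).
    by rewrite scale0r add0r; exact: cG.
   apply: (@near_pre _ _ (fun h : R => G (h *: ej + v)) 0 (fun y => `|F y - F (G v) - (y - G v) *m jac F (G v)| <= e1 * `|y - G v|) cGh).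
   by rewrite scale0r add0r.
  have := nearI N1 N2; move=> /nbhs_dnbhs; rewrite -nbhs_nearE => N.
  have N3 : \forall h \near (0 : R)^', h != 0 by exact: nbhs_dnbhs_neq.
  near=> h.
  have h0 : h != 0 by near: h; exact: N3.
  have [Wh Dh] : W (h *: ej + v) /\ `|F (G (h *: ej + v)) - F (G v) - (G (h *: ej + v) - G v) *m jac F (G v)| <= e1 * `|G (h *: ej + v) - G v| by near: h; exact: N.
  rewrite /=; move: Dh; have [_ ->] := hG _ Wh; rewrite FG addrK.
  set k := G (h *: ej + v) - G v => Dh.
  have kl : `|k| <= C * (`|h| * `|ej|).
   by apply: (le_trans (lipG _ _ Wh Wv)); rewrite addrK normrZ.
  have E : ej *m JG v - h^-1 *: k = h^-1 *: ((h *: ej - k *m jac F (G v)) *m JG v).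
   by rewrite mulmxBl -scalemxAl -(mulmxA k) mulmxV // mulmx1 [in RHS]scalerBr scalerA mulVf // scale1r.
  rewrite E normrZ normfV ler_pdivrMl ?normr_gt0 //.
  apply: (le_trans (hC1 _)).
  apply: (@le_trans _ _ (C1 * (e1 * (C * (`|h| * `|ej|))))).
   by rewrite ler_pM2l // (le_trans Dh) // ler_pM2l.
  rewrite /e1.
  have -> : C1 * (e / (C1 * (C * `|ej| + 1)) * (C * (`|h| * `|ej|))) = `|h| * e * ((C * `|ej|) / (C * `|ej| + 1)).
   by field; rewrite !gt_eqF.
  have he : 0 <= `|h| * e by rewrite mulr_ge0 // ltW.
  by rewrite ler_piMr // ler_pdivrMr // mul1r lerDl.
 split; first by apply/cvg_ex; exists (ej *m JG v).
 exact/cvg_lim.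
have smG k (i : 'I_m) : Ck k W (fun v => G v 0 i).
 elim: k i => [|k IH] i.
  split=> // v Wv; apply: (@continuous_comp _ _ _ G (fun M : 'rV[R]_m => M 0 i)); first exact: cG.
  exact: coord_continuous.
 split.
  move=> v Wv; apply: (@continuous_comp _ _ _ G (fun M : 'rV[R]_m => M 0 i)); first exact: cG.
  exact: coord_continuous.
 move=> j; split.
  move=> v Wv; have [/derivable_mxP d _] := dG v j Wv; exact: d.
 apply: (@Ck_ext _ _ _ _ (fun v => JG v j i)) => //.
  move=> v Wv; have [d e] := dG v j Wv.
  rewrite /partial; have := derive_mx d; rewrite e => /matrixP/(_ 0 i).
  by rewrite -rowE !mxE => ->.
 pose O := [set y : 'rV[R]_m | smooth_at y F].
 have oO : open O by rewrite openE => y; apply: sm_near.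
 apply: Ck_invmx => // [v Wv|a b]; first by have [/hB[]] := hG _ Wv.
 apply: (@Ck_comp _ _ _ _ W O G (fun y => jac F y a b)) => //.
  by move=> v Wv; have [/hB[]] := hG _ Wv.
 apply: smooth_on_jac => // l k'.
 by apply: Ck_local => y [U [_ Uy sU]]; exists U.
by exists W; split => // i k; exact: smG.
Unshelve. all: by end_near. Qed.
End IFT.

(** * Zero sets of submersions, and linear algebra of lagrangian subspaces *)

Section Coord.
Variable R : realType.
Lemma row_free_tr m n (A : 'M[R]_(m, n)) : row_free A^T = row_full A.
Proof. by rewrite /row_free /row_full mxrank_tr. Qed.
Lemma row_fullI m n (A : 'M[R]_(m, n)) : (forall l : 'cV_n, A *m l = 0 -> l = 0) -> row_full A.
Proof.
move=> h; rewrite -row_free_tr -kermx_eq0; apply/eqP/row_matrixP => i.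
rewrite row0; apply: trmx_inj; rewrite trmx0; apply: h.
apply: trmx_inj; rewrite trmx_mul trmxK trmx0; apply/sub_kermxP; exact: row_sub.
Qed.
Lemma row_fullE m n (A : 'M[R]_(m, n)) (l : 'cV_n) : row_full A -> A *m l = 0 -> l = 0.
Proof. by move=> /row_fullP[B BA] Al; rewrite -[l]mul1mx -BA -mulmxA Al mulmx0. Qed.
Lemma row_full_onto m n (A : 'M[R]_(m, n)) (w : 'rV_n) : row_full A -> exists v, v *m A = w.
Proof. by move=> /row_fullP[B BA]; exists (w *m B); rewrite -mulmxA BA mulmx1. Qed.
Lemma row_full_leq m n (A : 'M[R]_(m, n)) : row_full A -> (n <= m)%N.
Proof. by move=> /eqP <-; exact: rank_leq_row. Qed.
Lemma row_freeI m n (A : 'M[R]_(m, n)) : (forall v : 'rV_m, v *m A = 0 -> v = 0) -> row_free A.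
Proof.
move=> h; rewrite -kermx_eq0; apply/eqP/row_matrixP => i.
rewrite row0; apply: h; apply/sub_kermxP; exact: row_sub.
Qed.
Lemma compl_free k c (B : 'M[R]_(c, k + c)) : row_free B -> exists K : 'M[R]_(k, k + c), col_mx K B \in unitmx.
Proof.
move=> fB.
have e : \rank (B^C)%MS = k by rewrite mxrank_compl (eqP fB) addnK.
exists (castmx (e, erefl) (row_base (B^C)%MS)).
rewrite -row_full_unit -sub1mx.
have E : (castmx (e, erefl) (row_base (B^C)) :=: B^C)%MS.
 exact: eqmx_trans (eqmx_cast _ _) (eq_row_base _).
by rewrite -addsmxE (adds_eqmx E (eqmx_refl B)) sub1mx addsmxC addsmx_compl_full.
Qed.
Lemma compl_full k c (A : 'M[R]_(k + c, c)) : row_full A -> exists K : 'M[R]_(k + c, k), K:|A \in unitmx.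
Proof.
rewrite -row_free_tr => /compl_free[K hK]; exists K^T.
by rewrite -unitmx_tr tr_row_mx trmxK.
Qed.
Lemma detl_near m n x (F : 'rV[R]_m -> 'rV[R]_n) (B : 'M[R]_(n, m)) : smooth_at x F ->
 \det (B *m jac F x) != 0 -> \forall y \near x, \det (B *m jac F y) != 0.
Proof.
move=> [U [oU Ux sF]] n0.
have C : Ck 0 U (fun y => \det (B *m jac F y)).
 apply: Ck_det => // i j.
 apply: (@Ck_ext _ _ _ _ (fun y => \sum_k B i k * jac F y k j)) => //; first by move=> y _; rewrite mxE.
 by apply: Ck_sum => // k _; apply: Ck_mul => //; [exact: Ck_cst|exact: smooth_on_jac].
have c := Ck_cont C Ux.
have : \forall d \near \det (B *m jac F x), d != 0 by apply: open_near => //; exact: open_neq.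
exact: (@near_pre _ _ (fun y => \det (B *m jac F y)) x (fun d => d != 0) c).
Qed.
Lemma surj_near m n x (F : 'rV[R]_m -> 'rV[R]_n) : smooth_at x F -> row_full (jac F x) ->
 \forall y \near x, row_full (jac F y).
Proof.
move=> sF /row_fullP[B BF].
have n0 : \det (B *m jac F x) != 0 by rewrite BF det1 oner_neq0.
apply: nearS (detl_near sF n0) => y; rewrite -unitfE -unitmxE => u.
by apply/row_fullP; exists (invmx (B *m jac F y) *m B); rewrite -mulmxA mulVmx.
Qed.
(** Completing [h] by linear coordinates [u *m K] gives a local diffeomorphism, in which the zero
    set of [h] becomes a coordinate subspace. *)
Lemma straighten k c (h : 'rV[R]_(k + c) -> 'rV[R]_c) u0 : smooth_at u0 h -> row_full (jac h u0) ->
 exists K : 'M[R]_(k + c, k), let Phi u := (u *m K):|(h u) in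
 K:|(jac h u0) \in unitmx /\ exists G,
 [/\ smooth_at (Phi u0) G, \forall u \near u0, G (Phi u) = u,
   \forall w \near Phi u0, Phi (G w) = w & jac G (Phi u0) = invmx K:|(jac h u0)].
Proof.
move=> sh /compl_full[K uK]; exists K => Phi; split => //.
have sP : smooth_at u0 Phi by apply: sm_row_mx => //; exact: sm_mulmx.
have jP : jac Phi u0 = K:|(jac h u0).
 by rewrite /Phi jac_row_mx ?jac_mulmx //; exact: sm_mulmx.
have [|G [sG GP PG]] := inverse_function sP; first by rewrite jP.
exists G; split => //.
have : jac (G \o Phi) u0 = 1%:M.
 rewrite -(jac_id u0); apply: jac_ext => //; exact: sm_comp.
rewrite jac_comp // jP => e.
by rewrite -[LHS]mul1mx -(mulVmx uK) -mulmxA e mulmx1.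
Qed.
(** Elimination of the last [b] variables from [H = 0]: since [H] is a submersion whose derivative
    is injective in their direction, the zero set is the graph of [zeta] over a submanifold [h = 0].
    The factorization of [H] along this graph as [h y *m S] is kept because differentiating it shows
    how tangent vectors of [h = 0] lift to the zero set of [H]. *)
Lemma project_zero_set p b q e (H : 'rV[R]_(p + b) -> 'rV[R]_e) (y0 : 'rV_p) (z0 : 'rV_b) :
 e = (q + b)%N -> smooth_at y0:|z0 H -> H y0:|z0 = 0 ->
 row_full (jac H y0:|z0) ->
 (forall v : 'rV_b, 0:|v *m jac H y0:|z0 = 0 -> v = 0) ->
 exists (h : 'rV[R]_p -> 'rV[R]_q) (zeta : 'rV[R]_p -> 'rV[R]_b) (S : 'M[R]_(q, e)),
 [/\ smooth_at y0 h /\ smooth_at y0 zeta, zeta y0 = z0 /\ h y0 = 0, row_full (jac h y0),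
  \forall y \near y0, H y:|(zeta y) = h y *m S &
  \forall u \near y0:|z0, H u = 0 -> h (lsubmx u) = 0 /\ rsubmx u = zeta (lsubmx u)].
Proof.
move=> eE; subst e => sH H0 fH inj; set u0 := y0:|z0 in sH H0 fH inj *.
set J := jac H u0 in fH inj *.
pose M1 : 'M[R]_(b, q + b) := dsubmx J.
have M1E (v : 'rV_b) : v *m M1 = 0:|v *m J.
 by rewrite -[J in RHS]vsubmxK mul_row_col mul0mx add0r.
have fM : row_free M1 by apply: row_freeI => v; rewrite M1E; apply: inj.
have [K' uK] := compl_free fM.
(* [M1 *m N = 1] and [M1 *m Q = 0]: the part [H *m N] determines the eliminated variables, and
   [H *m Q] is what remains as an equation on the others. *)
pose NQ := invmx (col_mx K' M1); pose N := rsubmx NQ; pose Q := lsubmx NQ.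
have NQE : NQ = Q:|N by rewrite hsubmxK.
have [QK KN MQ MN] : [/\ K' *m Q = 1%:M, K' *m N = 0, M1 *m Q = 0 & M1 *m N = 1%:M].
 have : col_mx K' M1 *m NQ = 1%:M by rewrite mulmxV.
 by rewrite NQE mul_col_row scalar_mx_block => /eq_block_mx[-> -> -> ->].
pose H1 u := H u *m N.
have sH1 : smooth_at u0 H1 by apply: (sm_comp (G := mulmx^~ N) sH); exact: sm_mulmx.
pose P1 : 'M[R]_(p + b, p) := col_mx 1%:M 0.
have P1E (u : 'rV_(p + b)) : u *m P1 = lsubmx u by rewrite -[u in LHS]hsubmxK mul_row_col mulmx1 mulmx0 addr0.
pose Psi u := (u *m P1):|(H1 u).
have sPsi : smooth_at u0 Psi by apply: sm_row_mx => //; exact: sm_mulmx.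
have jPsi : jac Psi u0 = P1:|(J *m N).
 by rewrite /Psi jac_row_mx ?jac_mulmx ?jac_lsub //; exact: sm_mulmx.
have uPsi : jac Psi u0 \in unitmx.
 rewrite -row_free_unit; apply: row_freeI => v; rewrite jPsi mul_mx_row => e.
 have := congr1 lsubmx e; have := congr1 rsubmx e.
 rewrite !row_mxKl !row_mxKr !linear0 P1E mulmxA => e2 e1.
 move: e2; rewrite -[v]hsubmxK e1 -M1E -mulmxA MN mulmx1 => ->.
 by rewrite row_mx0.
have [G [sG GP PG]] := inverse_function sPsi uPsi.
have Psi0 : Psi u0 = y0:|0 by rewrite /Psi /H1 H0 mul0mx P1E row_mxKl.
rewrite Psi0 in sG PG.
pose j0 (y) : 'rV[R]_(p + b) := y:|0.
have sj y : smooth_at y j0 by apply: sm_row_mx; [exact: sm_id|exact: sm_cst].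
pose zeta y := G (j0 y) *m (col_mx 0 1%:M : 'M[R]_(p + b, b)).
have zE y : zeta y = rsubmx (G (j0 y)).
 by rewrite /zeta -[G _ in LHS]hsubmxK mul_row_col mulmx1 mulmx0 add0r.
have sGj : smooth_at y0 (fun y => G (j0 y)) by apply: (sm_comp (sj y0)).
have szeta : smooth_at y0 zeta.
 apply: (sm_comp (F := fun y => G (j0 y)) (G := mulmx^~ _) sGj); exact: sm_mulmx.
have G0 : G (j0 y0) = u0 by rewrite /j0 -Psi0; exact: (near_pt GP).
have z00 : zeta y0 = z0 by rewrite zE G0 row_mxKr.
have nG : \forall y \near y0, G (j0 y) = y:|(zeta y) /\ H y:|(zeta y) *m N = 0.
 have c := sm_cont (sj y0).
 have := @near_pre _ _ j0 y0 _ c PG.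
 apply: nearS => y; rewrite /Psi => e.
 have := congr1 lsubmx e; have := congr1 rsubmx e.
 rewrite !row_mxKl !row_mxKr P1E => e2 e1.
 have Ge : G (j0 y) = y:|(zeta y) by rewrite zE -[LHS]hsubmxK e1.
 by rewrite -Ge.
pose yz y := y:|(zeta y).
have syz : smooth_at y0 yz by apply: sm_row_mx => //; exact: sm_id.
have yz0 : yz y0 = u0 by rewrite /yz z00.
have sHz : smooth_at y0 (fun y => H (yz y)) by apply: (sm_comp' yz0).
pose h y := H (yz y) *m Q.
have sh : smooth_at y0 h by apply: (sm_comp (F := fun y => H (yz y)) (G := mulmx^~ Q) sHz); exact: sm_mulmx.
exists h, zeta, K'.
split => //.
- by split => //; rewrite /h yz0 H0 mul0mx.
- have jz : jac yz y0 = 1%:M:|(jac zeta y0).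
  by rewrite /yz jac_row_mx ?jac_id //; exact: sm_id.
 have jh : jac h y0 = jac yz y0 *m J *m Q.
  rewrite /h jac_lsub //; congr (_ *m _).
  by rewrite (jac_comp) // yz0.
 apply/row_fullP.
 have /row_fullP[B BJ] := fH.
 (* A left inverse of [jac h]: the rows of [K' *m B] are sent by [J] to [K'], and replacing their
    last components by those prescribed by [zeta] changes the value by something in the image of
    [M1], which [Q] kills. *)
 exists (lsubmx (K' *m B)).
 rewrite jh jz !mulmxA mul_mx_row mulmx1.
 set BB := K' *m B.
 have -> : (lsubmx BB):|(lsubmx BB *m jac zeta y0) = BB + 0:|(lsubmx BB *m jac zeta y0 - rsubmx BB).
  set L := lsubmx BB; set L' := rsubmx BB.
  have -> : BB = L:|L' by rewrite hsubmxK.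
  by rewrite add_row_mx addr0 [L' + _]addrC subrK.
 rewrite mulmxDl mulmxDl -{1}/BB -(mulmxA K') BJ mulmx1 QK.
 have E (w : 'M[R]_(q, b)) : 0:|w *m J = w *m M1.
  by rewrite -[J in LHS]vsubmxK mul_row_col mul0mx add0r.
 by rewrite E -mulmxA MQ mulmx0 addr0.
- apply: nearS nG => y [_ e].
 have : H (yz y) *m NQ = (h y):|0 by rewrite NQE mul_mx_row e.
 move=> /(congr1 (mulmx^~ (col_mx K' M1))); rewrite -mulmxA mulVmx // mulmx1 => ->.
 by rewrite mul_row_col mul0mx addr0.
- have c1 : {for u0, continuous (fun u : 'rV[R]_(p + b) => u *m P1)} by apply: mulmxr_continuous.
 have n1 : \forall y \near u0 *m P1, G (j0 y) = y:|(zeta y) /\ H y:|(zeta y) *m N = 0.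
  by rewrite P1E row_mxKl.
 have := @near_pre _ _ (fun u : 'rV[R]_(p + b) => u *m P1) u0 _ c1 n1.
 move=> n2; apply: nearS (GP &n n2) => u [e1 [e2 _]] Hu.
 have Pu : Psi u = j0 (lsubmx u) by rewrite /Psi /H1 Hu mul0mx P1E.
 rewrite Pu -P1E e2 P1E in e1.
 have e3 : rsubmx u = zeta (lsubmx u) by rewrite -{1}e1 row_mxKr.
 by split => //; rewrite /h /yz -e3 hsubmxK Hu mul0mx.
Qed.
Section LagLin.
Variables (d k : nat) (w : 'M[R]_d) (A : 'M[R]_(d, k)).
Hypotheses (dk : d = k.*2) (uw : w \in unitmx) (fA : row_full A)
 (iso : forall u v : 'rV_d, u *m A = 0 -> v *m A = 0 -> u *m w *m v^T = 0).
Let K := kermx A.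
(** [K *m w] lies in the annihilator of [K] by isotropy, and both have dimension [k]. *)
Lemma lag_ker : (kermx K^T <= K *m w)%MS.
Proof.
have rK : \rank K = k by rewrite mxrank_ker (eqP fA) dk -addnn addnK.
have s : (K *m w <= kermx K^T)%MS.
 apply/row_subP => i; apply/sub_kermxP; apply: trmx_inj.
 apply/row_matrixP => j.
 have e := @iso (row i K) (row j K) _ _.
 have h l : row l K *m A = 0 by apply/sub_kermxP; exact: row_sub.
 have := e (h i) (h j).
 rewrite trmx_mul trmxK trmx0 row0 !row_mul => E.
 by apply: trmx_inj; rewrite trmx_mul trmxK trmx0.
have := mxrank_leqif_eq s; rewrite mxrank_ker mxrank_tr rK mxrankMfree ?row_free_unit // rK.
by rewrite {1}dk -addnn addnK => -[_ /esym]; rewrite eqxx => /andP[].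
Qed.
Lemma lag_coiso (u : 'rV_d) : (forall v : 'rV_d, v *m A = 0 -> u *m w *m v^T = 0) -> u *m A = 0.
Proof.
move=> h.
have : (u *m w <= K *m w)%MS.
 apply: submx_trans lag_ker; apply/sub_kermxP; apply: trmx_inj.
 rewrite trmx_mul trmxK trmx0; apply/row_matrixP => i; rewrite row0 row_mul.
 have hr : row i K *m A = 0 by apply/sub_kermxP; exact: row_sub.
 have e := h _ hr.
 by apply: trmx_inj; rewrite trmx_mul trmxK trmx0.
move=> /submxP[D]; rewrite mulmxA => /(congr1 (mulmx^~ (invmx w))).
rewrite -!mulmxA mulmxV // !mulmx1 => ->.
by rewrite -mulmxA mulmx_ker mulmx0.
Qed.
(** [A *m l] runs over the covectors that vanish on the lagrangian subspace; each is the contraction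
    of the form with a vector of that subspace. In this shape isotropy and half dimension enter all
    transversality proofs. *)
Lemma lag_dual (l : 'cV_k) : exists2 t : 'rV_d, t *m A = 0 & t *m w = (A *m l)^T.
Proof.
have : ((A *m l)^T <= K *m w)%MS.
 apply: submx_trans lag_ker; apply/sub_kermxP; apply: trmx_inj.
 by rewrite trmx_mul !trmxK trmx0 mulmxA mulmx_ker mul0mx.
move=> /submxP[D e]; exists (D *m K); first by rewrite -mulmxA mulmx_ker mulmx0.
by rewrite -mulmxA -e.
Qed.
End LagLin.
(** Inclusion of the zero sets gives inclusion of the kernels of the derivatives, which have equal
    dimension and so coincide. Hence the same [K] straightens both systems, and a zero of [h'] near
    [u0] has the [K]-coordinates of a zero of [h], to which it must be equal. *)
Lemma same_dim_zero_set k c (h h' : 'rV[R]_(k + c) -> 'rV[R]_c) u0 :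
 smooth_at u0 h -> smooth_at u0 h' -> row_full (jac h u0) -> row_full (jac h' u0) ->
 h u0 = 0 -> (\forall u \near u0, h u = 0 -> h' u = 0) ->
 \forall u \near u0, h' u = 0 -> h u = 0.
Proof.
move=> sh sh' f f' h0 hh'.
have [K [uK [G [sG GP PG jG]]]] := straighten sh f.
set Phi := fun u => (u *m K):|(h u) in sG GP PG jG.
pose j0 (y) : 'rV[R]_(k + c) := y:|0.
have sj y : smooth_at y j0 by apply: sm_row_mx; [exact: sm_id|exact: sm_cst].
pose w0 := u0 *m K.
have P0 : (u0 *m K):|(h u0) = j0 w0 by rewrite h0.
have G0 : G (j0 w0) = u0 by rewrite -P0; exact: (near_pt GP).
rewrite /Phi P0 in sG PG jG.
have sGj : smooth_at w0 (fun y => G (j0 y)) by apply: (sm_comp (sj w0)).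
have cGj := sm_cont sGj.
have n1 : \forall y \near w0, Phi (G (j0 y)) = j0 y by exact: (@near_pre _ _ j0 w0 (fun w => (G w *m K):|(h (G w)) = w) (sm_cont (sj w0)) PG).
have n2 : \forall y \near w0, h' (G (j0 y)) = 0 /\ h (G (j0 y)) = 0 /\ G (j0 y) *m K = y.
 have n3 : \forall u \near G (j0 w0), h u = 0 -> h' u = 0 by rewrite G0.
 have n4 := @near_pre _ _ (fun y => G (j0 y)) w0 _ cGj n3.
 apply: nearS (n1 &n n4) => y [e hy].
 have := congr1 lsubmx e; have := congr1 rsubmx e.
 by rewrite /Phi /j0 !row_mxKl !row_mxKr => e2 e1; split => //; apply: hy.
have kk (u : 'rV_(k + c)) : u *m jac h u0 = 0 -> u *m jac h' u0 = 0.
 move=> e.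
 have : jac (fun y => h' (G (j0 y))) w0 = 0.
  rewrite -(jac_cst w0 0); apply: jac_ext; first by apply: nearS n2 => y [].
  by apply: (sm_comp' G0).
 rewrite (jac_comp (F := fun y => G (j0 y))) ?G0 //.
 rewrite (jac_comp) // jG.
 have -> : jac j0 w0 = 1%:M:|0.
  rewrite /j0 jac_row_mx ?jac_id ?jac_cst //; [exact: sm_id|exact: sm_cst].
 move=> /(congr1 (mulmx (u *m K))); rewrite mulmx0 !mulmxA mul_mx_row mulmx1 mulmx0.
 have -> : (u *m K):|0 = u *m K:|(jac h u0) by rewrite mul_mx_row e.
 by rewrite -(mulmxA u) mulmxV // mulmx1.
have kk' (u : 'rV_(k + c)) : u *m jac h' u0 = 0 -> u *m jac h u0 = 0.
 move=> /sub_kermxP h1; apply/sub_kermxP.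
 have s : (kermx (jac h u0) <= kermx (jac h' u0))%MS.
  apply/row_subP => i; apply/sub_kermxP/kk/sub_kermxP; exact: row_sub.
 have [_] := mxrank_leqif_eq s; rewrite !mxrank_ker (eqP f) (eqP f') eqxx => /esym/andP[_ s'].
 exact: submx_trans s'.
have uK' : K:|(jac h' u0) \in unitmx.
 rewrite -row_free_unit; apply: row_freeI => u; rewrite mul_mx_row => e.
 have := congr1 lsubmx e; have := congr1 rsubmx e.
 rewrite !row_mxKl !row_mxKr !linear0 => /kk' e2 e1.
 have : u *m K:|(jac h u0) = 0 by rewrite mul_mx_row e1 e2 row_mx0.
 by move=> /(congr1 (mulmx^~ (invmx K:|(jac h u0)))); rewrite -mulmxA mulmxV // mulmx1 mul0mx.
pose Phi' u := (u *m K):|(h' u).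
have sP' : smooth_at u0 Phi' by apply: sm_row_mx => //; exact: sm_mulmx.
have [|G' [_ GP' _]] := inverse_function sP'.
 by rewrite /Phi' jac_row_mx ?jac_mulmx //; exact: sm_mulmx.
have c1 : {for u0, continuous (fun u : 'rV[R]_(k + c) => u *m K)} by apply: mulmxr_continuous.
have m1 := @near_pre _ _ (fun u : 'rV[R]_(k + c) => u *m K) u0 _ c1 n2.
have m2 : \forall y \near w0, G' (Phi' (G (j0 y))) = G (j0 y).
 have n3 : \forall u \near G (j0 w0), G' (Phi' u) = u by rewrite G0.
 exact: (@near_pre _ _ (fun y => G (j0 y)) w0 _ cGj n3).
have m3 := @near_pre _ _ (fun u : 'rV[R]_(k + c) => u *m K) u0 _ c1 m2.
apply: nearS (GP' &n m1 &n m3) => u [a [[b [b' b'']] d]] hu.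
rewrite -a; set z := G (j0 (u *m K)) in b b' b'' d.
have -> : Phi' u = Phi' z by rewrite /Phi' hu b b''.
by rewrite d.
Qed.
(** The iterated directional derivatives of [F] are smooth on the same open set, and the higher
    derivatives of the restriction to the line are their values along it. *)
Lemma curve_smooth m n (F : 'rV[R]_m -> 'rV[R]_n) p v : smooth_at p F ->
 smooth_curve (fun t : R => F (p + t *: v)) /\ 'D_1 (fun t : R => F (p + t *: v)) 0 = v *m jac F p.
Proof.
move=> sF; have [U [oU Up sU]] := sF; split; last first.
 have := @derive_line R m _ F p v 0; rewrite scale0r addr0 => H.
 rewrite (H _).2 ?deriveJ //; apply: diff_derivable; exact: sm_diff.
have cl : {for (0 : R), continuous (fun t : R => p + t *: v)}.
 by apply: cvgD; [exact: cvg_cst|apply: cvgZr_tmp; exact: cvg_id].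
have : \forall t \near (0 : R), U (p + t *: v).
 by apply: (@near_pre _ _ (fun t : R => p + t *: v) 0 U cl); rewrite scale0r addr0; apply: open_near.
move=> /nbhs_ballP[e e0 he]; exists e => //.
have hU t : `|t| < e -> U (p + t *: v) by move=> te; apply: he; rewrite /ball /= sub0r normrN.
pose Fk k := iter k (fun (f : 'rV[R]_m -> 'rV[R]_n) x => 'D_v f x) F.
have sk k : smooth_on U (Fk k).
 elim: k => [|k IH] //= j l.
 apply: (@Ck_ext _ _ _ _ (fun x => \sum_i v 0 i * jac (Fk k) x i j)) => //.
  by move=> x Ux; rewrite (@deriveJ R _ _ x v (Fk k)) ?mxE //; exists U.
 by apply: Ck_sum => // i _; apply: Ck_mul => //; [exact: Ck_cst|exact: smooth_on_jac].
have dk k t : `|t| < e -> derivable (Fk k) (p + t *: v) v.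
 move=> te; apply: diff_derivable; apply: sm_diff; exists U; split => //; exact: hU.
have E k t : `|t| < e -> derive1n k (fun t : R => F (p + t *: v)) t = Fk k (p + t *: v).
 elim: k t => [|k IH] t te; first by rewrite derive1n0.
 rewrite derive1nS derive1E.
 have ne : \forall s \near t, `|s| < e.
  have : open [set s : R | `|s| < e].
   have -> : [set s : R | `|s| < e] = (fun s => `|s|) @^-1` [set s | s < e] by [].
   by apply: open_comp => [s _|]; [exact: norm_continuous|exact: open_lt].
  by move=> o; apply: open_near.
 rewrite (@near_eq_derive _ _ _ _ (fun s : R => Fk k (p + s *: v))); last by apply: nearS ne => s; apply: IH.
 by rewrite (derive_line (dk k t te)).2.
move=> k t te.
have ne : \forall s \near t, `|s| < e.
 have : open [set s : R | `|s| < e].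
  have -> : [set s : R | `|s| < e] = (fun s => `|s|) @^-1` [set s | s < e] by [].
  by apply: open_comp => [s _|]; [exact: norm_continuous|exact: open_lt].
 by move=> o; apply: open_near.
apply: (@near_eq_derivable _ _ _ (fun s : R => Fk k (p + s *: v))).
 by apply: nearS ne => s se; rewrite E.
exact: (derive_line (dk k t te)).1.
Qed.
End Coord.
Lemma sympl_mfd (R : realType) (M : presymplectic R) : is_symplectic M -> is_manifold M. Proof. by case. Qed.
Section Coord2.
Variable R : realType.
Lemma open_of_near {T : topT} (U : set T) : (forall x, U x -> \forall y \near x, U y) -> open U.
Proof. by rewrite openE. Qed.
Lemma coord_submanifold m k c (h : 'rV[R]_m -> 'rV[R]_c) u0 : m = (k + c)%N ->
 smooth_at u0 h -> row_full (jac h u0) -> h u0 = 0 ->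
 exists (O : set 'rV[R]_m) (F Finv : 'rV[R]_m -> 'rV[R]_m) (J : {set 'I_m}),
 [/\ open O /\ O u0, smooth_on O F, open (F @` O) /\ smooth_on (F @` O) Finv,
   forall u, O u -> Finv (F u) = u &
   #|J| = k /\ \forall u \near u0, h u = 0 <-> forall j, j \notin J -> F u 0 j = 0].
Proof.
move=> e; subst m => sh fh h0.
have [K [uK [G [sG GP PG _]]]] := straighten sh fh.
set Phi := fun u : 'rV[R]_(k + c) => (u *m K):|(h u) in sG GP PG.
have sP : smooth_at u0 Phi by apply: sm_row_mx => //; exact: sm_mulmx.
have [A [oA Au0 hA]] := nearO (GP &n (sm_near sP)).
have [B [oB Bv0 hB]] := nearO (PG &n (sm_near sG)).
pose U := [set u | A u /\ B (Phi u)].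
have oU : open U.
 apply: open_of_near => u [Au Bu]; apply: nearI; first exact: open_near.
 have c1 := sm_cont (hA _ Au).2.
 by apply: (@near_pre _ _ Phi u B c1); apply: open_near.
have imU : Phi @` U = [set w | B w /\ A (G w)].
 apply/seteqP; split=> w.
  by case=> u [Au Bu] <-; split => //; rewrite (hA _ Au).1.
 by case=> Bw Aw; have e := (hB _ Bw).1; exists (G w) => //; split => //; rewrite [Phi _]e.
exists U, Phi, G, [set lshift c i | i in 'I_k]%SET; split.
- by split.
- move=> j l; apply: Ck_local => u [Au _].
 by have [_ [V [oV Vu sV]]] := hA _ Au; exists V.
- split.
  rewrite imU; apply: open_of_near => w [Bw Aw]; apply: nearI; first exact: open_near.
  have c1 := sm_cont (hB _ Bw).2.
  by apply: (@near_pre _ _ G w A c1); apply: open_near.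
 rewrite imU => j l; apply: Ck_local => w [Bw _].
 by have [_ [V [oV Vu sV]]] := hB _ Bw; exists V.
- by move=> u [Au _]; have [] := hA _ Au.
- split; first by rewrite card_imset ?card_ord //; exact: lshift_inj.
 apply: nearT => u; split.
  move=> hu j; case: (split_ordP j) => i ->.
   by rewrite imset_f.
  by rewrite /Phi row_mxEr hu mxE.
 move=> H; apply/rowP => i; rewrite mxE; have := H (rshift k i).
 rewrite /Phi row_mxEr; apply.
 apply/negP => /imsetP[a _ /eqP]; by rewrite eq_sym eq_lrshift.
Qed.
(** [E] selects the components of [F] outside [J]; the local inverse [Finv] makes the Jacobian of
    [F] invertible, so these components form a submersion. *)
Lemma submanifold_coord m k (O : set 'rV[R]_m) (F Finv : 'rV[R]_m -> 'rV[R]_m) (J : {set 'I_m}) u0 :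
 open O -> O u0 -> smooth_on O F -> open (F @` O) -> smooth_on (F @` O) Finv ->
 (forall u, O u -> Finv (F u) = u) -> #|J| = k ->
 exists c (h : 'rV[R]_m -> 'rV[R]_c), [/\ m = (k + c)%N, smooth_at u0 h, row_full (jac h u0) &
  forall u, h u = 0 <-> forall j, j \notin J -> F u 0 j = 0].
Proof.
move=> oO Ou sF oF sFi FK cJ.
pose E : 'M[R]_(m, #|~: J|) := \matrix_(j, a) (j == enum_val a)%:R.
have sF0 : smooth_at u0 F by exists O.
have sFi0 : smooth_at (F u0) Finv by exists (F @` O); split => //; exists u0.
have hE (v) a : (v *m E) 0 a = v 0 (enum_val a).
 rewrite mxE (bigD1 (enum_val a)) //= mxE eqxx mulr1 big1 ?addr0 // => j /negPf ja.
 by rewrite mxE ja mulr0.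
exists #|~: J|, (fun u => F u *m E); split.
- by rewrite -cJ cardsC card_ord.
- by apply: (sm_comp (G := mulmx^~ E) sF0); exact: sm_mulmx.
- rewrite jac_lsub //; apply: row_fullI => l e.
 have JJ : jac Finv (F u0) *m jac F u0 = 1%:M.
  apply: mulmx1C; rewrite -jac_comp // -(jac_id u0); apply: jac_ext; last exact: sm_comp.
  by apply: nearS (open_near oO Ou) => u; apply: FK.
 have {}e : E *m l = 0 by rewrite -[E *m l]mul1mx -JJ -mulmxA [_ *m (E *m l)]mulmxA e mulmx0.
 apply/colP => a; move/colP: e => /(_ (enum_val a)); rewrite !mxE => <-.
 rewrite (bigD1 a) //= mxE eqxx mul1r big1 ?addr0 // => b /negPf ba.
 by rewrite mxE (inj_eq enum_val_inj) eq_sym ba mul0r.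
- move=> u; split.
  move=> /rowP h j jJ; have jC : j \in ~: J by rewrite inE.
  by have := h (enum_rank_in jC j); rewrite hE enum_rankK_in // mxE.
 by move=> h; apply/rowP => a; rewrite hE h ?mxE; have := enum_valP a; rewrite inE.
Qed.
Lemma coord_curve m k c (h : 'rV[R]_m -> 'rV[R]_c) u0 v : m = (k + c)%N ->
 smooth_at u0 h -> row_full (jac h u0) -> h u0 = 0 -> v *m jac h u0 = 0 ->
 exists cv : R -> 'rV[R]_m, [/\ smooth_curve cv, cv 0 = u0, 'D_1 cv 0 = v,
  {for 0, continuous cv} & \forall t \near (0 : R), h (cv t) = 0].
Proof.
move=> e; subst m => sh fh h0 vk.
have [K [uK [G [sG GP PG jG]]]] := straighten sh fh.
set Phi := fun u : 'rV[R]_(k + c) => (u *m K):|(h u) in sG GP PG jG.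
pose d : 'rV[R]_(k + c) := (v *m K):|0.
have [s1 s2] := curve_smooth d sG.
have cl : {for (0 : R), continuous (fun t : R => Phi u0 + t *: d)}.
 by apply: cvgD; [exact: cvg_cst|apply: cvgZr_tmp; exact: cvg_id].
exists (fun t : R => G (Phi u0 + t *: d)); split => //.
- by rewrite scale0r addr0; exact: (near_pt GP).
- rewrite s2 jG; have -> : d = v *m K:|(jac h u0) by rewrite mul_mx_row vk.
 by rewrite -mulmxA mulmxV // mulmx1.
- apply: (@continuous_comp _ _ _ (fun t : R => Phi u0 + t *: d) G 0 cl).
 rewrite scale0r addr0; exact: sm_cont sG.
- have PG' : \forall w \near Phi u0 + (0 : R) *: d, Phi (G w) = w by rewrite scale0r addr0.
 have := @near_pre _ _ (fun t : R => Phi u0 + t *: d) 0 _ cl PG'.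
 apply: nearS => t /(congr1 rsubmx); rewrite /Phi row_mxKr => ->.
 by rewrite h0 /d scale_row_mx scaler0 add_row_mx addr0 row_mxKr.
Qed.
End Coord2.
(** * Manifolds, submanifolds and tangent spaces in charts *)
Section Manifold.
Variables (R : realType) (M : premanifold R).
(** A local equation of [S], in the chart [i], by a submersion. The point [x] is not asked to lie in
    [S], so that the presentation persists at all neighbouring points. *)
Definition cut (i : mchart M) (x : M) (S : set M) c (h : 'rV[R]_(mdim M) -> 'rV[R]_c) :=
 [/\ mdom i x, smooth_at i:@x h, row_full (jac h i:@x) &
   \forall y \near x, S y <-> h i:@y = 0].
Hypothesis hM : is_manifold M.
Lemma mdom_open (i : mchart M) : open (mdom i). Proof. by case: hM. Qed.
Lemma mdom_near (i : mchart M) x : mdom i x -> \forall y \near x, mdom i y.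
Proof. by move=> ix; apply: open_near => //; exact: mdom_open. Qed.
Lemma mcoord_cont (i : mchart M) x : mdom i x -> {for x, continuous (mcoord i)}.
Proof. by move=> ix; case: hM => _ _ _ /(_ i)[_ c _] _; apply: c. Qed.
Lemma mcoord_inj (i : mchart M) x y : mdom i x -> mdom i y -> i:@x = i:@y -> x = y.
Proof. by move=> ix iy; case: hM => _ _ _ /(_ i)[c _ _] _; apply: c; rewrite inE. Qed.
Lemma chart_cont (i : mchart M) x (P : 'rV[R]_(mdim M) -> Prop) : mdom i x ->
 (\forall u \near i:@x, P u) -> \forall y \near x, P i:@y.
Proof. by move=> ix; apply: near_pre; exact: mcoord_cont. Qed.
Lemma chart_surj (i : mchart M) x (P : M -> Prop) : mdom i x -> (\forall y \near x, P y) ->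
 \forall u \near i:@x, exists y, [/\ mdom i y, P y & i:@y = u].
Proof.
move=> ix Px; have [U [oU Ux UP]] := nearO ((mdom_near ix) &n Px).
have oi : open (mcoord i @` U).
 by case: hM => _ _ _ /(_ i)[_ _ op] _; apply: op => // y /UP[].
have : \forall u \near i:@x, (mcoord i @` U) u by apply: open_near => //; exists x.
by apply: nearS => u [y /UP[iy Py] <-]; exists y.
Qed.
Lemma near_chart (i : mchart M) x (P : 'rV[R]_(mdim M) -> Prop) : mdom i x ->
 (\forall y \near x, P i:@y) -> \forall u \near i:@x, P u.
Proof. by move=> ix /(chart_surj ix); apply: nearS => u [y [_ Py <-]]. Qed.
Lemma transition (i j : mchart M) x : mdom i x -> mdom j x ->
 exists T, [/\ smooth_at i:@x T, \forall y \near x, j:@y = T i:@y,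
  T i:@x = j:@x & jac T i:@x \in unitmx].
Proof.
case: hM => _ _ _ _ tr ix jx.
have [T [sT eT]] := tr i j x ix jx; have [T' [sT' eT']] := tr j i x jx ix.
have T0 : T i:@x = j:@x by rewrite -(near_pt eT).
exists T; split => //.
have : jac (T' \o T) i:@x = 1%:M.
 rewrite -(jac_id i:@x); apply: jac_ext; last by apply: sm_comp; rewrite ?T0.
 apply: (near_chart ix); apply: nearS (eT &n eT') => y [e e'] /=.
 by rewrite -e -e'.
by rewrite jac_comp ?T0 // => /mulmx1_unit[].
Qed.
Lemma cut_cut (i j : mchart M) x S c (h : _ -> 'rV[R]_c) : cut i x S h -> mdom j x -> h i:@x = 0 ->
 exists T (h' : _ -> 'rV[R]_c), [/\ smooth_at j:@x T /\ (\forall y \near x, i:@y = T j:@y),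
  cut j x S h', jac T j:@x \in unitmx & jac h' j:@x = jac T j:@x *m jac h i:@x].
Proof.
move=> [ix sh fh Sh] jx h0.
have [T [sT eT T0 uT]] := transition jx ix.
exists T, (h \o T).
have je : jac (h \o T) j:@x = jac T j:@x *m jac h i:@x by rewrite jac_comp ?T0.
split => //; split => //; first by apply: sm_comp; rewrite ?T0.
 rewrite je /row_full -mxrank_tr trmx_mul mxrankMfree ?mxrank_tr //.
 by rewrite row_free_unit unitmx_tr.
by apply: nearS (eT &n Sh) => y [e H]; rewrite H e.
Qed.
Lemma cut_near (i : mchart M) x S c (h : _ -> 'rV[R]_c) : cut i x S h -> \forall y \near x, cut i y S h.
Proof.
move=> [ix sh fh Sh].
have n1 := chart_cont ix ((sm_near sh) &n (surj_near sh fh)).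
apply: nearS ((mdom_near ix) &n n1 &n (near_near Sh)) => y [a [[b c'] d]].
by split.
Qed.
Lemma cut_mem (i : mchart M) x S c (h : _ -> 'rV[R]_c) : cut i x S h -> S x <-> h i:@x = 0.
Proof. by move=> [_ _ _ Sh]; exact: (near_pt Sh). Qed.
Lemma submanifold_cut k S (i : mchart M) x : is_submanifold k S -> S x -> mdom i x ->
 exists c (h : _ -> 'rV[R]_c), mdim M = (k + c)%N /\ cut i x S h.
Proof.
move=> sS Sx ix; have [U [F [Fi [J [[oU Ux] sF [oF sFi] FK [cJ nS]]]]]] := sS x i Sx ix.
have [c [h [e sh fh hE]]] := submanifold_coord oU Ux sF oF sFi FK cJ.
exists c, h; split => //; split => //.
by apply: nearS nS => y ->; rewrite hE.
Qed.
Lemma cut_submanifold k c S : mdim M = (k + c)%N ->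
 (forall x, S x -> exists i (h : _ -> 'rV[R]_c), cut i x S h) -> is_submanifold k S.
Proof.
move=> e H x j Sx jx; have [i [h hc]] := H x Sx.
have h0 := (cut_mem hc).1 Sx.
have [T [h' [_ hc' _ _]]] := cut_cut hc jx h0.
have [_ sh fh nS] := hc'; have h0' := (cut_mem hc').1 Sx.
have [U [F [Fi [J [a b d f [cJ nn]]]]]] := coord_submanifold e sh fh h0'.
exists U, F, Fi, J; split => //; split => //.
by apply: nearS (nS &n (chart_cont jx nn)) => y [-> ->].
Qed.
Lemma tangent_kill (i : mchart M) x S c (h : _ -> 'rV[R]_c) v : mdom i x -> smooth_at i:@x h ->
 (\forall y \near x, S y -> h i:@y = 0) -> tangent i S x v -> v *m jac h i:@x = 0.
Proof.
move=> ix sh nS [cv [[ep ep0 sc] c0 <- nc]].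
have dc : derivable cv 0 1 by have := sc 0%N 0; rewrite normr0 => /(_ ep0); rewrite derive1n0.
have dfc : differentiable cv 0 by apply/derivable1_diffP.
have cc : {for (0 : R), continuous cv} := differentiable_continuous dfc.
have dh : differentiable h (cv 0) by rewrite c0; exact: sm_diff.
have E : 'D_1 (h \o cv) 0 = 'D_1 cv 0 *m jac h i:@x.
 rewrite deriveE; last exact: differentiable_comp.
 by rewrite diff_comp // /= -(deriveE _ dh) c0 (deriveJ _ sh) deriveE.
rewrite -E (@near_eq_derive _ _ _ _ (fun=> 0)) ?derive_cst //.
have nu : \forall u \near cv 0, forall y, mdom i y -> i:@y = u -> S y -> h u = 0.
 rewrite c0; apply: nearS (chart_surj ix nS) => u [z [iz nz eu]] y iy yu.
 by have -> : y = z by [apply: (mcoord_inj iy iz); rewrite yu]; rewrite -eu.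
have := @near_pre _ _ cv 0 _ cc nu => nt.
by apply: nearS (nt &n nc) => t [H [y [Sy iy yt]]]; apply: (H y iy yt).
Qed.
Lemma tangent_cut (i : mchart M) x S k c (h : _ -> 'rV[R]_c) v : mdim M = (k + c)%N ->
 cut i x S h -> S x -> tangent i S x v <-> v *m jac h i:@x = 0.
Proof.
move=> e hc Sx; have h0 := (cut_mem hc).1 Sx; have [ix sh fh nS] := hc; split.
 by apply: (tangent_kill ix sh); apply: nearS nS => y [].
move=> vk; have [cv [s1 c0 d cc nh]] := coord_curve e sh fh h0 vk.
exists cv; split => //.
have nu : \forall u \near cv 0, exists y, [/\ mdom i y, (S y <-> h i:@y = 0) & i:@y = u].
 by rewrite c0; apply: chart_surj.
have := @near_pre _ _ cv 0 _ cc nu => nt.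
by apply: nearS (nt &n nh) => t [[y [iy H yt]] ht]; exists y; split => //; apply/H; rewrite yt.
Qed.
Lemma same_dim_cut (i : mchart M) x S S' k c (h h' : _ -> 'rV[R]_c) : mdim M = (k + c)%N ->
 cut i x S h -> cut i x S' h' -> S x -> (\forall y \near x, S y -> S' y) ->
 \forall y \near x, S' y -> S y.
Proof.
move=> e [ix sh fh nS] [_ sh' fh' nS'] Sx SS'.
have h0 : h i:@x = 0 by apply/(near_pt nS).
have n1 : \forall u \near i:@x, h u = 0 -> h' u = 0.
 apply: (near_chart ix); apply: nearS (SS' &n nS &n nS') => y [a [b c']].
 by move=> /b/a/c'.
have : \forall u \near i:@x, h' u = 0 -> h u = 0.
 move: h h' sh sh' fh fh' n1 h0 {nS nS'}; rewrite /cut; move: (i:@x); rewrite e => u h h' sh sh' fh fh' n1 h0.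
 exact: (same_dim_zero_set sh sh' fh fh' h0 n1).
move=> /(chart_cont ix) n2.
by apply: nearS (n2 &n nS &n nS') => y [a [b c']] /c'/a/b.
Qed.
End Manifold.
Section Lagrangian.
Variables (R : realType) (M : presymplectic R).
Hypothesis hM : is_symplectic M.
Let hMm : is_manifold M. Proof. by case: hM. Qed.
Definition isotropic (i : mchart M) x k (h : 'rV[R]_(mdim M) -> 'rV[R]_k) :=
 forall u v : 'rV[R]_(mdim M), u *m jac h i:@x = 0 -> v *m jac h i:@x = 0 -> u *m form i x *m v^T = 0.
(** Isotropy is asked, with the same [h], at all points of [L] near [x]: this makes the notion
    stable under moving the point, which [lagr_shrink] uses for gluing. *)
Definition lagr_at (i : mchart M) x (L : set M) :=
 exists k (h : 'rV[R]_(mdim M) -> 'rV[R]_k), [/\ mdim M = k.*2, cut i x L h &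
  \forall y \near x, L y -> isotropic i y h].
Lemma lagr_atE L (i : mchart M) x : is_lagrangian L -> L x -> mdom i x -> lagr_at i x L.
Proof.
move=> [k e [sL iso]] Lx ix.
have [c [h [e' hc]]] := submanifold_cut sL Lx ix.
have ck : c = k by apply/eqP; rewrite -(eqn_add2l k) -e' e addnn.
move: h hc; rewrite ck => h hc; exists k, h; split => //.
have e2 : mdim M = (k + k)%N by rewrite addnn.
apply: nearS (cut_near hMm hc) => y hcy Ly u v /(tangent_cut hMm _ e2 hcy Ly) hu /(tangent_cut hMm _ e2 hcy Ly) hv.
by apply: (iso y); case: hcy.
Qed.
(** Each point of [C] has an open set on which its presentation of [L] stays valid. On the union of
    these sets the global definition holds; isotropy in another chart follows from the invariance of
    the form under transitions. *)
Lemma lagr_shrink k L C : mdim M = k.*2 -> (forall x, C x -> exists i, lagr_at i x L) ->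
 exists U, onbhd C U /\ is_lagrangian (L `&` U).
Proof.
move=> e H.
have ex x : C x -> exists U, [/\ open U, U x & forall y, U y -> exists i (h : _ -> 'rV[R]_k), cut i y L h /\ (L y -> isotropic i y h)].
 move=> Cx; have [i [k' [h [e' hc iso]]]] := H x Cx.
 have kk : k' = k by apply: double_inj; rewrite -e -e'.
 move: h hc iso; rewrite kk => h hc iso.
 have [U [oU Ux hU]] := nearO ((cut_near hMm hc) &n iso).
 by exists U; split => // y /hU[a b]; exists i, h.
have [U hU] : exists U : M -> set M, forall x, C x -> [/\ open (U x), U x x & forall y, U x y -> exists i (h : _ -> 'rV[R]_k), cut i y L h /\ (L y -> isotropic i y h)].
 have ex' x : exists U : set M, C x -> [/\ open U, U x & forall y, U y -> exists i (h : _ -> 'rV[R]_k), cut i y L h /\ (L y -> isotropic i y h)].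
  by have [/ex[U hU]|nC] := pselect (C x); [exists U | exists setT].
 by have [U hU] := choice ex'; exists U.
pose V := \bigcup_(x in C) U x.
have oV : open V by apply: bigcup_open => x /hU[].
have hV y : V y -> exists i (h : _ -> 'rV[R]_k), cut i y L h /\ (L y -> isotropic i y h).
 by move=> [x Cx Uy]; have [_ _] := hU x Cx; apply.
have e2 : mdim M = (k + k)%N by rewrite addnn.
have cutV i y (h : _ -> 'rV[R]_k) : V y -> cut i y L h -> cut i y (L `&` V) h.
 move=> Vy [a b c d]; split => //.
 by apply: nearS ((open_near oV Vy) &n d) => z [Vz Hz]; rewrite -Hz; split=> [[]|].
exists V; split; first by split => // x Cx; exists x; case: (hU x Cx).
exists k => //; split.
 apply: (cut_submanifold hMm e2) => y [Ly Vy]; have [i [h [hc _]]] := hV y Vy.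
 by exists i, h; apply: cutV.
move=> y j u v [Ly Vy] jy tu tv; have [i [h [hc iso]]] := hV y Vy.
have h0 := (cut_mem hc).1 Ly.
have [T [h' [[sT eT] hc' uT je]]] := cut_cut hMm hc jy h0.
have := cutV _ _ _ Vy hc' => hcV.
move: tu tv => /(tangent_cut hMm _ e2 hcV (conj Ly Vy)) hu /(tangent_cut hMm _ e2 hcV (conj Ly Vy)) hv.
have iy : mdom i y by case: hc.
case: hM => _ _ /(_ j i y T jy iy sT eT u v) -> _.
rewrite !(deriveJ _ sT); apply: (iso Ly); by rewrite -mulmxA -je.
Qed.
End Lagrangian.

(** * Products of manifolds and of symplectic manifolds *)

Section Prod.
Variable R : realType.
Lemma cont_fst {T U : topT} (p : T * U) : {for p, continuous (fst : T * U -> T)}.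
Proof. by move=> P; exact: cvg_fst. Qed.
Lemma cont_snd {T U : topT} (p : T * U) : {for p, continuous (snd : T * U -> U)}.
Proof. by move=> P; exact: cvg_snd. Qed.
Lemma near_fst {T U : topT} (x : T) (y : U) (P : T -> Prop) :
 (\forall z \near x, P z) -> \forall p \near (x, y), P p.1.
Proof. by move=> h; have := @near_pre (T * U)%type T fst (x, y) P (@cont_fst T U (x, y)); apply. Qed.
Lemma near_snd {T U : topT} (x : T) (y : U) (P : U -> Prop) :
 (\forall z \near y, P z) -> \forall p \near (x, y), P p.2.
Proof. by move=> h; have := @near_pre (T * U)%type U snd (x, y) P (@cont_snd T U (x, y)); apply. Qed.
Lemma near_fst_cont {T U V : topT} (f : T -> V) (x : T) (y : U) :
 {for x, continuous f} -> {for (x, y), continuous (fun p : T * U => f p.1)}.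
Proof. by move=> cf; exact: (@continuous_comp _ _ _ fst f (x, y) (@cont_fst T U (x, y)) cf). Qed.
Lemma near_snd_cont {T U V : topT} (f : U -> V) (x : T) (y : U) :
 {for y, continuous f} -> {for (x, y), continuous (fun p : T * U => f p.2)}.
Proof. by move=> cf; exact: (@continuous_comp _ _ _ snd f (x, y) (@cont_snd T U (x, y)) cf). Qed.
Lemma unbox {T U : topT} (x : T) (y : U) (P : T * U -> Prop) :
 (\forall p \near (x, y), P p) -> exists A B, [/\ \forall z \near x, A z, \forall z \near y, B z &
  forall a b, A a -> B b -> P (a, b)].
Proof.
move=> [[A B] [hA hB] h]; exists A, B; split => // a b Aa Bb.
exact: (h (a, b)).
Qed.
Lemma near2 {T U : topT} (x : T) (y : U) (A : T -> Prop) (B : U -> Prop) :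
 (\forall z \near x, A z) -> (\forall z \near y, B z) -> \forall p \near (x, y), A p.1 /\ B p.2.
Proof. by move=> hA hB; apply: nearI; [exact: near_fst|exact: near_snd]. Qed.
Lemma open_box {T U : topT} (A : set T) (B : set U) : open A -> open B -> open (A `*` B).
Proof.
by move=> oA oB; apply: open_of_near => -[a b] [/= Aa Bb]; apply: (near2 (open_near oA Aa) (open_near oB Bb)).
Qed.
Lemma cont_pair {T U V : topT} (f : T -> U) (g : T -> V) x :
 {for x, continuous f} -> {for x, continuous g} -> {for x, continuous (fun y => (f y, g y))}.
Proof. by move=> cf cg; exact: cvg_pair. Qed.
Lemma cont_lsub m n (u : 'rV[R]_(m + n)) : {for u, continuous (lsubmx : 'rV[R]_(m + n) -> 'rV[R]_m)}.
Proof.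
apply: contI => j; have -> : (fun y : 'rV[R]_(m + n) => lsubmx y 0 j) = (fun y => y 0 (lshift n j)).
 by apply/funext => y; rewrite mxE.
exact: coord_continuous.
Qed.
Lemma cont_rsub m n (u : 'rV[R]_(m + n)) : {for u, continuous (rsubmx : 'rV[R]_(m + n) -> 'rV[R]_n)}.
Proof.
apply: contI => j; have -> : (fun y : 'rV[R]_(m + n) => rsubmx y 0 j) = (fun y => y 0 (rshift m j)).
 by apply/funext => y; rewrite mxE.
exact: coord_continuous.
Qed.
Lemma cont_row_mx {T : topT} m n (f : T -> 'rV[R]_m) (g : T -> 'rV[R]_n) x :
 {for x, continuous f} -> {for x, continuous g} -> {for x, continuous (fun y => (f y):|(g y))}.
Proof.
move=> cf cg; apply: contI => j; case: (split_ordP j) => i ->.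
 have -> : (fun y => row_mx (f y) (g y) 0 (lshift n i)) = (fun y => f y 0 i).
  by apply/funext => y; rewrite row_mxEl.
 apply: (@continuous_comp _ _ _ f (fun M : 'rV[R]_m => M 0 i)) => //; exact: coord_continuous.
have -> : (fun y => row_mx (f y) (g y) 0 (rshift m i)) = (fun y => g y 0 i).
 by apply/funext => y; rewrite row_mxEr.
apply: (@continuous_comp _ _ _ g (fun M : 'rV[R]_n => M 0 i)) => //; exact: coord_continuous.
Qed.
Lemma lsubE m n p (u : 'M[R]_(p, m + n)) : lsubmx u = u *m col_mx 1%:M 0.
Proof. by rewrite -[u in RHS]hsubmxK mul_row_col mulmx1 mulmx0 addr0. Qed.
Lemma rsubE m n p (u : 'M[R]_(p, m + n)) : rsubmx u = u *m col_mx 0 1%:M.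
Proof. by rewrite -[u in RHS]hsubmxK mul_row_col mulmx1 mulmx0 add0r. Qed.
Lemma smooth_lsub m n (u : 'rV[R]_(m + n)) : smooth_at u (lsubmx : 'rV[R]_(m + n) -> 'rV[R]_m).
Proof. by apply: sm_ext (sm_mulmx u (col_mx 1%:M 0)); apply: nearT => y; rewrite -lsubE. Qed.
Lemma smooth_rsub m n (u : 'rV[R]_(m + n)) : smooth_at u (rsubmx : 'rV[R]_(m + n) -> 'rV[R]_n).
Proof. by apply: sm_ext (sm_mulmx u (col_mx 0 1%:M)); apply: nearT => y; rewrite -rsubE. Qed.
Lemma jac_lsubmx m n (u : 'rV[R]_(m + n)) : jac (lsubmx : 'rV[R]_(m + n) -> 'rV[R]_m) u = col_mx 1%:M 0.
Proof. by rewrite -[RHS](jac_mulmx u); congr (jac _ u); apply/funext => y; rewrite -lsubE. Qed.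
Lemma jac_rsubmx m n (u : 'rV[R]_(m + n)) : jac (rsubmx : 'rV[R]_(m + n) -> 'rV[R]_n) u = col_mx 0 1%:M.
Proof. by rewrite -[RHS](jac_mulmx u); congr (jac _ u); apply/funext => y; rewrite -rsubE. Qed.
Definition fprodmx m n m' n' (F : 'rV[R]_m -> 'rV[R]_m') (G : 'rV[R]_n -> 'rV[R]_n') :
 'rV[R]_(m + n) -> 'rV[R]_(m' + n') := fun u => (F (lsubmx u)):|(G (rsubmx u)).
Lemma smooth_prodmx m n m' n' (F : 'rV[R]_m -> 'rV[R]_m') (G : 'rV[R]_n -> 'rV[R]_n') a b :
 smooth_at a F -> smooth_at b G -> smooth_at a:|b (fprodmx F G).
Proof.
move=> sF sG; apply: sm_row_mx.
 by apply: (@sm_comp' _ _ _ _ a:|b a lsubmx F); [rewrite row_mxKl|exact: smooth_lsub |].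
by apply: (@sm_comp' _ _ _ _ a:|b b rsubmx G); [rewrite row_mxKr|exact: smooth_rsub |].
Qed.
Lemma jac_prodmx m n m' n' (F : 'rV[R]_m -> 'rV[R]_m') (G : 'rV[R]_n -> 'rV[R]_n') a b :
 smooth_at a F -> smooth_at b G -> jac (fprodmx F G) a:|b = block_mx (jac F a) 0 0 (jac G b).
Proof.
move=> sF sG; have sF' : smooth_at (lsubmx a:|b) F by rewrite row_mxKl.
have sG' : smooth_at (rsubmx a:|b) G by rewrite row_mxKr.
have sl := smooth_lsub a:|b; have sr := smooth_rsub a:|b.
rewrite /fprodmx jac_row_mx; [|exact: (sm_comp sl)|exact: (sm_comp sr)].
rewrite (jac_comp) // (jac_comp (G := G)) //.
rewrite jac_lsubmx jac_rsubmx row_mxKl row_mxKr !mul_col_mx !mul1mx !mul0mx.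
by rewrite block_mxEh.
Qed.
Lemma mul_block_row m n m' n' (u : 'rV[R]_(m + n)) (A : 'M[R]_(m, m')) (B : 'M[R]_(n, n')) :
 u *m block_mx A 0 0 B = (lsubmx u *m A):|(rsubmx u *m B).
Proof. by rewrite -[u in LHS]hsubmxK mul_row_block !mulmx0 addr0 add0r. Qed.
Lemma row_mx_tr_mul m n (a c : 'rV[R]_m) (b d : 'rV[R]_n) :
 a:|b *m (c:|d)^T = a *m c^T + b *m d^T.
Proof. by rewrite tr_row_mx mul_row_col. Qed.
Lemma block_form m n (u v : 'rV[R]_(m + n)) (A : 'M[R]_m) (B : 'M[R]_n) :
 u *m block_mx A 0 0 B *m v^T = lsubmx u *m A *m (lsubmx v)^T + rsubmx u *m B *m (rsubmx v)^T.
Proof. by rewrite mul_block_row -[v in LHS]hsubmxK row_mx_tr_mul. Qed.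
Lemma row_mx_eq0' m n (a : 'rV[R]_m) (b : 'rV[R]_n) : a:|b = 0 <-> a = 0 /\ b = 0.
Proof.
split=> [e|[-> ->]]; last exact: row_mx0.
by rewrite -(row_mxKl a b) -[X in _ /\ X = _](row_mxKr a b) e !linear0.
Qed.
Lemma hausdorff_pair {T U : topT} : hausdorff_space T -> hausdorff_space U -> hausdorff_space (T * U)%type.
Proof.
move=> hT hU [p1 p2] [q1 q2] c; congr pair.
 apply: hT => A B nA nB.
 have [[x y] [/= Ax Bx]] := c _ _ (near_fst p2 nA) (near_fst q2 nB); by exists x.
apply: hU => A B nA nB.
have [[x y] [/= Ax Bx]] := c _ _ (near_snd p1 nA) (near_snd q1 nB); by exists y.
Qed.
Lemma second_countable_pair {T U : topT} : @second_countable T -> @second_countable U ->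
 @second_countable (T * U)%type.
Proof.
move=> [B1 c1 [op1 b1]] [B2 c2 [op2 b2]].
exists [set A | exists2 p, (B1 `*` B2) p & A = p.1 `*` p.2].
 have -> : [set A | exists2 p, (B1 `*` B2) p & A = p.1 `*` p.2] = (fun p : set T * set U => p.1 `*` p.2) @` (B1 `*` B2).
  by apply/seteqP; split => A [p h e]; exists p.
 by apply: (sub_countable (card_image_le _ _)); apply: countableX.
split.
 move=> _ [[A B] [/= /op1 oA /op2 oB] ->]; exact: open_box.
move=> [x y] P [[A B] [nA nB] AB].
have [A' [h1 h1'] AA'] := b1 x A nA; have [B' [h2 h2'] BB'] := b2 y B nB.
exists (A' `*` B'); first by split; [exists (A', B')|split].
by move=> [a b] [/= Aa Bb]; apply: AB; split; [apply: AA'|apply: BB'].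
Qed.
Lemma mprodP (M N : premanifold R) : is_manifold M -> is_manifold N -> is_manifold (mprod M N).
Proof.
move=> hM hN; have [[hsM scM] cM oM chM tM] := hM; have [[hsN scN] cN oN chN tN] := hN.
split.
- by split; [exact: hausdorff_pair|exact: second_countable_pair].
- by move=> [x y]; have [i ix] := cM x; have [j jy] := cN y; exists (i, j).
- by move=> [i j]; apply: open_box; [exact: oM|exact: oN].
- move=> [i j]; split.
 + move=> [x y] [x' y']; rewrite !inE => -[/= ix jy] [/= ix' jy'] /eq_row_mx[e1 e2].
  by rewrite (mcoord_inj hM ix ix' e1) (mcoord_inj hN jy jy' e2).
 + move=> [x y] [/= ix jy]; apply: cont_row_mx.
   apply: (@continuous_comp _ _ _ fst (mcoord i)); [exact: cont_fst|exact: (mcoord_cont hM)].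
  apply: (@continuous_comp _ _ _ snd (mcoord j)); [exact: cont_snd|exact: (mcoord_cont hN)].
 + move=> U oU UD; apply: open_of_near => _ [[x y] Uxy <-].
  have [/= ix jy] := UD _ Uxy.
  have [A [B [nA nB AB]]] := unbox (open_near oU Uxy).
  have n1 := chart_surj hM ix nA; have n2 := chart_surj hN jy nB.
  set u := i:@x:|j:@y.
  have m1 : \forall v \near lsubmx u, exists y, [/\ mdom i y, A y & i:@y = v] by rewrite row_mxKl.
  have m2 : \forall v \near rsubmx u, exists y, [/\ mdom j y, B y & j:@y = v] by rewrite row_mxKr.
  have k1 := near_pre (cont_lsub (u := u)) m1; have k2 := near_pre (cont_rsub (u := u)) m2.
  apply: nearS (k1 &n k2) => v [[a [_ Aa ea]] [b [_ Bb eb]]].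
  exists (a, b); first exact: AB.
  by rewrite ea eb hsubmxK.
- move=> [i i'] [j j'] [x x'] [/= ix ix'] [/= jx jx'].
 have [T [sT eT]] := tM i j x ix jx; have [T' [sT' eT']] := tN i' j' x' ix' jx'.
 exists (fprodmx T T'); split; first exact: smooth_prodmx.
 apply: nearS (near2 eT eT') => -[y y'] [e e'].
 by rewrite /fprodmx row_mxKl row_mxKr e e'.
Qed.
Lemma derive_comp_mx m n (g : 'rV[R]_n -> R) (A : 'M[R]_(m, n)) v z :
 'D_v (fun y => g (y *m A)) z = 'D_(v *m A) g (z *m A).
Proof.
rewrite /derive; have -> // : (fun h : R => h^-1 *: (((fun y => g (y *m A)) \o shift z) (h *: v) - g (z *m A))) =
 (fun h : R => h^-1 *: ((g \o shift (z *m A)) (h *: (v *m A)) - g (z *m A))).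
by apply/funext => h /=; rewrite mulmxDl -scalemxAl.
Qed.
Lemma partial_left m n (g : 'rV[R]_m -> R) (a : 'I_m) (z : 'rV[R]_(m + n)) :
 partial (lshift n a) (fun y => g (lsubmx y)) z = partial a g (lsubmx z) /\
 forall b : 'I_n, partial (rshift m b) (fun y => g (lsubmx y)) z = 0.
Proof.
have -> : (fun y : 'rV[R]_(m + n) => g (lsubmx y)) = (fun y => g (y *m col_mx 1%:M 0)).
 by apply/funext => y; rewrite -lsubE.
rewrite /partial; split=> [|b]; rewrite derive_comp_mx -!lsubE.
 congr (derive g _ _); apply/rowP => j; rewrite !mxE.
 by rewrite (inj_eq (@lshift_inj _ _)).
transitivity (derive g (lsubmx z) 0); last exact: derive0.
congr (derive g _ _).
by apply/rowP => j; rewrite !mxE eq_lrshift.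
Qed.
Lemma partial_right m n (g : 'rV[R]_n -> R) (b : 'I_n) (z : 'rV[R]_(m + n)) :
 partial (rshift m b) (fun y => g (rsubmx y)) z = partial b g (rsubmx z) /\
 forall a : 'I_m, partial (lshift n a) (fun y => g (rsubmx y)) z = 0.
Proof.
have -> : (fun y : 'rV[R]_(m + n) => g (rsubmx y)) = (fun y => g (y *m col_mx 0 1%:M)).
 by apply/funext => y; rewrite -rsubE.
rewrite /partial; split=> [|a]; rewrite derive_comp_mx -!rsubE.
 congr (derive g _ _); apply/rowP => j; rewrite !mxE.
 by rewrite (inj_eq (@rshift_inj _ _)).
transitivity (derive g (rsubmx z) 0); last exact: derive0.
congr (derive g _ _).
by apply/rowP => j; rewrite !mxE eq_rlshift.
Qed.
Lemma sprodP (M N : presymplectic R) : is_symplectic M -> is_symplectic N -> is_symplectic (sprod M N).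
Proof.
move=> [hM fM iM cM] [hN fN iN cN]; have hMN := mprodP hM hN; split => //.
- move=> [i j] [x y] [/= ix jy]; have [a b] := fM i x ix; have [c d] := fN j y jy; split.
  by rewrite tr_block_mx !trmx0 a c opp_block_mx !oppr0.
 by rewrite unitmxE det_ublock unitrM -!unitmxE b.
- move=> [i i'] [j j'] [x x'] T [/= ix ix'] [/= jx jx'] sT eT u v.
 have [T1 [sT1 eT1 T10 _]] := transition hM ix jx; have [T2 [sT2 eT2 T20 _]] := transition hN ix' jx'.
 (* An arbitrary transition map [T] of the product agrees near the point with the product of two
    transitions, so its Jacobian is block diagonal. *)
 have jT : jac T i:@x:|i':@x' = block_mx (jac T1 i:@x) 0 0 (jac T2 i':@x').
  rewrite -jac_prodmx //; apply: jac_ext => //.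
  apply: (near_chart hMN (i := (i, i')) (x := (x, x'))); first by split.
  apply: nearS (eT &n (near2 eT1 eT2)) => -[y y'] /= [<- [e1 e2]].
  by rewrite /fprodmx row_mxKl row_mxKr -e1 -e2.
 rewrite !(deriveJ _ sT) jT /= !block_form.
 rewrite !mul_block_row !row_mxKl !row_mxKr.
 rewrite (iM i j x T1 ix jx sT1 eT1) (iN i' j' x' T2 ix' jx' sT2 eT2).
 by rewrite !(deriveJ _ sT1) !(deriveJ _ sT2).
- move=> [i i'] [x x'] [/= ix ix'].
 have [w1 [s1 e1 d1]] := cM i x ix; have [w2 [s2 e2 d2]] := cN i' x' ix'.
 exists (fun z => block_mx (w1 (lsubmx z)) 0 0 (w2 (rsubmx z))); split.
 + move=> a; case: (split_ordP a) => a' ->.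
   apply: (@sm_ext _ _ _ _ (fun z => (row a' (w1 (lsubmx z))):|0)).
    by apply: nearT => z; apply/rowP => j; case: (split_ordP j) => k ->; rewrite [RHS]mxE ?block_mxEul ?block_mxEur ?row_mxEl ?row_mxEr ?mxE.
   apply: sm_row_mx; last exact: sm_cst.
   by apply: (@sm_comp' _ _ _ _ _ i:@x lsubmx (fun z => row a' (w1 z))); [rewrite /= row_mxKl|exact: smooth_lsub |].
  apply: (@sm_ext _ _ _ _ (fun z => 0:|(row a' (w2 (rsubmx z))))).
   by apply: nearT => z; apply/rowP => j; case: (split_ordP j) => k ->; rewrite [RHS]mxE ?block_mxEdl ?block_mxEdr ?row_mxEl ?row_mxEr ?mxE.
  apply: sm_row_mx; first exact: sm_cst.
  by apply: (@sm_comp' _ _ _ _ _ i':@x' rsubmx (fun z => row a' (w2 z))); [rewrite /= row_mxKr|exact: smooth_rsub |].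
 + by apply: nearS (near2 e1 e2) => -[y y'] /= [-> ->]; rewrite row_mxKl row_mxKr.
 + set m := mdim M; set n := mdim N; set u := i:@x:|i':@x'.
  have P0 (a : 'I_(m + n)) : partial a (fun=> 0 : R) u = 0 by rewrite /partial derive_cst.
  pose W (z : 'rV[R]_(m + n)) : 'M[R]_(m + n) := block_mx (w1 (lsubmx z)) 0 0 (w2 (rsubmx z)).
  have E11 b c : (fun z => W z (lshift n b) (lshift n c)) = (fun z => w1 (lsubmx z) b c).
   by apply/funext => z; rewrite /W block_mxEul.
  have E12 b c : (fun z => W z (lshift n b) (rshift m c)) = (fun z => 0).
   by apply/funext => z; rewrite /W block_mxEur mxE.
  have E21 b c : (fun z => W z (rshift m b) (lshift n c)) = (fun z => 0).
   by apply/funext => z; rewrite /W block_mxEdl mxE.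
  have E22 b c : (fun z => W z (rshift m b) (rshift m c)) = (fun z => w2 (rsubmx z) b c).
   by apply/funext => z; rewrite /W block_mxEdr.
  have L1 a b c : partial (lshift n a) (fun z => w1 (lsubmx z) b c) u = partial a (fun z => w1 z b c) i:@x.
   by have [-> _] := partial_left (fun z => w1 z b c) a u; rewrite /u /= row_mxKl.
  have L2 a b c : partial (rshift m a) (fun z => w1 (lsubmx z) b c) u = 0.
   by have [_ ->] := partial_left (fun z => w1 z b c) b u.
  have R1 a b c : partial (rshift m a) (fun z => w2 (rsubmx z) b c) u = partial a (fun z => w2 z b c) i':@x'.
   by have [-> _] := partial_right (fun z => w2 z b c) a u; rewrite /u /= row_mxKr.
  have R2 a b c : partial (lshift n a) (fun z => w2 (rsubmx z) b c) u = 0.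
   by have [_ ->] := partial_right (fun z => w2 z b c) b u.
  move=> a b c; rewrite -/(W _).
  have -> // : partial a (fun z => W z b c) u + partial b (fun z => W z c a) u + partial c (fun z => W z a b) u = 0.
  case: (split_ordP a) => a' ->; case: (split_ordP b) => b' ->; case: (split_ordP c) => c' ->;
   by rewrite ?E11 ?E12 ?E21 ?E22 ?P0 ?L2 ?R2 ?L1 ?R1 ?L1 ?R1 ?L1 ?R1 ?d1 ?d2 ?P0 ?P0 ?addr0.
Qed.
Lemma soppP (M : presymplectic R) : is_symplectic M -> is_symplectic (sopp M).
Proof.
move=> [hM fM iM cM]; split => //.
- move=> i x ix; have [a b] := fM i x ix; split; first by rewrite -[form i x]/(- @form R M i x) linearN /= a.
 by rewrite -[form i x]/(- @form R M i x) -scaleN1r unitmxZ ?unitrN1.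
- move=> i j x T ix jx sT eT u v.
 by rewrite !mulmxN !mulNmx (iM i j x T ix jx sT eT).
- move=> i x ix; have [w [s e d]] := cM i x ix.
 exists (fun z => - w z); split.
 + move=> a; apply: (@sm_ext _ _ _ _ (fun z => - row a (w z))).
   by apply: nearT => z; rewrite linearN.
  exact: sm_opp.
 + by apply: nearS e => y /= ->.
 + have pN a b c : partial a (fun z => (- w z) b c) i:@x = - partial a (fun z => w z b c) i:@x.
   rewrite /partial -deriveN; first by congr ('D__ _ _); apply/funext => z; rewrite mxE.
   have := sm_diff (s b) => /(@diff_derivable _ _ _ _ _ (delta_mx 0 a))/derivable_mxP/(_ 0 c).
   by have -> : (fun x => row b (w x) 0 c) = (fun z => w z b c) by apply/funext => z; rewrite mxE.
  by move=> a b c; rewrite !pN -!opprD d oppr0.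
Qed.
Lemma sprod3_valid (M : presymplectic R) : is_symplectic M -> is_symplectic (sprod (sopp (sprod M M)) M).
Proof. by move=> hM; apply: sprodP => //; apply: soppP; exact: sprodP. Qed.
Lemma rV0 (x y : 'rV[R]_0) : x = y. Proof. by rewrite (thinmx0 x) (thinmx0 y). Qed.
Lemma spoint_valid : is_symplectic (spoint R).
Proof.
have E (x y : mpoint R) : x = y by exact: rV0.
split.
- split.
 + split; first by move=> p q _; exact: E.
  exists [set setT]; first exact: countable1.
  split; first by move=> _ ->; exact: openT.
  move=> x A nA; exists setT; first by split.
  by move=> y _; rewrite (E y x); exact: near_pt.
 + by move=> x; exists tt.
 + by move=> i; exact: openT.
 + move=> i; split; first by move=> x y _ _ _; exact: E.
   by move=> x _; exact: cvg_id.
  by move=> U oU _; rewrite image_id.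
 + move=> i j x _ _; exists id; split; first exact: sm_id.
  by apply: nearT => y.
- move=> i x _; split; first by rewrite trmx0 oppr0.
 by rewrite unitmxE det_mx00 unitr1.
- by move=> i j x T _ _ _ _ u v; rewrite (thinmx0 u) !mul0mx derive0 !mul0mx.
- move=> i x _; exists (fun=> 0); split.
 + by move=> a; exact: sm_cst.
 + by apply: nearT => y.
 + by case.
Qed.
End Prod.
(** The first half says that points of [L] near [(m, p)] factor through points as close to [n] as
    wanted, the second that composable pairs close to [m], [n], [p] compose into [L]. Together they
    determine the germ of [L] at [(m, p)]; factorizations through distant intermediate points, which
    spoil a bare relational composite, are ignored. *)
Definition lcomp {S T U : topT} (V : set (S * T)) (W : set (T * U)) (L : set (S * U)) (m : S) (n : T) (p : U) : Prop :=
 (forall N : T -> Prop, (\forall n' \near n, N n') ->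
   \forall q \near (m, p), L q -> exists n', [/\ N n', V (q.1, n') & W (n', q.2)]) /\
 (\forall t \near ((m, n), p), V t.1 -> W (t.1.2, t.2) -> L (t.1.1, t.2)).
(** * Composition of lagrangian submanifolds *)
Section LocalComposition.
Variables (R : realType) (M N P : presymplectic R).
Hypotheses (hM : is_symplectic M) (hN : is_symplectic N) (hP : is_symplectic P).
Let sMN := sprod (sopp M) N.
Let sNP := sprod (sopp N) P.
Let sMP := sprod (sopp M) P.
Let a := mdim M. Let b := mdim N. Let c := mdim P.
(** The middle manifold comes last, being the variable that [project_zero_set] eliminates; [P1] and
    [P2] extract the coordinates of the pairs [M], [N] and [N], [P]. *)
Let P1 : 'M[R]_((a + c) + b, a + b) := col_mx (col_mx 1%:M:|0 0) 0:|1%:M.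
Let P2 : 'M[R]_((a + c) + b, b + c) := col_mx (col_mx 0 0:|1%:M) 1%:M:|0.
Let P1E (x : 'rV[R]_a) (z : 'rV[R]_c) (y : 'rV[R]_b) : x:|z:|y *m P1 = x:|y.
Proof. by rewrite !mul_row_col !mul_mx_row !mulmx0 !mulmx1 addr0 add_row_mx addr0 add0r. Qed.
Let P2E (x : 'rV[R]_a) (z : 'rV[R]_c) (y : 'rV[R]_b) : x:|z:|y *m P2 = y:|z.
Proof. by rewrite !mul_row_col !mul_mx_row !mulmx0 !mulmx1 add0r add_row_mx addr0 add0r. Qed.
Let P1l k (x : 'M[R]_(a, k)) (y : 'M[R]_(b, k)) : P1 *m col_mx x y = col_mx (col_mx x 0) y.
Proof. by rewrite !mul_col_mx !mul_row_col !mul1mx !mul0mx addr0 add0r. Qed.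
Let P2l k (y : 'M[R]_(b, k)) (z : 'M[R]_(c, k)) : P2 *m col_mx y z = col_mx (col_mx 0 z) y.
Proof. by rewrite !mul_col_mx !mul_row_col !mul1mx !mul0mx addr0 add0r. Qed.
Variables (V : set (M * N)) (W : set (N * P)).
Variables (i : mchart M) (j : mchart N) (k : mchart P) (m0 : M) (n0 : N) (p0 : P).
(** The composite is the projection to [M] and [P] of the common zeros of [hV] and [hW]. The
    transversality hypothesis, that no nonzero [v] has [(0, v)] tangent to [V] and [(v, 0)] tangent
    to [W], gives injectivity in the direction of [N] and, by duality, the surjectivity asked by
    [project_zero_set]. The conclusion also records that tangent vectors of the composite factor and
    that the middle point is a smooth function [Z] of the ends. *)
Lemma local_composition k1 k2 (hV : 'rV[R]_(mdim sMN) -> 'rV[R]_k1) (hW : 'rV[R]_(mdim sNP) -> 'rV[R]_k2) :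
 V (m0, n0) -> W (n0, p0) -> mdim sMN = k1.*2 -> mdim sNP = k2.*2 ->
 @cut R sMN (i, j) (m0, n0) V _ hV -> @cut R sNP (j, k) (n0, p0) W _ hW ->
 (\forall y \near (m0, n0), V y -> @isotropic R sMN (i, j) y _ hV) ->
 (\forall y \near (n0, p0), W y -> @isotropic R sNP (j, k) y _ hW) ->
 (forall v : 'rV[R]_b, 0:|v *m jac hV i:@m0:|j:@n0 = 0 ->
   v:|0 *m jac hW j:@n0:|k:@p0 = 0 -> v = 0) ->
 exists (L : set (M * P)) q (h : 'rV[R]_(mdim sMP) -> 'rV[R]_q) (Z : 'rV[R]_(mdim sMP) -> 'rV[R]_b),
 [/\ mdim sMP = q.*2, @cut R sMP (i, k) (m0, p0) L _ h,
   (\forall y \near (m0, p0), L y -> @isotropic R sMP (i, k) y _ h) /\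
   (forall (u : 'rV[R]_a) (w : 'rV[R]_c), u:|w *m jac h i:@m0:|k:@p0 = 0 ->
    exists v, u:|v *m jac hV i:@m0:|j:@n0 = 0 /\
    v:|w *m jac hW j:@n0:|k:@p0 = 0),
   lcomp V W L m0 n0 p0 /\ L (m0, p0) &
   smooth_at i:@m0:|k:@p0 Z /\
   \forall t \near ((m0, n0), p0), V t.1 -> W (t.1.2, t.2) ->
    j:@t.1.2 = Z i:@t.1.1:|k:@t.2].
Proof.
move=> Vmn Wnp e1 e2 cV cW isoV isoW trans.
have hMm : is_manifold M by case: hM. have hNm : is_manifold N by case: hN. have hPm : is_manifold P by case: hP.
have hMN := mprodP hMm hNm; have hNP := mprodP hNm hPm; have hMP := mprodP hMm hPm.
have [[/= im jn] sV fV nV] := cV; have [[/= _ kp] sW fW nW] := cW.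
set x0 := i:@m0 in trans sV fV *; set y0 := j:@n0 in trans sV sW fV fW *; set z0 := k:@p0 in trans sW fW *.
have sMNs : is_symplectic sMN by apply: sprodP => //; exact: soppP.
have sNPs : is_symplectic sNP by apply: sprodP => //; exact: soppP.
have hV0 : hV x0:|y0 = 0 by exact: (cut_mem cV).1 Vmn.
have hW0 : hW y0:|z0 = 0 by exact: (cut_mem cW).1 Wnp.
pose t0 : 'rV[R]_((a + c) + b) := x0:|z0:|y0.
have t1 : t0 *m P1 = x0:|y0 by rewrite P1E.
have t2 : t0 *m P2 = y0:|z0 by rewrite P2E.
pose H (t : 'rV[R]_((a + c) + b)) : 'rV[R]_(k1 + k2) := (hV (t *m P1)):|(hW (t *m P2)).
have sVt t : smooth_at (t *m P1) hV -> smooth_at t (fun t => hV (t *m P1)).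
 by move=> s; apply: (sm_comp (sm_mulmx t P1)).
have sWt t : smooth_at (t *m P2) hW -> smooth_at t (fun t => hW (t *m P2)).
 by move=> s; apply: (sm_comp (sm_mulmx t P2)).
have sHt t : smooth_at (t *m P1) hV -> smooth_at (t *m P2) hW -> smooth_at t H.
 by move=> s s'; apply: sm_row_mx; [exact: sVt|exact: sWt].
have jHt t : smooth_at (t *m P1) hV -> smooth_at (t *m P2) hW ->
  jac H t = (P1 *m jac hV (t *m P1)):|(P2 *m jac hW (t *m P2)).
 move=> s s'; rewrite /H jac_row_mx; [|exact: sVt|exact: sWt].
 by rewrite (jac_comp (sm_mulmx t P1) s) (jac_comp (sm_mulmx t P2) s') !jac_mulmx.
have sH : smooth_at t0 H by apply: sHt; rewrite ?t1 ?t2.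
have jH : jac H t0 = (P1 *m jac hV x0:|y0):|(P2 *m jac hW y0:|z0).
 by rewrite jHt ?t1 ?t2.
have H0 : H t0 = 0 by rewrite /H t1 t2 hV0 hW0 row_mx0.
have ub : forall M' : presymplectic R, is_symplectic M' -> forall (l : mchart M') x, mdom l x -> form l x \in unitmx.
 by move=> M' [_ h _ _] l x lx; have [] := h l x lx.
(* A covector [l] killing the image yields covectors [al] and [be] that vanish in the directions of
   [M] and [P] and cancel in that of [N]. Their duals [t], tangent to [V], and [s], tangent to [W],
   have the form [(0, v)] and [(v, 0)], so they vanish by transversality. *)
have fH : row_full (jac H t0).
 apply: row_fullI => l; rewrite jH -[l]vsubmxK mul_row_col.
 set l1 := usubmx l; set l2 := dsubmx l.
 rewrite -!mulmxA; set al := jac hV _ *m l1; set be := jac hW _ *m l2.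
 rewrite -[al]vsubmxK -[be]vsubmxK P1l P2l !add_col_mx add0r addr0 => e.
 have e3 : usubmx al = 0 by have := congr1 (fun A => usubmx (usubmx A)) e; rewrite !col_mxKu !linear0.
 have e4 : dsubmx be = 0 by have := congr1 (fun A => dsubmx (usubmx A)) e; rewrite col_mxKu col_mxKd !linear0.
 have e5 : dsubmx al + usubmx be = 0 by have := congr1 dsubmx e; rewrite col_mxKd linear0.
 have [t tk tw] := lag_dual e1 (ub _ sMNs (i, j) (m0, n0) (conj im jn)) fV (near_pt isoV Vmn) l1.
 have [s sk sw] := lag_dual e2 (ub _ sNPs (j, k) (n0, p0) (conj jn kp)) fW (near_pt isoW Wnp) l2.
 rewrite -/al in tw; rewrite -/be in sw.
 rewrite mul_block_row -[al]vsubmxK tr_col_mx in tw.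
 rewrite mul_block_row -[be]vsubmxK tr_col_mx in sw.
 have [{}tw tw'] := eq_row_mx tw; have [{}sw sw'] := eq_row_mx sw.
 have uM := ub _ hM i m0 im; have uN := ub _ hN j n0 jn; have uP := ub _ hP k p0 kp.
 have cancel n (A : 'M[R]_n) (v w : 'rV[R]_n) : A \in unitmx -> v *m A = w *m A -> v = w.
  by move=> uA /(congr1 (mulmx^~ (invmx A))); rewrite -!mulmxA mulmxV // !mulmx1.
 have lt0 : lsubmx t = 0.
  apply: (cancel _ _ _ _ uM); rewrite mul0mx; apply: oppr_inj; rewrite -mulmxN tw e3 trmx0 oppr0 //.
 have rs0 : rsubmx s = 0 by apply: (cancel _ _ _ _ uP); rewrite mul0mx sw' e4 trmx0.
 have es : lsubmx s = rsubmx t.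
  apply: (cancel _ _ _ _ uN); rewrite tw'; apply: oppr_inj; rewrite -mulmxN sw.
  by rewrite -linearN; congr (_^T); apply/eqP; rewrite -addr_eq0 addrC e5.
 have v0 : rsubmx t = 0.
  apply: trans; first by rewrite -lt0 hsubmxK.
  by rewrite -es -rs0 hsubmxK.
 have al0 : al = 0.
  rewrite -[al]vsubmxK e3; have -> : dsubmx al = 0 by apply: trmx_inj; rewrite -tw' v0 mul0mx trmx0.
  exact: col_mx0.
 have be0 : be = 0.
  rewrite -[be]vsubmxK e4; have -> : usubmx be = 0 by apply: trmx_inj; rewrite -sw es v0 mul0mx trmx0.
  exact: col_mx0.
 by rewrite (row_fullE fV al0) (row_fullE fW be0) col_mx0.
have injH (v : 'rV[R]_b) : 0:|v *m jac H t0 = 0 -> v = 0.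
 rewrite jH mul_mx_row => /row_mx_eq0'[e3 e4]; apply: trans.
  by rewrite -(P1E 0 0 v) row_mx0 -mulmxA.
 by rewrite -(P2E 0 0 v) row_mx0 -mulmxA.
(* Half the dimension of the composite's ambient space: [2 k1 = a + b] and [2 k2 = b + c] give
   [2 q = a + c]. *)
pose q := (k1 + k2 - b)%N.
have dq : (k1 + k2 = q + b)%N.
 rewrite subnK // -leq_double doubleD -e1 -e2 /= -/a -/b -/c -addnn; lia.
have dq2 : mdim sMP = q.*2.
 apply/eqP; rewrite -(eqn_add2r b.*2) -doubleD -dq doubleD -e1 -e2 /= -/a -/b -/c -addnn; apply/eqP; lia.
have [h [Z [S [[sh sZ] [Z0 h0] fh nS nu]]]] := project_zero_set dq sH H0 fH injH.
exists [set t | h i:@t.1:|k:@t.2 = 0], q, h, Z.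
have dMP : @mdom R sMP (i, k) (m0, p0) by split.
have cut' : @cut R sMP (i, k) (m0, p0) [set t | h i:@t.1:|k:@t.2 = 0] _ h.
 by split => //; apply: nearT => -[m p].
have nZ : {for (m0, p0), continuous (fun q : M * P => Z i:@q.1:|k:@q.2)}.
 apply: (@continuous_comp _ _ _ (fun q : M * P => i:@q.1:|k:@q.2) Z).
  exact: (@mcoord_cont R sMP hMP (i, k) (m0, p0) dMP).
 exact: sm_cont.
have liftq (B : N -> Prop) : (\forall n \near n0, B n) -> \forall q \near (m0, p0),
  h i:@q.1:|k:@q.2 = 0 ->
  exists n', [/\ B n', V (q.1, n'), W (n', q.2), mdom j n' & j:@n' = Z i:@q.1:|k:@q.2].
 move=> nB.
 have [A1 [B1 [nA1 nB1 AB1]]] := unbox nV.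
 have [B2 [C2 [nB2 nC2 BC2]]] := unbox nW.
 have nj := chart_surj hNm jn (nB &n nB1 &n nB2).
 have nj' : \forall v \near Z i:@m0:|k:@p0, exists y, [/\ mdom j y, B y /\ B1 y /\ B2 y & j:@y = v].
  by rewrite -/x0 -/z0 Z0.
 have n1 := near_pre nZ nj'.
 have n2 := @chart_cont R sMP hMP (i, k) (m0, p0) _ dMP nS.
 apply: nearS (n1 &n n2 &n (near2 nA1 nC2)) => -[m p] [[n' [jn' [Bn [B1n B2n]] en]] [eH [A1m C2p]]] hq.
 move: eH; rewrite hq mul0mx /H P1E P2E -en => /row_mx_eq0'[ev ew].
 exists n'; split => //; first by apply/(AB1 m n').
 by apply/(BC2 n' p).
have nu' : \forall t \near ((m0, n0), p0), V t.1 -> W (t.1.2, t.2) ->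
  h i:@t.1.1:|k:@t.2 = 0 /\ j:@t.1.2 = Z i:@t.1.1:|k:@t.2.
 pose f (t : (M * N) * P) : 'rV[R]_((a + c) + b) := i:@t.1.1:|k:@t.2:|j:@t.1.2.
 have cf : {for ((m0, n0), p0), continuous f}.
  apply: cont_row_mx; first apply: cont_row_mx.
  - apply: (@continuous_comp _ _ _ (fun t : (M * N) * P => t.1.1) (mcoord i)); last exact: mcoord_cont.
   by apply: (@continuous_comp _ _ _ fst fst); exact: cont_fst.
  - apply: (@continuous_comp _ _ _ (fun t : (M * N) * P => t.2) (mcoord k)); last exact: mcoord_cont.
   exact: cont_snd.
  - apply: (@continuous_comp _ _ _ (fun t : (M * N) * P => t.1.2) (mcoord j)); last exact: mcoord_cont.
   by apply: (@continuous_comp _ _ _ fst snd); [exact: cont_fst|exact: cont_snd].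
 have n1 := near_pre cf nu.
 have n2 := @near_fst _ _ (m0, n0) p0 _ nV.
 have n3 : \forall t \near ((m0, n0), p0), W (t.1.2, t.2) <-> hW j:@t.1.2:|k:@t.2 = 0.
  have cg : {for ((m0, n0), p0), continuous (fun t : (M * N) * P => (t.1.2, t.2))}.
   apply: cont_pair; last exact: cont_snd.
   by apply: (@continuous_comp _ _ _ fst snd); [exact: cont_fst|exact: cont_snd].
  exact: (near_pre cg nW).
 apply: nearS (n1 &n n2 &n n3) => -[[m n] p] [H1 [H2 H3]] /H2 v /H3 w.
 have [] := H1; first by rewrite /f /H P1E P2E v w row_mx0.
 by rewrite /f row_mxKl row_mxKr.
(* Differentiating the factorization of [H] along the graph of [Z]: a tangent vector [u] of the
   composite, completed by [u *m jac Z y] in the middle, is tangent to both [V] and [W]. In the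
   proof of isotropy the contributions of this middle vector cancel. *)
have diffS : \forall y \near x0:|z0, forall u : 'rV[R]_(a + c), u *m jac h y = 0 ->
  smooth_at (y:|(Z y) *m P1) hV -> smooth_at (y:|(Z y) *m P2) hW ->
  (lsubmx u):|(u *m jac Z y) *m jac hV (y:|(Z y) *m P1) = 0 /\
  (u *m jac Z y):|(rsubmx u) *m jac hW (y:|(Z y) *m P2) = 0.
 apply: nearS ((near_near nS) &n (sm_near sh) &n (sm_near sZ)) => y [nSy [shy sZy]] u uh s1 s2.
 pose yz y := y:|(Z y).
 have syz : smooth_at y yz by apply: sm_row_mx => //; exact: sm_id.
 have jyz : jac yz y = 1%:M:|(jac Z y) by rewrite /yz jac_row_mx ?jac_id //; exact: sm_id.
 have : jac (H \o yz) y = jac h y *m S.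
  by rewrite -jac_lsub //; apply: jac_ext nSy _; apply: sm_comp => //; apply: sHt.
 rewrite (jac_comp syz (sHt _ s1 s2)) (jHt _ s1 s2) jyz => /(congr1 (mulmx u)).
 rewrite (mulmxA u (jac h y) S) uh mul0mx (mulmxA u _:|_) (mul_mx_row u) mulmx1 mul_mx_row => /row_mx_eq0'[].
 by rewrite !mulmxA -[u in u:|_]hsubmxK P1E P2E.
split => //.
- split.
  have [A1 [B1 [nA1 nB1 AB1]]] := unbox (isoV &n (cut_near hMN cV)).
  have [B2 [C2 [nB2 nC2 BC2]]] := unbox (isoW &n (cut_near hNP cW)).
  have n1 := liftq _ (nB1 &n nB2).
  have n2 := @chart_cont R sMP hMP (i, k) (m0, p0) _ dMP diffS.
  apply: nearS (n1 &n n2 &n (near2 nA1 nC2)) => -[m p] [l1 [D [A1m C2p]]] hq.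
  have [n [[B1n B2n] Vq Wq jn' en]] := l1 hq.
  have [iV [_ sVq _ _]] := AB1 _ _ A1m B1n; have [iW [_ sWq _ _]] := BC2 _ _ B2n C2p.
  set y := i:@m:|k:@p in D en hq.
  have ey1 : y:|(Z y) *m P1 = i:@m:|j:@n by rewrite P1E en.
  have ey2 : y:|(Z y) *m P2 = j:@n:|k:@p by rewrite P2E en.
  rewrite ey1 ey2 in D.
  move=> u v hu hv; have [u1 u2] := D u hu sVq sWq; have [v1 v2] := D v hv sVq sWq.
  have := iV Vq _ _ u1 v1; have := iW Wq _ _ u2 v2.
  rewrite !block_form !row_mxKl !row_mxKr => E2 E1.
  rewrite !mulmxN !mulNmx in E1 E2 *.
  have -> : rsubmx u *m form k p *m (rsubmx v)^T = (u *m jac Z y) *m form j n *m (v *m jac Z y)^T.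
   by apply/eqP; rewrite -subr_eq0 addrC E2.
  exact: E1.
 move=> u w uw.
 have [||v1 v2] := near_pt diffS _ uw; first by rewrite Z0 P1E.
  by rewrite Z0 P2E.
 rewrite Z0 P1E P2E row_mxKl row_mxKr in v1 v2.
 by exists (u:|w *m jac Z x0:|z0).
- split; last by rewrite /= h0.
 split.
  by move=> B nB; apply: nearS (liftq _ nB) => q' H1 /H1[n' [h1 h2 h3 _ _]]; exists n'.
 by apply: nearS nu' => t H1 v w; have [] := H1 v w.
- by split => //; apply: nearS nu' => t H1 v w; have [] := H1 v w.
Qed.
End LocalComposition.

(** * Germs and clean intersections *)

Section Germ.
Variable (T : topT).
Lemma onbhdT (C : set T) : onbhd C setT.
Proof. by split => //; exact: openT. Qed.
Lemma germ_eqxx (C V : set T) : germ_eq C V V.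
Proof. by exists setT => //; exact: onbhdT. Qed.
Lemma onbhdI (C U U' : set T) : onbhd C U -> onbhd C U' -> onbhd C (U `&` U').
Proof. by move=> [oU s] [oV s']; split; [exact: openI|move=> x Cx; split; [exact: s|exact: s']]. Qed.
(** The points near which [V] and [W] agree form an open set, so equality of germs can be tested
    pointwise along [C]. *)
Lemma germ_eq_near (C V W : set T) : germ_eq C V W <-> forall x, C x -> \forall y \near x, V y <-> W y.
Proof.
split=> [[U [oU CU] e] x Cx|H].
 have : nbhs x U by apply: open_nbhs_nbhs; split => //; exact: CU.
 apply: nearS => y Uy; split=> Vy.
  by have : (V `&` U) y by []; rewrite e => -[].
 by have : (W `&` U) y by []; rewrite -e => -[].
exists [set x | \forall y \near x, V y <-> W y].
 by split; [rewrite openE => p; exact: near_near|exact: H].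
by apply/seteqP; split=> p [Vp Hp]; split => //; apply/(near_pt Hp).
Qed.
Lemma germ_eq_sym (C V W : set T) : germ_eq C V W -> germ_eq C W V.
Proof. by move=> [U oU e]; exists U. Qed.
Lemma germ_eq_trans (C V W Z : set T) : germ_eq C V W -> germ_eq C W Z -> germ_eq C V Z.
Proof.
move=> /germ_eq_near H /germ_eq_near H'; apply/germ_eq_near => x Cx.
by apply: nearS ((H x Cx) &n (H' x Cx)) => y [-> ->].
Qed.
Lemma germ_ext (C V W : set T) : germ_eq C V W -> germ C V = germ C W.
Proof.
move=> VW; apply/seteqP; split=> Z H; last exact: germ_eq_trans VW H.
exact: germ_eq_trans (germ_eq_sym VW) H.
Qed.
Lemma germ_inj (C V W : set T) : germ C V = germ C W -> germ_eq C V W.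
Proof. by move=> e; have : germ C W W by [exact: germ_eqxx]; rewrite -e. Qed.
End Germ.
Section CleanLocal.
Variables (R : realType) (M : premanifold R).
Hypothesis hM : is_manifold M.
Lemma tangent_mono (i : mchart M) x S S' : mdom i x -> (\forall y \near x, S y -> S' y) ->
 tangent i S x `<=` tangent i S' x.
Proof.
move=> ix SS' v [cv [sc c0 d nc]]; exists cv; split => //.
have cc : {for (0 : R), continuous cv}.
 case: sc => ep ep0 sc.
 have dc : derivable cv 0 1 by have := sc 0%N 0; rewrite normr0 => /(_ ep0); rewrite derive1n0.
 by apply: differentiable_continuous; apply/derivable1_diffP.
have nu : \forall u \near cv 0, exists y, [/\ mdom i y, (S y -> S' y) & i:@y = u].
 by rewrite c0; apply: chart_surj.
apply: nearS ((near_pre cc nu) &n nc) => t [[y [iy H yt]] [z [Sz iz zt]]].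
have e : y = z by apply: (mcoord_inj hM iy iz); rewrite yt zt.
by exists z; split => //; rewrite -e; apply: H; rewrite e.
Qed.
(** A single matrix serves every [S] at once, so inclusions between tangent spaces pass from one
    chart to another. *)
Lemma tangent_change (i j : mchart M) x : mdom i x -> mdom j x -> exists A : 'M[R]_(mdim M),
 A \in unitmx /\ forall S k c (h : _ -> 'rV[R]_c) v, mdim M = (k + c)%N -> cut i x S h -> S x ->
  tangent j S x v <-> tangent i S x (v *m A).
Proof.
move=> ix jx; have [T [sT eT T0 uT]] := transition hM jx ix.
exists (jac T j:@x); split => // S k c h v e hc Sx.
have [_ sh fh Sh] := hc.
have je : jac (h \o T) j:@x = jac T j:@x *m jac h i:@x by rewrite jac_comp ?T0.
have hc' : cut j x S (h \o T).
 split => //; first by apply: sm_comp; rewrite ?T0.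
  rewrite je /row_full -mxrank_tr trmx_mul mxrankMfree ?mxrank_tr //.
  by rewrite row_free_unit unitmx_tr.
 by apply: nearS (eT &n Sh) => y [e' H]; rewrite H e'.
by rewrite (tangent_cut hM _ e hc' Sx) (tangent_cut hM _ e hc Sx) je mulmxA.
Qed.
Lemma col_basis m n (J : 'M[R]_(m, n)) r : \rank J = r -> exists E : 'M[R]_(n, r), row_full (J *m E).
Proof.
move=> <-; have /row_freeP[E e] := row_base_free J; exists E.
by rewrite -[J in J *m E]mulmx_base -mulmxA e mulmx1; exact: col_base_full.
Qed.
(** Cleanness at one point gives equality of sets nearby: the combined system of [h1] and [h2] has
    as kernel exactly the tangent space of [G], so [c] combinations of its components cut out a
    submanifold of the dimension of [G]. It contains [G], hence equals it, and it contains the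
    intersection of [S1] and [S2]. *)
Lemma clean_local (i : mchart M) x S1 S2 G k c1 c2 c (h1 : _ -> 'rV[R]_c1) (h2 : _ -> 'rV[R]_c2) (h : _ -> 'rV[R]_c) :
 mdim M = (k + c)%N -> cut i x S1 h1 -> cut i x S2 h2 -> cut i x G h -> G x ->
 (\forall y \near x, G y -> S1 y /\ S2 y) ->
 (forall u : 'rV[R]_(mdim M), u *m jac h1 i:@x = 0 -> u *m jac h2 i:@x = 0 -> u *m jac h i:@x = 0) ->
 \forall y \near x, S1 y -> S2 y -> G y.
Proof.
move=> e C1 C2 C Gx GS tan; have [ix sh1 _ n1] := C1; have [_ sh2 _ n2] := C2; have [_ sh fh nn] := C.
set u0 := i:@x in tan sh1 sh2 sh fh.
have [S1x S2x] := near_pt GS Gx.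
pose H u := (h1 u):|(h2 u).
have sH : smooth_at u0 H by apply: sm_row_mx.
have jH : jac H u0 = (jac h1 u0):|(jac h2 u0) by rewrite jac_row_mx.
have tan' (u : 'rV[R]_(mdim M)) : u *m jac h u0 = 0 -> u *m jac H u0 = 0.
 move=> uh; have tu : tangent i G x u by apply/(tangent_cut hM _ e C Gx).
 have t1 : tangent i S1 x u by apply: (tangent_mono ix _ tu); apply: nearS GS => y H' /H'[].
 have t2 : tangent i S2 x u by apply: (tangent_mono ix _ tu); apply: nearS GS => y H' /H'[].
 have e1 : mdim M = ((mdim M - c1) + c1)%N by rewrite subnK; case: C1 => _ _ /row_full_leq.
 have e2 : mdim M = ((mdim M - c2) + c2)%N by rewrite subnK; case: C2 => _ _ /row_full_leq.
 rewrite jH mul_mx_row (tangent_cut hM _ e1 C1 S1x).1 // (tangent_cut hM _ e2 C2 S2x).1 //.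
 exact: row_mx0.
have rk : \rank (jac H u0) = c.
 have ek : (kermx (jac H u0) :=: kermx (jac h u0))%MS.
  apply/eqmxP/andP; split; apply/row_subP => a; apply/sub_kermxP.
   have : row a (kermx (jac H u0)) *m jac H u0 = 0 by apply/sub_kermxP; exact: row_sub.
   by rewrite jH mul_mx_row => /row_mx_eq0'[]; exact: tan.
  by apply: tan'; apply/sub_kermxP; exact: row_sub.
 have := mxrank_ker (jac H u0); rewrite ek mxrank_ker (eqP fh).
 have := rank_leq_row (jac H u0); have := row_full_leq fh; lia.
have [E fE] := col_basis rk.
pose h' u := H u *m E.
have sh' : smooth_at u0 h' by apply: (sm_comp (G := mulmx^~ E) sH); exact: sm_mulmx.
have C' : cut i x [set y | h' i:@y = 0] h'.
 by split => //; [rewrite -/u0 /h' jac_lsub|apply: nearT].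
have n3 : \forall y \near x, G y -> h' i:@y = 0.
 apply: nearS (GS &n n1 &n n2) => y [a [b d]] /a[/b y1 /d y2].
 by rewrite /h' /H y1 y2 row_mx0 mul0mx.
have n4 := same_dim_cut hM e C C' Gx n3.
apply: nearS (n4 &n n1 &n n2) => y [a [b d]] /b y1 /d y2.
by apply: a; rewrite /= /h' /H y1 y2 row_mx0 mul0mx.
Qed.
End CleanLocal.
Section CutProd.
Variables (R : realType) (M N : premanifold R).
Lemma cut_prod (i : mchart M) (j : mchart N) x y S T c d (h : _ -> 'rV[R]_c) (g : _ -> 'rV[R]_d) :
 cut i x S h -> cut j y T g -> @cut R (mprod M N) (i, j) (x, y) (S `*` T) _ (fprodmx h g).
Proof.
move=> [ix sh fh nS] [jy sg fg nT]; split => //.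
- exact: smooth_prodmx.
- rewrite jac_prodmx //; have /row_fullP[A hA] := fh; have /row_fullP[B hB] := fg.
 apply/row_fullP; exists (block_mx A 0 0 B).
 by rewrite mulmx_block !mulmx0 !mul0mx !addr0 add0r hA hB -scalar_mx_block.
- apply: nearS (near2 nS nT) => -[a b] [Ha Hb].
 rewrite /fprodmx row_mxKl row_mxKr row_mx_eq0'; split=> [[/Ha ? /Hb ?]|[/Ha ? /Hb ?]] //.
Qed.
Lemma fprod_ker (i : mchart M) (j : mchart N) x y c d (h : _ -> 'rV[R]_c) (g : _ -> 'rV[R]_d)
 (u : 'rV[R]_(mdim M)) (v : 'rV[R]_(mdim N)) :
 smooth_at i:@x h -> smooth_at j:@y g ->
 u:|v *m jac (fprodmx h g) i:@x:|j:@y = 0 <->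
 u *m jac h i:@x = 0 /\ v *m jac g j:@y = 0.
Proof. by move=> sh sg; rewrite jac_prodmx // mul_block_row row_mxKl row_mxKr row_mx_eq0'. Qed.
End CutProd.

(** * Micromorphisms at a point of the core map *)

Section Micro.
Variables (R : realType) (X Y : premicrofold R).
Hypotheses (hX : is_mf X) (hY : is_mf Y).
Let sXY := sprod (sopp X) Y.
Let hXm := sympl_mfd (proj1 hX).
Let hYm := sympl_mfd (proj1 hY).
Let hXYm : is_manifold (mprod X Y). Proof. exact: mprodP. Qed.
Let hXYs : is_symplectic sXY.
Proof. by apply: sprodP; [apply: soppP; case: hX|case: hY]. Qed.
Lemma core_lagr (Z : premicrofold R) (i : mchart Z) a : is_mf Z -> core Z a -> mdom i a ->
 exists k (h : 'rV[R]_(mdim Z) -> 'rV[R]_k), [/\ mdim Z = k.*2, cut i a (core Z) h & isotropic i a h].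
Proof.
move=> [hZ lZ] ca ia; have [k [h [e hc iso]]] := lagr_atE hZ lZ ca ia.
by exists k, h; split => //; exact: (near_pt iso).
Qed.
Lemma valcore (Z : premicrofold R) (a : core Z) : core Z (val a).
Proof. exact: set_mem (valP a). Qed.
Definition ext_at (phi : core Y -> core X) (b : core Y) (i : mchart X) (j : mchart Y) F :=
 smooth_at j:@(val b) F /\ \forall z \near val b, forall b' : core Y, val b' = z ->
  mdom i (val (phi b')) /\ i:@(val (phi b')) = F j:@z.
(* T gr(phi) = {(D phi v, v) | v in TB} *)
Lemma gr_cut_ext (phi : core Y -> core X) (b : core Y) (i : mchart X) (j : mchart Y) k (hB : _ -> 'rV[R]_k) F :
 ext_at phi b i j F -> mdom i (val (phi b)) -> mdom j (val b) ->
 cut j (val b) (core Y) hB -> mdim Y = k.*2 ->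
 exists h : _ -> 'rV[R]_(mdim X + k),
  [/\ @cut R (mprod X Y) (i, j) (val (phi b), val b) (gr phi) _ h,
   mdim X + mdim Y = k + (mdim X + k) :> nat &
   forall (u : 'rV[R]_(mdim X)) (v : 'rV[R]_(mdim Y)), u:|v *m jac h i:@(val (phi b)):|j:@(val b) = 0 <->
    v *m jac hB j:@(val b) = 0 /\ u = v *m jac F j:@(val b)].
Proof.
move=> [sF nF] ix jy cB dB.
have [_ sB fB nB] := cB.
set x0 := i:@_ ; set y0 := j:@(val b) in sF sB fB *.
pose h (u) := (lsubmx u - F (rsubmx u)):|(hB (rsubmx u)).
have sl := smooth_lsub x0:|y0; have sr := smooth_rsub x0:|y0.
have sF' : smooth_at x0:|y0 (fun u => F (rsubmx u)) by apply: (sm_comp' (row_mxKr x0 y0) sr).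
have sB' : smooth_at x0:|y0 (fun u => hB (rsubmx u)) by apply: (sm_comp' (row_mxKr x0 y0) sr).
have sh1 : smooth_at x0:|y0 (fun u => lsubmx u - F (rsubmx u)).
 by apply: sm_add => //; exact: sm_opp.
have sh : smooth_at x0:|y0 h by apply: sm_row_mx.
have jr p (K : _ -> 'rV[R]_p) : smooth_at y0 K -> jac (fun u : 'rV[R]_(mdim X + mdim Y) => K (rsubmx u)) x0:|y0 = col_mx 0 (jac K y0).
 move=> sK; have sK' : smooth_at (rsubmx x0:|y0) K by rewrite row_mxKr.
 by rewrite (jac_comp sr sK') jac_rsubmx row_mxKr mul_col_mx mul0mx mul1mx.
have jh : jac h x0:|y0 = (col_mx 1%:M (- jac F y0)):|(col_mx 0 (jac hB y0)).
 rewrite /h jac_row_mx // jac_add //; last exact: sm_opp.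
 by rewrite jac_opp // !jr // jac_lsubmx opp_col_mx oppr0 add_col_mx addr0 add0r.
have ker (u) (v : 'rV[R]_(mdim Y)) : u:|v *m jac h x0:|y0 = 0 <-> v *m jac hB y0 = 0 /\ u = v *m jac F y0.
 rewrite jh mul_mx_row !mul_row_col mulmx1 mulmx0 add0r mulmxN row_mx_eq0'.
 by split=> [[/eqP + ->]|[-> ->]]; rewrite ?subr_eq0 ?subrr // => /eqP.
have dd : (mdim X + mdim Y = k + (mdim X + k))%N by rewrite dB -addnn; lia.
exists h; split => //.
split => //.
- change (row_full (jac h x0:|y0)); rewrite jh; have /row_fullP[B hBB] := fB.
 apply/row_fullP; exists (col_mx 1%:M:|0 (B *m jac F y0):|B).
 rewrite mul_col_mx !mul_mx_row !mul_row_col !mulmx1 !mulmx0 !mul0mx !addr0 add0r hBB.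
 by rewrite mulmxN subrr; exact/esym/scalar_mx_block.
- have nx : \forall p \near (val (phi b), val b), mdom i p.1.
  exact: (near_fst (val b) (mdom_near hXm ix)).
 have ny := near_snd (val (phi b)) (nF &n nB).
 apply: nearS (nx &n ny) => -[m n] [im [HF HB]].
 rewrite /h row_mxKl row_mxKr row_mx_eq0'; split.
  move=> [b' [-> e2]]; have [d1 e1] := HF b' (esym e2).
  rewrite e1 subrr; split => //; apply/HB; rewrite e2; exact: valcore.
 move=> [/eqP]; rewrite subr_eq0 => /eqP e1 /HB cn.
 pose b' : core Y := exist _ n (mem_set cn); exists b'.
 have [d1 e2] := HF b' erefl; congr pair; apply: (mcoord_inj hXm im d1).
 by rewrite e1 e2.
Qed.
Lemma gr_cut (phi : core Y -> core X) (b : core Y) (i : mchart X) (j : mchart Y) k (hB : _ -> 'rV[R]_k) :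
 @smooth_map R Y X (core Y) (fun b => val (phi b)) -> mdom i (val (phi b)) -> mdom j (val b) ->
 cut j (val b) (core Y) hB -> mdim Y = k.*2 ->
 exists F (h : _ -> 'rV[R]_(mdim X + k)),
  [/\ smooth_at j:@(val b) F, @cut R (mprod X Y) (i, j) (val (phi b), val b) (gr phi) _ h,
   mdim X + mdim Y = k + (mdim X + k) :> nat,
   (\forall z \near val b, forall b' : core Y, val b' = z -> mdom i (val (phi b')) /\ i:@(val (phi b')) = F j:@z) &
   forall (u : 'rV[R]_(mdim X)) (v : 'rV[R]_(mdim Y)), u:|v *m jac h i:@(val (phi b)):|j:@(val b) = 0 <->
    v *m jac hB j:@(val b) = 0 /\ u = v *m jac F j:@(val b)].
Proof.
move=> sphi ix jy cB dB; have [F [sF nF]] := sphi b j i jy ix.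
by have [h [a c d]] := gr_cut_ext (conj sF nF) ix jy cB dB; exists F, h.
Qed.
(** Validity of a representative at one point, in some pair of charts: what a construction has to
    supply. [micro_all] below is the same in every pair of charts: what a valid micromorphism
    yields. *)
Definition micro_at (phi : core Y -> core X) (V : set (X * Y)) (b : core Y) : Prop :=
 exists i j, [/\ mdom i (val (phi b)), mdom j (val b),
  @lagr_at R sXY (i, j) (val (phi b), val b) V, V (val (phi b), val b) &
  forall u, @tangent R (mprod X Y) (i, j) V (val (phi b), val b) u ->
   @tangent R (mprod X Y) (i, j) (core X `*` core Y) (val (phi b), val b) u ->
   @tangent R (mprod X Y) (i, j) (gr phi) (val (phi b), val b) u].
Lemma micro_at_mem phi V b : micro_at phi V b -> V (val (phi b), val b).
Proof. by move=> [i [j []]]. Qed.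
Lemma lagr_at_ext (M : presymplectic R) (i : mchart M) x L L' : lagr_at i x L ->
 (\forall y \near x, L y <-> L' y) -> lagr_at i x L'.
Proof.
move=> [k [h [e [a b c n] iso]]] LL'; exists k, h; split => //.
 by split => //; apply: nearS (n &n LL') => y [H H']; rewrite -H'.
by apply: nearS (iso &n LL') => y [H H'] /H'; exact: H.
Qed.
Lemma micro_at_ext phi V V' b : (\forall p \near (val (phi b), val b), V p <-> V' p) -> micro_at phi V b ->
 micro_at phi V' b.
Proof.
move=> VV' [i [j [ix jy lg Vb cl]]]; exists i, j; split => //; first exact: (lagr_at_ext lg).
 exact: (near_pt VV').1.
move=> u u1; apply: cl; have cx : @mdom R (mprod X Y) (i, j) (val (phi b), val b) by [].
by apply: (tangent_mono hXYm cx _ u1); apply: nearS VV' => y [].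
Qed.
(** By [clean_local] the intersection of [V] with the product of the cores is the graph near each
    point of the graph. Shrinking [V] to the open set where this holds, and again by [lagr_shrink],
    produces a representative with all properties globally. *)
Lemma is_microI (phi : core Y -> core X) V : @smooth_map R Y X (core Y) (fun b => val (phi b)) ->
 (forall b, micro_at phi V b) -> is_micro (@PreMicro R X Y phi (germ (gr phi) V)).
Proof.
move=> sphi mV.
have dX : exists k, mdim X = k.*2 by case: hX => _ [k e _]; exists k.
have dY : exists k, mdim Y = k.*2 by case: hY => _ [k e _]; exists k.
have [kX eX] := dX; have [kY eY] := dY.
have dXY : mdim sXY = (kX + kY).*2 by rewrite /= eX eY doubleD.
have loc (b : core Y) : \forall p \near (val (phi b), val b), V p -> (core X `*` core Y) p -> gr phi p.
 have [i [j [ix jy [k [h [e cV _]]] Vb cl]]] := mV b.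
 have [kA [hA [eA cA _]]] := core_lagr hX (valcore (phi b)) ix.
 have [kB [hB [eB cB _]]] := core_lagr hY (valcore b) jy.
 have [F [hg [sF cg dg _ kg]]] := gr_cut sphi ix jy cB eB.
 have e2 : mdim (mprod X Y) = (k + k)%N by rewrite addnn.
 have cAB := cut_prod cA cB.
 have eAB : mdim (mprod X Y) = ((kA + kB) + (kA + kB))%N by rewrite addnn /= eA eB doubleD.
 have Gx : gr phi (val (phi b), val b) by exists b.
 have ABx : (core X `*` core Y) (val (phi b), val b) by split; exact: valcore.
 have nV : \forall p \near (val (phi b), val b), gr phi p -> V p /\ (core X `*` core Y) p.
  apply: nearT => p [b' ->]; split; first exact: (micro_at_mem (mV _)).
  by split; exact: valcore.
 apply: (clean_local hXYm dg cV cAB cg Gx nV) => u u1 u2.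
 apply/(tangent_cut hXYm _ dg cg Gx); apply: cl.
  exact/(tangent_cut hXYm _ e2 cV Vb).
 exact/(tangent_cut hXYm _ eAB cAB ABx).
have grV : gr phi `<=` V by move=> p [b ->]; exact: (micro_at_mem (mV _)).
have grAB : gr phi `<=` core X `*` core Y by move=> p [b ->]; split; exact: valcore.
pose U2 : set (X * Y) := [set p | \forall q \near p, V q -> (core X `*` core Y) q -> gr phi q].
have oU2 : open U2 by rewrite openE => p; exact: near_near.
have gU2 : gr phi `<=` U2 by move=> p [b ->]; exact: loc.
have U2in p : U2 p -> V p -> (core X `*` core Y) p -> gr phi p by exact: near_pt.
have lV (p : X * Y) : gr phi p -> exists i, @lagr_at R sXY i p (V `&` U2).
 move=> grp; have [b ep] := grp; have [i [j [ix jy lg _ _]]] := mV b.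
 exists (i, j); rewrite ep; apply: (lagr_at_ext lg).
 have : nbhs (val (phi b), val b) U2 by apply: open_nbhs_nbhs; split => //; apply: gU2; exists b.
 by apply: nearS => q Uq; split=> [|[]].
have [U1 [[oU1 gU1] lU1]] := lagr_shrink hXYs dXY lV.
pose V' := V `&` U2 `&` U1.
have gV' : gr phi `<=` V' by move=> p gp; split; [split|]; [exact: grV|exact: gU2|exact: gU1].
have UU : onbhd (gr phi) (U2 `&` U1).
 by split; [exact: openI|move=> p gp; split; [exact: gU2|exact: gU1]].
split=> //; exists V'; split => //=.
- apply: germ_ext; exists (U2 `&` U1) => //.
 by rewrite /V' -setIA -setIA setIid.
- apply/seteqP; split=> [p [[[Vp Up] _] ABp]|p gp]; first exact: U2in.
 by split; [exact: gV'|exact: grAB].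
- move=> x c gx cx; apply/seteqP; split; last first.
  move=> u tu; split; apply: (tangent_mono hXYm cx _ tu); apply: nearT; [exact: gV'|exact: grAB].
 have [b ep] := gx; move: cx; rewrite ep => cx u [u1 u2].
 have [i [j [ix jy [k [h [e cV _]]] Vb cl]]] := mV b.
 have [kA [hA [eA cA _]]] := core_lagr hX (valcore (phi b)) ix.
 have [kB [hB [eB cB _]]] := core_lagr hY (valcore b) jy.
 have [F [hg [sF cg dg _ kg]]] := gr_cut sphi ix jy cB eB.
 have e2 : mdim (mprod X Y) = (k + k)%N by rewrite addnn.
 have eAB : mdim (mprod X Y) = ((kA + kB) + (kA + kB))%N by rewrite addnn /= eA eB doubleD.
 have ijd : @mdom R (mprod X Y) (i, j) (val (phi b), val b) by [].
 have [A [_ HA]] := tangent_change hXYm ijd cx.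
 have Gx : gr phi (val (phi b), val b) by exists b.
 have ABx := grAB _ Gx.
 apply/(HA _ _ _ _ _ dg cg Gx); apply: cl.
  apply/(HA _ _ _ _ _ e2 cV Vb).
  by apply: (tangent_mono hXYm cx _ u1); apply: nearT => p [[]].
 exact/(HA _ _ _ _ _ eAB (cut_prod cA cB) ABx).
Qed.
Definition micro_all (phi : core Y -> core X) (V : set (X * Y)) (b : core Y) : Prop :=
 V (val (phi b), val b) /\ forall i j, mdom i (val (phi b)) -> mdom j (val b) ->
 @lagr_at R sXY (i, j) (val (phi b), val b) V /\
  forall u, @tangent R (mprod X Y) (i, j) V (val (phi b), val b) u ->
   @tangent R (mprod X Y) (i, j) (core X `*` core Y) (val (phi b), val b) u ->
   @tangent R (mprod X Y) (i, j) (gr phi) (val (phi b), val b) u.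
Lemma is_micro_rep (f : X =>> Y) : is_micro f -> exists V, [/\
 mgerm f = germ (gr (coremap f)) V, V `&` (core X `*` core Y) = gr (coremap f),
 @is_lagrangian R sXY V & forall b, micro_all (coremap f) V b].
Proof.
move=> [sphi [V [lV eV VAB cl]]]; exists V; split => // b.
have Vb : V (val (coremap f b), val b).
 have : gr (coremap f) (val (coremap f b), val b) by exists b.
 by rewrite -VAB => -[].
split => // i j ix jy; split; first exact: (lagr_atE hXYs lV Vb).
move=> u u1 u2; rewrite -(cl _ (i, j)) //; by exists b.
Qed.
Lemma micro_all_ext phi V V' b : micro_all phi V b -> (\forall p \near (val (phi b), val b), V p <-> V' p) ->
 micro_all phi V' b.
Proof.
move=> [Vb H] VV'; split; first exact: (near_pt VV').1.
move=> i j ix jy; have [lg cl] := H i j ix jy; split; first exact: (lagr_at_ext lg).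
move=> u u1; apply: cl; have cx : @mdom R (mprod X Y) (i, j) (val (phi b), val b) by [].
by apply: (tangent_mono hXYm cx _ u1); apply: nearS VV' => y [].
Qed.
Lemma micro_rep (f : X =>> Y) V : is_micro f -> mgerm f = germ (gr (coremap f)) V ->
 forall b, micro_all (coremap f) V b.
Proof.
move=> /is_micro_rep[V' [e _ _ H]] e' b; apply: (micro_all_ext (H b)).
by apply: (iffLR (germ_eq_near _ _ _) (germ_inj (etrans (esym e) e'))); exists b.
Qed.
End Micro.

(** * Regularity of manifolds and thin neighbourhoods *)

Section Regular.
Variables (R : realType) (M : premanifold R).
Hypothesis hM : is_manifold M.
Lemma closed_ball_compact m (u0 : 'rV[R]_m) r : compact [set u : 'rV[R]_m | `|u - u0| <= r].
Proof.
apply: bounded_closed_compact.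
 exists (r + `|u0|); split; first exact: num_real.
 move=> M' lM u ur; apply: le_trans (ltW lM).
 by rewrite -[u](subrK u0); apply: le_trans (ler_normD _ _) _; rewrite lerD2r.
apply: closed_comp (@closed_le _ r) => u _; apply: (continuous_comp).
 apply: cont_dist => e e0; have : nbhs u (ball u e) by exact: nbhsx_ballx.
 by apply: nearS => y; rewrite -ball_normE opprB addrA subrK => /ltW.
exact: norm_continuous.
Qed.
(** Points have compact neighbourhoods, namely closed coordinate balls, and the space is
    Hausdorff. *)
Lemma manifold_regular : @regular_space M.
Proof.
move=> x; have [[hs _] cM _ chM _] := hM; have [i ix] := cM x.
have [U [oU Ux UP]] := nearO (chart_surj hM ix (nearT _ (fun y => I))).
have [e e0 eO] : exists2 e : R, 0 < e & forall u, `|u - i:@x| <= e -> U u.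
 have /nbhs_ballP[e e0 be] : nbhs i:@x U by apply: open_nbhs_nbhs.
 exists (e / 2); first by rewrite divr_gt0.
 move=> u ue; apply: be; rewrite -ball_normE /= distrC; apply: le_lt_trans ue _.
 by rewrite ltr_pdivrMr // ltr_pMr // ltr1n.
pose K := [set u : 'rV[R]_(mdim M) | `|u - i:@x| <= e].
pose V := [set y | mdom i y /\ K i:@y].
apply: (@compact_regular _ _ V) => //; last first.
 apply: nearI (mdom_near hM ix) _; apply: (chart_cont hM ix).
 have : nbhs i:@x (ball i:@x e) by exact: nbhsx_ballx.
 by apply: nearS => u; rewrite -ball_normE /= distrC => /ltW.
move=> F PF FV; pose G := mcoord i @ F.
have PG : ProperFilter G by exact: fmap_proper_filter.
have GK : G K by apply: (@filterS _ F _ V (mcoord i @^-1` K)) FV => y [].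
have [u [Ku cu]] := closed_ball_compact PG GK.
have [y [iy _ yu]] := UP u (eO u Ku).
exists y; split; first by split => //; rewrite yu.
move=> A B FA By; have G1 : G (mcoord i @` (A `&` V)).
 by apply: (@filterS _ F _ (A `&` V) (mcoord i @^-1` _)) (filterI FA FV) => z Hz; exists z.
have G2 : nbhs u [set v | exists z, [/\ mdom i z, B z & i:@z = v]].
 by rewrite -yu; exact: (chart_surj hM iy By).
have [v [[z1 [Az1 [iz1 _]] e1] [z2 [iz2 Bz2 e2]]]] := cu _ _ G1 G2.
exists z1; split => //; suff <- : z2 = z1 by [].
by apply: (mcoord_inj hM iz2 iz1); rewrite e1 e2.
Qed.
End Regular.
(* A countable cover by basis sets b_k whose closures are small; the sets
  closure b_j minus the previous b_i are closed and locally finite. *)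
Lemma thin {N P : topT} (G : set (N * P)) (Box : set N -> set P -> Prop) :
 @second_countable P -> @regular_space P ->
 (forall n0 c, G (n0, c) -> exists N' P', [/\ Box N' P', open N' &
   \forall p \near c, P' p /\ forall n, G (n, p) -> N' n]) ->
 exists U : set (N * P), [/\ onbhd G U,
  forall n p, U (n, p) -> exists N' P', [/\ Box N' P', P' p & forall n', U (n', p) -> N' n'] &
  forall n0 c, U (n0, c) -> exists k (F : nat -> set N * set P) (v : nat -> Prop),
   (forall j, (j <= k)%N -> v j -> Box (F j).1 (F j).2 /\ (F j).2 c) /\
   \forall p \near c, exists j, [/\ (j <= k)%N, v j, (F j).2 p & forall n, U (n, p) -> (F j).1 n]].
Proof.
move=> [B cB [oB bB]] reg H.
have /countable_injP[f finj] := cB.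
pose D k (t : set P * (set N * set P)) := [/\ B t.1, f t.1 = k, Box t.2.1 t.2.2, open t.2.1 &
 closure t.1 `<=` [set p | t.2.2 p /\ forall n, G (n, p) -> t.2.1 n]].
(* Codes [k] that do not belong to a basis set with a suitable box get the empty set and so take no
   part in the cover. *)
have /choice[t Ht] : forall k, exists t, (D k t) \/ ((forall t', ~ D k t') /\ t.1 = set0).
 move=> k; have [[t' Dt]|nD] := pselect (exists t', D k t'); first by exists t'; left.
 by exists (set0, (set0, set0)); right; split => // t' Dt; apply: nD; exists t'.
pose b k := (t k).1; pose NN k := (t k).2.1; pose PP k := (t k).2.2.
have bD k p : b k p -> D k (t k) by case: (Ht k) => [//|[_ e]]; rewrite /b e.
have clD k p : closure (b k) p -> D k (t k) by case: (Ht k) => [//|[_ e]]; rewrite /b e closure0.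
have ob k : open (b k) by apply: open_of_near => p bp; apply: open_near; case: (bD k p bp) => /oB.
have cov n0 c : G (n0, c) -> exists k, b k c.
 move=> Gc; have [N' [P' [bx oN nP]]] := H _ _ Gc.
 have [A nA AS] := reg c _ nP; have [B' [BB' B'c] B'A] := bB c _ nA.
 have DD : D (f B') (B', (N', P')) by split => // p /(closure_subset B'A) /AS.
 exists (f B'); case: (Ht (f B')) => [[Bt ft _ _ _]|[/(_ (B', (N', P')))//]].
 by rewrite /b (finj _ _ _ _ ft) ?inE.
(* Over [p] the first coordinate must lie in the box of every [j] such that [p] is in the closure of
   [b j] and in no earlier [b i]. Taking the closure makes the condition open, and the least [j]
   with [b j p] is among these indices. *)
pose U : set (N * P) := [set q | (exists i, b i q.2) /\
 forall j, closure (b j) q.2 -> (forall i, (i < j)%N -> ~ b i q.2) -> NN j q.1].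
have minb p i : b i p -> exists j, [/\ (j <= i)%N, b j p & forall i', (i' < j)%N -> ~ b i' p].
 move=> bi; have ex : exists j, `[< b j p >] by exists i; apply/asboolP.
 exists (ex_minn ex); case: ex_minnP => j /asboolP bj mj; split => //; first by apply: mj; apply/asboolP.
 by move=> i' l bi'; have := mj i'; rewrite leqNgt l => h; move: h => /(_ (asboolT bi')).
have near_le (T : topT) (x : T) (Q : nat -> T -> Prop) i :
  (forall j, (j <= i)%N -> \forall y \near x, Q j y) -> \forall y \near x, forall j, (j <= i)%N -> Q j y.
 elim: i => [|i IH] h.
  by apply: nearS (h 0%N isT) => y Qy j; rewrite leqn0 => /eqP ->.
 have h1 := IH (fun j l => h j (leqW l)); apply: nearS (h1 &n (h i.+1 (leqnn _))) => y [a a'] j.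
 by rewrite leq_eqVlt ltnS => /predU1P[->|/a].
exists U; split.
- split; last first.
  move=> [n p] Gnp; split; first exact: cov Gnp.
  move=> j clj _; have [_ _ _ _ /(_ p clj)[_]] := clD j p clj; exact.
 apply: open_of_near => -[n p] [[i bi] Hj].
 have ni : \forall q \near (n, p), b i q.2 by apply: near_snd; apply: open_near.
 have nj : \forall q \near (n, p), forall j, (j <= i)%N -> closure (b j) q.2 -> (forall i, (i < j)%N -> ~ b i q.2) -> NN j q.1.
  apply: near_le => j ji; have [clj|ncl] := pselect (closure (b j) p); last first.
   have : \forall q \near p, ~ closure (b j) q.
    by apply: (open_near (O := ~` closure (b j))) => //; apply: closed_openC; exact: closed_closure.
   by move/(near_snd n); apply: nearS => q h /h.
  have [[i' [l bi']]|nex] := pselect (exists i', (i' < j)%N /\ b i' p).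
   have : \forall q \near p, b i' q by exact: open_near.
   by move/(near_snd n); apply: nearS => q h _ /(_ i' l).
  have Nj : NN j n by apply: Hj => // i' l bi'; apply: nex; exists i'.
  have : \forall m \near n, NN j m by apply: open_near; case: (clD j p clj).
  by move/(near_fst p); apply: nearS => q h _ _.
 apply: nearS (ni &n nj) => q [bq Hq]; split; first by exists i.
 move=> j clj hj; case: (leqP j i) => [ji|ij]; first exact: Hq.
 by case: (hj i ij).
- move=> n p [[i bi] _] ; have [j [ji bj mj]] := minb p i bi.
 have clj : closure (b j) p by exact: subset_closure.
 have [_ _ bx _ /(_ p clj)[Pj _]] := clD j p clj.
 by exists (NN j), (PP j); split => // n' [_ /(_ j clj mj)].
- move=> n0 c [[i bi] _].
 exists i, (fun k => (t k).2), (fun k => closure (b k) c); split.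
  by move=> j _ clj; have [_ _ bx _ /(_ c clj)[Pj _]] := clD j c clj.
 have n1 : \forall p \near c, forall j, (j <= i)%N -> b j p -> closure (b j) c.
  apply: near_le => j _; have [clj|ncl] := pselect (closure (b j) c); first exact: nearT.
  have : \forall q \near c, ~ closure (b j) q.
   by apply: (open_near (O := ~` closure (b j))) => //; apply: closed_openC; exact: closed_closure.
  by apply: nearS => q h /(@subset_closure _ (b j)) /h.
 apply: nearS ((open_near (ob i) bi) &n n1) => p [bip Hp].
 have [j [ji bj mj]] := minb p i bip; exists j.
 have clj : closure (b j) p by exact: subset_closure.
 have [_ _ bx _ /(_ p clj)[Pj _]] := clD j p clj.
 by split => //; [exact: Hp|move=> n [_ /(_ j clj mj)]].
Qed.
(** Triples are controlled by a neighbourhood in the last two factors alone: the set [M'] is hidden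
    in the boxes of [thin], and since only finitely many boxes occur near [c k], the corresponding
    neighbourhoods of [a k] can be intersected. *)
Lemma thin_comp {M N P : topT} (K : Type) (a : K -> M) (b : K -> N) (c : K -> P)
  (Good : set ((M * N) * P)) :
 @second_countable P -> @regular_space P ->
 (forall k (A : M * N -> Prop), (\forall q \near (a k, b k), A q) ->
   \forall p \near c k, forall k', c k' = p -> A (a k', b k')) ->
 (forall k, \forall t \near ((a k, b k), c k), Good t) ->
 exists U : set (N * P), onbhd [set q | exists k, q = (b k, c k)] U /\
  forall k, \forall q \near (a k, c k), forall n, U (n, q.2) -> Good ((q.1, n), q.2).
Proof.
move=> sc reg cont gd.
pose Box (N' : set N) (P' : set P) := exists M' : set M, [/\ open M', (forall k, P' (c k) -> M' (a k)) &
  forall m n p, M' m -> N' n -> P' p -> Good ((m, n), p)].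
have [|U [oU _ HU]] := @thin _ _ [set q | exists k, q = (b k, c k)] Box sc reg.
 move=> n0 p0 [k [_ ->]].
 have [A [C [nA nC AC]]] := unbox (gd k).
 have [A1 [A2 [/nearO[M' [oM Mk MA]] /nearO[N' [oN Nk NA]] A12]]] := unbox nA.
 have := cont k (fun q => M' q.1 /\ N' q.2) (near2 (open_near oM Mk) (open_near oN Nk)).
 move=> np; exists N', [set p | C p /\ forall k', c k' = p -> M' (a k') /\ N' (b k')]; split => //.
  exists M'; split => //; first by move=> k' [_ /(_ k' erefl)[]].
  by move=> m n p Mm Nn [Cp _]; apply: AC => //; apply: A12; [exact: MA|exact: NA].
 apply: nearS (nC &n np) => p [Cp Hp]; split => // n [k' [-> e]].
 by case: (Hp k' (esym e)).
exists U; split => // k; have [i [F [v [HF nF]]]] := HU (b k) (c k) (oU.2 _ (ex_intro _ k erefl)).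
have h j : exists M' : set M, (j <= i)%N -> v j -> [/\ open M', M' (a k) &
  forall m n p, M' m -> (F j).1 n -> (F j).2 p -> Good ((m, n), p)].
 have [[ji vj]|nv] := pselect ((j <= i)%N /\ v j); last by exists setT => ji vj; case: nv.
 have [[M' [oM Mk MG]] Fc] := HF j ji vj; exists M' => _ _; split => //; exact: Mk.
have /choice[M' HM] := h.
have nM : \forall m \near a k, forall j : 'I_i.+1, v j -> M' j m.
 apply: near_forallI => j; have [vj|nv] := pselect (v j); last exact: nearT.
 have [oM Mk _] := HM j (ltn_ord j) vj.
 by apply: nearS (open_near oM Mk) => m.
apply: nearS (near2 nM nF) => -[m p] [Hm [j [ji vj Fp Un]]] n /Un Fn.
have [_ _ G] := HM j ji vj; apply: G => //.
by have := Hm (Ordinal (ji : (j < i.+1)%N)) vj.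
Qed.
(** * Symplectic micromorphisms *)
Section MicroData.
Variables (R : realType) (X Y : premicrofold R).
Hypotheses (hX : is_mf X) (hY : is_mf Y).
Let sXY := sprod (sopp X) Y.
Let hXm := sympl_mfd (proj1 hX).
Let hYm := sympl_mfd (proj1 hY).
Let hXYm : is_manifold (mprod X Y). Proof. exact: mprodP. Qed.
Let hXYs : is_symplectic sXY.
Proof. by apply: sprodP; [apply: soppP; case: hX|case: hY]. Qed.
Definition core_cut (Z : premicrofold R) (i : mchart Z) (a : Z) k (h : 'rV[R]_(mdim Z) -> 'rV[R]_k) :=
 [/\ mdim Z = k.*2, cut i a (core Z) h & isotropic i a h].
(** The local data of a micromorphism at [b], with [F] a smooth extension of the core map. The last
    clause is cleanness: a tangent vector of [V] whose two parts are tangent to the cores lies on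
    the graph of the derivative of [F]. *)
Definition micro_data (phi : core Y -> core X) (V : set (X * Y)) (b : core Y) i j kA hA kB hB k hV F :=
 [/\ [/\ mdim sXY = k.*2, V (val (phi b), val b) & ext_at phi b i j F],
  @core_cut X i (val (phi b)) kA hA, @core_cut Y j (val b) kB hB,
  @cut R sXY (i, j) (val (phi b), val b) V k hV /\
   (\forall y \near (val (phi b), val b), V y -> @isotropic R sXY (i, j) y k hV) &
  forall (u : 'rV[R]_(mdim X)) (v : 'rV[R]_(mdim Y)),
   u:|v *m jac hV i:@(val (phi b)):|j:@(val b) = 0 ->
   u *m jac hA i:@(val (phi b)) = 0 -> v *m jac hB j:@(val b) = 0 ->
   u = v *m jac F j:@(val b)].
Lemma micro_dataI phi V b i j kA hA kB hB k hV F : @micro_data phi V b i j kA hA kB hB k hV F -> micro_at phi V b.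
Proof.
move=> [[e Vb eF] [eA cA iA] [eB cB iB] [cV iV] ker].
have [[ix sA fA _] [jy sB fB _]] := (cA, cB).
exists i, j; split => //; first by exists k, hV.
have [h [hc eh kh]] := gr_cut_ext hX eF ix jy cB eB.
have e2 : mdim (mprod X Y) = (k + k)%N by rewrite addnn.
have eAB : mdim (mprod X Y) = ((kA + kB) + (kA + kB))%N by rewrite addnn /= eA eB doubleD.
have Gx : gr phi (val (phi b), val b) by exists b.
have ABx : (core X `*` core Y) (val (phi b), val b) by split; exact: valcore.
move=> u; rewrite -[u](@hsubmxK _ _ (mdim X) (mdim Y)); move: (lsubmx _) (rsubmx _) => u1 u2.
move=> /(tangent_cut hXYm _ e2 cV Vb) uV /(tangent_cut hXYm _ eAB (cut_prod cA cB) ABx)/(fprod_ker _ _ sA sB)[uA uB].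
by apply/(tangent_cut hXYm _ eh hc Gx)/kh; split=> //; exact: ker.
Qed.
(** Beyond the data, the graph of the derivative of the core map is tangent to [V]. Pairing with
    such vectors is what transfers orthogonality from [Y] to [X] in composites. *)
Lemma micro_dataE phi V b i j kA hA kB hB :
 @smooth_map R Y X (core Y) (fun b => val (phi b)) -> (forall b, micro_all phi V b) ->
 mdom i (val (phi b)) -> mdom j (val b) ->
 @core_cut X i (val (phi b)) kA hA -> @core_cut Y j (val b) kB hB ->
 exists k hV F, @micro_data phi V b i j kA hA kB hB k hV F /\
  forall v : 'rV[R]_(mdim Y), v *m jac hB j:@(val b) = 0 ->
   (v *m jac F j:@(val b)):|v *m jac hV i:@(val (phi b)):|j:@(val b) = 0 /\
   v *m jac F j:@(val b) *m jac hA i:@(val (phi b)) = 0.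
Proof.
move=> sphi all ix jy [eA cA iA] [eB cB iB].
have [Vb /(_ i j ix jy)[[k [hV [e cV isoV]]] cl]] := all b.
have [F [h [sF hc eh nF kh]]] := gr_cut hX sphi ix jy cB eB.
have [[_ sA fA _] [_ sB fB _]] := (cA, cB).
have e2 : mdim (mprod X Y) = (k + k)%N by rewrite addnn.
have eAB : mdim (mprod X Y) = ((kA + kB) + (kA + kB))%N by rewrite addnn /= eA eB doubleD.
have Gx : gr phi (val (phi b), val b) by exists b.
have ABx : (core X `*` core Y) (val (phi b), val b) by split; exact: valcore.
exists k, hV, F; split.
 split => // u v uV uA uB.
 have /(tangent_cut hXYm _ eh hc Gx)/kh[] // : @tangent R (mprod X Y) (i, j) (gr phi) (val (phi b), val b) u:|v.
 apply: cl; first exact/(tangent_cut hXYm _ e2 cV Vb).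
 by apply/(tangent_cut hXYm _ eAB (cut_prod cA cB) ABx)/fprod_ker.
move=> v vB.
have tg : @tangent R (mprod X Y) (i, j) (gr phi) (val (phi b), val b) (v *m jac F j:@(val b)):|v.
 by apply/(tangent_cut hXYm _ eh hc Gx)/kh.
have ijd : @mdom R (mprod X Y) (i, j) (val (phi b), val b) by [].
split.
 apply/(tangent_cut hXYm _ e2 cV Vb); apply: (tangent_mono hXYm ijd _ tg).
 by apply: nearT => p [b' ->]; case: (all b').
have tAB : @tangent R (mprod X Y) (i, j) (core X `*` core Y) (val (phi b), val b) (v *m jac F j:@(val b)):|v.
 by apply: (tangent_mono hXYm ijd _ tg); apply: nearT => p [b' ->]; split; exact: valcore.
by have [? _] := (fprod_ker _ _ sA sB).1 ((tangent_cut hXYm _ eAB (cut_prod cA cB) ABx).1 tAB).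
Qed.
Lemma core_cutE (Z : premicrofold R) (i : mchart Z) a : is_mf Z -> core Z a -> mdom i a ->
 exists k (h : 'rV[R]_(mdim Z) -> 'rV[R]_k), core_cut i a h.
Proof. by move=> hZ ca ia; have [k [h [? ? ?]]] := core_lagr hZ ca ia; exists k, h. Qed.
Lemma cmcont_ext (phi : core Y -> core X) b i j F (A : X -> Prop) :
 ext_at phi b i j F -> mdom j (val b) -> (\forall x \near val (phi b), A x) ->
 \forall z \near val b, forall b', val b' = z -> A (val (phi b')).
Proof.
move=> [sF nF] jy nA; have [ix e0] := near_pt nF b erefl.
have := chart_surj hXm ix nA; rewrite e0 => /(near_pre (sm_cont sF))/(chart_cont hYm jy) n1.
apply: nearS (nF &n n1) => z [Hz [y [iy Ay ey]]] b' eb.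
have [ib e1] := Hz b' eb.
suff <- : y = val (phi b') by [].
by apply: (mcoord_inj hXm iy ib); rewrite ey e1.
Qed.
Lemma cmcont (phi : core Y -> core X) b (A : X -> Prop) :
 @smooth_map R Y X (core Y) (fun b => val (phi b)) -> (\forall x \near val (phi b), A x) ->
 \forall z \near val b, forall b', val b' = z -> A (val (phi b')).
Proof.
move=> sphi nA; have [_ cX _ _ _] := hXm; have [_ cY _ _ _] := hYm.
have [i ix] := cX (val (phi b)); have [j jy] := cY (val b).
by have [F sF] := sphi b j i jy ix; apply: (cmcont_ext sF jy nA).
Qed.
Lemma smooth_mapI (phi : core Y -> core X) :
 (forall b, exists i j F, mdom j (val b) /\ ext_at phi b i j F) ->
 @smooth_map R Y X (core Y) (fun b => val (phi b)).
Proof.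
move=> H b j i jy ix; have [i0 [j0 [F [jy0 eF]]]] := H b.
have [sF nF] := eF; have [ix0 e0] := near_pt nF b erefl.
have [T [sT nT T0 _]] := transition hYm jy jy0.
have [S [sS nS S0 _]] := transition hXm ix0 ix.
exists (S \o F \o T); split.
 apply: (sm_comp) => //; rewrite T0.
 by apply: sm_comp => //; rewrite -e0.
have n1 := cmcont_ext eF jy0 (nS &n (mdom_near hXm ix)).
apply: nearS (nF &n nT &n n1) => z [HF [HT HS]] b' eb.
by have [d1 e1] := HF b' eb; have [HS' d2] := HS b' eb; rewrite /= -HT -e1.
Qed.
End MicroData.

(** * The germ of a relational composite *)

Section Lcomp.
Variables (M N P Q : topT).
Implicit Types (m : M) (n : N) (p : P) (q : Q).
Lemma lcomp_ext (V V' : set (M * N)) (W W' : set (N * P)) (L L' : set (M * P)) m n p :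
 (\forall z \near (m, n), V z <-> V' z) -> (\forall z \near (n, p), W z <-> W' z) ->
 (\forall z \near (m, p), L z <-> L' z) -> lcomp V W L m n p -> lcomp V' W' L' m n p.
Proof.
move=> nV nW nL [c1 c2].
have [A [B [nA nB AB]]] := unbox nV; have [C [D [nC nD CD]]] := unbox nW.
split=> [N' nN'|].
 have nn := c1 _ (nN' &n nB &n nC).
 apply: nearS (nn &n nL &n (near2 nA nD)) => -[m' p'] [h [[LL' LL''] [Am Dp]]] /LL''/h.
 by move=> [n' [[Nn [Bn Cn]] Vn Wn]]; exists n'; split => //; [apply/AB|apply/CD].
have nL' : \forall t \near ((m, n), p), L (t.1.1, t.2) <-> L' (t.1.1, t.2).
 have [E [F [nE nF EF]]] := unbox nL.
 by apply: nearS (near2 (near_fst n nE) nF) => t [/= ? ?]; apply: EF.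
have nB' := near_snd m nB; have nA' := near_fst n nA; have nC' := near_snd m nC.
apply: nearS (c2 &n (nL' &n (near2 (nA' &n nB' &n nC') nD))).
move=> [[m' n'] p'] [h [LL [[Am [Bn Cn]] Dp]]] /AB Vn /CD Wn.
by apply/LL; apply: h; [exact: Vn|exact: Wn].
Qed.
(** Factor a point of [L] by the first half of one hypothesis, close enough to [n] for the second
    half of the other to recombine it. *)
Lemma lcomp_uniq (V : set (M * N)) (W : set (N * P)) (L L' : set (M * P)) m n p :
 lcomp V W L m n p -> lcomp V W L' m n p -> \forall z \near (m, p), L z -> L' z.
Proof.
move=> [c1 _] [_ c2]; have [A [B [nA nB AB]]] := unbox c2.
have [C [D [nC nD CD]]] := unbox nA.
apply: nearS ((c1 _ nD) &n (near2 nC nB)) => -[m' p'] [h [Cm Bp]] /h[n' [Dn Vn Wn]].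
by apply: (AB (m', n') p') => //; exact: CD.
Qed.
(** Split off [p], then [n], and recombine the last two factors; the neighbourhoods are chosen in
    the order opposite to their use. *)
Lemma lcompA (U : set (M * N)) (V : set (N * P)) (W : set (P * Q)) (K1 : set (M * P)) (K2 : set (N * Q)) L m n p q :
 lcomp U V K1 m n p -> lcomp V W K2 n p q -> lcomp K1 W L m p q -> lcomp U K2 L m n q.
Proof.
move=> [a1 a2] [b1 b2] [c1 c2]; split=> [N' nN'|].
 have [A [B [nA nB AB]]] := unbox b2; have [C [D [nC nD CD]]] := unbox nA.
 have h1 := a1 _ (nN' &n nC).
 have [E [F [nE nF EF]]] := unbox h1.
 have h2 := c1 _ (nD &n nF).
 apply: nearS (h2 &n (near2 nE nB)) => -[m' q'] [h [Em Bq]] /h[p' [[Dp Fp] K1p Wp]].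
 have [n' [[Nn Cn] Un Vn]] := EF _ _ Em Fp K1p.
 by exists n'; split => //; apply: (AB (n', p') q') => //; exact: CD.
have [A [B [nA nB AB]]] := unbox c2; have [C [D [nC nD CD]]] := unbox nA.
have [A' [B' [nA' nB' AB']]] := unbox a2; have [C' [D' [nC' nD' CD']]] := unbox nA'.
have [E [F [nE nF EF]]] := unbox (b1 _ (nD &n nB')).
have nmn := near2 (nC &n nC') (nE &n nD').
apply: nearS (near2 nmn (nB &n nF)) => -[[m' n'] q'] [[[Cm C'm] [En D'n]] [Bq Fq]] Un K2n.
have [p' [[Dp B'p] Vp Wp]] := EF _ _ En Fq K2n.
apply: (AB (m', p') q') => //; first exact: CD.
by apply: (AB' (m', n') p') => //; exact: CD'.
Qed.
Lemma lcomp_graphr (V : set (M * N)) (F : N -> P) (G : P -> N) m n p :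
 cancel F G -> cancel G F -> continuous G -> G p = n ->
 lcomp V [set z | z.2 = F z.1] [set z | V (z.1, G z.2)] m n p.
Proof.
move=> FG GF cG e; split=> [N' nN'|].
 have nn : \forall z \near p, N' (G z) by apply: (near_pre (cG p)); rewrite e.
 by apply: nearS (near_snd m nn) => -[m' p'] Np Vp; exists (G p'); rewrite /= GF.
by apply: nearT => -[[m' n'] p'] /= Vn ->; rewrite FG.
Qed.
Lemma lcomp_graphl (W : set (N * P)) (F : M -> N) m n p :
 continuous F -> F m = n ->
 lcomp [set z | z.2 = F z.1] W [set z | W (F z.1, z.2)] m n p.
Proof.
move=> cF e; split=> [N' nN'|].
 have nn : \forall z \near m, N' (F z) by apply: (near_pre (cF m)); rewrite e.
 by apply: nearS (near_fst p nn) => -[m' p'] Np Vp; exists (F m').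
by apply: nearT => -[[m' n'] p'] ->.
Qed.
End Lcomp.
(** A variant of [thin_comp] that keeps the finite list of boxes visible, for box properties that
    involve a choice, such as the local composites glued in [comp_global]. *)
Lemma thin_boxes {M N P : topT} (K : Type) (a : K -> M) (b : K -> N) (c : K -> P)
  (Bx : set M -> set N -> set P -> Prop) :
 @second_countable P -> @regular_space P ->
 (forall k (A : M * N -> Prop), (\forall q \near (a k, b k), A q) ->
   \forall p \near c k, forall k', c k' = p -> A (a k', b k')) ->
 (forall k, exists M' N' P', [/\ open M' /\ M' (a k), open N' /\ N' (b k), \forall p \near c k, P' p & 
   forall P'' : set P, P'' `<=` P' -> (forall k', P'' (c k') -> M' (a k') /\ N' (b k')) -> Bx M' N' P'']) ->
 exists U : set (N * P), onbhd [set q | exists k, q = (b k, c k)] U /\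
  forall k, exists l (F : nat -> set M * set N * set P) (v : nat -> Prop),
   (forall j, (j <= l)%N -> v j -> [/\ Bx (F j).1.1 (F j).1.2 (F j).2, open (F j).1.1, (F j).1.1 (a k) & (F j).2 (c k)]) /\
   \forall q \near (a k, c k), exists j, [/\ (j <= l)%N, v j, (F j).1.1 q.1, (F j).2 q.2 & forall n, U (n, q.2) -> (F j).1.2 n].
Proof.
move=> sc reg cont gd.
pose Box (N' : set N) (P' : set P) := exists M' : set M, [/\ open M', (forall k, P' (c k) -> M' (a k)) & Bx M' N' P'].
have [|U [oU _ HU]] := @thin _ _ [set q | exists k, q = (b k, c k)] Box sc reg.
 move=> n0 p0 [k [_ ->]].
 have [M' [N' [P' [[oM Mk] [oN Nk] nP H]]]] := gd k.
 have := cont k (fun q => M' q.1 /\ N' q.2) (near2 (open_near oM Mk) (open_near oN Nk)).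
 move=> np; exists N', [set p | P' p /\ forall k', c k' = p -> M' (a k') /\ N' (b k')]; split => //.
  exists M'; split => //; first by move=> k' [_ /(_ k' erefl)[]].
  by apply: H => [p []|k' [_ /(_ k' erefl)]].
 apply: nearS (nP &n np) => p [Cp Hp]; split => // n [k' [-> e]].
 by case: (Hp k' (esym e)).
exists U; split => // k; have [l [F [v [HF nF]]]] := HU (b k) (c k) (oU.2 _ (ex_intro _ k erefl)).
have h j : exists M' : set M, (j <= l)%N -> v j -> [/\ Bx M' (F j).1 (F j).2, open M', M' (a k) & (F j).2 (c k)].
 have [[ji vj]|nv] := pselect ((j <= l)%N /\ v j); last by exists setT => ji vj; case: nv.
 have [[M' [oM Mk MG]] Fc] := HF j ji vj; exists M' => _ _; split => //; exact: Mk.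
have /choice[M' HM] := h.
exists l, (fun j => ((M' j, (F j).1), (F j).2)), v; split=> [//|].
have nM : \forall m \near a k, forall j : 'I_l.+1, v j -> M' j m.
 apply: near_forallI => j; have [vj|nv] := pselect (v j); last exact: nearT.
 have [_ oM Mk _] := HM j (ltn_ord j) vj.
 by apply: nearS (open_near oM Mk) => m.
apply: nearS (near2 nM nF) => -[m p] [Hm [j [ji vj Fp Un]]]; exists j; split => //.
by have := Hm (Ordinal (ji : (j < l.+1)%N)) vj.
Qed.
Lemma near_leq (T : topT) (x : T) (Q : nat -> T -> Prop) i :
  (forall j, (j <= i)%N -> \forall y \near x, Q j y) -> \forall y \near x, forall j, (j <= i)%N -> Q j y.
Proof.
elim: i => [|i IH] h.
 by apply: nearS (h 0%N isT) => y Qy j; rewrite leqn0 => /eqP ->.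
have h1 := IH (fun j l => h j (leqW l)); apply: nearS (h1 &n (h i.+1 (leqnn _))) => y [a a'] j.
by rewrite leq_eqVlt ltnS => /predU1P[->|/a].
Qed.
Section Rep.
Variable (R : realType).
Implicit Types (X Y Z : premicrofold R).
Definition rep X Y (f : X =>> Y) (V : set (X * Y)) := mgerm f = germ (gr (coremap f)) V.
Lemma micro_ext X Y (f g : X =>> Y) V W : rep f V -> rep g W ->
 (forall b, val (coremap f b) = val (coremap g b)) ->
 (forall b, \forall p \near (val (coremap f b), val b), V p <-> W p) -> f = g.
Proof.
case: f g => [phi G] [psi H]; rewrite /rep /= => eG eH epsi VW.
have e : phi = psi by apply/funext => b; apply: val_inj; exact: epsi.
rewrite -e in eH *; congr PreMicro; rewrite eG eH; apply: germ_ext.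
by apply/germ_eq_near => p [b ->]; exact: VW.
Qed.
Lemma rep_ext X Y (f : X =>> Y) V W : rep f V ->
 (forall b, \forall p \near (val (coremap f b), val b), V p <-> W p) -> rep f W.
Proof.
by rewrite /rep => -> VW; apply: germ_ext; apply/germ_eq_near => p [b ->].
Qed.
Lemma rep_near X Y (f : X =>> Y) V W : rep f V -> rep f W ->
 forall b, \forall p \near (val (coremap f b), val b), V p <-> W p.
Proof.
rewrite /rep => -> /germ_inj/germ_eq_near H b; by apply: H; exists b.
Qed.
Lemma germ_mem X Y (f : X =>> Y) V W : rep f V -> mgerm f W ->
 forall b, \forall p \near (val (coremap f b), val b), V p <-> W p.
Proof. by rewrite /rep => -> /germ_eq_near H b; apply: H; exists b. Qed.
(** With restricted representatives the first half of [lcomp] still factors points of [K], because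
    the intermediate point can be taken inside the restrictions. For the converse [thin_comp]
    provides a neighbourhood of the graph of the second core map over which every intermediate point
    is close enough for the second half. Only the second relation has to be restricted in
    advance. *)
Lemma rep_comp X Y Z (hX : is_mf X) (hY : is_mf Y) (hZ : is_mf Z) (f : X =>> Y) (g : Y =>> Z) V W K :
 @smooth_map R Y X (core Y) (fun b => val (coremap f b)) ->
 @smooth_map R Z Y (core Z) (fun b => val (coremap g b)) ->
 rep f V -> rep g W ->
 (forall c, lcomp V W K (val (coremap f (coremap g c))) (val (coremap g c)) (val c)) ->
 rep (g \o' f) K.
Proof.
move=> sf sg rV rW lc.
have claim V' W' : mgerm f V' -> mgerm g W' ->
  exists U0 U0', onbhd (gr (coremap f)) U0 /\ onbhd (gr (coremap g)) U0' /\
   forall U U', onbhd (gr (coremap f)) U -> onbhd (gr (coremap g)) U' -> U `<=` U0 -> U' `<=` U0' ->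
   germ_eq (gr (coremap f \o coremap g)) K (rel_comp (W' `&` U') (V' `&` U)).
 move=> mV mW.
 have {}lc c : lcomp V' W' K (val (coremap f (coremap g c))) (val (coremap g c)) (val c).
  apply: lcomp_ext (lc c); [exact: germ_mem|exact: germ_mem|exact: nearT].
 pose Good : set ((X * Y) * Z) := [set t | V' t.1 -> W' (t.1.2, t.2) -> K (t.1.1, t.2)].
 have [[hZm _ _ _] _] := hZ; have [hsZ _ _ _ _] := hZm.
 have [|c|U0 [oU0 HU]] := @thin_comp _ _ _ (core Z) (fun c => val (coremap f (coremap g c))) (fun c => val (coremap g c)) val Good hsZ.2 (manifold_regular hZm).
 - move=> c A nA; have [A1 [A2 [n1 n2 A12]]] := unbox nA.
  have n3 := cmcont hX hY sf n1; have n4 := cmcont hY hZ sg (n2 &n n3).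
  by apply: nearS n4 => z Hz c' ec; have [a2 a1] := Hz c' ec; apply: A12 => //; exact: a1.
 - by have [_] := lc c.
 exists setT, U0; split; first exact: onbhdT; split => // U U' [oU gU] [oU' gU'] _ U'U.
 apply/germ_eq_near => p [c ->].
 have [c1 _] := lc c.
 have nU : \forall z \near (val (coremap f (coremap g c)), val (coremap g c)), U z.
  by apply: open_near => //; apply: gU; exists (coremap g c).
 have nU' : \forall z \near (val (coremap g c), val c), U' z by apply: open_near => //; apply: gU'; exists c.
 have [A [B [nA nB AB]]] := unbox nU; have [C [D [nC nD CD]]] := unbox nU'.
 apply: nearS ((c1 _ (nB &n nC)) &n (HU c) &n (near2 nA nD)).
 move=> [m p'] [h1 [h2 [Am Dp]]]; split.
  by move=> /h1[n' [[Bn Cn] Vn Wn]]; exists n'; split; split => //=; [exact: AB|exact: CD].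
 by move=> [n' [[Vn _] [Wn Un]]]; apply: (h2 n') => //; exact: U'U.
rewrite /rep; apply/seteqP; split=> L.
 move=> [V' [W' [mV [mW [U0 [U0' [oU0 [oU0' H]]]]]]]].
 have [U1 [U1' [oU1 [oU1' H1]]]] := claim _ _ mV mW.
 apply: germ_eq_trans (H1 (U0 `&` U1) (U0' `&` U1') _ _ _ _) (germ_eq_sym (H _ _ _ _ _ _)); try exact: onbhdI; by move=> p [].
move=> KL; have mV : mgerm f V by rewrite rV; exact: germ_eqxx.
have mW : mgerm g W by rewrite rW; exact: germ_eqxx.
exists V, W; split => //; split => //.
have [U1 [U1' [oU1 [oU1' H1]]]] := claim _ _ mV mW.
exists U1, U1'; split => //; split => // U U' oU oU' UU UU'.
exact: germ_eq_trans (germ_eq_sym KL) (H1 _ _ oU oU' UU UU').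
Qed.
End Rep.
Section Nearby.
Variables (R : realType) (M P : topT) (N : premanifold R).
Hypothesis hN : is_manifold N.
(** The middle point of a composable pair is a continuous function [Zf] of its ends. A factorization
    near the base point is therefore automatically near the middle point of any composable triple
    close by. *)
Lemma lcomp_nearby (j : mchart N) n0 (Zf : M * P -> 'rV[R]_(mdim N)) m0 p0 (V : set (M * N)) (W : set (N * P)) (L : set (M * P)) :
 mdom j n0 -> lcomp V W L m0 n0 p0 ->
 (\forall t \near ((m0, n0), p0), V t.1 -> W (t.1.2, t.2) -> j:@t.1.2 = Zf (t.1.1, t.2)) ->
 (\forall q \near (m0, p0), {for q, continuous Zf}) ->
 \forall t \near ((m0, n0), p0), V t.1 -> W (t.1.2, t.2) -> lcomp V W L t.1.1 t.1.2 t.2.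
Proof.
move=> jn [c1 c2] nZ cZ.
have [A0 [D [nA0 nD AD]]] := unbox nZ; have [A [B [nA nB AB]]] := unbox nA0.
have h1 := near_near (c1 _ (nB &n (mdom_near hN jn))).
have nAD := near_near (near2 nA nD).
have [A1 [D1 [nA1 nD1 AD1]]] := unbox (h1 &n nAD &n cZ).
have n1 := near2 (near2 (nA &n nA1) (nB &n (mdom_near hN jn))) (nD &n nD1).
apply: nearS (n1 &n (near_near c2)) => -[[m1 n1'] p1] [[[[Am A1m] [Bn jn1]] [Dp D1p]] c2'] Vn Wn.
have [H1 [H2 H3]] := AD1 _ _ A1m D1p.
split=> // N' nN'.
have e1 : j:@n1' = Zf (m1, p1) by apply: (AD (m1, n1') p1) => //; exact: AB.
have := chart_surj hN jn1 nN'; rewrite e1 => /(near_pre H3) n2.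
apply: nearS (H1 &n H2 &n n2) => -[m p] [h [[Am' Dp'] [y [jy Ny ey]]]] /h[n' [[Bn' jn'] Vn' Wn']].
exists n'; split => //; suff <- : y = n' by [].
apply: (mcoord_inj hN jy jn'); rewrite ey; apply/esym.
by apply: (AD (m, n') p) => //; exact: AB.
Qed.
End Nearby.
Section Comp.
Variables (R : realType) (X Y Z : premicrofold R).
Hypotheses (hX : is_mf X) (hY : is_mf Y) (hZ : is_mf Z).
Let hXs := proj1 hX.
Let hYs := proj1 hY.
Let hZs := proj1 hZ.
Let hXm := sympl_mfd hXs.
Let hYm := sympl_mfd hYs.
Let hZm := sympl_mfd hZs.
Lemma ext_comp (phi : core Y -> core X) (psi : core Z -> core Y) c i j k F G :
 @smooth_map R Z Y (core Z) (fun b => val (psi b)) -> mdom j (val (psi c)) ->  mdom k (val c) ->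
 ext_at phi (psi c) i j F -> ext_at psi c j k G -> ext_at (phi \o psi) c i k (F \o G).
Proof.
move=> spsi jy kz [sF nF] [sG nG].
have [_ e0] := near_pt nG c erefl.
split; first by apply: sm_comp => //; rewrite -e0.
have n1 := cmcont hY hZ spsi nF.
apply: nearS (nG &n n1) => z [HG HF] c' ec.
have [jc ec'] := HG c' ec; have [ic ei] := HF c' ec (psi c') erefl.
by split=> //=; rewrite ei ec'.
Qed.
Lemma smooth_comp (phi : core Y -> core X) (psi : core Z -> core Y) :
 @smooth_map R Y X (core Y) (fun b => val (phi b)) ->
 @smooth_map R Z Y (core Z) (fun b => val (psi b)) ->
 @smooth_map R Z X (core Z) (fun b => val ((phi \o psi) b)).
Proof.
move=> sphi spsi c k i kz ix; have [_ /(_ (val (psi c)))[j jy] _ _ _] := hYm.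
have [F HF] := sphi (psi c) j i jy ix; have [G HG] := spsi c k j kz jy.
by have [s n] := ext_comp spsi jy kz HF HG; exists (F \o G).
Qed.
Lemma core_coiso (T : premicrofold R) i (x : T) k (h : 'rV[R]_(mdim T) -> 'rV[R]_k) (u : 'rV[R]_(mdim T)) :
 is_mf T -> core_cut i x h ->
 (forall v : 'rV[R]_(mdim T), v *m jac h i:@x = 0 -> u *m form i x *m v^T = 0) -> u *m jac h i:@x = 0.
Proof.
move=> [hT _] [e [ix sh fh _] iso]; have [_ uf _ _] := hT; have [_ unit] := uf i x ix.
exact: (lag_coiso e unit fh iso).
Qed.
Section Local.
Variables (phi : core Y -> core X) (psi : core Z -> core Y) (V : set (X * Y)) (W : set (Y * Z)).
Hypotheses (sphi : @smooth_map R Y X (core Y) (fun b => val (phi b)))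
 (spsi : @smooth_map R Z Y (core Z) (fun b => val (psi b)))
 (aV : forall b, micro_all phi V b) (aW : forall c, micro_all psi W c).
(** Transversality holds because the cores are lagrangian. If [(0, v)] is tangent to [V], isotropy
    against the graph of the derivative of [phi] makes [v] orthogonal to the core of [Y], hence
    tangent to it; if also [(v, 0)] is tangent to [W], cleanness of [W] gives [v = 0]. *)
Lemma comp_local c : exists L, [/\ micro_at (phi \o psi) L c, lcomp V W L (val (phi (psi c))) (val (psi c)) (val c) &
 \forall t \near ((val (phi (psi c)), val (psi c)), val c), V t.1 -> W (t.1.2, t.2) ->
   L (t.1.1, t.2) /\ lcomp V W L t.1.1 t.1.2 t.2].
Proof.
have [_ /(_ (val (phi (psi c))))[i ix] _ _ _] := hXm.
have [_ /(_ (val (psi c)))[j jy] _ _ _] := hYm.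
have [_ /(_ (val c))[k kz] _ _ _] := hZm.
have [kA [hA cA]] := core_cutE hX (valcore (phi (psi c))) ix.
have [kB [hB cB]] := core_cutE hY (valcore (psi c)) jy.
have [kC [hC cC]] := core_cutE hZ (valcore c) kz.
have [k1 [hV [F [[[eV Vb eF] _ _ [cV iV] kV] tV]]]] := micro_dataE hX hY sphi aV ix jy cA cB.
have [k2 [hW [G [[[eW Wc eG] _ _ [cW iW] kW] tW]]]] := micro_dataE hY hZ spsi aW jy kz cB cC.
set a0 := val (phi _) in ix cA cV iV kV tV Vb *; set b0 := val (psi c) in jy cB cV iV kV tV Vb cW iW kW tW Wc *.
set c0 := val c in kz cC cW iW kW tW Wc *.
have isoA : isotropic i a0 hA by case: cA.
have isoV (u u' : 'rV[R]_(mdim X)) (v v' : 'rV[R]_(mdim Y)) :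
  u:|v *m jac hV i:@a0:|j:@b0 = 0 ->
  u':|v' *m jac hV i:@a0:|j:@b0 = 0 ->
  v *m form j b0 *m v'^T = u *m form i a0 *m u'^T.
 move=> h1 h2; have := near_pt iV Vb _ _ h1 h2.
 rewrite block_form !row_mxKl !row_mxKr mulmxN mulNmx addrC => /eqP.
 by rewrite subr_eq0 => /eqP.
have trans (v : 'rV[R]_(mdim Y)) : 0:|v *m jac hV i:@a0:|j:@b0 = 0 ->
  v:|0 *m jac hW j:@b0:|k:@c0 = 0 -> v = 0.
 move=> v1 v2; have vB : v *m jac hB j:@b0 = 0.
  apply: (core_coiso hY cB) => w wB.
  by rewrite (isoV 0 _ v w v1 (tV w wB).1) !mul0mx.
 by rewrite (kW v 0 v2 vB) ?mul0mx.
have [L [q [h [Zf [eq hc [iL tL] [lc Lc] [sZ nZ]]]]]] := local_composition hXs hYs hZs Vb Wc eV eW cV cW iV iW trans.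
exists L; split => //.
 apply: (micro_dataI hX hZ (i := i) (j := k) (hA := hA) (hB := hC) (hV := h)).
 split => //; first by split => //; exact: (ext_comp spsi jy kz eF eG).
 (* Cleanness of the composite: as [u] is tangent to the lagrangian core of [X], the middle vector
    [v] is orthogonal to the core of [Y], hence tangent to it, and cleanness of [W] and then of [V]
    applies. *)
 move=> u w uw uA wC; have [v [v1 v2]] := tL u w uw.
 have vB : v *m jac hB j:@b0 = 0.
  apply: (core_coiso hY cB) => y yB; rewrite (isoV u _ v y v1 (tV y yB).1).
  by apply: isoA; case: (tV y yB).
 have [sG nG] := eG; have [sF nF] := eF.
 have [_ e0] := near_pt nG c erefl.
 rewrite jac_comp //; last by rewrite -e0.
 by rewrite mulmxA -e0 -(kW v w v2 vB wC); exact: kV.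
have n2 : \forall t \near ((a0, b0), c0), V t.1 -> W (t.1.2, t.2) -> lcomp V W L t.1.1 t.1.2 t.2.
 apply: (lcomp_nearby hYm jy lc nZ).
 have sn := sm_near sZ.
 have crow m p : mdom i m -> mdom k p -> {for (m, p), continuous (fun r : X * Z => i:@r.1:|k:@r.2)}.
  move=> im kp; apply: cont_row_mx.
   by have := @near_fst_cont X Z _ (mcoord i) m p (mcoord_cont hXm im).
  by have := @near_snd_cont X Z _ (mcoord k) m p (mcoord_cont hZm kp).
 have c1 : {for (a0, c0), continuous (fun r : X * Z => i:@r.1:|k:@r.2)}.
  exact: (crow _ _ ix kz).
 have n1 := near_pre c1 sn.
 apply: nearS (n1 &n (near2 (mdom_near hXm ix) (mdom_near hZm kz))) => -[m p] [sm [im kp]].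
 have c2 : {for (m, p), continuous (fun r : X * Z => i:@r.1:|k:@r.2)}.
  exact: (crow _ _ im kp).
 exact: (continuous_comp c2 (sm_cont sm)).
have [_ c2] := lc.
by apply: nearS (n2 &n c2) => t [h1 h2] Vt Wt; split; [exact: h2|exact: h1].
Qed.
Lemma core_pair_cont c (A : X * Y -> Prop) : (\forall q \near (val (phi (psi c)), val (psi c)), A q) ->
 \forall p \near val c, forall c', val c' = p -> A (val (phi (psi c')), val (psi c')).
Proof.
move=> nA; have [A1 [A2 [n1 n2 A12]]] := unbox nA.
have n3 := cmcont hX hY sphi n1; have n4 := cmcont hY hZ spsi (n2 &n n3).
by apply: nearS n4 => z Hz c' ec; have [a2 a1] := Hz c' ec; apply: A12 => //; exact: a1.
Qed.
(** The local composites come with no relation between different core points. Restricting [W] to a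
    thin neighbourhood makes one relational composite [K] satisfy [lcomp] everywhere, and
    [lcomp_uniq] identifies it with each local composite near its point. *)
Lemma comp_global : exists K, (forall c, micro_at (phi \o psi) K c) /\
 forall c, lcomp V W K (val (phi (psi c))) (val (psi c)) (val c).
Proof.
pose a c := val (phi (psi c)); pose b c := val (psi c).
pose Bx (M' : set X) (N' : set Y) (P' : set Z) := (forall c, P' (val c) -> M' (a c) /\ N' (b c)) /\
 exists L, forall m n p, M' m -> N' n -> P' p -> V (m, n) -> W (n, p) -> L (m, p) /\ lcomp V W L m n p.
have [hsZ _ _ _ _] := hZm.
have [| c | U [[oU gU] HU]] := @thin_boxes _ _ _ (core Z) a b val Bx hsZ.2 (manifold_regular hZm).
- exact: core_pair_cont.
- have [L [_ _ nL]] := comp_local c.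
 have [A0 [D [nA0 nD AD]]] := unbox nL; have [A [B [/nearO[M' [oM Ma MA]] /nearO[N' [oN Nb NB]] AB]]] := unbox nA0.
 exists M', N', D; split => // P'' PD Pa; split => //; exists L => m n p Mm Nn /PD Dp.
 by apply: (AD (m, n) p) => //; apply: AB; [exact: MA|exact: NB].
pose K := rel_comp (W `&` U) V.
have lK c : lcomp V W K (a c) (b c) (val c).
 split; last first.
  have : \forall q \near (b c, val c), U q by apply: open_near => //; apply: gU; exists c.
  move=> /unbox[A [B [nA nB AB]]].
  apply: nearS (near2 (near_snd (a c) nA) nB) => -[[m n] p] [An Bp] Vn Wn.
  by exists n; split => //; split => //; exact: AB.
 move=> N' nN'; have [l [F [v [HF nF]]]] := HU c.
 have n1 : \forall q \near (a c, val c), forall j, (j <= l)%N -> v j -> forall L : set (X * Z),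
   L = L -> (exists L0, (forall m n p, (F j).1.1 m -> (F j).1.2 n -> (F j).2 p -> V (m, n) -> W (n, p) -> L0 (m, p)) /\
    (L0 q -> exists n', [/\ N' n', V (q.1, n') & W (n', q.2)])).
  apply: near_leq => j jl; have [vj|nv] := pselect (v j); last exact: nearT.
  have [[PP [L HL]] oM Ma Pc] := HF j jl vj.
  have [_ Nb] := PP c Pc.
  have [_ [c1 _]] := HL _ _ _ Ma Nb Pc (aV (psi c)).1 (aW c).1.
  apply: nearS (c1 _ nN') => q Hq _ _ _; exists L; split => // m n p Mm Nn Pp Vn Wn.
  by have [] := HL m n p Mm Nn Pp Vn Wn.
 apply: nearS (n1 &n nF) => -[m p] [H1 [j [jl vj Mm Pp HN]]] [n [Vn [Wn Un]]].
 have [L0 [HL0 h0]] := H1 j jl vj setT erefl.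
 by apply: h0; apply: HL0 (HN _ Un) Pp Vn Wn.
exists K; split => // c.
have [L [mL lL _]] := comp_local c.
have e1 := lcomp_uniq (lK c) lL; have e2 := lcomp_uniq lL (lK c).
have n1 : \forall z \near (a c, val c), L z <-> K z.
 by apply: nearS (e1 &n e2) => z [? ?]; split.
exact: micro_at_ext n1 mL.
Qed.
End Local.
Lemma comp_lcomp (f : X =>> Y) (g : Y =>> Z) V W : is_micro f -> is_micro g -> rep f V -> rep g W ->
 is_micro (g \o' f) /\ exists K, rep (g \o' f) K /\
  forall c, lcomp V W K (val (coremap f (coremap g c))) (val (coremap g c)) (val c).
Proof.
move=> mf mg rV rW; have [sf _] := mf; have [sg _] := mg.
have aV := micro_rep hX hY mf rV; have aW := micro_rep hY hZ mg rW.
have [K [mK lK]] := comp_global sf sg aV aW.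
have rK := rep_comp hX hY hZ sf sg rV rW lK.
split; last by exists K.
have := is_microI hX hZ (smooth_comp sf sg) mK.
suff -> : {| coremap := coremap f \o coremap g; mgerm := germ (gr (coremap f \o coremap g)) K |} = g \o' f by [].
by apply: (micro_ext (W := K)) => // b; exact: nearT.
Qed.
End Comp.

(** * Tensor products *)

Section LagrAt.
Variable (R : realType).
Implicit Types (M N : presymplectic R).
Definition lagr_cut M (i : mchart M) x (L : set M) k (h : 'rV[R]_(mdim M) -> 'rV[R]_k) :=
 [/\ mdim M = k.*2, cut i x L h & \forall y \near x, L y -> isotropic i y h].
Lemma lagr_atI M k (L : set M) : is_symplectic M -> mdim M = k.*2 -> (forall x, L x -> exists i, lagr_at i x L) -> is_lagrangian L.
Proof.
move=> hM e H; have [U [[_ LU] lU]] := lagr_shrink hM e H.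
by have e' : L `&` U = L by [apply/seteqP; split=> [x []//|x Lx]; split => //; exact: LU]; rewrite e' in lU.
Qed.
Lemma lagr_prod M N (i : mchart M) (j : mchart N) x y L L' k l h g :
 is_symplectic M -> is_symplectic N ->
 @lagr_cut M i x L k h -> @lagr_cut N j y L' l g ->
 @lagr_cut (sprod M N) (i, j) (x, y) (L `*` L') _ (fprodmx h g).
Proof.
move=> [hM _ _ _] [hN _ _ _] [e1 c1 i1] [e2 c2 i2]; split; first by rewrite /= e1 e2 doubleD.
 exact: cut_prod.
have n1 := nearI (cut_near hM c1) i1; have n2 := nearI (cut_near hN c2) i2.
apply: nearS (near2 n1 n2) => -[m n] [[[_ sm _ _] Im] [[_ sn _ _] In]] [/Im{}Im /In{}In] u v.
rewrite -[u](@hsubmxK _ _ (mdim M) (mdim N)) -[v](@hsubmxK _ _ (mdim M) (mdim N)).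
move=> /(fprod_ker _ _ sm sn)[u1 u2] /(fprod_ker _ _ sm sn)[v1 v2].
by rewrite block_form !row_mxKl !row_mxKr Im // In // addr0.
Qed.
Lemma core_cut_prod (A B : premicrofold R) (i : mchart A) (j : mchart B) x y k l h g :
 @core_cut R A i x k h -> @core_cut R B j y l g ->
 @core_cut R A:~B (i, j) (x, y) _ (fprodmx h g).
Proof.
move=> [e1 c1 i1] [e2 c2 i2]; have [[_ s1 _ _] [_ s2 _ _]] := (c1, c2).
split; [by rewrite /= e1 e2 doubleD|exact: cut_prod |].
move=> u v; rewrite -[u](@hsubmxK _ _ (mdim A) (mdim B)) -[v](@hsubmxK _ _ (mdim A) (mdim B)).
move=> /(fprod_ker _ _ s1 s2)[u1 u2] /(fprod_ker _ _ s1 s2)[v1 v2].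
by rewrite block_form !row_mxKl !row_mxKr i1 // i2 // addr0.
Qed.
Lemma mfprodP (A B : premicrofold R) : is_mf A -> is_mf B -> is_mf A:~B.
Proof.
move=> hA hB; have [sA [k e lA]] := hA; have [sB [l e' lB]] := hB; split; first exact: sprodP.
apply: (@lagr_atI _ (k + l)%N); first exact: sprodP.
 by rewrite /= e e' doubleD.
move=> [x y] [/= Ax By]; have [[_ /(_ x)[i ix] _ _ _] _ _ _] := sA; have [[_ /(_ y)[j jy] _ _ _] _ _ _] := sB.
have [k1 [h H1]] := lagr_atE sA (ex_intro2 _ _ k e lA) Ax ix.
have [k2 [g H2]] := lagr_atE sB (ex_intro2 _ _ l e' lB) By jy.
by exists (i, j), (k1 + k2)%N, (fprodmx h g); apply: lagr_prod.
Qed.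
Lemma mfunitP : is_mf (mfunit R).
Proof.
have hs := spoint_valid R; split => //; apply: (@lagr_atI _ 0) => // x _.
exists tt, 0%N, (fun _ => 0); split => //.
 split => //; first exact: sm_cst.
  by rewrite /row_full -leqn0 rank_leq_col.
 by apply: nearT => y; split.
by apply: nearT => y _ u v _ _; rewrite !thinmx0 mul0mx.
Qed.
(** [F] is linear with matrix [P] in the charts, and multiplying by [Q], for which [Q *m P = 1],
    preserves surjectivity of the derivative. *)
Lemma cut_pull M N (i : mchart M) (j : mchart N) (F : M -> N) x (P : 'M[R]_(mdim M, mdim N)) Q L k h :
 is_manifold M -> mdom i x -> {for x, continuous F} -> Q *m P = 1%:M ->
 (\forall y \near x, j:@(F y) = i:@y *m P) ->
 @cut R N j (F x) L k h -> @cut R M i x (F @^-1` L) k (h \o mulmx^~ P).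
Proof.
move=> hM ix cF QP nF [jx sh fh nL].
have e0 := near_pt nF; split => //.
- by apply: sm_comp; [exact: sm_mulmx|rewrite -e0].
- rewrite jac_comp; [|exact: sm_mulmx|by rewrite -e0].
 rewrite jac_mulmx -e0; have /row_fullP[B hB] := fh.
 by apply/row_fullP; exists (B *m Q); rewrite mulmxA -[B *m Q *m P]mulmxA QP mulmx1.
- by apply: nearS (nF &n (near_pre cF nL)) => y [e H] /=; rewrite -e.
Qed.
Lemma lagr_pull M N (i : mchart M) (j : mchart N) (F : M -> N) x (P : 'M[R]_(mdim M, mdim N)) Q L k h :
 is_manifold M -> is_manifold N -> mdom i x -> {for x, continuous F} -> Q *m P = 1%:M -> mdim M = mdim N ->
 (\forall y \near x, j:@(F y) = i:@y *m P /\
   forall u v : 'rV[R]_(mdim M), u *m form i y *m v^T = (u *m P) *m form j (F y) *m (v *m P)^T) ->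
 @lagr_cut N j (F x) L k h -> @lagr_cut M i x (F @^-1` L) k (h \o mulmx^~ P).
Proof.
move=> hM hN ix cF QP e nF [eN hc iso].
have nF1 : \forall y \near x, j:@(F y) = i:@y *m P by apply: nearS nF => y [].
split; [by rewrite e|exact: (cut_pull hM ix cF QP nF1 hc) |].
have nh := near_pre cF (iso &n (cut_near hN hc)).
apply: nearS (nF &n nh) => y [[e1 e2] [iy [_ sy _ _]]] /iy{}iy u v.
have -> : jac (h \o mulmx^~ P) i:@y = P *m jac h j:@(F y).
 by rewrite jac_comp; [rewrite jac_mulmx e1|exact: sm_mulmx|rewrite -e1].
by rewrite !mulmxA e2 => h1 h2; apply: iy.
Qed.
End LagrAt.
Section Perm.
Variables (R : realType) (a a' b b' : nat).
(** The exchange of the two middle blocks of a row vector, which carries tangent vectors of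
    [rel_prod V V'] to those of the cartesian product of [V] and [V']. *)
Definition swap_mx : 'M[R]_((a + a') + (b + b'), (a + b) + (a' + b')) :=
 col_mx (col_mx 1%:M:|0:|0 0:|(1%:M:|0))
     (col_mx 0:|1%:M:|0 0:|(0:|1%:M)).
Lemma swap_mxE k (x : 'M[R]_(k, a)) x' (y : 'M[R]_(k, b)) y' :
 x:|x':|(y:|y') *m swap_mx = x:|y:|(x':|y').
Proof. by rewrite !mul_row_col !mul_mx_row !mulmx0 !mulmx1 !add_row_mx !addr0 !add0r !add_row_mx !addr0 !add0r. Qed.
End Perm.
Lemma swap_mxK (R : realType) a a' b b' : swap_mx R a b a' b' *m swap_mx R a a' b b' = 1%:M.
Proof.
apply: eq_rowmul => u; rewrite mulmx1 mulmxA.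
by rewrite -[u]hsubmxK -[lsubmx u]hsubmxK -[rsubmx u]hsubmxK !swap_mxE.
Qed.
Section Tensor.
Variables (R : realType) (X Y X' Y' : premicrofold R).
Hypotheses (hX : is_mf X) (hY : is_mf Y) (hX' : is_mf X') (hY' : is_mf Y').
Let hXX := mfprodP hX hX'.
Let hYY := mfprodP hY hY'.
Definition tens_core (phi : core Y -> core X) (phi' : core Y' -> core X') :=
 fun b : core Y:~Y' => core_pair (phi (core_fst b)) (phi' (core_snd b)) : core X:~X'.
Lemma ext_tens phi phi' (b : core Y:~Y') i j i' j' F F' :
 ext_at phi (core_fst b) i j F -> ext_at phi' (core_snd b) i' j' F' ->
 @ext_at R X:~X' Y:~Y' (tens_core phi phi') b (i, i') (j, j') (fprodmx F F').
Proof.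
move: b => [[y y'] hb] [sF nF] [sF' nF']; split; first exact: smooth_prodmx.
apply: nearS (near2 nF nF') => -[z z'] [H H'] b' eb.
have [i1 e1] := H (core_fst b') (congr1 fst eb); have [i2 e2] := H' (core_snd b') (congr1 snd eb).
by split=> //=; rewrite /fprodmx row_mxKl row_mxKr e1 e2.
Qed.
(** The tensor product is the preimage of a product of two lagrangians under the exchange of middle
    factors, which is linear in product charts and matches the signs of the forms. *)
Lemma tens_valid (phi : core Y -> core X) (phi' : core Y' -> core X') V V' b :
 @smooth_map R Y X (core Y) (fun b => val (phi b)) -> @smooth_map R Y' X' (core Y') (fun b => val (phi' b)) ->
 (forall b, micro_all phi V b) -> (forall b, micro_all phi' V' b) ->
 (exists i j F, mdom j (val b) /\ @ext_at R X:~X' Y:~Y' (tens_core phi phi') b i j F) /\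
 @micro_at R X:~X' Y:~Y' (tens_core phi phi') (rel_prod V V') b.
Proof.
move=> sphi sphi' aV aV'.
have [[hXm hYm] [hXm' hYm']] : (is_manifold X /\ is_manifold Y) /\ (is_manifold X' /\ is_manifold Y').
 by case: hX hY hX' hY' => [[? _ _ _] _] [[? _ _ _] _] [[? _ _ _] _] [[? _ _ _] _].
have [_ /(_ (val (phi (core_fst b))))[i ix] _ _ _] := hXm.
have [_ /(_ (val (core_fst b)))[j jy] _ _ _] := hYm.
have [_ /(_ (val (phi' (core_snd b))))[i' ix'] _ _ _] := hXm'.
have [_ /(_ (val (core_snd b)))[j' jy'] _ _ _] := hYm'.
have [kA [hA cA]] := core_cutE hX (valcore (phi (core_fst b))) ix.
have [kB [hB cB]] := core_cutE hY (valcore (core_fst b)) jy.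
have [kA' [hA' cA']] := core_cutE hX' (valcore (phi' (core_snd b))) ix'.
have [kB' [hB' cB']] := core_cutE hY' (valcore (core_snd b)) jy'.
have [k [hV [F [[[eV Vb eF] _ _ [cV iV] kV] _]]]] := micro_dataE hX hY sphi aV ix jy cA cB.
have [k' [hV' [F' [[[eV' Vb' eF'] _ _ [cV' iV'] kV'] _]]]] := micro_dataE hX' hY' sphi' aV' ix' jy' cA' cB'.
have eFF := ext_tens eF eF'.
split; first by exists (i, i'), (j, j'), (fprodmx F F').
have hs : is_symplectic (sprod (sopp X) Y) by apply: sprodP; [apply: soppP; case: hX|case: hY].
have hs' : is_symplectic (sprod (sopp X') Y') by apply: sprodP; [apply: soppP; case: hX'|case: hY'].
have lc1 := lagr_prod hs hs' (And3 eV cV iV) (And3 eV' cV' iV').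
pose M := sprod (sopp X:~X') Y:~Y'; pose N := sprod (sprod (sopp X) Y) (sprod (sopp X') Y').
pose T (p : M) : N := ((p.1.1, p.2.1), (p.1.2, p.2.2)).
pose P := swap_mx R (mdim X) (mdim X') (mdim Y) (mdim Y').
have hM : is_manifold M by apply: mprodP; apply: mprodP.
have hN : is_manifold N by apply: mprodP; apply: mprodP.
pose x : M := (val (tens_core phi phi' b), val b).
have cT : {for x, continuous T}.
 by move: x => x0; apply: (cont_pair (f := fun p : M => (p.1.1, p.2.1)) (g := fun p : M => (p.1.2, p.2.2)));
  apply: cont_pair; (apply: (@continuous_comp _ _ _ _ _ x0); [exact: cont_fst || exact: cont_snd|exact: cont_fst || exact: cont_snd]).
have xd : @mdom R M ((i, i'), (j, j')) x by [].
have lc2 : @lagr_cut R M ((i, i'), (j, j')) x (rel_prod V V') _ (fprodmx hV hV' \o mulmx^~ P).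
 apply: (@lagr_pull R M N ((i, i'), (j, j')) ((i, j), (i', j')) T x P _ _ _ _ hM hN xd cT (swap_mxK _ _ _ _ _) _ _ lc1).
  by rewrite /=; lia.
 apply: nearT => y; split; first by rewrite /P swap_mxE.
 move=> u v; rewrite -[u](@hsubmxK _ _ (mdim X + mdim X') (mdim Y + mdim Y')) -[v](@hsubmxK _ _ (mdim X + mdim X') (mdim Y + mdim Y')).
 rewrite -[lsubmx u]hsubmxK -[rsubmx u]hsubmxK -[lsubmx v]hsubmxK -[rsubmx v]hsubmxK !swap_mxE.
 rewrite !block_form !row_mxKl !row_mxKr mulmxN mulNmx !block_form !row_mxKl !row_mxKr !mulmxN !mulNmx opprD.
 by rewrite addrACA.
have [e2 c2 i2] := lc2.
apply: (micro_dataI hXX hYY (i := (i, i')) (j := (j, j')) (k := (k + k')%N) (hA := fprodmx hA hA') (hB := fprodmx hB hB')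
  (hV := fprodmx hV hV' \o mulmx^~ P) (F := fprodmx F F')).
have [[_ [_ sA _ _] _] [_ [_ sA' _ _] _]] := (cA, cA').
have [[_ [_ sB _ _] _] [_ [_ sB' _ _] _]] := (cB, cB').
have [[_ sV _ _] [_ sV' _ _]] := (cV, cV').
split => //; [exact: core_cut_prod|exact: core_cut_prod |].
move=> u v; rewrite -[u](@hsubmxK _ _ (mdim X) (mdim X')) -[v](@hsubmxK _ _ (mdim Y) (mdim Y')).
move: (lsubmx u) (rsubmx u) (lsubmx v) (rsubmx v) => u1 u2 v1 v2.
have e0 : (@mcoord R X:~X' (i, i') (val (tens_core phi phi' b))):|(@mcoord R Y:~Y' (j, j') (val b)) *m P =
  i:@(val (phi (core_fst b))):|j:@(val (core_fst b)):|(i':@(val (phi' (core_snd b))):|j':@(val (core_snd b))) by rewrite swap_mxE.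
rewrite jac_comp; [|exact: sm_mulmx|by rewrite e0; exact: smooth_prodmx].
rewrite jac_mulmx e0 mulmxA swap_mxE => /(fprod_ker _ _ sV sV')[w1 w2] /(fprod_ker _ _ sA sA')[uA uA'] /(fprod_ker _ _ sB sB')[vB vB'].
have [[sF _] [sF' _]] := (eF, eF').
rewrite jac_prodmx // mul_block_row row_mxKl row_mxKr; congr row_mx; [exact: kV|exact: kV'].
Qed.
Lemma tens_rep (f : X =>> Y) (f' : X' =>> Y') V V' : rep f V -> rep f' V' -> rep (f \x f') (rel_prod V V').
Proof.
move=> rV rV'.
have claim W W' : mgerm f W -> mgerm f' W' -> germ_eq (gr (tens_core (coremap f) (coremap f'))) (rel_prod V V') (rel_prod W W').
 move=> mW mW'; apply/germ_eq_near => _ [b ->].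
 have [A [B [nA nB AB]]] := unbox (germ_mem rV mW (core_fst b)).
 have [A' [B' [nA' nB' AB']]] := unbox (germ_mem rV' mW' (core_snd b)).
 case: b nA nB nA' nB' => -[y y'] hb nA nB nA' nB'.
 apply: nearS (near2 (near2 nA nA') (near2 nB nB')) => -[[m m'] [n n']] [[Am Am'] [Bn Bn']].
 by rewrite /rel_prod; split=> -[/(AB _ _ Am Bn) ? /(AB' _ _ Am' Bn') ?].
rewrite /rep; apply/seteqP; split=> L.
 move=> [W [W' [mW mW' LW]]]; apply: germ_eq_trans (claim _ _ mW mW') (germ_eq_sym LW).
move=> VL; exists V, V'; split; [by rewrite rV; exact: germ_eqxx|by rewrite rV'; exact: germ_eqxx|exact: germ_eq_sym].
Qed.
Lemma tens_micro (f : X =>> Y) (f' : X' =>> Y') : is_micro f -> is_micro f' -> is_micro (f \x f').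
Proof.
move=> mf mf'; have [V [rV _ _ aV]] := is_micro_rep hX hY mf; have [V' [rV' _ _ aV']] := is_micro_rep hX' hY' mf'.
have [sf _] := mf; have [sf' _] := mf'.
have H b := tens_valid b sf sf' aV aV'.
have := is_microI hXX hYY (smooth_mapI hXX hYY (fun b => (H b).1)) (fun b => (H b).2).
suff -> : {| coremap := tens_core (coremap f) (coremap f'); mgerm := germ (gr (tens_core (coremap f) (coremap f'))) (rel_prod V V') |} = f \x f' by [].
apply: (@micro_ext R X:~X' Y:~Y' _ _ (rel_prod V V') (rel_prod V V')) => //; first exact: tens_rep.
by move=> b; exact: nearT.
Qed.
End Tensor.
Lemma lcomp_prod {M N P M' N' P' : topT} (V : set (M * N)) (W : set (N * P)) (L : set (M * P))
 (V' : set (M' * N')) (W' : set (N' * P')) (L' : set (M' * P')) m n p m' n' p' :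
 lcomp V W L m n p -> lcomp V' W' L' m' n' p' ->
 lcomp (rel_prod V V') (rel_prod W W') (rel_prod L L') (m, m') (n, n') (p, p').
Proof.
move=> [a1 a2] [b1 b2]; split=> [A nA|].
 have [A1 [A2 [nA1 nA2 AA]]] := unbox nA.
 have [B [C [nB nC BC]]] := unbox (a1 _ nA1); have [B' [C' [nB' nC' BC']]] := unbox (b1 _ nA2).
 apply: nearS (near2 (near2 nB nB') (near2 nC nC')) => -[[x x'] [z z']] [[Bx Bx'] [Cz Cz']] [/= Lx Lx'].
 have [y [Ay Vy Wy]] := BC _ _ Bx Cz Lx; have [y' [Ay' Vy' Wy']] := BC' _ _ Bx' Cz' Lx'.
 by exists (y, y'); split => //; exact: AA.
have [B [C [nB nC BC]]] := unbox a2; have [B' [C' [nB' nC' BC']]] := unbox b2.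
have [D [E [nD nE DE]]] := unbox nB; have [D' [E' [nD' nE' DE']]] := unbox nB'.
apply: nearS (near2 (near2 (near2 nD nD') (near2 nE nE')) (near2 nC nC')).
move=> [[[x x'] [y y']] [z z']] [[[Dx Dx'] [Ey Ey']] [Cz Cz']] [/= Vx Vx'] [/= Wx Wx']; split => /=.
 by apply: (BC (x, y) z) => //; exact: DE.
by apply: (BC' (x', y') z') => //; exact: DE'.
Qed.

(** * Structural isomorphisms as graphs *)

Lemma cont_assoc {T U V : topT} : continuous (fun p : (T * U) * V => (p.1.1, (p.1.2, p.2))).
Proof.
move=> [p q]; apply: (@cont_pair _ _ _ (fun p : (T * U) * V => p.1.1) (fun p : (T * U) * V => (p.1.2, p.2))).
 by have := @near_fst_cont (T * U)%type V T fst p q (@cont_fst T U p).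
apply: (@cont_pair _ _ _ (fun p : (T * U) * V => p.1.2) snd); last exact: cont_snd.
by have := @near_fst_cont (T * U)%type V U snd p q (@cont_snd T U p).
Qed.
Lemma cont_assocV {T U V : topT} : continuous (fun p : T * (U * V) => ((p.1, p.2.1), p.2.2)).
Proof.
move=> [p q]; apply: (@cont_pair _ _ _ (fun p : T * (U * V) => (p.1, p.2.1)) (fun p : T * (U * V) => p.2.2)); last first.
 by have := @near_snd_cont T (U * V)%type V snd p q (@cont_snd U V q).
apply: (@cont_pair _ _ _ fst (fun p : T * (U * V) => p.2.1)); first exact: cont_fst.
by have := @near_snd_cont T (U * V)%type U fst p q (@cont_fst U V q).
Qed.
Lemma cont_swap {T U : topT} : continuous (fun p : T * U => (p.2, p.1)).
Proof. by move=> p; apply: cont_pair; [exact: cont_snd|exact: cont_fst]. Qed.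
Section Form3.
Variables (R : realType) (m n p : nat) (A : 'M[R]_m) (B : 'M[R]_n) (C : 'M[R]_p).
Lemma row3L (u : 'rV[R]_((m + n) + p)) : exists a b c, u = a:|b:|c.
Proof. by exists (lsubmx (lsubmx u)), (rsubmx (lsubmx u)), (rsubmx u); rewrite !hsubmxK. Qed.
Lemma form3 (a a' : 'rV[R]_m) (b b' : 'rV[R]_n) (c c' : 'rV[R]_p) :
 a:|b:|c *m block_mx (block_mx A 0 0 B) 0 0 C *m (a':|b':|c')^T =
 a:|(b:|c) *m block_mx A 0 0 (block_mx B 0 0 C) *m (a':|(b':|c'))^T.
Proof. by rewrite !block_form !(row_mxKl, row_mxKr) addrA. Qed.
End Form3.
Section Graph.
Variable (R : realType).
Implicit Types (X Y Z : premicrofold R).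
(** All structural isomorphisms are linear in product charts, so smoothness and compatibility with
    the forms reduce to one invertible matrix [P]. *)
Definition lin_sympl (M N : presymplectic R) (F : M -> N) (G : N -> M) :=
 [/\ cancel F G /\ cancel G F, continuous F, continuous G, mdim M = mdim N & forall y : N, exists (i : mchart M) (j : mchart N) (P : 'M[R]_(mdim M, mdim N)) Q,
  [/\ mdom j y, P *m Q = 1%:M /\ Q *m P = 1%:M, forall x, mdom i x <-> mdom j (F x) & forall x, mdom i x -> j:@(F x) = i:@x *m P /\
   forall u v : 'rV[R]_(mdim M), u *m form i x *m v^T = (u *m P) *m form j (F x) *m (v *m P)^T]].
Lemma lin_sympl_sym (M N : presymplectic R) (F : M -> N) (G : N -> M) : lin_sympl F G -> lin_sympl G F.
Proof.
move=> [[FG GF] cF cG e H]; split => // x; have [i [j [P [Q [jy [PQ QP] ij H']]]]] := H (F x).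
exists j, i, Q, P; split => // [|y|y jy']; first exact/ij; first by rewrite ij GF.
have iy : mdom i (G y) by rewrite ij GF.
have [E1 E2] := H' _ iy; rewrite GF in E1 E2; split; first by rewrite E1 -mulmxA PQ mulmx1.
by move=> u v; rewrite E2 -[u *m Q *m P]mulmxA -[v *m Q *m P]mulmxA QP !mulmx1.
Qed.
(** The inverse [G] is carried along because the core map runs backwards: it is the restriction of
    [G]. *)
Definition isgraph X Y (f : X =>> Y) (F : X -> Y) (G : Y -> X) :=
 [/\ is_micro f, rep f [set p | p.2 = F p.1], (forall b, val (coremap f b) = G (val b)),
  cancel F G /\ cancel G F & continuous F /\ continuous G].
(** In the charts the graph is the kernel of [col_mx P (- 1%:M)], and preservation of the form is
    isotropy for the difference of the two forms. *)
Lemma graph_valid X Y (hX : is_mf X) (hY : is_mf Y) (F : X -> Y) (G : Y -> X) (phi : core Y -> core X) :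
 lin_sympl F G -> (forall b, val (phi b) = G (val b)) ->
 isgraph (PreMicro phi (germ (gr phi) [set p | p.2 = F p.1])) F G.
Proof.
move=> [[FG GF] cF cG edim lin] ephi; split => //.
have [hXm hYm] : is_manifold X /\ is_manifold Y by case: hX hY => [[? _ _ _] _] [[? _ _ _] _].
have ext b : exists i j (P : 'M[R]_(mdim X, mdim Y)) Q, [/\ mdom i (G (val b)), mdom j (val b), P *m Q = 1%:M,
  (forall x, mdom i x -> [/\ mdom j (F x), j:@(F x) = i:@x *m P &
   forall u v : 'rV[R]_(mdim X), u *m form i x *m v^T = (u *m P) *m form j (F x) *m (v *m P)^T]) &
  ext_at phi b i j (mulmx^~ Q)].
 have [i [j [P [Q [jy [PQ _] ij H]]]]] := lin (val b); have ix : mdom i (G (val b)) by rewrite ij GF.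
 exists i, j, P, Q; split => // [x ixx|]; first by have [? ?] := H x ixx; split => //; exact/ij.
 split; first exact: sm_mulmx.
 have n1 := near_pre (cG (val b)) (mdom_near hXm ix).
 apply: nearS n1 => z iz b' e; move: iz; rewrite -e => iz; rewrite ephi; split => //.
 by have [+ _] := H _ iz; rewrite GF => ->; rewrite -mulmxA PQ mulmx1.
apply: (is_microI hX hY).
 by apply: (smooth_mapI hX hY) => b; have [i [j [P [Q [_ jy _ _ e]]]]] := ext b; exists i, j, (mulmx^~ Q).
move=> b; have [i [j [P [Q [ix jy PQ H eF]]]]] := ext b.
rewrite -ephi in ix.
have [kA [hA cA]] := core_cutE hX (valcore (phi b)) ix.
have [kB [hB cB]] := core_cutE hY (valcore b) jy.
pose A : 'M[R]_(mdim X + mdim Y, mdim Y) := col_mx P (- 1%:M).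
have kerA (u) (v) : u:|v *m A = 0 <-> u *m P = v.
 rewrite mul_row_col mulmxN mulmx1; split=> [/eqP|<-]; last exact: subrr.
 by rewrite subr_eq0 => /eqP.
have iA z : jac (mulmx^~ A) z = A by exact: jac_mulmx.
apply: (micro_dataI hX hY (i := i) (j := j) (hA := hA) (hB := hB) (hV := mulmx^~ A) (F := mulmx^~ Q)).
have nx : \forall p \near (val (phi b), val b), mdom i p.1 /\ mdom j p.2 by apply: near2; exact: mdom_near.
split => //.
- by split; [rewrite /= edim addnn|rewrite /= ephi GF|].
- split; last first.
  apply: nearS nx => -[x y] /= [ixx jyy] -> u v.
  rewrite iA -[u](@hsubmxK _ _ (mdim X) (mdim Y)) -[v](@hsubmxK _ _ (mdim X) (mdim Y)) => /kerA h1 /kerA h2.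
  rewrite block_form !row_mxKl !row_mxKr -h1 -h2 mulmxN mulNmx.
  by have [_ _ ->] := H x ixx; rewrite addNr.
 split => //; first exact: sm_mulmx.
  rewrite iA; apply/row_fullP; exists 0:|(- 1%:M).
  by rewrite mul_row_col mul0mx add0r mulmxN mulmx1 opprK.
 apply: nearS nx => -[x y] [ixx jyy]; have [jF eF' _] := H x ixx.
 rewrite kerA -eF'; split=> [->//|e]; exact: (mcoord_inj hYm jyy jF (esym e)).
- move=> u v; rewrite iA => /kerA <- _ _.
 by rewrite jac_mulmx -mulmxA PQ mulmx1.
Qed.
(** Reduces coherence laws to equalities between maps of points: [F] determines [G], and the pair
    determines the germ and the core map. *)
Lemma isgraph_eq X Y (f g : X =>> Y) F G F' G' : isgraph f F G -> isgraph g F' G' -> (forall x, F x = F' x) -> f = g.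
Proof.
move=> [_ rf ef [c1 c2] _] [_ rg eg [c1' c2'] _] e; apply: (micro_ext rf rg).
 by move=> b; rewrite ef eg -[LHS]c1' -e c2.
by move=> b; apply: nearT => p /=; rewrite e.
Qed.
Lemma isgraph_id X : is_mf X -> isgraph (i_ X) id id.
Proof.
move=> hX.
have H : isgraph (PreMicro id (germ (@gr R X X id) [set p : X * X | p.2 = id p.1])) id id.
 apply: (graph_valid hX hX); split => // y; try by move=> A.
 have [[[_ /(_ y)[i iy] _ _ _] _ _ _] _] := hX.
 by exists i, i, 1%:M, 1%:M; split; rewrite ?mulmx1 // => x ix; split; rewrite ?mulmx1 // => u v; rewrite !mulmx1.
have e : i_ X = PreMicro id (germ (@gr R X X id) [set p : X * X | p.2 = id p.1]).
 by congr PreMicro; congr germ; apply/seteqP; split=> p /= ->.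
by rewrite e.
Qed.
Section Two.
Variables (X Y Z : premicrofold R).
Hypotheses (hX : is_mf X) (hY : is_mf Y) (hZ : is_mf Z).
(** Composing with a graph is substitution in the representative; naturality of the structural
    isomorphisms is obtained by comparing such substitutions. *)
Lemma comp_graphr (f : X =>> Y) (s : Y =>> Z) V F G : is_micro f -> rep f V -> isgraph s F G ->
 rep (s \o' f) [set z | V (z.1, G z.2)].
Proof.
move=> [sf _] rV [[ss _] rs es [c1 c2] [cF cG]]; apply: (rep_comp hX hY hZ sf ss rV rs) => c.
by apply: lcomp_graphr => //; rewrite es.
Qed.
Lemma comp_graphl (s : X =>> Y) (f : Y =>> Z) V F G : is_micro f -> rep f V -> isgraph s F G ->
 rep (f \o' s) [set z | V (F z.1, z.2)].
Proof.
move=> [sf _] rV [[ss _] rs es [c1 c2] [cF cG]]; apply: (rep_comp hX hY hZ ss sf rs rV) => c.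
by apply: lcomp_graphl => //; rewrite es c2.
Qed.
Lemma comp_micro (f : X =>> Y) (g : Y =>> Z) : is_micro f -> is_micro g -> is_micro (g \o' f).
Proof.
move=> mf mg; have [V [rV _ _ _]] := is_micro_rep hX hY mf; have [W [rW _ _ _]] := is_micro_rep hY hZ mg.
by case: (comp_lcomp hX hY hZ mf mg rV rW).
Qed.
Lemma isgraph_comp (f : X =>> Y) (g : Y =>> Z) F G F' G' : isgraph f F G -> isgraph g F' G' ->
 isgraph (g \o' f) (F' \o F) (G \o G').
Proof.
move=> gf gg; have [mf rf ef [c1 c2] [cF cG]] := gf; have [mg rg eg [c1' c2'] [cF' cG']] := gg.
split; first exact: comp_micro.
- exact: (comp_graphl mg rg gf).
- by move=> b; rewrite ef eg.
- by split=> x /=; rewrite ?c1' ?c2 ?c2'.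
- by split=> x; apply: continuous_comp; [exact: cF|exact: cF'|exact: cG'|exact: cG].
Qed.
End Two.
Lemma isgraph_tens X Y X' Y' (hX : is_mf X) (hY : is_mf Y) (hX' : is_mf X') (hY' : is_mf Y')
 (f : X =>> Y) (f' : X' =>> Y') F G F' G' : isgraph f F G -> isgraph f' F' G' ->
 isgraph (f \x f') (fun p => (F p.1, F' p.2)) (fun p => (G p.1, G' p.2)).
Proof.
move=> [mf rf ef [c1 c2] [cF cG]] [mg rg eg [c1' c2'] [cF' cG']].
split; first exact: (tens_micro hX hY hX' hY').
- apply: rep_ext (tens_rep rf rg) _ => b; apply: nearT => -[[x x'] [y y']].
 by rewrite /rel_prod /=; split=> [[-> ->]|[-> ->]].
- by move=> b /=; rewrite ef eg.
- by split=> -[x y]; rewrite ?c1 ?c1' ?c2 ?c2'.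
- split=> p; apply: cont_pair; (apply: (@continuous_comp _ _ _ _ _ p); [exact: cont_fst || exact: cont_snd|]).
 + exact: cF. + exact: cF'. + exact: cG. + exact: cG'.
Qed.
Lemma graph_isgraph X Y (hX : is_mf X) (hY : is_mf Y) F G GA : lin_sympl F G ->
 isgraph (@micro_graph R X Y F G GA) F G.
Proof. by move=> l; apply: graph_valid. Qed.
Lemma lin_assoc X Y Z : is_mf X -> is_mf Y -> is_mf Z ->
 @lin_sympl X:~Y:~Z X:~(Y:~Z) (fun p => (p.1.1, (p.1.2, p.2))) (fun p => ((p.1, p.2.1), p.2.2)).
Proof.
move=> hX hY hZ; split; [by split=> [[[x y] z]|[x [y z]]]|exact: cont_assoc|exact: cont_assocV|by rewrite /= addnA|].
move=> [x [y z]].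
have [[[_ /(_ x)[i ix] _ _ _] _ _ _] _] := hX; have [[[_ /(_ y)[j jy] _ _ _] _ _ _] _] := hY; have [[[_ /(_ z)[k kz] _ _ _] _ _ _] _] := hZ.
pose P : 'M[R]_((mdim X + mdim Y) + mdim Z, mdim X + (mdim Y + mdim Z)) :=
 col_mx (col_mx 1%:M:|0 0:|(1%:M:|0)) 0:|(0:|1%:M).
pose Q : 'M[R]_(mdim X + (mdim Y + mdim Z), (mdim X + mdim Y) + mdim Z) :=
 col_mx 1%:M:|0:|0 (col_mx 0:|1%:M:|0 0:|1%:M).
have PE a b c : a:|b:|c *m P = a:|(b:|c).
 by rewrite !mul_row_col !mul_mx_row !mulmx0 !mulmx1 !add_row_mx !addr0 !add0r !add_row_mx !addr0 !add0r.
have QE a b c : a:|(b:|c) *m Q = a:|b:|c.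
 by rewrite !mul_row_col !mul_mx_row !mulmx0 !mulmx1 !add_row_mx !addr0 !add0r !add_row_mx !addr0 !add0r.
exists ((i, j), k), (i, (j, k)), P, Q; split => //.
- by split; apply: eq_rowmul => u; rewrite mulmxA mulmx1 -[u]hsubmxK; [rewrite -[lsubmx u]hsubmxK PE QE|rewrite -[rsubmx u]hsubmxK QE PE].
- by move=> [[x' y'] z']; split=> [[[? ?] ?]|[? [? ?]]].
move=> [[x' y'] z'] _; rewrite PE; split => // u v.
by have [u1 [u2 [u3 ->]]] := row3L u; have [v1 [v2 [v3 ->]]] := row3L v; rewrite !PE; exact: form3.
Qed.
Lemma isgraph_assoc X Y Z : is_mf X -> is_mf Y -> is_mf Z ->
 isgraph (micro_assoc X Y Z) (fun p => (p.1.1, (p.1.2, p.2))) (fun p => ((p.1, p.2.1), p.2.2)).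
Proof. by move=> hX hY hZ; apply: graph_isgraph; [do ?apply: mfprodP..|exact: lin_assoc]. Qed.
Lemma isgraph_assocV X Y Z : is_mf X -> is_mf Y -> is_mf Z ->
 isgraph (micro_assocV X Y Z) (fun p => ((p.1, p.2.1), p.2.2)) (fun p => (p.1.1, (p.1.2, p.2))).
Proof. by move=> hX hY hZ; apply: graph_isgraph; [do ?apply: mfprodP..|exact: lin_sympl_sym (lin_assoc hX hY hZ)]. Qed.
Lemma isgraph_braid X Y : is_mf X -> is_mf Y ->
 isgraph (micro_braid X Y) (fun p => (p.2, p.1)) (fun p => (p.2, p.1)).
Proof.
move=> hX hY; apply: graph_isgraph; try by do ?apply: mfprodP.
split; [by split=> -[x y]|exact: cont_swap|exact: cont_swap|by rewrite /= addnC|].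
move=> [y x].
have [[[_ /(_ x)[i ix] _ _ _] _ _ _] _] := hX; have [[[_ /(_ y)[j jy] _ _ _] _ _ _] _] := hY.
have E m n (a : 'rV[R]_m) (b : 'rV[R]_n) : a:|b *m col_mx 0:|1%:M 1%:M:|0 = b:|a.
 by rewrite mul_row_col !mul_mx_row !mulmx0 !mulmx1 add_row_mx addr0 add0r.
exists (i, j), (j, i), (col_mx 0:|1%:M 1%:M:|0), (col_mx 0:|1%:M 1%:M:|0); split => //.
- by split; apply: eq_rowmul => u; rewrite mulmxA mulmx1 -[u]hsubmxK !E.
- by move=> [x' y']; split=> -[].
move=> [x' y'] _; rewrite E; split => // u v; rewrite -[u](@hsubmxK _ _ (mdim X) (mdim Y)) -[v](@hsubmxK _ _ (mdim X) (mdim Y)).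
by rewrite !E !block_form !row_mxKl !row_mxKr addrC.
Qed.
Lemma lin_unitors X : is_mf X -> @lin_sympl X (mfunit R):~X (fun x => (0, x)) snd /\ @lin_sympl X X:~(mfunit R) (fun x => (x, 0)) fst.
Proof.
move=> hX; have m0 (x : 'rV[R]_0) : x = 0 by exact: rV0.
split.
- split; [by split=> [x|[e x]] //=; rewrite (m0 e)|by move=> x; apply: (@cont_pair _ _ _ (fun _ => 0) id x); [exact: cvg_cst|exact: cvg_id]|by move=> x; exact: cont_snd|by [] |].
 move=> [e x]; have [[[_ /(_ x)[i ix] _ _ _] _ _ _] _] := hX.
 exists i, (tt, i), 0:|1%:M, (col_mx 0 1%:M); split => //.
 + split; first by rewrite mul_row_col mulmx1 mulmx0 add0r.
  by apply: eq_rowmul => u; rewrite mulmxA mulmx1 -[u]hsubmxK mul_row_col mulmx0 mulmx1 add0r mul_mx_row mulmx0 mulmx1 (m0 (lsubmx u)).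
 + by move=> x'; split=> [|[]].
 move=> x' _; rewrite mul_mx_row mulmx0 mulmx1 (m0 0); split => // u v; rewrite !mul_mx_row !mulmx0 !mulmx1.
 by rewrite block_form !row_mxKl !row_mxKr !mul0mx add0r.
- split; [by split=> [x|[x e]] //=; rewrite (m0 e)|by move=> x; apply: (@cont_pair _ _ _ id (fun _ => 0) x); [exact: cvg_id|exact: cvg_cst]|by move=> x; exact: cont_fst|by rewrite /= addn0 |].
 move=> [x e]; have [[[_ /(_ x)[i ix] _ _ _] _ _ _] _] := hX.
 exists i, (i, tt), 1%:M:|0, (col_mx 1%:M 0); split => //.
 + split; first by rewrite mul_row_col mulmx1 mulmx0 addr0.
  by apply: eq_rowmul => u; rewrite mulmxA mulmx1 -[u]hsubmxK mul_row_col mulmx0 mulmx1 addr0 mul_mx_row mulmx0 mulmx1 (m0 (rsubmx u)).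
 + by move=> x'; split=> [|[]].
 move=> x' _; rewrite mul_mx_row mulmx0 mulmx1 (m0 0); split => // u v; rewrite !mul_mx_row !mulmx0 !mulmx1.
 by rewrite block_form !row_mxKl !row_mxKr !mul0mx addr0.
Qed.
Lemma isgraph_unitors X : is_mf X -> [/\ isgraph (micro_lunit X) snd (fun x => (0, x)),
 isgraph (micro_lunitV X) (fun x => (0, x)) snd, isgraph (micro_runit X) fst (fun x => (x, 0)) &
 isgraph (micro_runitV X) (fun x => (x, 0)) fst].
Proof.
move=> hX; have hE := mfunitP R; have [l r] := lin_unitors hX; have [l' r'] := (lin_sympl_sym l, lin_sympl_sym r).
by split; apply: graph_isgraph; try by [exact: hX|exact: mfprodP|exact: l|exact: r|exact: l'|exact: r'].
Qed.
End Graph.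

(** * The morphism from the unit object *)

Section Init.
Variable (R : realType).
Implicit Types (X Y Z : premicrofold R).
Lemma lagr_sub_eq (M : presymplectic R) (i : mchart M) x (V W : set M) : is_manifold M -> lagr_at i x V -> lagr_at i x W -> V x ->
 (\forall p \near x, V p -> W p) -> \forall p \near x, W p -> V p.
Proof.
move=> hM [k [h [e c _]]] [k' [h' [e' c' _]]] Vx VW.
have kk : k' = k by apply: double_inj; rewrite -e -e'.
move: h' c'; rewrite kk => h' c'; have e2 : mdim M = (k + k)%N by rewrite addnn.
exact: (same_dim_cut hM e2 c c' Vx VW).
Qed.
(** Lagrangian submanifolds have the same dimension, so one inclusion of representatives near the
    graph already gives equality of germs. *)
Lemma micro_sub_eq X Y (hX : is_mf X) (hY : is_mf Y) (f g : X =>> Y) V W : is_micro f -> is_micro g ->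
 rep f V -> rep g W -> (forall b, val (coremap f b) = val (coremap g b)) ->
 (forall b, \forall p \near (val (coremap f b), val b), V p -> W p) -> f = g.
Proof.
move=> mf mg rV rW e VW; apply: (micro_ext rV rW e) => b.
have [hXm hYm] : is_manifold X /\ is_manifold Y by case: hX hY => [[? _ _ _] _] [[? _ _ _] _].
have [_ /(_ (val (coremap f b)))[i ix] _ _ _] := hXm; have [_ /(_ (val b))[j jy] _ _ _] := hYm.
have [Vb HV] := micro_rep hX hY mf rV b; have [_ HW] := micro_rep hX hY mg rW b.
have [lV _] := HV i j ix jy; have : mdom i (val (coremap g b)) by rewrite -e.
move=> /HW/(_ jy)[+ _]; rewrite -e => lW.
have WV := @lagr_sub_eq (sprod (sopp X) Y) _ _ _ _ (mprodP hXm hYm) lV lW Vb (VW b).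
by apply: nearS ((VW b) &n WV) => p [? ?]; split.
Qed.
Lemma micro_e_valid X : is_mf X -> is_micro (micro_e X).
Proof.
move=> hX; have hE := mfunitP R.
set phi := coremap (micro_e X).
have [sX lX] := hX; have [hXm _ _ _] := sX.
have ext b i : mdom i (val b) -> @ext_at R (mfunit R) X phi b tt i (fun _ => 0).
 by move=> ib; split; [exact: sm_cst|apply: nearT => z b' _; split => //; exact: rV0].
apply: (is_microI hE hX).
 by apply: (smooth_mapI hE hX) => b; have [_ /(_ (val b))[i ib] _ _ _] := hXm; exists tt, i, (fun _ => 0); split => //; exact: ext.
move=> b; have [_ /(_ (val b))[i ib] _ _ _] := hXm.
have [k [h [e c iso]]] := lagr_atE sX lX (valcore b) ib.
pose h0 (_ : 'rV[R]_0) : 'rV[R]_0 := 0.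
have l0 : @lagr_cut R (sopp (spoint R)) tt 0 setT 0 h0.
 split => //; last by apply: nearT => y _ u v _ _; rewrite !thinmx0 mul0mx.
 split => //; first exact: sm_cst.
  by rewrite /row_full -leqn0 rank_leq_col.
 by apply: nearT => y; split.
have [e2 c2 i2] := lagr_prod (soppP (spoint_valid R)) sX l0 (And3 e c iso).
have c0 : @core_cut R (mfunit R) tt (val (phi b)) 0 h0.
 split => //; last by move=> u v _ _; rewrite !thinmx0 mul0mx.
 split => //; first exact: sm_cst.
  by rewrite /row_full -leqn0 rank_leq_col.
 by apply: nearT => y; split.
have cX : core_cut i (val b) h by split => //; exact: (near_pt iso (valcore b)).
apply: (micro_dataI hE hX (j := i) (hA := h0) (hB := h) (hV := fprodmx h0 h)); split => //.
- split => //; first by split => //; exact: valcore.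
 exact: ext.
- by move=> u v _ _ _; exact: rV0.
Qed.
(** The unit object has a single point, so the core map is forced; a representative contains the
    graph of the core map, which is the representative of [micro_e X], and [micro_sub_eq]
    concludes. *)
Lemma micro_e_uniq X (f : (mfunit R) =>> X) : is_mf X -> is_micro f -> f = micro_e X.
Proof.
move=> hX mf; have hE := mfunitP R; apply/esym.
have [V [rV _ _ aV]] := is_micro_rep hE hX mf.
apply: (micro_sub_eq hE hX (micro_e_valid hX) mf erefl rV) => b; first exact: rV0.
apply: nearT => -[p x] [_ cx].
have [H _] := aV (exist _ x (mem_set cx)).
by rewrite (_ : p = val (coremap f (exist _ x (mem_set cx)))) //; exact: rV0.
Qed.
Lemma isgraph_lunit X : is_mf X -> isgraph (micro_lunit X) snd (fun x => (0, x)).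
Proof. by case/isgraph_unitors. Qed.
Lemma isgraph_lunitV X : is_mf X -> isgraph (micro_lunitV X) (fun x => (0, x)) snd.
Proof. by case/isgraph_unitors. Qed.
Lemma isgraph_runit X : is_mf X -> isgraph (micro_runit X) fst (fun x => (x, 0)).
Proof. by case/isgraph_unitors. Qed.
Lemma isgraph_runitV X : is_mf X -> isgraph (micro_runitV X) (fun x => (x, 0)) fst.
Proof. by case/isgraph_unitors. Qed.
Lemma isgraph_micro X Y (f : X =>> Y) F G : isgraph f F G -> is_micro f.
Proof. by case. Qed.
End Init.
Ltac mfd := lazymatch goal with
 | |- is_mf _:~_ => apply: mfprodP; mfd
 | |- is_mf (mfunit _) => exact: mfunitP
 | |- _ => assumption
 end.
(** Finds by unification the point maps underlying a composite of structural isomorphisms; with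
    [isgraph_eq] this settles coherence equations. *)
Ltac ig := lazymatch goal with
 | |- isgraph (_ \o' _) _ _ => eapply isgraph_comp; [mfd | mfd | mfd | ig | ig]
 | |- isgraph (_ \x _) _ _ => eapply isgraph_tens; [mfd | mfd | mfd | mfd | ig | ig]
 | |- isgraph (i_ _) _ _ => eapply isgraph_id; mfd
 | |- isgraph (micro_assoc _ _ _) _ _ => eapply isgraph_assoc; mfd
 | |- isgraph (micro_assocV _ _ _) _ _ => eapply isgraph_assocV; mfd
 | |- isgraph (micro_braid _ _) _ _ => eapply isgraph_braid; mfd
 | |- isgraph (micro_lunit _) _ _ => eapply isgraph_lunit; mfd
 | |- isgraph (micro_lunitV _) _ _ => eapply isgraph_lunitV; mfd
 | |- isgraph (micro_runit _) _ _ => eapply isgraph_runit; mfd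
 | |- isgraph (micro_runitV _) _ _ => eapply isgraph_runitV; mfd
 end.
Ltac vm := lazymatch goal with
 | |- is_mf _ => mfd
 | |- is_micro (_ \o' _) => first [assumption|apply: comp_micro; vm]
 | |- is_micro (_ \x _) => first [assumption|apply: tens_micro; vm]
 | |- is_micro (micro_e _) => apply: micro_e_valid; mfd
 | |- is_micro _ => first [assumption | eapply isgraph_micro; ig]
 end.
(** * The microsymplectic category *)
Section SMC.
Variable (R : realType).
Implicit Types (X Y Z : premicrofold R).
(** By [lcompA], a set representing one bracketing also represents the other. *)
Lemma micro_compA W X Y Z (h : Y =>> Z) (g : X =>> Y) (f : W =>> X) : is_mf W -> is_mf X -> is_mf Y -> is_mf Z ->
 is_micro h -> is_micro g -> is_micro f -> h \o' (g \o' f) = (h \o' g) \o' f.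
Proof.
move=> hW hX hY hZ mh mg mf'.
have [U [rU _ _ _]] := is_micro_rep hW hX mf'; have [V [rV _ _ _]] := is_micro_rep hX hY mg; have [T [rT _ _ _]] := is_micro_rep hY hZ mh.
have [m1 [K1 [rK1 l1]]] := comp_lcomp hW hX hY mf' mg rU rV.
have [m2 [K2 [rK2 l2]]] := comp_lcomp hX hY hZ mg mh rV rT.
have [m3 [L [rL l3]]] := comp_lcomp hW hY hZ m1 mh rK1 rT.
have [sf _] := mf'; have [s2 _] := m2.
have rL' : rep ((h \o' g) \o' f) L.
 by apply: (rep_comp hW hX hZ sf s2 rU rK2) => c; exact: lcompA (l1 _) (l2 _) (l3 _).
by apply: (micro_ext rL rL') => // b; exact: nearT.
Qed.
Lemma micro_comp1 X Y (f : X =>> Y) : is_mf X -> is_mf Y -> is_micro f -> (i_ Y) \o' f = f /\ f \o' (i_ X) = f.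
Proof.
move=> hX hY m; have [V [rV _ _ _]] := is_micro_rep hX hY m.
split.
 apply: (micro_ext (comp_graphr hX hY hY m rV (isgraph_id hY)) rV) => // b.
 by apply: nearT => -[].
apply: (micro_ext (comp_graphl hX hX hY m rV (isgraph_id hX)) rV) => // b.
by apply: nearT => -[].
Qed.
Lemma micro_tensC X Y Z X' Y' Z' (g : Y =>> Z) (f : X =>> Y) (g' : Y' =>> Z') (f' : X' =>> Y') :
 is_mf X -> is_mf Y -> is_mf Z -> is_mf X' -> is_mf Y' -> is_mf Z' -> is_micro g -> is_micro f -> is_micro g' -> is_micro f' ->
 (g \o' f) \x (g' \o' f') = (g \x g') \o' (f \x f').
Proof.
move=> hX hY hZ hX' hY' hZ' mg mf mg' mf'.
have [V [rV _ _ _]] := is_micro_rep hX hY mf; have [W [rW _ _ _]] := is_micro_rep hY hZ mg.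
have [V' [rV' _ _ _]] := is_micro_rep hX' hY' mf'; have [W' [rW' _ _ _]] := is_micro_rep hY' hZ' mg'.
have [_ [K [rK l]]] := comp_lcomp hX hY hZ mf mg rV rW.
have [_ [K' [rK' l']]] := comp_lcomp hX' hY' hZ' mf' mg' rV' rW'.
have [s1 _] := tens_micro hX hY hX' hY' mf mf'; have [s2 _] := tens_micro hY hZ hY' hZ' mg mg'.
have hXX := mfprodP hX hX'; have hYY := mfprodP hY hY'; have hZZ := mfprodP hZ hZ'.
have e (c : core Z:~Z') : core_fst (core_pair (coremap g (core_fst c)) (coremap g' (core_snd c))) = coremap g (core_fst c).
 exact: val_inj.
have e' (c : core Z:~Z') : core_snd (core_pair (coremap g (core_fst c)) (coremap g' (core_snd c))) = coremap g' (core_snd c).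
 exact: val_inj.
apply: (@micro_ext R X:~X' Z:~Z' _ _ (rel_prod K K') (rel_prod K K') (tens_rep rK rK')).
- apply: (rep_comp hXX hYY hZZ s1 s2 (tens_rep rV rV') (tens_rep rW rW')) => c.
 rewrite /= e e'; case: c => -[z z'] hc.
 exact: (lcomp_prod (l (core_fst _)) (l' (core_snd _))).
- by move=> b; rewrite /= e e'.
- by move=> b; exact: nearT.
Qed.
Lemma assoc_natural X Y Z X' Y' Z' (f : X =>> X') (g : Y =>> Y') (h : Z =>> Z') :
 is_mf X -> is_mf Y -> is_mf Z -> is_mf X' -> is_mf Y' -> is_mf Z' -> is_micro f -> is_micro g -> is_micro h ->
 (micro_assoc X' Y' Z') \o' ((f \x g) \x h) = (f \x (g \x h)) \o' (micro_assoc X Y Z).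
Proof.
move=> hX hY hZ hX' hY' hZ' m1 m2 m3.
have [U [rU _ _ _]] := is_micro_rep hX hX' m1; have [V [rV _ _ _]] := is_micro_rep hY hY' m2; have [W [rW _ _ _]] := is_micro_rep hZ hZ' m3.
have ml : is_micro ((f \x g) \x h) by vm.
have mr : is_micro (f \x (g \x h)) by vm.
have r1 : rep _ _ := @comp_graphr R X:~Y:~Z X':~Y':~Z' X':~(Y':~Z') ltac:(mfd) ltac:(mfd) ltac:(mfd) _ _ _ _ _ ml (tens_rep (tens_rep rU rV) rW) (isgraph_assoc hX' hY' hZ').
have r2 : rep _ _ := @comp_graphl R X:~Y:~Z X:~(Y:~Z) X':~(Y':~Z') ltac:(mfd) ltac:(mfd) ltac:(mfd) _ _ _ _ _ mr (tens_rep rU (tens_rep rV rW)) (isgraph_assoc hX hY hZ).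
apply: (micro_ext r1 r2).
 by move=> b; congr ((val (coremap f _), val (coremap g _)), val (coremap h _)); exact: val_inj.
by move=> b; apply: nearT => p; rewrite /rel_prod; split=> [[[? ?] ?]|[? [? ?]]].
Qed.
Lemma braid_natural X Y X' Y' (f : X =>> X') (g : Y =>> Y') :
 is_mf X -> is_mf Y -> is_mf X' -> is_mf Y' -> is_micro f -> is_micro g ->
 (micro_braid X' Y') \o' (f \x g) = (g \x f) \o' (micro_braid X Y).
Proof.
move=> hX hY hX' hY' m1 m2.
have [U [rU _ _ _]] := is_micro_rep hX hX' m1; have [V [rV _ _ _]] := is_micro_rep hY hY' m2.
have ml : is_micro (f \x g) by vm.
have mr : is_micro (g \x f) by vm.
have r1 : rep _ _ := @comp_graphr R X:~Y X':~Y' Y':~X' ltac:(mfd) ltac:(mfd) ltac:(mfd) _ _ _ _ _ ml (tens_rep rU rV) (isgraph_braid hX' hY').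
have r2 : rep _ _ := @comp_graphl R X:~Y Y:~X Y':~X' ltac:(mfd) ltac:(mfd) ltac:(mfd) _ _ _ _ _ mr (tens_rep rV rU) (isgraph_braid hX hY).
apply: (micro_ext r1 r2).
 by move=> b; congr (val (coremap f _), val (coremap g _)); exact: val_inj.
by move=> b; apply: nearT => p; rewrite /rel_prod; split=> [[? ?]|[? ?]].
Qed.
Lemma unitor_natural X Y (f : X =>> Y) : is_mf X -> is_mf Y -> is_micro f ->
 (micro_lunit Y) \o' ((i_ (mfunit R)) \x f) = f \o' (micro_lunit X) /\
 (micro_runit Y) \o' (f \x (i_ (mfunit R))) = f \o' (micro_runit X).
Proof.
move=> hX hY m; have hE := mfunitP R.
have [V [rV _ _ _]] := is_micro_rep hX hY m.
have [mi ri _ _ _] := isgraph_id hE.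
split.
 have ml : is_micro ((i_ (mfunit R)) \x f) by vm.
 have r1 : rep _ _ := @comp_graphr R (mfunit R):~X (mfunit R):~Y (Y) ltac:(mfd) ltac:(mfd) ltac:(mfd) _ _ _ _ _ ml (tens_rep ri rV) (isgraph_lunit hY).
 have r2 : rep _ _ := @comp_graphl R (mfunit R):~X (X) (Y) ltac:(mfd) ltac:(mfd) ltac:(mfd) _ _ _ _ _ m rV (isgraph_lunit hX).
 apply: (micro_ext r1 r2).
  by move=> b; congr (0, val (coremap f _)); exact: val_inj.
 move=> b; apply: nearT => -[[e x] y]; rewrite /rel_prod; split=> [[_ ?]//|?]; split => //; exact: rV0.
have ml : is_micro (f \x (i_ (mfunit R))) by vm.
have r1 : rep _ _ := @comp_graphr R X:~(mfunit R) Y:~(mfunit R) (Y) ltac:(mfd) ltac:(mfd) ltac:(mfd) _ _ _ _ _ ml (tens_rep rV ri) (isgraph_runit hY).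
have r2 : rep _ _ := @comp_graphl R X:~(mfunit R) (X) (Y) ltac:(mfd) ltac:(mfd) ltac:(mfd) _ _ _ _ _ m rV (isgraph_runit hX).
apply: (micro_ext r1 r2).
 by move=> b; congr (val (coremap f _), 0); exact: val_inj.
move=> b; apply: nearT => -[[x e] y]; rewrite /rel_prod; split=> [[? _]//|?]; split => //; exact: rV0.
Qed.
Lemma is_smc_SymplMic : is_smc (SymplMic R).
Proof.
have hE := mfunitP R.
have m0 (x y : 'rV[R]_0) : x = y by exact: rV0.
split.
- split => /=.
 + by move=> X hX; vm.
 + by move=> X Y Z g f hX hY hZ mg mf'; vm.
 + by move=> X Y f hX hY m; exact: micro_comp1.
 + by move=> W X Y Z h g f hW hX hY hZ mh mg mf'; exact: micro_compA.
- split => /=.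
 + by split => // X Y hX hY; mfd.
 + by move=> X Y X' Y' f f' hX hY hX' hY' m m'; vm.
 + by move=> X Y hX hY; eapply isgraph_eq; [ig | ig|case].
 + by move=> X Y Z X' Y' Z' g f g' f' hX hY hZ hX' hY' hZ' mg mf' mg' mf''; exact: micro_tensC.
- split => /=.
 + by move=> X Y Z hX hY hZ; split => /=; try vm; (eapply isgraph_eq; [ig | ig|]); [move=> [[a b] c]|move=> [a [b c]]].
 + split; last by move=> X Y hX hY; split => /=; try vm; (eapply isgraph_eq; [ig | ig|case]).
  move=> X hX; split; split => /=; try vm; (eapply isgraph_eq; [ig | ig|]) => //.
  * by move=> [a b]; rewrite (m0 a 0).
  * by move=> [a b]; rewrite (m0 b 0).
 + by move=> X Y Z X' Y' Z' f g h; exact: assoc_natural.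
 + by move=> X Y f; exact: unitor_natural.
 + by move=> X Y X' Y' f g; exact: braid_natural.
- split => /=.
 + by move=> W X Y Z hW hX hY hZ; eapply isgraph_eq; [ig | ig|move=> [[[a b] c] d]].
 + by move=> X Y hX hY; eapply isgraph_eq; [ig | ig|move=> [[a b] c]].
 + by move=> X Y Z hX hY hZ; eapply isgraph_eq; [ig | ig|move=> [[a b] c]].
Qed.
End SMC.
Ltac rA := rewrite micro_compA; try vm.
Ltac lA := rewrite -micro_compA; try vm.
Ltac cA k := rewrite -(micro_compA (h := k)); try vm.
(** * Monoids in the microsymplectic category *)
Section MonSMC.
Variable (R : realType).
Implicit Types (X Y Z : premicrofold R).
Let C := SymplMic R.
Fact mswap_key : unit. Proof. by []. Qed.
(** Locked, so that the exchange of middle factors is handled as one structural isomorphism instead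
    of unfolding into associativities and a braiding. *)
Definition mswap X Y X' Y' : X:~Y:~(X':~Y') =>> X:~X':~(Y:~Y') :=
 locked_with mswap_key (@middle_swap C X Y X' Y').
Lemma mswapE X Y X' Y' : mswap X Y X' Y' = @middle_swap C X Y X' Y'.
Proof. by rewrite /mswap unlock. Qed.
Lemma isgraph_mswap X Y X' Y' : is_mf X -> is_mf Y -> is_mf X' -> is_mf Y' ->
 isgraph (mswap X Y X' Y') (fun p => ((p.1.1, p.2.1), (p.1.2, p.2.2))) (fun p => ((p.1.1, p.2.1), (p.1.2, p.2.2))).
Proof.
move=> hX hY hX' hY'.
have : exists F G, isgraph (mswap X Y X' Y') F G /\ (forall p, F p = ((p.1.1, p.2.1), (p.1.2, p.2.2))) /\ (forall p, G p = ((p.1.1, p.2.1), (p.1.2, p.2.2))).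
 rewrite mswapE /middle_swap /=; do 2 eexists; split; first by ig.
 by split=> -[[a b] [c d]].
move=> [F [G [g [eF eG]]]].
by have -> : (fun p : X:~Y:~(X':~Y') => ((p.1.1, p.2.1), (p.1.2, p.2.2))) = F;
 [exact/funext|have -> : (fun p : X:~X':~(Y:~Y') => ((p.1.1, p.2.1), (p.1.2, p.2.2))) = G; [exact/funext|]].
Qed.
Lemma mswap_natural X Y X' Y' A B A' B' (f : X =>> A) (g : Y =>> B) (f' : X' =>> A') (g' : Y' =>> B') :
 is_mf X -> is_mf Y -> is_mf X' -> is_mf Y' -> is_mf A -> is_mf B -> is_mf A' -> is_mf B' -> is_micro f -> is_micro g -> is_micro f' -> is_micro g' ->
 mswap A B A' B' \o' ((f \x g) \x (f' \x g')) = ((f \x f') \x (g \x g')) \o' mswap X Y X' Y'.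
Proof.
move=> hX hY hX' hY' hA hB hA' hB' m1 m2 m3 m4.
have [V1 [r1 _ _ _]] := is_micro_rep hX hA m1; have [V2 [r2 _ _ _]] := is_micro_rep hY hB m2.
have [V3 [r3 _ _ _]] := is_micro_rep hX' hA' m3; have [V4 [r4 _ _ _]] := is_micro_rep hY' hB' m4.
have ml : is_micro ((f \x g) \x (f' \x g')) by vm.
have mr : is_micro ((f \x f') \x (g \x g')) by vm.
have q1 : rep _ _ := @comp_graphr R X:~Y:~(X':~Y') A:~B:~(A':~B') A:~A':~(B:~B')
 ltac:(mfd) ltac:(mfd) ltac:(mfd) _ _ _ _ _ ml (tens_rep (tens_rep r1 r2) (tens_rep r3 r4)) (isgraph_mswap hA hB hA' hB').
have q2 : rep _ _ := @comp_graphl R X:~Y:~(X':~Y') X:~X':~(Y:~Y') A:~A':~(B:~B')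
 ltac:(mfd) ltac:(mfd) ltac:(mfd) _ _ _ _ _ mr (tens_rep (tens_rep r1 r3) (tens_rep r2 r4)) (isgraph_mswap hX hY hX' hY').
have [_ _ es _ _] := isgraph_mswap hA hB hA' hB'; have [_ _ es' _ _] := isgraph_mswap hX hY hX' hY'.
apply: (micro_ext q1 q2).
 move=> b; have eb := es b.
 change (val (coremap ((f \x g) \x (f' \x g')) (coremap (mswap A B A' B') b)) = val (coremap (mswap X Y X' Y') (coremap ((f \x f') \x (g \x g')) b))).
 rewrite es'; move: (coremap (mswap A B A' B') b) eb => b' eb.
 by congr ((val (coremap f _), val (coremap g _)), (val (coremap f' _), val (coremap g' _))); apply: val_inj; rewrite /= eb.
by move=> b; apply: nearT => p; rewrite /rel_prod; split=> [[[? ?] [? ?]]|[[? ?] [? ?]]].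
Qed.
End MonSMC.
Ltac lower l1 l2 := move=> *; repeat match goal with H : isob _ |- _ => apply l1 in H | H : ishom _ |- _ => apply l2 in H end.
Ltac ig ::= lazymatch goal with
 | |- isgraph (mswap _ _ _ _) _ _ => eapply isgraph_mswap; mfd
 | |- isgraph (_ \o' _) _ _ => eapply isgraph_comp; [mfd | mfd | mfd | ig | ig]
 | |- isgraph (_ \x _) _ _ => eapply isgraph_tens; [mfd | mfd | mfd | mfd | ig | ig]
 | |- isgraph (i_ _) _ _ => eapply isgraph_id; mfd
 | |- isgraph (micro_assoc _ _ _) _ _ => eapply isgraph_assoc; mfd
 | |- isgraph (micro_assocV _ _ _) _ _ => eapply isgraph_assocV; mfd
 | |- isgraph (micro_braid _ _) _ _ => eapply isgraph_braid; mfd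
 | |- isgraph (micro_lunit _) _ _ => eapply isgraph_lunit; mfd
 | |- isgraph (micro_lunitV _) _ _ => eapply isgraph_lunitV; mfd
 | |- isgraph (micro_runit _) _ _ => eapply isgraph_runit; mfd
 | |- isgraph (micro_runitV _) _ _ => eapply isgraph_runitV; mfd
 end.
Section MonSMC2.
Variable (R : realType).
Implicit Types (X Y Z : premicrofold R).
Let C := SymplMic R.
Lemma tens_id X Y : is_mf X -> is_mf Y -> i_ X \x i_ Y = i_ X:~Y.
Proof. by move=> hX hY; eapply isgraph_eq; [ig | ig|case]. Qed.
Definition mmul (X : premonoid C) : (mon_ob X):~(mon_ob X) =>> (mon_ob X) := mon_mul X.
Definition mone (X : premonoid C) : (mfunit R) =>> (mon_ob X) := mon_one X.
Lemma monoidE (X : premonoid C) : is_monoid X <-> [/\ is_mf (mon_ob X), is_micro (mmul X), is_micro (mone X),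
  mmul X \o' (mmul X \x i_ (mon_ob X)) = mmul X \o' (i_ (mon_ob X) \x mmul X) \o' micro_assoc _ _ _ &
  mmul X \o' (mone X \x i_ (mon_ob X)) = micro_lunit (mon_ob X) /\ mmul X \o' (i_ (mon_ob X) \x mone X) = micro_runit (mon_ob X)].
Proof. by []. Qed.
(** Compatibility with the units is automatic, since there is only one micromorphism from the unit
    object. *)
Lemma monoid_morE (X Y : premonoid C) (T : (mon_ob X) =>> (mon_ob Y)) : is_monoid X -> is_monoid Y ->
 is_monoid_mor (X := X) (Y := Y) T <-> is_micro T /\ T \o' mmul X = mmul Y \o' (T \x T).
Proof.
move=> /monoidE[hX mX eX _ _] /monoidE[hY mY eY _ _].
split=> [[m e _]|[m e]]; first by split.
split => //; change (T \o' (mone X) = mone Y).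
rewrite (micro_e_uniq hY eY); apply: micro_e_uniq => //.
by have hE := mfunitP R; vm.
Qed.
Lemma tens_compl X Y Z A B (f : X =>> Y) (g : Y =>> Z) (h : A =>> B) : is_mf X -> is_mf Y -> is_mf Z -> is_mf A -> is_mf B ->
 is_micro f -> is_micro g -> is_micro h -> (g \o' f) \x h = (g \x h) \o' (f \x i_ A).
Proof.
move=> hX hY hZ hA hB m1 m2 m3.
have mA : is_micro (i_ A) by vm.
by rewrite -micro_tensC // (micro_comp1 hA hB m3).2.
Qed.
Lemma tens_compr X Y Z A B (f : X =>> Y) (g : Y =>> Z) (h : A =>> B) : is_mf X -> is_mf Y -> is_mf Z -> is_mf A -> is_mf B ->
 is_micro f -> is_micro g -> is_micro h -> h \x (g \o' f) = (h \x g) \o' (i_ A \x f).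
Proof.
move=> hX hY hZ hA hB m1 m2 m3.
have mA : is_micro (i_ A) by vm.
by rewrite -micro_tensC // (micro_comp1 hA hB m3).2.
Qed.
Section TensorMonoid.
Variables (x y z : premicrofold R) (hx : is_mf x) (hy : is_mf y) (hz : is_mf z).
Variables (mx : x:~x =>> x) (my : y:~y =>> y) (mz : z:~z =>> z).
Hypotheses (vx : is_micro mx) (vy : is_micro my) (vz : is_micro mz).
Definition mul2 := (mx \x my) \o' mswap x y x y.
Lemma mul2_micro : is_micro mul2.
Proof. by rewrite /mul2; vm. Qed.
(** The interchange law behind the tensor product of monoids: the exchange moves past the four
    arguments and leaves two separate products, so that the axioms of each factor apply. *)
Lemma mul2E A B A' B' (f : A =>> x) (g : B =>> y) (f' : A' =>> x) (g' : B' =>> y) :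
 is_mf A -> is_mf B -> is_mf A' -> is_mf B' -> is_micro f -> is_micro g -> is_micro f' -> is_micro g' ->
 mul2 \o' ((f \x g) \x (f' \x g')) = ((mx \o' (f \x f')) \x (my \o' (g \x g'))) \o' mswap A B A' B'.
Proof.
move=> hA hB hA' hB' m1 m2 m3 m4; rewrite /mul2.
lA.
rewrite mswap_natural; try vm.
rA.
by rewrite -micro_tensC; try vm.
Qed.
Hypotheses (ax : mx \o' (mx \x i_ x) = mx \o' (i_ x \x mx) \o' micro_assoc x x x)
 (ay : my \o' (my \x i_ y) = my \o' (i_ y \x my) \o' micro_assoc y y y).
Lemma mul2A : mul2 \o' (mul2 \x i_ x:~y) = mul2 \o' (i_ x:~y \x mul2) \o' micro_assoc _ _ _.
Proof. have vm2 := mul2_micro.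
have -> : mul2 \x i_ x:~y = ((mx \x my) \x (i_ x \x i_ y)) \o' (mswap x y x y \x i_ x:~y).
 by rewrite /mul2 -[in LHS]tens_id // tens_compl; try vm.
have -> : i_ x:~y \x mul2 = ((i_ x \x i_ y) \x (mx \x my)) \o' (i_ x:~y \x mswap x y x y).
 by rewrite /mul2 -[in LHS]tens_id // tens_compr; try vm.
rA. rewrite mul2E; try vm.
rewrite [in RHS]micro_compA; try vm. rewrite mul2E; try vm.
rewrite ax ay micro_tensC; try vm.
rewrite -!micro_compA; try vm.
congr (_ \o' _); eapply isgraph_eq; [ig | ig|by move=> [[[a b] [c d]] [e f]]].
Qed.
Variables (ex : (mfunit R) =>> x) (ey : (mfunit R) =>> y).
Hypotheses (ux : is_micro ex) (uy : is_micro ey)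
 (lx : mx \o' (ex \x i_ x) = micro_lunit x) (rx : mx \o' (i_ x \x ex) = micro_runit x)
 (ly : my \o' (ey \x i_ y) = micro_lunit y) (ry : my \o' (i_ y \x ey) = micro_runit y).
Lemma mul2_unit : mul2 \o' (((ex \x ey) \o' micro_lunitV (mfunit R)) \x i_ x:~y) = micro_lunit x:~y /\
 mul2 \o' (i_ x:~y \x ((ex \x ey) \o' micro_lunitV (mfunit R))) = micro_runit x:~y.
Proof. have vm2 := mul2_micro.
split.
 rewrite -[in LHS]tens_id // (tens_compl); try vm.
 rA. rewrite mul2E; try vm. rewrite lx ly.
 eapply isgraph_eq; [ig | ig|by move=> [a [b c]]].
rewrite -[in LHS]tens_id // (tens_compr); try vm.
rA. rewrite mul2E; try vm. rewrite rx ry.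
eapply isgraph_eq; [ig | ig|by move=> [[a b] c]].
Qed.
End TensorMonoid.
Section TensorMaps.
Variables (x y z : premicrofold R) (hx : is_mf x) (hy : is_mf y) (hz : is_mf z).
Variables (mx : x:~x =>> x) (my : y:~y =>> y) (mz : z:~z =>> z).
Hypotheses (vx : is_micro mx) (vy : is_micro my) (vz : is_micro mz).
Lemma mul2_map x' y' (mx' : x':~x' =>> x') (my' : y':~y' =>> y') (f : x =>> x') (g : y =>> y') :
 is_mf x' -> is_mf y' -> is_micro mx' -> is_micro my' -> is_micro f -> is_micro g -> f \o' mx = mx' \o' (f \x f) -> g \o' my = my' \o' (g \x g) ->
 (f \x g) \o' mul2 mx my = mul2 mx' my' \o' ((f \x g) \x (f \x g)).
Proof.
move=> hx' hy' vx' vy' m1 m2 e1 e2.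
rewrite [RHS]mul2E; try vm. rewrite -e1 -e2 micro_tensC; try vm.
by rewrite /mul2 micro_compA; try vm.
Qed.
Lemma mul2_assoc : micro_assoc x y z \o' mul2 (mul2 mx my) mz = mul2 mx (mul2 my mz) \o' (micro_assoc x y z \x micro_assoc x y z).
Proof.
have -> : mul2 (mul2 mx my) mz = ((mx \x my) \x mz) \o' ((mswap x y x y \x i_ z:~z) \o' mswap x:~y z x:~y z).
 rewrite /mul2 (tens_compl); try vm. by rA.
have -> : mul2 mx (mul2 my mz) = (mx \x (my \x mz)) \o' ((i_ x:~x \x mswap y z y z) \o' mswap x y:~z x y:~z).
 rewrite /mul2 (tens_compr); try vm. by rA.
rA. rewrite assoc_natural; try vm.
rewrite -!micro_compA; try vm.
congr (_ \o' _); eapply isgraph_eq; [ig | ig|by move=> [[[a b] c] [[d e] f]]].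
Qed.
Lemma mul2_braid : micro_braid x y \o' mul2 mx my = mul2 my mx \o' (micro_braid x y \x micro_braid x y).
Proof.
rewrite /mul2 micro_compA; try vm. rewrite braid_natural; try vm.
rewrite -!micro_compA; try vm.
congr (_ \o' _); eapply isgraph_eq; [ig | ig|by move=> [[a b] [c d]]].
Qed.
Lemma mul2_lunit : micro_lunit x \o' mul2 (micro_lunit (mfunit R)) mx = mx \o' (micro_lunit x \x micro_lunit x).
Proof.
have hE := mfunitP R.
have -> : mul2 (micro_lunit (mfunit R)) mx = (i_ (mfunit R) \x mx) \o' ((micro_lunit (mfunit R) \x i_ x:~x) \o' mswap (mfunit R) x (mfunit R) x).
 have e : micro_lunit (mfunit R) = i_ (mfunit R) \o' micro_lunit (mfunit R) by rewrite (micro_comp1 _ _ _).1 //; vm.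
 rewrite /mul2 {1}e tens_compl; try vm. by rA.
rA. rewrite (unitor_natural _ _ vx).1; try vm.
rewrite -!micro_compA; try vm.
congr (_ \o' _); eapply isgraph_eq; [ig | ig|by move=> [[a b] [c d]]].
Qed.
Lemma mul2_runit : micro_runit x \o' mul2 mx (micro_lunit (mfunit R)) = mx \o' (micro_runit x \x micro_runit x).
Proof.
have hE := mfunitP R.
have -> : mul2 mx (micro_lunit (mfunit R)) = (mx \x i_ (mfunit R)) \o' ((i_ x:~x \x micro_lunit (mfunit R)) \o' mswap x (mfunit R) x (mfunit R)).
 have e : micro_lunit (mfunit R) = i_ (mfunit R) \o' micro_lunit (mfunit R) by rewrite (micro_comp1 _ _ _).1 //; vm.
 rewrite /mul2 {1}e tens_compr; try vm. by rA.
rA. rewrite (unitor_natural _ _ vx).2; try vm.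
rewrite -!micro_compA; try vm.
congr (_ \o' _); eapply isgraph_eq; [ig | ig|by move=> [[a b] [c d]]].
Qed.
(** Insert [f \o' g = id] on both factors of the source of [my'], move [f] across the
    multiplications and cancel [g \o' f]. *)
Lemma inverse_map y' (my' : y':~y' =>> y') (f : x =>> y') (g : y' =>> x) : is_mf y' -> is_micro my' ->
 is_micro f -> is_micro g -> g \o' f = i_ x -> f \o' g = i_ y' -> f \o' mx = my' \o' (f \x f) -> g \o' my' = mx \o' (g \x g).
Proof.
move=> hy' vy' m1 m2 e1 e2 e.
have e3 : (f \x f) \o' (g \x g) = i_ y':~y' by rewrite -micro_tensC // e2 tens_id.
rewrite -[in LHS](micro_comp1 (mfprodP hy' hy') hy' vy').2 -e3.
rewrite (micro_compA (h := my')); try vm. rewrite -e.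
rewrite -(micro_compA); try vm. rewrite (micro_compA); try vm.
by rewrite e1 (micro_comp1 _ _ _).1; try vm.
Qed.
End TensorMaps.
Lemma mon_tensE (X Y : premonoid C) : mmul (mon_tens X Y) = mul2 (mmul X) (mmul Y).
Proof. by rewrite /mul2 mswapE. Qed.
Lemma mtens_valid (X Y : premonoid C) : is_monoid X -> is_monoid Y -> is_monoid (mon_tens X Y).
Proof.
move=> /monoidE[hX mX eX aX [lX rX]] /monoidE[hY mY eY aY [lY rY]]; apply/monoidE; split.
- exact: mfprodP.
- rewrite mon_tensE; exact: (mul2_micro hX hY mX mY).
-
 have : is_micro ((mone X \x mone Y) \o' micro_lunitV (mfunit R)) by vm.
 exact.
- rewrite mon_tensE; exact: (mul2A hX hY mX mY aX aY).
- rewrite mon_tensE; exact: (mul2_unit hX hY mX mY eX eY lX rX lY rY).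
Qed.
Lemma mon_unit_valid : is_monoid (mon_unit C).
Proof.
 have m0 (p q : 'rV[R]_0) : p = q by exact: rV0.
apply/monoidE; rewrite /mmul /mone /=; split; try vm.
 eapply isgraph_eq; [ig | ig|by move=> [[a b] c]].
by split; (eapply isgraph_eq; [ig | ig|by move=> [a b]; exact: m0]).
Qed.
(** The equations are inherited from the ambient category. What has to be shown is that identities,
    composites, tensor products and constraints preserve the multiplications; inverses of
    constraints then do so by [inverse_map]. *)
Lemma is_smc_Mon : is_smc (Mon C).
Proof.
have [c1 c2 c3 c4] := is_smc_SymplMic R.
have hE := mfunitP R.
have isob_mon (X : premonoid C) : is_monoid X -> is_mf (mon_ob X) by case/monoidE.
have morI (X Y : premonoid C) (T : (mon_ob X) =>> (mon_ob Y)) : is_monoid X -> is_monoid Y -> is_micro T ->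
  T \o' mmul X = mmul Y \o' (T \x T) -> is_monoid_mor (Y := Y) T.
 by move=> hX hY m e; apply/(monoid_morE _ hX hY).
have morE (X Y : premonoid C) (T : (mon_ob X) =>> (mon_ob Y)) : is_monoid X -> is_monoid Y ->
  is_monoid_mor (Y := Y) T -> is_micro T /\ T \o' mmul X = mmul Y \o' (T \x T).
 by move=> hX hY /(monoid_morE _ hX hY).
have isom (X Y : premonoid C) (T : (mon_ob X) =>> (mon_ob Y)) (S : (mon_ob Y) =>> (mon_ob X)) : is_monoid X -> is_monoid Y ->
  @inverses C (mon_ob X) (mon_ob Y) T S -> T \o' mmul X = mmul Y \o' (T \x T) -> @inverses (Mon C) X Y T S.
 move=> hX hY [/= mT mS e1 e2] e.
 have /monoidE[oX mX _ _ _] := hX; have /monoidE[oY mY _ _ _] := hY.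
 split => //=; first exact: morI.
 exact: (morI _ _ _ hY hX mS (inverse_map oX mX oY mY mT mS e1 e2 e)).
have mor_mic (X Y : premonoid C) (T : (mon_ob X) =>> (mon_ob Y)) : is_monoid_mor (Y := Y) T -> is_micro T by case.
split.
- have [a1 a2 a3 a4] := c1; split.
 + move=> X hX; have /monoidE[oX mX _ _ _] := hX; have ix : is_micro (i_ (mon_ob X)) by vm.
  apply: morI => //; rewrite tens_id //.
  by rewrite (micro_comp1 (mfprodP oX oX) oX mX).1 (micro_comp1 (mfprodP oX oX) oX mX).2.
 + move=> X Y Z g f hX hY hZ /(morE _ _ _ hY hZ)[mg eg] /(morE _ _ _ hX hY)[mf' ef].
  have /monoidE[oX mX _ _ _] := hX; have /monoidE[oY mY _ _ _] := hY; have /monoidE[oZ mZ _ _ _] := hZ.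
  apply: morI => //=; first by vm.
  lA. rewrite ef micro_compA; try vm. rewrite eg micro_tensC; try vm.
  by rA.
 + by lower isob_mon mor_mic; exact: a3.
 + by lower isob_mon mor_mic; exact: a4.
- have [a1 a2 a3 a4] := c2; split.
 + by split; [exact: mon_unit_valid|exact: mtens_valid].
 + move=> X Y X' Y' f f' hX hY hX' hY' /(morE _ _ _ hX hY)[m e] /(morE _ _ _ hX' hY')[m' e'].
  have /monoidE[oX mX _ _ _] := hX; have /monoidE[oY mY _ _ _] := hY; have /monoidE[oX' mX' _ _ _] := hX'; have /monoidE[oY' mY' _ _ _] := hY'.
  apply: morI; [exact: mtens_valid|exact: mtens_valid|exact: tens_micro |].
  rewrite !mon_tensE; exact: (mul2_map oX oX' mX mX' oY oY' mY mY' m m' e e').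
 + by lower isob_mon mor_mic; exact: a3.
 + by lower isob_mon mor_mic; exact: a4.
- have [a1 [a2 a2'] a3 a4 a5] := c3; split.
 + move=> X Y Z hX hY hZ; have /monoidE[oX mX _ _ _] := hX; have /monoidE[oY mY _ _ _] := hY; have /monoidE[oZ mZ _ _ _] := hZ.
  apply: isom; [by do 2 apply: mtens_valid => //|by do 2 apply: mtens_valid => //|exact: a1 |].
  rewrite !mon_tensE; exact: (mul2_assoc oX oY oZ mX mY mZ).
 + split.
   move=> X hX; have /monoidE[oX mX _ _ _] := hX; have [l r] := a2 _ oX; split.
    apply: isom => //; [exact: (mtens_valid mon_unit_valid hX)|rewrite !mon_tensE; exact: (mul2_lunit oX mX)].
   apply: isom => //; [exact: (mtens_valid hX mon_unit_valid)|rewrite !mon_tensE; exact: (mul2_runit oX mX)].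
  move=> X Y hX hY; have /monoidE[oX mX _ _ _] := hX; have /monoidE[oY mY _ _ _] := hY.
  apply: isom; [exact: mtens_valid|exact: mtens_valid|exact: a2'|rewrite !mon_tensE; exact: (mul2_braid oX oY mX mY)].
 + by lower isob_mon mor_mic; exact: a3.
 + by lower isob_mon mor_mic; exact: a4.
 + by lower isob_mon mor_mic; exact: a5.
- have [a1 a2 a3] := c4; split.
 + by lower isob_mon mor_mic; exact: a1.
 + by lower isob_mon mor_mic; exact: a2.
 + by lower isob_mon mor_mic; exact: a3.
Qed.
End MonSMC2.
(** The orthogonal of [K] has complementary rank, and the two hypotheses identify it with [K]. This
    gives the dimension of the units of a symplectic groupoid. *)
Lemma self_dual_dim (R : realType) d (w K : 'M[R]_d) : w \in unitmx ->
 (forall u v : 'rV_d, (u <= K)%MS -> (v <= K)%MS -> u *m w *m v^T = 0) ->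
 (forall u : 'rV_d, (forall v : 'rV_d, (v <= K)%MS -> u *m w *m v^T = 0) -> (u <= K)%MS) -> d = (\rank K).*2.
Proof.
move=> unit iso cois.
have sub1 : (kermx (w *m K^T) <= K)%MS.
 apply/row_subP => r; apply: cois => v /submxP[D ->].
 have E : row r (kermx (w *m K^T)) *m (w *m K^T) = 0 by apply/sub_kermxP; exact: row_sub.
 by rewrite [(D *m K)^T]trmx_mul mulmxA -[_ *m w *m K^T]mulmxA E mul0mx.
have sub2 : (K <= kermx (w *m K^T))%MS.
 apply/sub_kermxP; apply/row_matrixP => r; rewrite row0 row_mul; apply: trmx_inj; apply/row_matrixP => r'.
 rewrite trmx0 row0 mulmxA trmx_mul trmxK row_mul; apply: trmx_inj.
 by rewrite trmx_mul trmxK trmx0; apply: iso; exact: row_sub.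
have e1 : \rank (kermx (w *m K^T)) = \rank K by apply/eqP; rewrite eqn_leq !mxrankS.
have e2 : \rank (w *m K^T) = \rank K by rewrite -mxrank_tr trmx_mul trmxK mxrankMfree // row_free_unit unitmx_tr.
move: e1; rewrite mxrank_ker e2 => e1.
by have := rank_leq_row K; rewrite -addnn; lia.
Qed.
(** * The monoid of a symplectic microgroupoid *)
Section SmoothMaps.
Variables (R : realType) (M N : premanifold R).
Hypotheses (hM : is_manifold M) (hN : is_manifold N).
Lemma smap_ext (S : set M) (f : M -> N) x i j : @smooth_map R M N S (fun y => f (val y)) -> S x -> mdom i x -> mdom j (f x) ->
 exists F, smooth_at i:@x F /\ \forall z \near x, S z -> mdom j (f z) /\ j:@(f z) = F i:@z.
Proof.
move=> sf Sx ix jfx; have [F [sF nF]] := sf (exist _ x (mem_set Sx)) i j ix jfx; exists F; split => //.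
by apply: nearS nF => z H Sz; exact: (H (exist _ z (mem_set Sz)) erefl).
Qed.
Lemma smap_cont (S : set M) (f : M -> N) x (A : N -> Prop) : @smooth_map R M N S (fun y => f (val y)) -> S x ->
 (\forall y \near f x, A y) -> \forall z \near x, S z -> A (f z).
Proof.
move=> sf Sx nA; have [_ cM _ _ _] := hM; have [_ cN _ _ _] := hN.
have [i ix] := cM x; have [j jx] := cN (f x).
have [F [sF nF]] := smap_ext sf Sx ix jx.
have [_ e0] := near_pt nF Sx.
have := chart_surj hN jx nA; rewrite e0 => /(near_pre (sm_cont sF))/(chart_cont hM ix) n1.
apply: nearS (nF &n n1) => z [HF [y [jy Ay ey]]] /HF[jz ez].
suff <- : y = f z by [].
by apply: (mcoord_inj hN jy jz); rewrite ey ez.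
Qed.
Lemma smap_contT (f : M -> N) : @smooth_map R M N setT (fun y => f (val y)) -> continuous f.
Proof. by move=> sf x A nA; have := smap_cont sf I nA; apply: nearS => z; apply. Qed.
Lemma smap_extT (f : M -> N) x i j : @smooth_map R M N setT (fun y => f (val y)) -> mdom i x -> mdom j (f x) ->
 exists F, smooth_at i:@x F /\ \forall z \near x, mdom j (f z) /\ j:@(f z) = F i:@z.
Proof.
move=> sf ix jfx; have [F [sF nF]] := smap_ext sf I ix jfx; exists F; split => //.
by apply: nearS nF => z; apply.
Qed.
(** Chain rule for [h \o K], which vanishes near the point. It places the derivatives of a map with
    values in [V] in the tangent space of [V]. *)
Lemma map_kill (f : N -> M) (j : mchart N) (i : mchart M) y V k (h : _ -> 'rV[R]_k) K : mdom j y -> {for y, continuous f} ->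
 smooth_at j:@y K -> (\forall z \near y, i:@(f z) = K j:@z) ->
 (\forall z \near y, V (f z)) -> cut i (f y) V h -> jac K j:@y *m jac h i:@(f y) = 0.
Proof.
move=> jy cf sK nK nV [_ sh _ nh]; have e0 := near_pt nK.
rewrite e0 -jac_comp -?e0 // -(jac_cst j:@y (0)).
apply: jac_ext; last by apply: sm_comp; rewrite -?e0.
apply: (near_chart hN jy).
by apply: nearS ((near_pre cf nh) &n nK &n nV) => z [H [e Vz]] /=; rewrite -e; apply/H.
Qed.
Lemma cut_kill (i : mchart M) x S k c d (h : _ -> 'rV[R]_c) (g : _ -> 'rV[R]_d) (v : 'rV[R]_(mdim M)) :
 mdim M = (k + c)%N -> cut i x S h -> S x -> smooth_at i:@x g -> (\forall y \near x, S y -> g i:@y = 0) ->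
 v *m jac h i:@x = 0 -> v *m jac g i:@x = 0.
Proof.
move=> e hc Sx sg ng vh; have [ix _ _ _] := hc; apply: (tangent_kill hM ix sg ng).
exact/(tangent_cut hM _ e hc Sx).
Qed.
End SmoothMaps.
Section Gpd.
Variables (R : realType) (G : pregroupoid R).
Hypothesis hG : gp G.
Let M3 := sprod (sopp (sprod G G)) G.
Lemma gpd_sympl : is_symplectic G. Proof. by case: hG. Qed.
Lemma gpd_manifold : is_manifold G. Proof. by case: gpd_sympl. Qed.
Let hs := gpd_sympl.
Let hm := gpd_manifold.
Lemma src_core g : core G (gsrc g). Proof. by case: hG => -[_ [/(_ g)[]]]. Qed.
Lemma tgt_core g : core G (gtgt g). Proof. by case: hG => -[_ [/(_ g)[]]]. Qed.
Lemma src_fix a : core G a -> gsrc a = a. Proof. by case: hG => -[_ [_ H] _ _ _] _ _ /H[]. Qed.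
Lemma tgt_fix a : core G a -> gtgt a = a. Proof. by case: hG => -[_ [_ H] _ _ _] _ _ /H[]. Qed.
Lemma src_smooth : @smooth_map R G G setT (fun x => gsrc (val x)). Proof. by case: hG => -[_ _ [? _ _ _] _ _] _ _. Qed.
Lemma tgt_smooth : @smooth_map R G G setT (fun x => gtgt (val x)). Proof. by case: hG => -[_ _ [_ ? _ _] _ _] _ _. Qed.
Lemma src_cont : continuous (gsrc : G -> G). Proof. exact: smap_contT src_smooth. Qed.
Lemma tgt_cont : continuous (gtgt : G -> G). Proof. exact: smap_contT tgt_smooth. Qed.
Lemma dom_eq p : gmul_dom G p -> gtgt p.1 = gsrc p.2.
Proof. by case: hG => -[_ _ _ [[U _ ->] _] _] _ _ []. Qed.
Lemma dom_near a : core G a -> \forall p \near (a, a), gtgt p.1 = gsrc p.2 -> gmul_dom G p.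
Proof.
move=> ca; case: hG => -[_ _ _ [[U [oU HU] e] _] _] _ _; rewrite e.
have : U (a, a) by apply: HU.
by move/(open_near oU); apply: nearS => p Up ep.
Qed.
Lemma dom_core a : core G a -> gmul_dom G (a, a).
Proof. by move=> ca; apply: (near_pt (dom_near ca)); rewrite tgt_fix // src_fix. Qed.
Lemma mul_cont p (A : G -> Prop) : gmul_dom G p -> (\forall z \near gmul p, A z) -> \forall q \near p, gmul_dom G q -> A (gmul q).
Proof.
case: hG => -[_ _ _ [_ [sm _ _]] _] _ _ dp nA.
exact: (smap_cont (mprodP hm hm) hm sm dp nA).
Qed.
Lemma inv_cont a (A : G -> Prop) : core G a -> (\forall z \near ginv a, A z) -> \forall g \near a, A (ginv g).
Proof.
case: hG => -[_ _ _ [_ [_ [od cd] si]] _] _ _ ca nA.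
have n1 := smap_cont hm hm si (cd _ ca) nA.
by apply: nearS (n1 &n (open_near od (cd _ ca))) => g [H /H].
Qed.
Definition gpd_axioms (g : G) : Prop := [/\ gmul_dom G (gsrc g, g), gmul (gsrc g, g) = g, gmul_dom G (g, gtgt g) & gmul (g, gtgt g) = g].
Lemma axioms_near : exists U : set G, onbhd (core G) U /\ [/\ forall g, U g -> gpd_axioms g,
  forall g h, U g -> U h -> gtgt g = gsrc h ->
   [/\ gmul_dom G (g, h), gsrc (gmul (g, h)) = gsrc g & gtgt (gmul (g, h)) = gtgt h],
  forall g h k, U g -> U h -> U k -> gtgt g = gsrc h -> gtgt h = gsrc k ->
   [/\ gmul_dom G (gmul (g, h), k), gmul_dom G (g, gmul (h, k)) &
     gmul (gmul (g, h), k) = gmul (g, gmul (h, k))] &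
  forall g, U g ->
   [/\ ginv_dom G g, gsrc (ginv g) = gtgt g /\ gtgt (ginv g) = gsrc g,
     gmul_dom G (g, ginv g) /\ gmul (g, ginv g) = gsrc g &
     gmul_dom G (ginv g, g) /\ gmul (ginv g, g) = gtgt g]].
Proof. by case: hG => -[_ _ _ _ [U [a b c d e]]] _ _; exists U. Qed.
Lemma unit_mul a : core G a -> gmul (a, a) = a.
Proof.
move=> ca; have [U [[_ cU] [h1 _ _ _]]] := axioms_near.
by have [_ + _ _] := h1 a (cU _ ca); rewrite src_fix.
Qed.
(** Tangent data at a unit, with [S] and [T] the derivatives of source and target. After the
    presentation of the graph, the clauses are the infinitesimal forms of: the graph of the product
    is isotropic; [s(g) g = g = g t(g)]; composable elements satisfy [t(g) = s(h)]; source and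
    target retract onto the units. *)
Lemma gpd_local (a : G) (i : mchart G) : core G a -> mdom i a -> exists k (hV : 'rV[R]_(mdim M3) -> 'rV[R]_k) (S T : 'M[R]_(mdim G)),
 [/\ @lagr_cut R M3 ((i, i), i) ((a, a), a) (gmul_graph G) k hV,
 forall u v w u' v' w' : 'rV[R]_(mdim G), u:|v:|w *m jac hV i:@a:|i:@a:|i:@a = 0 ->
  u':|v':|w' *m jac hV i:@a:|i:@a:|i:@a = 0 ->
  w *m form i a *m w'^T = u *m form i a *m u'^T + v *m form i a *m v'^T,
 forall u : 'rV[R]_(mdim G), (u *m S):|u:|u *m jac hV i:@a:|i:@a:|i:@a = 0 /\
   u:|(u *m T):|u *m jac hV i:@a:|i:@a:|i:@a = 0,
 forall u v w : 'rV[R]_(mdim G), u:|v:|w *m jac hV i:@a:|i:@a:|i:@a = 0 -> u *m T = v *m S &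
 forall k c (h : _ -> 'rV[R]_c), mdim G = (k + c)%N -> cut i a (core G) h -> forall v : 'rV[R]_(mdim G),
  (v *m jac h i:@a = 0 -> v *m S = v /\ v *m T = v) /\ v *m S *m jac h i:@a = 0 /\ v *m T *m jac h i:@a = 0].
Proof.
move=> ca ia; have [U [[oU cU] [h1 _ _ _]]] := axioms_near.
have isa : mdom i (gsrc a) by rewrite src_fix.
have ita : mdom i (gtgt a) by rewrite tgt_fix.
have [Fs [ss ns]] := smap_extT src_smooth ia isa; have [Ft [st nt]] := smap_extT tgt_smooth ia ita.
have [_ _ lV] := hG.
have Va : gmul_graph G ((a, a), a) by split; [exact: dom_core|rewrite unit_mul].
have hM3 : is_symplectic M3 by exact: sprod3_valid.
have hMM : is_manifold M3 by case: hM3.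
have id3 : @mdom R M3 ((i, i), i) ((a, a), a) by [].
have [k [hV lc]] := lagr_atE hM3 lV Va id3.
have [e2 cV iV] := lc.
have nU := open_near oU (cU _ ca).
have Fsa : Fs i:@a = i:@a by have [_ <-] := near_pt ns; rewrite src_fix.
have Fta : Ft i:@a = i:@a by have [_ <-] := near_pt nt; rewrite tgt_fix.
exists k, hV, (jac Fs i:@a), (jac Ft i:@a).
have sid := @sm_id R _ i:@a.
split => //.
- move=> u v w u' v' w' k1 k2; have := near_pt iV Va _ _ k1 k2.
 rewrite block_form !row_mxKl !row_mxKr mulmxN mulNmx block_form !row_mxKl !row_mxKr addrC => /eqP.
 by rewrite subr_eq0 => /eqP.
- move=> u; split.
  pose K z := (Fs z):|z:|z.
  have sK1 : smooth_at i:@a (fun z => (Fs z):|z) by apply: sm_row_mx.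
  have sK : smooth_at i:@a K by apply: sm_row_mx.
  have cf : {for a, continuous (fun g : G => ((gsrc g, g), g))}.
   apply: (@cont_pair _ _ _ (fun g : G => (gsrc g, g)) id); last exact: cvg_id.
   by apply: (@cont_pair _ _ _ gsrc id); [exact: src_cont|exact: cvg_id].
  have nK : \forall z \near a, @mcoord R M3 ((i, i), i) ((gsrc z, z), z) = K i:@z.
   by apply: nearS ns => z [_ e] /=; rewrite e.
  have nV : \forall z \near a, gmul_graph G ((gsrc z, z), z).
   by apply: nearS nU => z /h1[d e _ _]; split.
  have cV' : @cut R M3 ((i, i), i) ((gsrc a, a), a) (gmul_graph G) k hV by rewrite src_fix.
  have := @map_kill R M3 G hm _ i ((i, i), i) a _ _ _ _ ia cf sK nK nV cV'.
  rewrite src_fix // => /(congr1 (mulmx u)); rewrite mulmx0 mulmxA.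
  by rewrite jac_row_mx // jac_row_mx // jac_id !mul_mx_row mulmx1.
 pose K z := z:|(Ft z):|z.
 have sK1 : smooth_at i:@a (fun z => z:|(Ft z)) by apply: sm_row_mx.
 have sK : smooth_at i:@a K by apply: sm_row_mx.
 have cf : {for a, continuous (fun g : G => ((g, gtgt g), g))}.
  apply: (@cont_pair _ _ _ (fun g : G => (g, gtgt g)) id); last exact: cvg_id.
  by apply: (@cont_pair _ _ _ id gtgt); [exact: cvg_id|exact: tgt_cont].
 have nK : \forall z \near a, @mcoord R M3 ((i, i), i) ((z, gtgt z), z) = K i:@z.
  by apply: nearS nt => z [_ e] /=; rewrite e.
 have nV : \forall z \near a, gmul_graph G ((z, gtgt z), z).
  by apply: nearS nU => z /h1[_ _ d e]; split.
 have cV' : @cut R M3 ((i, i), i) ((a, gtgt a), a) (gmul_graph G) k hV by rewrite tgt_fix.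
 have := @map_kill R M3 G hm _ i ((i, i), i) a _ _ _ _ ia cf sK nK nV cV'.
 rewrite tgt_fix // => /(congr1 (mulmx u)); rewrite mulmx0 mulmxA.
 by rewrite jac_row_mx // jac_row_mx // jac_id !mul_mx_row mulmx1.
- pose g (z : 'rV[R]_((mdim G + mdim G) + mdim G)) := Ft (lsubmx (lsubmx z)) - Fs (rsubmx (lsubmx z)).
 set z0 := i:@a:|i:@a:|i:@a.
 pose A1 : 'M[R]_((mdim G + mdim G) + mdim G, mdim G) := col_mx (col_mx 1%:M 0) 0.
 pose A2 : 'M[R]_((mdim G + mdim G) + mdim G, mdim G) := col_mx (col_mx 0 1%:M) 0.
 have gE : g = (fun z => Ft (z *m A1) + - Fs (z *m A2)).
  apply/funext => z; rewrite /g /A1 /A2 -[z in RHS]hsubmxK -[lsubmx z in RHS]hsubmxK.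
  by rewrite !mul_row_col !mulmx0 !mulmx1 !addr0 add0r.
 have z1 : z0 *m A1 = i:@a by rewrite /z0 /A1 !mul_row_col !mulmx0 !mulmx1 !addr0.
 have z2 : z0 *m A2 = i:@a by rewrite /z0 /A2 !mul_row_col !mulmx0 !mulmx1 !addr0 add0r.
 have s1 : smooth_at z0 (fun z => Ft (z *m A1)) by apply: (sm_comp' z1 (sm_mulmx z0 A1)).
 have s2 : smooth_at z0 (fun z => Fs (z *m A2)) by apply: (sm_comp' z2 (sm_mulmx z0 A2)).
 have sg : smooth_at z0 g by rewrite gE; apply: sm_add => //; exact: sm_opp.
 have jt : jac (fun z => Ft (z *m A1)) z0 = A1 *m jac Ft i:@a.
  by have := jac_comp (sm_mulmx z0 A1); rewrite z1 jac_mulmx; apply.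
 have js : jac (fun z => Fs (z *m A2)) z0 = A2 *m jac Fs i:@a.
  by have := jac_comp (sm_mulmx z0 A2); rewrite z2 jac_mulmx; apply.
 have jg : jac g z0 = A1 *m jac Ft i:@a - A2 *m jac Fs i:@a.
  by rewrite gE jac_add //; [rewrite jac_opp // jt js|exact: sm_opp].
 move=> u v w huv; have ee : mdim M3 = (k + k)%N by rewrite addnn.
 have := cut_kill hMM ee cV Va sg _ huv; rewrite -/z0 jg mulmxBr !mulmxA => H.
 have {H} : u:|v:|w *m A1 *m jac Ft i:@a - u:|v:|w *m A2 *m jac Fs i:@a = 0.
  apply: H; have n1 := near_fst a (near2 nt ns).
  apply: nearS n1 => -[[x y] z] [[_ et] [_ es]] [/dom_eq d _].
  by rewrite /g !row_mxKl !row_mxKr -et -es d subrr.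
 rewrite /A1 /A2 !mul_row_col !mulmx0 !mulmx1 !addr0 add0r => /eqP.
 by rewrite subr_eq0 => /eqP.
- move=> k' c h e hc v; split.
  move=> vh.
  have gk (F : 'rV[R]_(mdim G) -> 'rV[R]_(mdim G)) (f : G -> G) : (forall a, core G a -> f a = a) -> smooth_at i:@a F ->
    (\forall z \near a, mdom i (f z) /\ i:@(f z) = F i:@z) -> v *m jac F i:@a = v.
   move=> fix_ sF nF; have sF' : smooth_at i:@a (fun z => F z + - id z) by apply: sm_add => //; exact: sm_opp.
   have := cut_kill hm e hc ca sF' _ vh.
   rewrite jac_add //; last exact: sm_opp.
   rewrite jac_opp // jac_id mulmxDr mulmxN mulmx1 => H.
   apply/eqP; rewrite -subr_eq0; apply/eqP; apply: H.
   by apply: nearS nF => z [_ eF] cz; rewrite -eF fix_ // subrr.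
  by split; [exact: (gk Fs gsrc src_fix)|exact: (gk Ft gtgt tgt_fix)].
 have hs' : cut i (gsrc a) (core G) h by rewrite src_fix.
 have ht' : cut i (gtgt a) (core G) h by rewrite tgt_fix.
 have := map_kill hm ia (@src_cont a) ss (nearS (fun z => @proj2 _ _) ns) (nearT _ src_core) hs'.
 have := map_kill hm ia (@tgt_cont a) st (nearS (fun z => @proj2 _ _) nt) (nearT _ tgt_core) ht'.
 by rewrite src_fix // tgt_fix // -!mulmxA => -> ->; rewrite !mulmx0.
Qed.
(** The units are lagrangian. On vectors tangent to them isotropy of the graph reads
    [omega = omega + omega], so the form vanishes. If [u] is orthogonal to the units, pairing
    [(u S, u, u)] with [(w, w T, w)] for all [w] gives [u = u S], which is tangent to the units. The
    dimension follows from [self_dual_dim]. *)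
Lemma gpd_core_cut (a : G) (i : mchart G) : core G a -> mdom i a -> exists k (h : 'rV[R]_(mdim G) -> 'rV[R]_k), core_cut i a h.
Proof.
move=> ca ia; have [[[_ [k sub]] _ _ _ _] _ _] := hG.
have [c [h [e hc]]] := submanifold_cut sub ca ia.
have [k3 [hV [S [T [_ form3 tg _ cr]]]]] := gpd_local ca ia.
have {}cr := cr k c h e hc.
have [_ uf _ _] := hs; have [_ unit] := uf i a ia.
have iso : isotropic i a h.
 move=> u v hu hv; have [/(_ hu)[uS uT] _] := cr u; have [/(_ hv)[vS vT] _] := cr v.
 have := form3 _ _ _ _ _ _ (tg u).1 (tg v).1; rewrite uS vS => /eqP.
 by rewrite -{1}[u *m _ *m _]addr0 (inj_eq (addrI _)) eq_sym => /eqP.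
have cois (u : 'rV[R]_(mdim G)) : (forall v : 'rV[R]_(mdim G), v *m jac h i:@a = 0 -> u *m form i a *m v^T = 0) -> u *m jac h i:@a = 0.
 move=> H; have [_ [uSh _]] := cr u; suff e0 : u = u *m S by rewrite e0.
 have e1 (w : 'rV[R]_(mdim G)) : u *m form i a *m w^T = u *m S *m form i a *m w^T.
  have [_ [_ wTh]] := cr w.
  by rewrite (form3 _ _ _ _ _ _ (tg u).1 (tg w).2) (H _ wTh) addr0.
 have : u *m form i a = u *m S *m form i a.
  apply: trmx_inj; apply: eq_rowmul => w; apply: trmx_inj.
  by rewrite !trmx_mul !trmxK.
 by move=> /(congr1 (mulmx^~ (invmx (form i a)))); rewrite -!mulmxA mulmxV // !mulmx1.
have [_ sh fh _] := hc.
have kerP (v) : (v <= kermx (jac h i:@a))%MS <-> v *m jac h i:@a = 0.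
 by split=> [/sub_kermxP|/sub_kermxP].
have := @self_dual_dim _ _ (form i a) (kermx (jac h i:@a)) unit.
rewrite mxrank_ker (eqP fh) => ee.
exists c, h; split => //.
suff H : mdim G = (mdim G - c).*2 by rewrite H -!addnn; move: H e; rewrite -!addnn; lia.
apply: ee.
 by move=> u v /kerP hu /kerP hv; exact: iso.
by move=> u H; apply/kerP; apply: cois => v /kerP; exact: H.
Qed.
Lemma gpd_mf : is_mf G.
Proof.
split => //; have [_ _ [k3 e3 _]] := hG.
have [k e] : exists k, mdim G = k.*2.
 (* The graph is lagrangian in dimension [3 dim G = 2 k3], hence [dim G = 2 (k3 - dim G)]. *)
 by exists (k3 - mdim G)%N; move: e3; rewrite /= -addnn -addnn; lia.
exists k => //.
have cc x : core G x -> exists i (h : _ -> 'rV[R]_k), core_cut i x h.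
 move=> cx; have [_ /(_ x)[i ix] _ _ _] := hm; have [k' [h hc]] := gpd_core_cut cx ix.
 have [e' _ _] := hc; have kk : k' = k by apply: double_inj; rewrite -e -e'.
 by move: h hc; rewrite kk => h hc; exists i, h.
split.
 apply: (cut_submanifold hm (c := k)); first by rewrite e addnn.
 by move=> x /cc[i [h [_ hc _]]]; exists i, h.
move=> x i u v cx ix; have [k' [h [e' hc iso]]] := gpd_core_cut cx ix.
have ee : mdim G = (k' + k')%N by rewrite addnn.
by move=> /(tangent_cut hm _ ee hc cx) hu /(tangent_cut hm _ ee hc cx) hv; apply: iso.
Qed.
(** Cleanness: let [u1], [u2] be tangent to the units and [(u1, u2, w)] to the graph. Composability
    gives [u1 = u2]; then [(0, 0, w - u1)] is tangent to the graph, and pairing it with the vectors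
    [(x S, x, x)] shows [w = u1]. *)
Lemma gr_mul_micro : is_micro (gr_mul G).
Proof.
have hX := gpd_mf; have hXX := mfprodP hX hX.
set phi := coremap (gr_mul G).
have ext (b : core G) i : mdom i (val b) -> @ext_at R G:~G G phi b (i, i) i (fun z => z:|z).
 move=> ib; split; first by apply: sm_row_mx; exact: sm_id.
 by apply: nearS (mdom_near hm ib) => z iz b' e; split; [split; rewrite /= e|rewrite /= e].
apply: (is_microI hXX hX).
 apply: (smooth_mapI hXX hX) => b; have [_ /(_ (val b))[i ib] _ _ _] := hm.
 by exists (i, i), i, (fun z => z:|z); split => //; exact: ext.
move=> b; have [_ /(_ (val b))[i ib] _ _ _] := hm.
have ca := valcore b.
have [k [h hc]] := gpd_core_cut ca ib; have [e1 c1 i1] := hc.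
have [k3 [hV [S [T [[e3 cV iV] form3 tg cm cr]]]]] := gpd_local ca ib.
have ee : mdim G = (k + k)%N by rewrite addnn.
have {}cr := cr k k h ee c1.
have [_ uf _ _] := hs; have [_ unit] := uf i (val b) ib.
have [_ sh _ _] := c1.
apply: (micro_dataI hXX hX (i := (i, i)) (j := i) (hA := fprodmx h h) (hB := h) (hV := hV)); split => //.
- by split => //; [split; [exact: dom_core|rewrite unit_mul]|exact: ext].
- exact: core_cut_prod.
move=> u w; rewrite -[u](@hsubmxK _ _ (mdim G) (mdim G)); move: (lsubmx u) (rsubmx u) => u1 u2.
move=> hu /(fprod_ker _ _ sh sh)[h1 h2] hw.
have [/(_ h1)[u1S u1T] _] := cr u1; have [/(_ h2)[u2S u2T] _] := cr u2.
have e12 : u1 = u2 by rewrite -u1T -u2S; exact: cm hu.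
have hz : w = u1.
 have k1 := (tg u1).1; rewrite u1S in k1.
 have k2 : 0:|0:|(w - u1) *m jac hV i:@(val b):|i:@(val b):|i:@(val b) = 0.
  rewrite (_ : 0:|0:|(w - u1) = u1:|u2:|w - u1:|u1:|u1).
   by rewrite mulmxBl hu k1 subrr.
  by rewrite opp_row_mx add_row_mx opp_row_mx add_row_mx e12 !subrr.
 have e0 (x : 'rV[R]_(mdim G)) : (w - u1) *m form i (val b) *m x^T = 0.
  by rewrite (form3 _ _ _ _ _ _ k2 (tg x).1) !mul0mx addr0.
 have : (w - u1) *m form i (val b) = 0.
  apply: trmx_inj; rewrite trmx0; apply: eq_rowmul => x; apply: trmx_inj.
  by rewrite trmx_mul trmxK e0 mulmx0 trmx0.
 move=> /(congr1 (mulmx^~ (invmx (form i (val b))))); rewrite -!mulmxA mulmxV // mulmx1 mul0mx => /eqP.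
 by rewrite subr_eq0 => /eqP.
have sid := @sm_id R _ i:@(val b).
by rewrite jac_row_mx // jac_id mul_mx_row mulmx1 hz e12.
Qed.
End Gpd.
Lemma bil_ext (R : realType) m n (A B : 'M[R]_(m, n)) : (forall (u : 'rV[R]_m) (v : 'rV[R]_n), u *m A *m v^T = u *m B *m v^T) -> A = B.
Proof.
move=> H; apply: eq_rowmul => u; apply: trmx_inj; apply: eq_rowmul => v; apply: trmx_inj.
by rewrite [LHS]trmx_mul [RHS]trmx_mul !trmxK H.
Qed.
(** * Lagrangian submicrogroupoids and monoid morphisms *)
Section InvClosure.
Variables (R : realType) (M : presymplectic R).
Hypothesis hM : is_symplectic M.
Let hm : is_manifold M. Proof. by case: hM. Qed.
(** [iota], [sigma] and [tau] play the roles of inversion, source and target. Below, [anti] says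
    that [iota] reverses the form, and [fixed] that closure under [iota] is already known near the
    points of [C] fixed by it. *)
Variables (C V D : set M) (iota sigma tau : M -> M).
Hypotheses (lV : is_lagrangian V) (CV : C `<=` V) (oD : onbhd C D).
Hypothesis anti : forall q i j, D q -> mdom i q -> mdom j (iota q) -> exists F, [/\ smooth_at i:@q F,
  \forall z \near q, mdom j (iota z) /\ j:@(iota z) = F i:@z &
  forall u v : 'rV[R]_(mdim M), u *m form i q *m v^T = - ((u *m jac F i:@q) *m form j (iota q) *m (v *m jac F i:@q)^T)].
Hypotheses (csig : continuous sigma) (ctau : continuous tau) (sigC : forall c, C c -> sigma c = c) (tauC : forall c, C c -> tau c = c).
Hypothesis sig_iota : forall q, D q -> sigma (iota q) = tau q.
Hypothesis fixed : forall c, C c -> iota c = c -> \forall q \near c, V q -> V (iota q).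
Let img (N' : set M) : set M := [set p | exists q, [/\ N' q, V q & iota q = p]].
(** Third clause: preimages in [N'] of points near [iota q] are near [q]. Fourth: the image of the
    part of [V] in [N'] is lagrangian at its points. Last, an alternative: either [iota] maps this
    part of [V] into [V], or it moves [N'] off itself. *)
Definition inv_box (N' : set M) : Prop := [/\ open N', N' `<=` D,
 forall q (A : M -> Prop), N' q -> (\forall z \near q, A z) -> \forall p \near iota q, forall q', N' q' -> iota q' = p -> A q',
 forall q, N' q -> V q -> exists j, lagr_at j (iota q) (img N') &
 (forall q, N' q -> V q -> V (iota q)) \/ (forall q, N' q -> \forall p \near iota q, ~ N' p)].
(** If [iota c = c], the hypothesis [fixed] gives the first alternative; otherwise the Hausdorff
    property separates [c] from [iota c] and gives the second. As [iota] reverses a nondegenerate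
    form its derivative is invertible, so it is a local diffeomorphism carrying lagrangian pieces to
    lagrangian pieces. *)
Lemma inv_box_exists c : C c -> exists N', N' c /\ inv_box N'.
Proof.
move=> Cc; have [hsT _ _ _ _] := hm; have [_ cM _ _ _] := hm.
have Dc := oD.2 _ Cc.
have [i ic] := cM c; have [j jc] := cM (iota c).
have [F [sF nF aF]] := anti Dc ic jc.
have [_ uf _ _] := hM; have [_ uni] := uf i c ic.
have uJ : jac F i:@c \in unitmx.
 have e1 : form i c = jac F i:@c *m - (form j (iota c) *m (jac F i:@c)^T).
  by apply: bil_ext => u v; rewrite aF trmx_mul mulmxN mulmxN mulNmx !mulmxA.
 by move: uni; rewrite e1 unitmx_mul => /andP[].
have [G [sG GF FG]] := inverse_function sF uJ.
have cmi := mcoord_cont hm ic.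
have cFi : {for c, continuous (F \o mcoord i)} by apply: continuous_comp => //; exact: sm_cont.
have cio : forall q, D q -> {for q, continuous iota}.
 move=> q Dq; have [i' iq] := cM q; have [j' jq] := cM (iota q); have [F' [sF' nF' _]] := anti Dq iq jq.
 move=> A nA; have [_ e'] := near_pt nF'.
 have := chart_surj hm jq nA; rewrite e' => /(near_pre (sm_cont sF'))/(chart_cont hm iq) n1.
 apply: nearS (nF' &n n1) => z [[jz ez] [y [jy Ay ey]]].
 change (A (iota z)); suff <- : y = iota z by [].
 by apply: (mcoord_inj hm jy jz); rewrite ey ez.
have alt : exists A : set M, (\forall q \near c, A q) /\ ((forall q, A q -> V q -> V (iota q)) \/ exists B : set M, [/\ open A, open B, forall q, A q -> B (iota q) & forall p, A p -> B p -> False]).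
 have [ec|nec] := pselect (iota c = c); first by exists [set q | V q -> V (iota q)]; split; [exact: fixed|left].
 have [A [B [oA oB Ac Bc AB]]] : exists A B : set M, [/\ open A, open B, A c, B (iota c) & forall p, A p -> B p -> False].
  apply: contrapT => H; apply: nec; apply/esym; apply: hsT.1 => A B nA nB.
  have [A' [oA Ac AA]] := nearO nA; have [B' [oB Bc BB]] := nearO nB.
  apply: contrapT => H'; apply: H; exists A', B'; split => // p Ap Bp; apply: H'; exists p; split; [exact: AA|exact: BB].
 have n1 := near_pre (cio c Dc) (open_near oB Bc).
 have [A2 [oA2 A2c AA2]] := nearO n1.
 exists (A `&` A2); split; first by apply: nearI; exact: open_near.
 by right; exists B; split => //; [exact: openI|move=> q [_ /AA2]|move=> p [Ap _]; exact: AB].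
have [A5 [nA5 H5]] := alt.
have nG1 := near_pre cFi ((sm_near sG) &n (near_near FG)).
have nG2 : \forall q \near c, smooth_at i:@q F /\ G (F i:@q) = i:@q.
 by apply: (chart_cont hm ic (P := fun u => smooth_at u F /\ G (F u) = u)); apply: nearI GF; exact: sm_near.
have [N' [oN Nc HN]] := nearO (((open_near oD.1 Dc) &n (mdom_near hm ic)) &n (near_near nF) &n (nA5 &n (nG1 &n nG2))).
have {}HN q : N' q -> [/\ D q /\ mdom i q, \forall z \near q, mdom j (iota z) /\ j:@(iota z) = F i:@z,
  A5 q, smooth_at (F i:@q) G /\ (\forall u \near F i:@q, F (G u) = u) & smooth_at i:@q F /\ G (F i:@q) = i:@q].
 by move=> /HN[[a b] [d [e [f g]]]].
have back q (A : M -> Prop) : N' q -> (\forall z \near q, A z) -> \forall p \near iota q, exists y, [/\ mdom i y, A y & i:@y = G j:@p].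
 move=> Nq nA; have [[Dq iq] nq _ [sGq _] [_ eGF]] := HN q Nq.
 have [jq eq] := near_pt nq.
 have := chart_surj hm iq nA; rewrite -eGF => n1.
 have n2 := near_pre (sm_cont sGq) n1; rewrite -eq in n2.
 exact: (chart_cont hm jq n2).
have val_ q : N' q -> i:@q = G j:@(iota q).
 by move=> Nq; have [_ nq _ _ [_ eGF]] := HN q Nq; have [_ ->] := near_pt nq; rewrite eGF.
have B2 q (A : M -> Prop) : N' q -> (\forall z \near q, A z) -> \forall p \near iota q, forall q', N' q' -> iota q' = p -> A q'.
 move=> Nq nA; apply: nearS (back q A Nq nA) => p [y [iy Ay ey]] q' Nq' e.
 have [[_ iq'] _ _ _ _] := HN q' Nq'.
 suff <- : y = q' by [].
 by apply: (mcoord_inj hm iy iq'); rewrite ey (val_ q' Nq') e.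
exists N'; split => //; split => //.
- by move=> q /HN[[]].
- move=> q Nq Vq; have [[Dq iq] nq _ [sGq nFG] [sFq eGF]] := HN q Nq.
 have [jq eq] := near_pt nq.
 have [k [h [ek hc hiso]]] := lagr_atE hM lV Vq iq; have [_ sh fh nh] := hc.
 exists j, k, (h \o G).
 have shG : smooth_at (G j:@(iota q)) h by rewrite -val_.
 have sG' : smooth_at j:@(iota q) G by rewrite eq.
 have FG1 y : N' y -> jac G j:@(iota y) *m jac F i:@y = 1%:M.
  move=> Ny; have [_ ny _ [sGy nFGy] [sFy eGFy]] := HN y Ny; have [_ ey] := near_pt ny.
  rewrite (val_ y Ny) -jac_comp; [|by rewrite ey|by rewrite -val_].
  rewrite -(jac_id j:@(iota y)); apply: jac_ext; first by rewrite ey.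
  by apply: sm_comp; rewrite ?ey // eGFy.
 split => //.
  split => //; first by apply: sm_comp.
   rewrite jac_comp // -val_ //; have /row_fullP[B hB] := fh.
   apply/row_fullP; exists (B *m jac F i:@q).
   have := mulmx1C (FG1 q Nq) => e1.
   by rewrite mulmxA -[B *m _ *m _]mulmxA e1 mulmx1.
  have n1 := B2 q _ Nq nh; have n2 := back q _ Nq ((open_near oN Nq) &n nh).
  have n3 : \forall p \near iota q, F (G j:@p) = j:@p by apply: (chart_cont hm jq (P := fun u => F (G u) = u)); rewrite eq.
  apply: nearS (n1 &n n2 &n (n3 &n (mdom_near hm jq))) => p [H1 [H2 [H3 jp]]]; split.
   by move=> [q' [Nq' Vq' e]]; have := H1 q' Nq' e => -[/(_ Vq') + _]; rewrite (val_ q' Nq') e.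
  move=> h0; have [y [iy [Ny Vy] ey]] := H2; exists y; split => //; first by apply/Vy; rewrite ey.
  have [_ ny _ _ _] := HN y Ny; have [jy ejy] := near_pt ny.
  by apply: (mcoord_inj hm jy jp); rewrite ejy ey.
 have n1 := B2 q _ Nq (hiso &n (chart_cont hm iq (sm_near sh))).
 apply: nearS n1 => p H [y [Ny Vy e]] u v; have [iso_y sy] := H y Ny e.
 have [[Dy iy] ny _ [sGy _] [sFy eGFy]] := HN y Ny; have [jy ejy] := near_pt ny.
 rewrite -e jac_comp; [|by rewrite ejy|by rewrite -val_].
 rewrite -val_ // !mulmxA => hu hv.
 have := iso_y Vy _ _ hu hv.
 have [Fy [sFy' nFy aFy]] := anti Dy iy jy.
 have jF : jac Fy i:@y = jac F i:@y.
  by apply: jac_ext => //; apply: (near_chart hm iy); apply: nearS (nFy &n ny) => z [[_ <-] [_ <-]].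
 have e1 (z) : z *m jac G j:@(iota y) *m jac F i:@y = z by rewrite -mulmxA FG1 // mulmx1.
 by rewrite aFy jF !e1 => /eqP; rewrite oppr_eq0 => /eqP.
- case: H5 => [H5|[B [oA oB AB dis]]]; [left => q Nq|right => q Nq].
  by have [_ _ Aq _ _] := HN q Nq; exact: H5.
 have [_ _ Aq _ _] := HN q Nq.
 by apply: nearS (open_near oB (AB q Aq)) => p Bp Np; have [_ _ Ap _ _] := HN p Np; exact: dis Bp.
Qed.
(** The union of [V] with its image is a submanifold only if the sheets coincide wherever they come
    close. Boxes provide this alternative locally, and a thin neighbourhood makes any two relevant
    points share a box. *)
Lemma inv_closure : exists V' E : set M, [/\ onbhd C E /\ E `<=` D, is_lagrangian V', V' `&` E = V `&` E,
  forall p, V' p -> (V p /\ E p) \/ exists q, [/\ V q, E q & p = iota q] & forall q, V q -> E q -> V' (iota q)].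
Proof.
have [hsT _ _ _ _] := hm.
have [|U [[oU CU] U2 U3]] := @thin M M [set q | C q.1 /\ q.2 = q.1] (fun N' _ => inv_box N') hsT.2 (manifold_regular hm).
 move=> n0 c [/= Cn ->]; have [N' [Nc bx]] := inv_box_exists Cn.
 exists N', setT; have [oN _ _ _ _] := bx; split => //.
 by apply: nearS (open_near oN Nc) => p Np; split => // n [/= _ <-].
(* Since [sigma (iota q) = tau q], testing points against both [sigma] and [tau] puts [q] and
   [iota q], when both lie in [E], into a common box. *)
pose E : set M := [set q | U (q, tau q) /\ U (q, sigma q)].
have cpair (f : M -> M) q : continuous f -> {for q, continuous (fun z => (z, f z))}.
 by move=> cf; apply: (@cont_pair _ _ _ id f); [exact: cvg_id|exact: cf].
have oE : open E.
 apply: open_of_near => q [U1 U1'].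
 exact: nearI (near_pre (cpair _ q ctau) (open_near oU U1)) (near_pre (cpair _ q csig) (open_near oU U1')).
have CE : C `<=` E by move=> c Cc; split; apply: CU; rewrite ?tauC ?sigC.
have ED : E `<=` D.
 by move=> q [Uq _]; have [N' [_ [[_ ND _ _ _] _ HN]]] := U2 _ _ Uq; apply: ND; exact: HN.
pose V' : set M := [set p | (V p /\ E p) \/ exists q, [/\ V q, E q & p = iota q]].
have VE p : V' p -> E p -> V p.
 move=> [[]//|[q [Vq Eq e]]] Ep.
 have [N' [_ [[_ _ _ _ alt] _ HN]]] := U2 _ _ Eq.1.
 have Nq := HN _ Eq.1; have Np : N' p by apply: HN; case: Ep => _; rewrite e sig_iota //; exact: ED.
 case: alt => [H|H]; first by rewrite e; exact: H.
 by case: (near_pt (H q Nq)); rewrite -e.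
have [k ek _] := lV.
exists V', E; split => //.
- apply: (lagr_atI hM ek) => p0 [[Vp Ep]|[q0 [Vq0 Eq0 e0]]].
  have [_ /(_ p0)[i ip] _ _ _] := hm; exists i.
  apply: (lagr_at_ext (lagr_atE hM lV Vp ip)).
  apply: nearS (open_near oE Ep) => p Ep'; split=> [Vp'|V'p]; first by left.
  exact: VE.
 have [N0 [_ [bx0 _ HN0]]] := U2 _ _ Eq0.1; have N0q := HN0 _ Eq0.1.
 have [oN0 _ B20 B40 _] := bx0.
 have [i li] := B40 q0 N0q Vq0; exists i; rewrite e0; apply: (lagr_at_ext li).
 have sp : sigma (iota q0) = tau q0 by apply: sig_iota; exact: ED.
 have [l [F [v [HF nF]]]] := U3 _ _ Eq0.1; rewrite -sp in nF.
 have n1 := near_pre (@csig (iota q0)) nF.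
 have n2 : \forall p \near iota q0, U (q0, sigma p).
  have cc : {for iota q0, continuous (fun p => (q0, sigma p))}.
   by apply: (@cont_pair _ _ _ (fun _ => q0) sigma); [exact: cvg_cst|exact: csig].
  by apply: (@near_pre _ _ _ _ U cc); apply: open_near => //; rewrite sp; exact: Eq0.1.
 have n3 : \forall p \near iota q0, forall j, (j <= l)%N -> v j -> (F j).1 q0 ->
   (forall q', (F j).1 q' -> iota q' = p -> N0 q') /\ (V p -> (F j).1 p -> img (F j).1 p).
  apply: near_leq => j jl; have [[vj Nj]|nv] := pselect (v j /\ (F j).1 q0); last by apply: nearT => p vj Nj; case: nv.
  have [[_ _ B2 B4 alt] _] := HF j jl vj.
  have nV : \forall p \near iota q0, V p -> (F j).1 p -> img (F j).1 p.
   (* In the first alternative the image lies in [V] and has its dimension, so it fills [V] near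
      [iota q0]; in the second the box misses a neighbourhood of [iota q0]. *)
   case: alt => [H|H]; last by apply: nearS (H q0 Nj) => p np _ /np.
   have [i' li'] := B4 q0 Nj Vq0; have [k' [h' [_ [ii _ _ _] _]]] := li'.
   have L0 : img (F j).1 (iota q0) by exists q0.
   have := lagr_sub_eq hm li' (lagr_atE hM lV (H q0 Nj Vq0) ii) L0.
   move=> /(_ (nearT _ _)) HH.
   apply: nearS (HH _) => [p Hp Vp _|p [q' [Nq' Vq' <-]]]; [exact: Hp|exact: H].
  by apply: nearS ((B2 q0 _ Nj (open_near oN0 N0q)) &n nV) => p [a b] _ _; split.
 have n4 := B20 q0 _ N0q (open_near oE Eq0).
 apply: nearS (n1 &n n2 &n (n3 &n n4)) => p [[j [jl vj _ Hj]] [Uq0 [H3 H4]]].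
 have Njq0 := Hj _ Uq0; have [H3a H3b] := H3 j jl vj Njq0.
 split=> [[q' [Nq' Vq' e']]|]; first by right; exists q'; split => //; exact: H4 e'.
 case=> [[Vp [_ Ep]]|[q' [Vq' Eq' e']]].
  by have [q' [Nq' Vq' e']] := H3b Vp (Hj _ Ep); exists q'; split => //; exact: H3a e'.
 exists q'; split => //; apply: H3a => //; apply: Hj; rewrite e' sig_iota; first by case: Eq'.
 exact: ED.
- by apply/seteqP; split=> p [Vp Ep]; split => //; [exact: VE|left].
- by move=> q Vq Eq; right; exists q.
Qed.
End InvClosure.
Lemma cont_id {T : topT} (x : T) : {for x, continuous (id : T -> T)}.
Proof. exact: cvg_id. Qed.
Lemma near_pair {T : topT} (U V : topT) (f : T -> U) (g : T -> V) x (A : U * V -> Prop) :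
 {for x, continuous f} -> {for x, continuous g} -> (\forall p \near (f x, g x), A p) -> \forall y \near x, A (f y, g y).
Proof. by move=> cf cg; exact: (@near_pre _ _ (fun y => (f y, g y)) x A (cont_pair cf cg)). Qed.
Section GpdMonoid.
Variables (R : realType) (G : pregroupoid R).
Hypothesis hG : gp G.
Let hX := gpd_mf hG.
Let hs := gpd_sympl hG.
Let hm := gpd_manifold hG.
Let hE := mfunitP R.
Lemma rep_gr_mul : rep (gr_mul G) (gmul_graph G). Proof. by []. Qed.
Lemma rep_e : rep (micro_e G) (setT `*` core G). Proof. by []. Qed.
Lemma rep_id (X : premicrofold R) : rep (i_ X) [set p | p.1 = p.2]. Proof. by []. Qed.
Lemma core_diag (a : core G) : core_fst (core_pair a a) = a /\ core_snd (core_pair a a) = a.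
Proof. by split; exact: val_inj. Qed.
Lemma gpd_monoid : is_monoid (groupoid_monoid G).
Proof.
have hXX := mfprodP hX hX; have hEX := mfprodP hE hX; have hXE := mfprodP hX hE.
have hX3 := mfprodP hXX hX; have hX3' := mfprodP hX hXX.
have mm := gr_mul_micro hG; have me := micro_e_valid hX.
have [U [[oU cU] [h1 h2 h3 h4]]] := axioms_near hG.
have nU a : core G a -> \forall z \near a, U z by move=> ca; apply: open_near => //; exact: cU.
have csrc := @src_cont _ _ hG; have ctgt := @tgt_cont _ _ hG.
have eqd (a : core G) := core_diag a.
apply/monoidE; split => //.
- (* both sides are represented by the set of ((g, h), k), l with l = ghk *)
 pose K1 : set (((G * G) * G) * G) := [set q | [/\ gtgt q.1.1.1 = gsrc q.1.1.2, gtgt q.1.1.2 = gsrc q.1.2 & q.2 = gmul (gmul (q.1.1.1, q.1.1.2), q.1.2)]].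
 pose K2 : set ((G * (G * G)) * G) := [set q | [/\ gtgt q.1.1 = gsrc q.1.2.1, gtgt q.1.2.1 = gsrc q.1.2.2 & q.2 = gmul (q.1.1, gmul (q.1.2.1, q.1.2.2))]].
 have m1 : is_micro ((gr_mul G) \x (i_ G)) by vm.
 have m2 : is_micro ((i_ G) \x (gr_mul G)) by vm.
 have [s0 _] := mm; have [s1 _] := m1; have [s2 _] := m2.
 have nmul a (N : G -> Prop) : core G a -> (\forall z \near a, N z) -> \forall p \near (a, a), gtgt p.1 = gsrc p.2 -> gmul_dom G p /\ N (gmul p).
  move=> ca nN; have := mul_cont hG (dom_core hG ca) (A := N); rewrite unit_mul // => /(_ nN) n1.
  by apply: nearS (n1 &n (dom_near hG ca)) => p [H1 H2] /H2 d; split => //; exact: H1.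
 have r1 : rep ((gr_mul G) \o' ((gr_mul G) \x (i_ G))) K1.
  apply: (rep_comp hX3 hXX hX s1 s0 (tens_rep rep_gr_mul (rep_id G)) rep_gr_mul) => c /=.
  have ca : core G (sval c) := valcore c; move: (sval c) ca => a ca; split.
   move=> N nN; have [A [B [nA nB AB]]] := unbox nN.
   have n1 := near_fst a (near_fst a (nmul a A ca nA)).
   have n2 := near_fst a (near2 (near2 (nU _ ca) (nU _ ca)) (nB &n (nU _ ca))).
   apply: nearS (n1 &n n2) => -[[[g h] k] l] [H [[Ug Uh] [Bk Uk]]] [/= e1 e2 e3].
   have [d Ag] := H e1; have [d1 _ _] := h3 g h k Ug Uh Uk e1 e2.
   by exists (gmul (g, h), k); split; [exact: AB|split|split].
  have n2 := near_fst a (near_fst (a, a) (near_fst a (near2 (nU _ ca) (nU _ ca)))).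
  apply: nearS n2 => -[[[[g h] k] [n k']] l] [Ug Uh] [/= [/= d e] ek] [/= d' e'].
  have e1 := dom_eq hG d; have e2 := dom_eq hG d'; rewrite /= in e1 e2.
  have [_ _ t2] := h2 g h Ug Uh e1.
  by split => //=; [rewrite ek -e2 e t2|rewrite e' e ek].
 have r2 : rep ((gr_mul G) \o' ((i_ G) \x (gr_mul G))) K2.
  apply: (rep_comp hX3' hXX hX s2 s0 (tens_rep (rep_id G) rep_gr_mul) rep_gr_mul) => c /=.
  have ca : core G (sval c) := valcore c; move: (sval c) ca => a ca; split.
   move=> N nN; have [A [B [nA nB AB]]] := unbox nN.
   have n1 := near_fst a (near_snd a (nmul a B ca nB)).
   have n2 := near_fst a (near2 (nA &n (nU _ ca)) (near2 (nU _ ca) (nU _ ca))).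
   apply: nearS (n1 &n n2) => -[[g [h k]] l] [H [[Ag Ug] [Uh Uk]]] [/= e1 e2 e3].
   have [d Ah] := H e2; have [_ d1 _] := h3 g h k Ug Uh Uk e1 e2.
   by exists (g, gmul (h, k)); split; [exact: AB|split|split].
  have n2 := near_fst a (near_fst (a, a) (near_snd a (near2 (nU _ ca) (nU _ ca)))).
  apply: nearS n2 => -[[[g [h k]] [g' n]] l] [Uh Uk] [/= eg [/= d e]] [/= d' e'].
  have e1 := dom_eq hG d; have e2 := dom_eq hG d'; rewrite /= in e1 e2.
  have [_ t2 _] := h2 h k Uh Uk e1.
  by split => //=; [rewrite eg e2 e t2|rewrite e' e eg].
 have mr : is_micro ((gr_mul G) \o' ((i_ G) \x (gr_mul G))) by vm.
 have r3 := @comp_graphl R _ _ _ hX3 hX3' hX _ _ _ _ _ mr r2 (isgraph_assoc hX hX hX).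
 apply: (@micro_ext R G:~G:~G G _ _ _ _ r1 r3) => //= c.
 have ca : core G (sval c) := valcore c; move: (sval c) ca => a ca.
 have n2 := near_fst a (near2 (near2 (nU _ ca) (nU _ ca)) (nU _ ca)).
 apply: nearS n2 => -[[[g h] k] l] [[Ug Uh] Uk]; rewrite /K1 /K2.
 split=> -[/= e1 e2 e3]; split => //=; have [_ _ e4] := h3 g h k Ug Uh Uk e1 e2; rewrite e3 e4 //.
- have m1 : is_micro ((micro_e G) \x (i_ G)) by vm.
 have m2 : is_micro ((i_ G) \x (micro_e G)) by vm.
 have [s0 _] := mm; have [s1 _] := m1; have [s2 _] := m2.
 split.
  have [_ rl el _ _] := isgraph_lunit hX.
  have r1 : rep ((gr_mul G) \o' ((micro_e G) \x (i_ G))) [set p | p.2 = p.1.2].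
   apply: (rep_comp hEX hXX hX s1 s0 (tens_rep rep_e (rep_id G)) rep_gr_mul) => c /=.
   have ca : core G (sval c) := valcore c; move: (sval c) ca => a ca; split.
    move=> N nN; have n1 : \forall g \near a, N (gsrc g, g).
     by have := @near_pair G G G gsrc id a N (@csrc a) (@cont_id _ a); rewrite src_fix // => /(_ nN).
    apply: nearS (near_fst a (near_snd 0 (n1 &n (nU _ ca)))) => -[[e g] l] [Ng Ug] ->.
    have [d1 e1 _ _] := h1 g Ug.
    by exists (gsrc g, g); split => //; split; split => //; exact: src_core.
   apply: nearS (near_fst a (near_fst (a, a) (near_snd 0 (nU _ ca)))) => -[[[e g] [x y]] l] Ug [[/= _ cx] eg] [/= d e'].
   have e1 := dom_eq hG d; rewrite /= tgt_fix // in e1.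
   by have [_ e2 _ _] := h1 g Ug; rewrite e' e1 -eg.
  apply: (@micro_ext R (mfunit R):~G G _ _ _ _ r1 rl) => //= c.
  exact: nearT.
 have [_ rl el _ _] := isgraph_runit hX.
 have r1 : rep ((gr_mul G) \o' ((i_ G) \x (micro_e G))) [set p | p.2 = p.1.1].
  apply: (rep_comp hXE hXX hX s2 s0 (tens_rep (rep_id G) rep_e) rep_gr_mul) => c /=.
  have ca : core G (sval c) := valcore c; move: (sval c) ca => a ca; split.
   move=> N nN; have n1 : \forall g \near a, N (g, gtgt g).
    by have := @near_pair G G G id gtgt a N (@cont_id _ a) (@ctgt a); rewrite tgt_fix // => /(_ nN).
   apply: nearS (near_fst a (near_fst 0 (n1 &n (nU _ ca)))) => -[[g e] l] [Ng Ug] ->.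
   have [_ _ d1 e1] := h1 g Ug.
   by exists (g, gtgt g); split => //; split; split => //; exact: tgt_core.
  apply: nearS (near_fst a (near_fst (a, a) (near_fst 0 (nU _ ca)))) => -[[[g e] [x y]] l] Ug [/= eg [/= _ cy]] [/= d e'].
  have e1 := dom_eq hG d; rewrite [gsrc y]src_fix // in e1.
  by have [_ _ _ e2] := h1 g Ug; rewrite e' -e1 -eg.
 apply: (@micro_ext R G:~(mfunit R) G _ _ _ _ r1 rl) => //= c.
 exact: nearT.
Qed.
Lemma nmul a (N : G -> Prop) : core G a -> (\forall z \near a, N z) -> \forall p \near (a, a), gtgt p.1 = gsrc p.2 -> gmul_dom G p /\ N (gmul p).
Proof.
move=> ca nN; have := mul_cont hG (dom_core hG ca) (A := N); rewrite unit_mul // => /(_ nN) n1.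
by apply: nearS (n1 &n (dom_near hG ca)) => p [H1 H2] /H2 d; split => //; exact: H1.
Qed.
(** The map sending [g] to [g], its inverse and its source lands in the graph of the product. The
    last component lies in the lagrangian units and contributes nothing, so isotropy says that the
    form and its pullback by inversion add up to zero. *)
Lemma ginv_anti : exists U : set G, onbhd (core G) U /\ forall q i j, U q -> mdom i q -> mdom j (ginv q) -> exists F, [/\ smooth_at i:@q F,
  \forall z \near q, mdom j (ginv z) /\ j:@(ginv z) = F i:@z &
  forall u v : 'rV[R]_(mdim G), u *m form i q *m v^T = - ((u *m jac F i:@q) *m form j (ginv q) *m (v *m jac F i:@q)^T)].
Proof.
have [U [[oU cU] [h1 h2 h3 h4]]] := axioms_near hG.
exists U; split => // q i j Uq iq jq.
case: hG => -[_ _ _ [_ [_ [od cd] si]] _] _ lV.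
have [dq [s1 t1] [d1 e1] _] := h4 q Uq.
have [F [sF nF]] := smap_ext si dq iq jq.
have {}nF : \forall z \near q, mdom j (ginv z) /\ j:@(ginv z) = F i:@z.
 by apply: nearS (nF &n (open_near od dq)) => z [H /H].
exists F; split => // u v.
have [_ /(_ (gsrc q))[l lq] _ _ _] := hm.
have [Fs [ss ns]] := smap_extT (src_smooth hG) iq lq.
pose M3 := sprod (sopp (sprod G G)) G.
have hM3 : is_symplectic M3 by exact: sprod3_valid.
have Vq : gmul_graph G ((q, ginv q), gsrc q) by split.
have [k [hV [e cV iV]]] := @lagr_atE R M3 hM3 _ ((i, j), l) ((q, ginv q), gsrc q) lV Vq (conj (conj iq jq) lq).
pose K z := z:|(F z):|(Fs z).
have sid := @sm_id R _ i:@q.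
have sK1 : smooth_at i:@q (fun z => z:|(F z)) by apply: sm_row_mx.
have sK : smooth_at i:@q K by apply: sm_row_mx.
have ci : {for q, continuous (ginv : G -> G)}.
 by move=> A nA; have := smap_cont hm hm si dq nA; move=> n1; apply: nearS (n1 &n (open_near od dq)) => z [H /H].
have cf : {for q, continuous (fun g : G => ((g, ginv g), gsrc g))}.
 apply: (@cont_pair _ _ _ (fun g : G => (g, ginv g)) gsrc); last exact: src_cont.
 by apply: (@cont_pair _ _ _ id ginv); [exact: cont_id|exact: ci].
have nK : \forall z \near q, @mcoord R M3 ((i, j), l) ((z, ginv z), gsrc z) = K i:@z.
 by apply: nearS (nF &n ns) => z [[_ ez] [_ ez']] /=; rewrite ez ez'.
have nV : \forall z \near q, gmul_graph G ((z, ginv z), gsrc z).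
 by apply: nearS (open_near oU Uq) => z /h4[_ _ [d ez] _]; split.
have kill := @map_kill R M3 G hm _ i ((i, j), l) q _ _ _ _ iq cf sK nK nV cV.
have {}kill (w : 'rV[R]_(mdim G)) : w:|(w *m jac F i:@q):|(w *m jac Fs i:@q) *m jac hV (@mcoord R M3 ((i, j), l) ((q, ginv q), gsrc q)) = 0.
 have := congr1 (mulmx w) kill; rewrite mulmx0 mulmxA.
 by rewrite jac_row_mx // jac_row_mx // jac_id !mul_mx_row mulmx1.
have [kc [hc [ec cc ic]]] := gpd_core_cut hG (src_core hG q) lq.
have killc := map_kill hm iq (@src_cont _ _ hG q) ss (nearS (fun z => @proj2 _ _) ns) (nearT _ (src_core hG)) cc.
have killc' (w : 'rV[R]_(mdim G)) : w *m jac Fs i:@q *m jac hc l:@(gsrc q) = 0 by rewrite -mulmxA killc mulmx0.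
have := near_pt iV Vq _ _ (kill u) (kill v).
rewrite block_form !row_mxKl !row_mxKr mulmxN mulNmx block_form !row_mxKl !row_mxKr (ic _ _ (killc' u) (killc' v)) addr0 => /eqP.
by rewrite oppr_eq0 addr_eq0 => /eqP.
Qed.
End GpdMonoid.
Lemma src_near (R : realType) (G : pregroupoid R) (hG : gp G) a (A : G -> Prop) : core G a ->
 (\forall z \near a, A z) -> \forall g \near a, A (gsrc g).
Proof. by move=> ca; rewrite -{1}(src_fix hG ca) => nA; have := @src_cont _ _ hG a _ nA. Qed.
Lemma tgt_near (R : realType) (G : pregroupoid R) (hG : gp G) a (A : G -> Prop) : core G a ->
 (\forall z \near a, A z) -> \forall g \near a, A (gtgt g).
Proof. by move=> ca; rewrite -{1}(tgt_fix hG ca) => nA; have := @tgt_cont _ _ hG a _ nA. Qed.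
Lemma cont_prodmap {T U T' U' : topT} (f : T -> T') (g : U -> U') : continuous f -> continuous g ->
 continuous (fun p : T * U => (f p.1, g p.2)).
Proof.
move=> cf cg [x y]; apply: (@cont_pair _ _ _ (fun p : T * U => f p.1) (fun p => g p.2)).
 exact: (@near_fst_cont _ _ _ f x y (cf x)).
exact: (@near_snd_cont _ _ _ g x y (cg y)).
Qed.
Section GpdMor.
Variables (R : realType) (G H : pregroupoid R).
Hypotheses (hG : gp G) (hH : gp H).
Let hX := gpd_mf hG.
Let hY := gpd_mf hH.
Let hXX := mfprodP hX hX.
Let hYY := mfprodP hY hY.
Variable f : premicro G H.
Hypothesis mf' : is_micro f.
Let phi := coremap f.
Section Rep.
Variable V : set (G * H).
Hypothesis rV : rep f V.
Lemma rep_mor_mul : rep (f \o' (gr_mul G)) [set q | gmul_dom G q.1 /\ V (gmul q.1, q.2)].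
Proof.
have [s1 _] := gr_mul_micro hG; have [s2 _] := mf'.
apply: (rep_comp hXX hX hY s1 s2 (rep_gr_mul G) rV) => c.
have ca : core G (sval (phi c)) := valcore (phi c).
split.
 move=> N nN; have n1 := near_fst (val c) (nmul hG ca nN).
 by apply: nearS n1 => -[p h] H1 [d v]; exists (gmul p); split => //; apply: (H1 (dom_eq hG d)).2.
by apply: nearT => -[[p g] h] [/= d e] v; split => //=; rewrite -e.
Qed.
Lemma rep_mul_mor : exists K, rep ((gr_mul H) \o' (f \x f)) K /\ forall c : core H,
 lcomp (rel_prod V V) (gmul_graph H) K (sval (phi c), sval (phi c)) (sval c, sval c) (sval c).
Proof.
have [_ [K [rK lK]]] := comp_lcomp hXX hYY hY (tens_micro hX hY hX hY mf' mf') (gr_mul_micro hH) (tens_rep rV rV) (rep_gr_mul H).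
exists K; split => // c; have := lK c => /=.
by have [-> ->] := core_diag c.
Qed.
(** Composing [f] with the unit of [G] gives the unit of [H], by uniqueness of the morphism from the
    unit object; on representatives this says that [V] relates units only to units. *)
Lemma mor_core (b : core H) : \forall p \near (sval (phi b), sval b), V p -> core G p.1 -> core H p.2.
Proof.
have hE := mfunitP R; have me := micro_e_valid hX.
have [me' [K [rK lK]]] := comp_lcomp hE hX hY me mf' (rep_e G) rV.
have eq : f \o' (micro_e G) = micro_e H by exact: micro_e_uniq.
rewrite eq in rK; have n1 := rep_near rK (rep_e H) b; have [_ n2] := lK b.
have [P [Q [nP nQ PQ]]] := unbox n1.
have [P' [Q' [nP' nQ' PQ']]] := unbox n2; have [P1 [P2 [nP1 nP2 P12]]] := unbox nP'.
apply: nearS (near2 nP2 (nQ &n nQ')) => -[g h] [P2g [Qh Q'h]] v cg.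
have K0 := PQ' ((0, g)) h (P12 0 g (near_pt nP1) P2g) Q'h (conj I cg) v.
by have [/(_ K0)[]] := PQ _ _ (near_pt nP) Qh.
Qed.
End Rep.
Lemma gr_core (p : G * H) : gr phi p -> core G p.1 /\ core H p.2.
Proof. by move=> [b ->]; split; exact: valcore. Qed.
Lemma gr_inj (p q : G * H) : gr phi p -> gr phi q -> p.2 = q.2 -> p.1 = q.1.
Proof. by move=> [b ->] [b' ->] /val_inj ->. Qed.
(** Closure of the subgroupoid under products gives one inclusion of representatives, and
    [micro_sub_eq] upgrades it to equality. *)
Lemma gpd_mor_monoid : is_groupoid_mor f -> f \o' (gr_mul G) = (gr_mul H) \o' (f \x f).
Proof.
move=> [_ [_ _ [V [rV [_ _ hst [U [[oU cU] hmul _]]]]]]].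
have rK1 := rep_mor_mul rV; have [K [rK2 lK]] := rep_mul_mor rV.
have m1 := comp_micro hXX hX hY (gr_mul_micro hG) mf'.
have m2 := comp_micro hXX hYY hY (tens_micro hX hY hX hY mf' mf') (gr_mul_micro hH).
apply/esym/(micro_sub_eq hXX hY m2 m1 rK2 rK1) => b /=; first by have [-> ->] := core_diag b.
have [-> ->] := core_diag b.
have ca : core G (sval (phi b)) := valcore (phi b); have cb : core H (sval b) := valcore b.
have [A [B [nA nB AB]]] : exists A B, [/\ \forall z \near sval (phi b), A z, \forall z \near sval b, B z & forall x y, A x -> B y -> U (x, y)].
 by apply: unbox; apply: (open_near oU); apply: cU; exists b.
have n2 := nearI (dom_near hH cb) (near2 nB nB).
have [lK1 _] := lK b.
apply: nearS ((lK1 _ n2) &n (near_fst (sval b) ((dom_near hG ca) &n (near2 nA nA)))).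
move=> [[g1 g2] h] [Kq [dG [A1 A2]]] /Kq[[h1 h2] [[/= dH [B1 B2]] [/= v1 v2] [/= d e]]].
have e1 := dom_eq hH d; rewrite /= in e1.
have [_ t1] := hst _ v1; have [s2 _] := hst _ v2.
(* The targets of the first pair and the sources of the second both lie on the graph of the core
   map, over the same unit of [H]; composability in [H] thus forces it in [G]. *)
have e2 : gtgt g1 = gsrc g2 by exact: (gr_inj t1 s2 e1).
have d' := dG e2; split => //; rewrite e.
exact: (hmul (g1, h1) (g2, h2) v1 v2 (AB _ _ A1 B1) (AB _ _ A2 B2) (conj d' d)).
Qed.
Section Converse.
Hypothesis mmul : f \o' (gr_mul G) = (gr_mul H) \o' (f \x f).
Variable V : set (G * H).
Hypotheses (rV : rep f V) (Vcore : V `&` (core G `*` core H) = gr phi).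
Variable b : core H.
Let a := sval (phi b).
Let c := sval b.
Let ca : core G a := valcore (phi b).
Let cc : core H c := valcore b.
(** The first half of [lcomp] for [gr_mul H] after [f \x f], read through the equation [mmul]: a
    factorization in [G] is matched by one in [H] with factors as close to the unit as wanted. *)
Lemma mor_factor (N : H -> Prop) : (\forall h \near c, N h) -> exists A B, [/\ \forall g \near a, A g, \forall h \near c, B h &
 forall g1 g2 h, A g1 -> A g2 -> B h -> gmul_dom G (g1, g2) -> V (gmul (g1, g2), h) ->
  exists h1 h2, [/\ N h1, N h2, V (g1, h1), V (g2, h2) & gmul_dom H (h1, h2) /\ h = gmul (h1, h2)]].
Proof.
move=> nN; have rK1 := rep_mor_mul rV; have [K [rK2 lK]] := rep_mul_mor rV.
have e0 : val (coremap (f \o' (gr_mul G)) b) = (a, a) by [].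
have := lK b; rewrite -mmul in rK2; have n1 := rep_near rK1 rK2 b; rewrite e0 in n1.
move=> [/(_ _ (near2 nN nN)) n2 _].
have [P [B [nP nB PB]]] := unbox (n1 &n n2); have [A1 [A2 [nA1 nA2 A12]]] := unbox nP.
exists (fun g => A1 g /\ A2 g), B; split => //; first exact: nearI.
move=> g1 g2 h [A11 _] [_ A22] Bh d v.
have [/= [k12 _] kk] := PB _ _ (A12 _ _ A11 A22) Bh.
have [[h1 h2] [[/= N1 N2] [/= v1 v2] [/= d' e]]] := kk (k12 (conj d v)).
by exists h1, h2.
Qed.
(** The second half of [lcomp] for the same composite, read back through [mmul] as membership in the
    representative of [f \o' gr_mul G]. *)
Lemma mor_mul_closed : \forall x \near ((a, c), (a, c)), V x.1 -> V x.2 -> gmul_dom G (x.1.1, x.2.1) -> gmul_dom H (x.1.2, x.2.2) ->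
 V (gmul (x.1.1, x.2.1), gmul (x.1.2, x.2.2)).
Proof.
have rK1 := rep_mor_mul rV; have [K [rK2 lK]] := rep_mul_mor rV.
have e0 : val (coremap (f \o' (gr_mul G)) b) = (a, a) by [].
have [_ n2] := lK b; rewrite -mmul in rK2; have n1 := rep_near rK1 rK2 b; rewrite e0 in n1.
have [P [B [nP nB PB]]] := unbox n1; have [A1 [A2 [nA1 nA2 A12]]] := unbox nP.
have [Q [B' [nQ nB' QB]]] := unbox n2; have [Q1 [Q2 [nQ1 nQ2 Q12]]] := unbox nQ.
have [A1' [A2' [nA1' nA2' A12']]] := unbox nQ1.
have nq2 := nearI nQ2 (nmul hH cc (nB &n nB')); have [C1 [C2 [nC1 nC2 C12]]] := unbox nq2.
apply: nearS (near2 (near2 (nA1 &n nA1') nC1) (near2 (nA2 &n nA2') nC2)).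
move=> [[g1 h1] [g2 h2]] [[[p1 p2] p3] [[p4 p5] p6]] v1 v2 d1 d2.
have [q2 /(_ (dom_eq hH d2))[_ [Bh B'h]]] := C12 _ _ p3 p6.
have k := QB _ (gmul (h1, h2)) (Q12 _ _ (A12' _ _ p2 p5) q2) B'h (conj v1 v2) (conj d2 erefl).
by have [_ /(_ k)[]] := PB _ _ (A12 _ _ p1 p4) Bh.
Qed.
Let grI g h : V (g, h) -> core G g -> core H h -> gr phi (g, h).
Proof. by move=> v cg ch; rewrite -Vcore. Qed.
(** Factor [g = s(g) g]: the factor of [h] related to the unit [s(g)] is a unit by [mor_core], hence
    equals [s(h)]. The factorization [g = g t(g)] gives the targets. *)
Lemma mor_src_tgt : \forall x \near (a, c), V x -> gr phi (gsrc x.1, gsrc x.2) /\ gr phi (gtgt x.1, gtgt x.2).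
Proof.
have [U [[oU cU] [h1 _ _ _]]] := axioms_near hG; have [U' [[oU' cU'] [h1' h2' _ _]]] := axioms_near hH.
have [C [D [nC nD CD]]] := unbox (mor_core rV b).
have [A [B [nA nB AB]]] := mor_factor (nD &n (open_near oU' (cU' _ cc))).
have nCA := nearI nA nC.
have ns := src_near hG ca nCA.
have nt := tgt_near hG ca nCA.
apply: nearS (near2 ((ns &n nt) &n nA &n (open_near oU (cU _ ca))) nB).
move=> [g h] [[[[As Cs] [At Ct]] [Ag Ug]] Bh] v; have [d1 e1 d2 e2] := h1 g Ug.
split.
 have [|k1 [k2 [[D1 U1] [D2 U2] v1 v2 [d e]]]] := AB (gsrc g) g h As Ag Bh d1; first by rewrite e1.
 have ck : core H k1 := CD _ _ Cs D1 v1 (src_core hG g).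
 have [_ + _] := h2' k1 k2 U1 U2 (dom_eq hH d); rewrite -e (src_fix hH ck) => ->.
 by apply: grI => //; exact: src_core.
have [|k1 [k2 [[D1 U1] [D2 U2] v1 v2 [d e]]]] := AB g (gtgt g) h Ag At Bh d2; first by rewrite e2.
have ck : core H k2 := CD _ _ Ct D2 v2 (tgt_core hG g).
have [_ _ +] := h2' k1 k2 U1 U2 (dom_eq hH d); rewrite -e (tgt_fix hH ck) => ->.
by apply: grI => //; exact: tgt_core.
Qed.
(* If (g^-1, g) factors as (h1, h2) with h1 h2 = t h, then (g g^-1, h h1) is close to a unit, so h h1 is a unit. *)
Lemma mor_inv_closed : ginv a = a -> ginv c = c -> \forall x \near (a, c), V x -> V (ginv x.1, ginv x.2).
Proof.
move=> fa fc.
have [U [[oU cU] [u1 u2 u3 u4]]] := axioms_near hG; have [U' [[oU' cU'] [h1 h2 h3 h4]]] := axioms_near hH.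
have [M1 [M2 [nM1 nM2 M12]]] := unbox mor_mul_closed.
have [P1 [Q1 [nP1 nQ1 PQ1]]] := unbox nM1; have [P2 [Q2 [nP2 nQ2 PQ2]]] := unbox nM2.
have [C [D [nC nD CD]]] := unbox (mor_core rV b).
have nU' := open_near oU' (cU' _ cc).
have [D1 [D2 [nD1 nD2 D12]]] := unbox (nmul hH cc nD).
have [A [B [nA nB AB]]] := mor_factor ((nQ2 &n nD2) &n nU').
have n1 : \forall g \near a, A (ginv g) /\ P2 (ginv g) by have := inv_cont hG ca (A := fun g => A g /\ P2 g); rewrite fa => /(_ (nA &n nP2)).
have n2 : \forall h \near c, U' (ginv h) by apply: (inv_cont hH cc); rewrite fc.
have n3 := src_near hG ca nC.
have n4 := tgt_near hH cc nB.
have nG := nearI (n1 &n n3) ((nA &n nP1) &n (open_near oU (cU _ ca))).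
have nH := nearI (n2 &n n4) ((nD1 &n nQ1) &n nU').
apply: nearS (mor_src_tgt &n (near2 nG nH)) => -[g h] [st [[[[Ai Pi] Cs] [[Ag Pg] Ug]] [[Ui Bt] [[Dh Qh] Uh]]]] v.
have [_ grt] := st v; have [_ [si ti] [d1 e1] [d2 e2]] := u4 g Ug.
have [|k1 [k2 [[[Q2k D2k] Uk] [_ Uk2] v1 _ [d e]]]] := AB (ginv g) g (gtgt h) Ai Ag Bt d2.
 by rewrite e2; have [v0 _] : (V `&` (core G `*` core H)) (gtgt g, gtgt h) by rewrite Vcore.
have [_ [sih tih] [dh eh] [dh' eh']] := h4 h Uh.
have sk : gsrc k1 = gtgt h by have [_ + _] := h2 k1 k2 Uk Uk2 (dom_eq hH d); rewrite -e (src_fix hH (tgt_core hH h)).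
have [dhk Dhk] := D12 _ _ Dh D2k (esym sk).
have v3 := M12 _ _ (PQ1 _ _ Pg Qh) (PQ2 _ _ Pi Q2k) v v1 d1 dhk.
rewrite e1 in v3; have chk : core H (gmul (h, k1)) := CD _ _ Cs Dhk v3 (src_core hG g).
have [_ shk _] := h2 h k1 Uh Uk (esym sk); rewrite src_fix // in shk.
have [_ _ eA] := h3 (ginv h) h k1 Ui Uh Uk tih (esym sk).
have [_ ek _ _] := h1 k1 Uk; have [_ _ _ ei] := h1 (ginv h) Ui.
by rewrite eh' shk -sk ek -tih ei in eA; rewrite -eA.
Qed.
End Converse.
Let M := sprod (sopp G) H.
Let hM : is_symplectic M := sprodP (soppP (gpd_sympl hG)) (gpd_sympl hH).
Let iota (x : M) : M := (ginv x.1, ginv x.2).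
Lemma gpd_anti_prod : exists D : set M, onbhd (core G `*` core H) D /\ forall q i j, D q -> mdom i q -> mdom j (iota q) ->
 exists F, [/\ smooth_at i:@q F,
  \forall z \near q, mdom j (iota z) /\ j:@(iota z) = F i:@z &
  forall u v : 'rV[R]_(mdim M), u *m form i q *m v^T =
   - ((u *m jac F i:@q) *m form j (iota q) *m (v *m jac F i:@q)^T)].
Proof.
have [U [[oU cU] HU]] := ginv_anti hG; have [U' [[oU' cU'] HU']] := ginv_anti hH.
exists (U `*` U'); split; first by split; [exact: open_box|move=> [g h] [/= /cU ? /cU' ?]].
move=> [g h] [i i'] [j j'] [/= Ug Uh] [/= ig ih] [/= jg jh].
have [F [sF nF aF]] := HU g i j Ug ig jg; have [F' [sF' nF' aF']] := HU' h i' j' Uh ih jh.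
exists (fprodmx F F'); split; first exact: smooth_prodmx.
 apply: nearS (near2 nF nF') => -[g' h'] [[d e] [d' e']].
 by split => //; rewrite /fprodmx row_mxKl row_mxKr e e'.
move=> u v; rewrite jac_prodmx // !block_form !mul_block_row !row_mxKl !row_mxKr.
by rewrite mulmxN mulNmx mulmxN mulNmx aF aF' !opprD.
Qed.
Lemma monoid_mor_gpd : f \o' (gr_mul G) = (gr_mul H) \o' (f \x f) -> is_groupoid_mor f.
Proof.
move=> mm; have [V [rV Vcore lV Vall]] := is_micro_rep hX hY mf'.
pose P : set M := gr phi.
have PV : P `<=` V by rewrite /P -Vcore => p [].
have fst_core p : P p -> core G p.1 /\ core H p.2 by exact: gr_core.
have [D0 [[oD0 cD0] HD0]] := gpd_anti_prod.
have [U [[oU cU] [u1 u2 u3 u4]]] := axioms_near hG; have [U' [[oU' cU'] [h1 h2 h3 h4]]] := axioms_near hH.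
pose st (x : M) := V x -> gr phi (gsrc x.1, gsrc x.2) /\ gr phi (gtgt x.1, gtgt x.2).
(* On [D] inversion reverses the form, and [V] is compatible with source and target. *)
pose D : set M := (D0 `&` (U `*` U')) `&` interior st.
have oD : onbhd P D.
 split; first by apply: openI; [apply: openI => //; exact: open_box|exact: open_interior].
 move=> _ [b ->]; have ca : core G (sval (phi b)) := valcore (phi b); have cb : core H (sval b) := valcore b.
 by split; [split; [exact: cD0|split; [exact: cU|exact: cU']]|exact: (mor_src_tgt mm rV Vcore b)].
pose sg (x : M) : M := (gsrc x.1, gsrc x.2); pose tg (x : M) : M := (gtgt x.1, gtgt x.2).
have csg : continuous sg.
 exact: (@cont_prodmap G H G H gsrc gsrc (@src_cont _ _ hG) (@src_cont _ _ hH)).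
have ctg : continuous tg.
 exact: (@cont_prodmap G H G H gtgt gtgt (@tgt_cont _ _ hG) (@tgt_cont _ _ hH)).
have sgP p : P p -> sg p = p by move=> /fst_core[c1 c2]; rewrite /sg !src_fix; case: p c1 c2.
have tgP p : P p -> tg p = p by move=> /fst_core[c1 c2]; rewrite /tg !tgt_fix; case: p c1 c2.
have inv p : D p -> [/\ sg (iota p) = tg p, tg (iota p) = sg p & ginv_dom G p.1 /\ ginv_dom H p.2].
 by move=> [[_ [/u4[d [e1 e2] _ _] /h4[d' [e1' e2'] _ _]]] _]; rewrite /sg /tg /iota e1 e2 e1' e2'.
have anti q i j (Dq : D q) := HD0 q i j Dq.1.1.
have fixed p : P p -> iota p = p -> \forall q \near p, V q -> V (iota q).
 by move=> [b ->] [e1 e2]; exact: (mor_inv_closed mm rV Vcore).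
have [V' [E [[[oE PE] ED] lV' VE VV' iV]]] := inv_closure hM lV oD anti csg ctg sgP tgP (fun q Dq => let: And3 a _ _ := inv q Dq in a) fixed.
have stV p : V p -> E p -> P (sg p) /\ P (tg p) by move=> v e; exact: (near_pt (ED _ e).2 v).
have V'I p : V p -> E p -> V' p by move=> v e; have [] : (V' `&` E) p by rewrite VE.
have V'E p : V' p -> E p -> V p by move=> v e; have [] : (V `&` E) p by rewrite -VE.
split => //; split.
- have [sphi _] := mf'; have [sY [kY eY _]] := hY; exists kY.
 have [hMm _ _ _] := hM; apply: (@cut_submanifold R (mprod G H) hMm kY (mdim G + kY)%N P).
  by rewrite /= eY -addnn addnCA.
 move=> p [b ->]; have [_ /(_ (val (phi b)))[i ia] _ _ _] := gpd_manifold hG.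
 have [_ /(_ (val b))[j jb] _ _ _] := gpd_manifold hH.
 have [k [h [ek ch _]]] := core_lagr hY (valcore b) jb.
 have kk : k = kY by apply: double_inj; rewrite -ek -eY.
 rewrite kk in h ch *; have [F [h' [_ ch' _ _ _]]] := gr_cut hX sphi ia jb ch eY.
 by exists (i, j), h'.
- by move=> p /fst_core.
exists V'; split.
 rewrite rV; apply: germ_ext; exists E => //.
split => //.
- by move=> p Pp; apply: V'I; [exact: PV|exact: PE].
- move=> p /VV'[[v e]|[q [v e ->]]]; first exact: stV.
 by have [e1 e2 _] := inv q (ED _ e); have [c1 c2] := stV q v e; rewrite -e1 -e2 in c1 c2.
(* Closure under products is known near each point of the core graph. Composable elements [x], [x']
   share the point [tg x = sg x'], so over a thin neighbourhood they lie in one box. *)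
pose Box (N' : set M) (_ : set M) := forall x x', N' x -> N' x' -> V x -> V x' -> gmul_dom G (x.1, x'.1) -> gmul_dom H (x.2, x'.2) ->
 V (gmul (x.1, x'.1), gmul (x.2, x'.2)) /\ E (gmul (x.1, x'.1), gmul (x.2, x'.2)).
have [hMm _ _ _] := hM; have [[_ scM] _ _ _ _] := hMm.
have [|U2 [[oU2 cU2] HU2 _]] := @thin M M [set q | P q.1 /\ q.2 = q.1] Box scM (manifold_regular hMm).
 move=> n0 p [/= [b en] ->].
 have ca : core G (sval (phi b)) := valcore (phi b); have cb : core H (sval b) := valcore b.
 have nE : \forall p \near (sval (phi b), sval b), E p by apply: open_near => //; apply: PE; exists b.
 have [A [B [nA nB AB]]] := unbox nE.
 have [A1 [A2 [nA1 nA2 A12]]] := unbox (nmul hG ca nA); have [B1 [B2 [nB1 nB2 B12]]] := unbox (nmul hH cb nB).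
 have [M1 [M2 [nM1 nM2 M12]]] := unbox (mor_mul_closed mm rV b).
 have nn := nearI (nM1 &n nM2) ((near2 nA1 nB1) &n (near2 nA2 nB2)).
 exists (interior [set x | (M1 x /\ M2 x) /\ ((A1 x.1 /\ B1 x.2) /\ (A2 x.1 /\ B2 x.2))]), setT; split.
 - move=> x x' /interior_subset/= [[m1 _] [[a1 b1] _]] /interior_subset/= [[_ m2] [_ [a2 b2]]] v v' d d'; split.
   exact: M12 _ _ m1 m2 v v' d d'.
  by apply: AB; [exact: (A12 _ _ a1 a2 (dom_eq hG d)).2|exact: (B12 _ _ b1 b2 (dom_eq hH d')).2].
 - exact: open_interior.
 - rewrite en; apply: nearS (open_near (@open_interior _ _) (nn : interior _ _)) => p' Sp; split => // n' [_ <-]; exact: Sp.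
exists (E `&` [set x | U2 (x, sg x) /\ U2 (x, tg x)]); split.
- split.
  apply: openI => //; apply: open_of_near => q [q1 q2]; apply: nearI.
   exact: (near_pre (cont_pair (@cont_id _ q) (@csg q)) (open_near oU2 q1)).
  exact: (near_pre (cont_pair (@cont_id _ q) (@ctg q)) (open_near oU2 q2)).
 by move=> p Pp; split; [exact: PE|rewrite /= sgP // tgP //; split; exact: cU2].
- move=> x x' v v' [e [_ t]] [e' [s _]] [d d'].
 have st' : tg x = sg x' by rewrite /tg /sg (dom_eq hG d) (dom_eq hH d').
 have [N' [N2 [bx _ HN]]] := HU2 _ _ t; rewrite -st' in s.
 have [w we] := bx x x' (HN _ t) (HN _ s) (V'E _ v e) (V'E _ v' e') d d'.
 exact: V'I.
- by move=> x v [e _] _; apply: iV => //; exact: V'E.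
Qed.
End GpdMor.

(** * Products of symplectic groupoids *)

Section GpdProd.
Variable R : realType.
Lemma smap_intro (M N : premanifold R) (S : set M) (f : M -> N) : (forall x i j, S x -> mdom i x -> mdom j (f x) ->
  exists F, smooth_at i:@x F /\ \forall z \near x, S z -> mdom j (f z) /\ j:@(f z) = F i:@z) ->
 @smooth_map R M N S (fun y => f (val y)).
Proof.
move=> H x i j ix jx; have [F [sF nF]] := H (val x) i j (set_mem (valP x)) ix jx; exists F; split => //.
by apply: nearS nF => z Hz y ez; rewrite ez; apply: Hz; rewrite -ez; exact: set_mem (valP y).
Qed.
Lemma smap_prod (M N M' N' : premanifold R) (S : set M) (S' : set M') (f : M -> N) (f' : M' -> N') :
 @smooth_map R M N S (fun y => f (val y)) -> @smooth_map R M' N' S' (fun y => f' (val y)) ->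
 @smooth_map R (mprod M M') (mprod N N') (S `*` S') (fun y => (f (val y).1, f' (val y).2)).
Proof.
move=> sf sf'; apply: (@smap_intro (mprod M M') (mprod N N') _ (fun y => (f y.1, f' y.2))) => -[x x'] [i i'] [j j'] [/= Sx Sx'] [/= ix ix'] [/= jx jx'].
have [F [sF nF]] := smap_ext sf Sx ix jx; have [F' [sF' nF']] := smap_ext sf' Sx' ix' jx'.
exists (fprodmx F F'); split; first exact: smooth_prodmx.
apply: nearS (near2 nF nF') => -[z z'] [Hz Hz'] [/Hz[d e] /Hz'[d' e']]; split => //.
by rewrite /fprodmx row_mxKl row_mxKr e e'.
Qed.
Variables G H : pregroupoid R.
Hypotheses (hG : gp G) (hH : gp H).
Let hX := gpd_mf hG.
Let hY := gpd_mf hH.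
Let hXY := mfprodP hX hY.
Let mG := gpd_manifold hG.
Let mH := gpd_manifold hH.
Lemma submersion_prod (f : G -> G) (f' : H -> H) : @smooth_map R G G setT (fun y => f (val y)) -> @smooth_map R H H setT (fun y => f' (val y)) ->
 (forall g, core G (f g)) -> (forall h, core H (f' h)) ->
 submersion_to f (core G) -> submersion_to f' (core H) ->
 @submersion_to R (mprod G H) (mprod G H) (fun x => (f x.1, f' x.2)) (core G `*` core H).
Proof.
move=> sf sf' cf cf' sub sub' [x x'] [i i'] [j j'] [/= ix ix'] [/= jx jx'] F sF nFF v tv.
have [F1 [sF1 nF1]] := smap_extT sf ix jx; have [F2 [sF2 nF2]] := smap_extT sf' ix' jx'.
have [k [h ch]] := gpd_core_cut hG (cf x) jx; have [k' [h' ch']] := gpd_core_cut hH (cf' x') jx'.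
have [_ cc cc2] := core_cut_prod ch ch'; have [e1 c1 _] := ch; have [e2 c2 _] := ch'.
have [[_ s1 _ _] [_ s2 _ _]] := (c1, c2).
have e3 : mdim (mprod G H) = ((k + k') + (k + k'))%N by rewrite /= e1 e2 -!addnn addnACA.
have mP := mprodP mG mH.
have Cc : (core G `*` core H) (f x, f' x') by split; [exact: cf|exact: cf'].
have := iffLR (tangent_cut mP v e3 cc Cc) tv; rewrite -[v](@hsubmxK _ _ (mdim G) (mdim H)).
move=> /(fprod_ker _ _ s1 s2)[k1 k2].
have [u1 d1] := sub x i j ix jx F1 sF1 (nearS (fun _ => @proj2 _ _) nF1) _ (iffRL (tangent_cut mG _ (etrans e1 (esym (addnn k))) c1 (cf x)) k1).
have [u2 d2] := sub' x' i' j' ix' jx' F2 sF2 (nearS (fun _ => @proj2 _ _) nF2) _ (iffRL (tangent_cut mH _ (etrans e2 (esym (addnn k'))) c2 (cf' x')) k2).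
rewrite deriveJ in d1; rewrite deriveJ // in d2.
exists u1:|u2; rewrite deriveJ // -d1 -d2.
have -> : jac F (@mcoord R (mprod G H) (i, i') (x, x')) = jac (fprodmx F1 F2) i:@x:|i':@x'.
 apply: jac_ext => //; apply: (@near_chart R (mprod G H) mP (i, i') (x, x')) => //.
 apply: nearS (nFF &n (near2 nF1 nF2)) => -[y y'] [<- [[_ e] [_ e']]].
 by rewrite /fprodmx row_mxKl row_mxKr e e'.
by rewrite jac_prodmx // mul_block_row row_mxKl row_mxKr.
Qed.
(** Regroups the six tangent components: three pairs from [G] and [H] become a triple from [G]
    followed by a triple from [H]. [Q3] undoes it. *)
Let P3 : 'M[R]_((mdim G + mdim H + (mdim G + mdim H)) + (mdim G + mdim H), (mdim G + mdim G + mdim G) + (mdim H + mdim H + mdim H)) :=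
 block_mx (swap_mx R (mdim G) (mdim H) (mdim G) (mdim H)) 0 0 1%:M *m swap_mx R (mdim G + mdim G) (mdim H + mdim H) (mdim G) (mdim H).
Let Q3 := swap_mx R (mdim G + mdim G) (mdim G) (mdim H + mdim H) (mdim H) *m block_mx (swap_mx R (mdim G) (mdim G) (mdim H) (mdim H)) 0 0 1%:M.
Let P3E (a a' a'' : 'rV[R]_(mdim G)) (b b' b'' : 'rV[R]_(mdim H)) :
 a:|b:|(a':|b'):|(a'':|b'') *m P3 = a:|a':|a'':|(b:|b':|b'').
Proof. by rewrite /P3 mulmxA mul_block_row row_mxKl row_mxKr swap_mxE mulmx1 swap_mxE. Qed.
Let Q3P : Q3 *m P3 = 1%:M.
Proof.
rewrite /Q3 /P3 -mulmxA [block_mx _ _ _ _ *m (_ *m _)]mulmxA mulmx_block.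
by rewrite !mulmx0 !mul0mx !addr0 !add0r swap_mxK mulmx1 -scalar_mx_block mul1mx swap_mxK.
Qed.
Let form_shuffle (a a' a'' c c' c'' : 'rV[R]_(mdim G)) (b b' b'' d d' d'' : 'rV[R]_(mdim H)) A A' A'' B B' B'' :
 a:|b:|(a':|b'):|(a'':|b'') *m
  block_mx (- block_mx (block_mx A 0 0 B) 0 0 (block_mx A' 0 0 B')) 0 0 (block_mx A'' 0 0 B'') *m
  (c:|d:|(c':|d'):|(c'':|d''))^T =
 a:|a':|a'':|(b:|b':|b'') *m
  block_mx (block_mx (- block_mx A 0 0 A') 0 0 A'') 0 0 (block_mx (- block_mx B 0 0 B') 0 0 B'') *m
  (c:|c':|c'':|(d:|d':|d''))^T.
Proof.
do 4 rewrite ?block_form ?row_mxKl ?row_mxKr ?mulmxN ?mulNmx.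
by rewrite !opprD !addrA; apply/matrixP => x y; rewrite !mxE; ring.
Qed.
Lemma gprod_graph : @is_lagrangian R (sprod (sopp (sprod (gprod G H) (gprod G H))) (gprod G H)) (gmul_graph (gprod G H)).
Proof.
have [_ sG lG] := hG; have [_ sH lH] := hH.
pose MG := sprod (sopp (sprod G G)) G; pose MH := sprod (sopp (sprod H H)) H.
pose M := sprod (sopp (sprod (sprod G H) (sprod G H))) (sprod G H).
have hMG : is_symplectic MG := sprodP (soppP (sprodP sG sG)) sG.
have hMH : is_symplectic MH := sprodP (soppP (sprodP sH sH)) sH.
have hGH := sprodP sG sH.
have hM : is_symplectic M := sprodP (soppP (sprodP hGH hGH)) hGH.
have [hMm _ _ _] := hM; have hNm := mprodP (let: And4 a _ _ _ := hMG in a) (let: And4 a _ _ _ := hMH in a).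
have [kG eG _] := lG; have [kH eH _] := lH.
apply: (@lagr_atI _ M (kG + kH)%N _ hM).
 by rewrite doubleD -eG -eH /=; lia.
move=> p vp.
have [_ /(_ p)[[[[i i'] [j j']] [l l']] [[[/= ii ii'] [/= jj jj']] [/= ll ll']]] _ _ _] := hMm.
pose T (p : M) : sprod MG MH := (((p.1.1.1, p.1.2.1), p.2.1), ((p.1.1.2, p.1.2.2), p.2.2)).
have [[d1 d2] e0] := vp.
have v1 : gmul_graph G (T p).1 by split; rewrite /T e0.
have v2 : gmul_graph H (T p).2 by split; rewrite /T e0.
have [k1 [h1 c1]] := @lagr_atE R MG hMG _ ((i, j), l) _ lG v1 (conj (conj ii jj) ll).
have [k2 [h2 c2]] := @lagr_atE R MH hMH _ ((i', j'), l') _ lH v2 (conj (conj ii' jj') ll').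
have lc := lagr_prod hMG hMH c1 c2.
have cT : {for p, continuous T}.
 move=> A nA; have [A1 [A2 [n1 n2 A12]]] := unbox nA.
 have [B1 [B2 [m1 m2 B12]]] := unbox n1; have [B1' [B2' [m1' m2' B12']]] := unbox n2.
 have [C1 [C2 [q1 q2 C12]]] := unbox m1; have [C1' [C2' [q1' q2' C12']]] := unbox m1'.
 have := near2 (near2 (near2 q1 q1') (near2 q2 q2')) (near2 m2 m2').
 case: (p) => [[[? ?] [? ?]] [? ?]]; apply: nearS => q [[[/C12 H1 /C12' H2] [/H1 H3 /H2 H4]] [H5 H6]].
 by apply: A12; [exact: B12|exact: B12'].
have pd : @mdom R M (((i, i'), (j, j')), (l, l')) p by [].
exists (((i, i'), (j, j')), (l, l')), (k1 + k2)%N, (fprodmx h1 h2 \o mulmx^~ P3).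
have -> : gmul_graph (gprod G H) = T @^-1` (gmul_graph G `*` gmul_graph H) :> set M.
 apply/seteqP; split=> [[[[a a'] [b b']] [c c']] [[/= d d'] [-> ->]]|[[[a a'] [b b']] [c c']] [[/= d ->] [/= d' ->]]] //.
apply: (@lagr_pull R M (sprod MG MH) (((i, i'), (j, j')), (l, l')) (((i, j), l), ((i', j'), l')) T p P3 Q3 _ _ _ hMm hNm pd cT Q3P _ _ lc).
 by rewrite /=; lia.
apply: nearT => y; split; first by rewrite P3E.
move=> u v; have [u1 [u2 [u3 ->]]] := row3L u; have [v1' [v2' [v3 ->]]] := row3L v.
rewrite -[u1]hsubmxK -[u2]hsubmxK -[u3]hsubmxK -[v1']hsubmxK -[v2']hsubmxK -[v3]hsubmxK !P3E.
exact: form_shuffle.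
Qed.
Lemma gprod_axioms : groupoid_axioms_near_units (gprod G H).
Proof.
have [[_ _ _ _ [U [[oU cU] u1 u2 u3 u4]]] _ _] := hG; have [[_ _ _ _ [U' [[oU' cU'] u1' u2' u3' u4']]] _ _] := hH.
exists (U `*` U'); split.
- by split; [exact: open_box|move=> [g h] [/= /cU ? /cU' ?]].
- by move=> [g h] [/= /u1[d1 e1 d2 e2] /u1'[d1' e1' d2' e2']]; split => //; congr pair.
- move=> [g g'] [h h'] [/= Ug Ug'] [/= Uh Uh'] [e e'].
 by have [d1 e1 e2] := u2 g h Ug Uh e; have [d1' e1' e2'] := u2' g' h' Ug' Uh' e'; split => //; congr pair.
- move=> [g g'] [h h'] [k k'] [/= Ug Ug'] [/= Uh Uh'] [/= Uk Uk'] [e e'] [f f'].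
 by have [d1 e1 e2] := u3 g h k Ug Uh Uk e f; have [d1' e1' e2'] := u3' g' h' k' Ug' Uh' Uk' e' f'; split => //; congr pair.
- move=> [g h] [/= /u4[d [e1 e1'] [d1 e2] [d2 e3]] /u4'[d' [f1 f1'] [d1' f2] [d2' f3]]].
 by split; split => //; congr pair.
Qed.
Lemma gprod_valid : gp (gprod G H).
Proof.
have [[[_ _] _ [ss st bs bt] [[W [oW cW] eW] [sm [od cd] si]] _] sG _] := hG.
have [[[_ _] _ [ss' st' bs' bt'] [[W' [oW' cW'] eW'] [sm' [od' cd'] si']] _] sH _] := hH.
have [sGH [k _ [sub _]]] := hXY; have mGH := mprodP mG mH.
split => //; last exact: gprod_graph.
split; last exact: gprod_axioms.
- by split => //; exists k.
- split; first by move=> [g h]; split; split; solve [exact: src_core|exact: tgt_core].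
 by move=> [g h] [/= cg ch]; rewrite !src_fix // !tgt_fix.
- have T2 : [set: gprod G H] = [set: G] `*` [set: H] by apply/seteqP; split.
 split.
 + rewrite T2; exact: (smap_prod ss ss').
 + rewrite T2; exact: (smap_prod st st').
 + exact: (submersion_prod ss ss' (src_core hG) (src_core hH) bs bs').
 + exact: (submersion_prod st st' (tgt_core hG) (tgt_core hH) bt bt').
- split.
  exists [set p : gprod G H * gprod G H | W (p.1.1, p.2.1) /\ W' (p.1.2, p.2.2)].
   split; last by move=> [[g h] [g' h']] [[cg ch] [-> ->]]; split; [exact: cW|exact: cW'].
   apply: open_of_near => -[[g h] [g' h']] [w w'].
   have [A [B [nA nB AB]]] := unbox (open_near oW w); have [A' [B' [nA' nB' AB']]] := unbox (open_near oW' w').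
   by apply: nearS (near2 (near2 nA nA') (near2 nB nB')) => -[[x y] [x' y']] [[a b] [a' b']]; split; [exact: AB|exact: AB'].
  rewrite /= eW eW'; apply/seteqP; split=> [[[g h] [g' h']] [[w /= ->] [w' ->]]|[[g h] [g' h']] [[w w'] [e e']]] //.
 split.
 + apply: (@smap_intro (mprod (mprod G H) (mprod G H)) (mprod G H) _ (fun p => (gmul (p.1.1, p.2.1), gmul (p.1.2, p.2.2)))).
  move=> [[g h] [g' h']] [[i i'] [j j']] [l l'] [d d'] [[/= ig ih] [/= jg jh]] [/= lg lh].
  have [F [sF nF]] := smap_ext (M := mprod G G) (i := (i, j)) sm d (conj ig jg) lg.
  have [F' [sF' nF']] := smap_ext (M := mprod H H) (i := (i', j')) sm' d' (conj ih jh) lh.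
  exists (fprodmx F F' \o mulmx^~ (swap_mx R (mdim G) (mdim H) (mdim G) (mdim H))); split.
   by apply: sm_comp; [exact: sm_mulmx|rewrite swap_mxE; exact: smooth_prodmx].
  have [A [B [nA nB AB]]] := unbox nF; have [A' [B' [nA' nB' AB']]] := unbox nF'.
  apply: nearS (near2 (near2 nA nA') (near2 nB nB')) => -[[x y] [x' y']] /= [[a b] [a' b']] [e e'].
  have [m1 f1] := AB _ _ a a' e; have [m2 f2] := AB' _ _ b b' e'; split => //.
  by rewrite swap_mxE /fprodmx row_mxKl row_mxKr f1 f2.
 + by split; [exact: open_box|move=> [g h] [/= /cd ? /cd' ?]].
 + exact: (smap_prod si si').
Qed.
Lemma gr_mul_prod : gr_mul (gprod G H) = mul2 (gr_mul G) (gr_mul H).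
Proof.
have hGG := mfprodP hX hX; have hHH := mfprodP hY hY.
have mt := tens_micro hGG hX hHH hY (gr_mul_micro hG) (gr_mul_micro hH).
have r := @comp_graphl R _ _ _ (mfprodP hXY hXY) (mfprodP hGG hHH) hXY _ _ _ _ _ mt
 (tens_rep (rep_gr_mul G) (rep_gr_mul H)) (isgraph_mswap hX hY hX hY).
have [_ _ es _ _] := isgraph_mswap hX hY hX hY.
apply: (@micro_ext R G:~H:~(G:~H) G:~H _ _ _ _ (rep_gr_mul (gprod G H)) r) => c.
 change (val (coremap (gr_mul (gprod G H)) c) = val (coremap (mswap G H G H) (coremap ((gr_mul G) \x (gr_mul H)) c))).
 by rewrite es; case: c => -[].
apply: nearT => -[[[a b] [a' b']] [c1 c2]]; rewrite /gmul_graph /rel_prod /=.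
by split=> [[[d d'] [-> ->]]|[[d ->] [d' ->]]].
Qed.
End GpdProd.
Section GpdSMC.
Variable R : realType.
Let C := SymplMic R.
Let hE := mfunitP R.
Lemma gunit_valid : gp (gunit R).
Proof.
have hs := spoint_valid R; have [hm _ _ _] := hs; have [sE [k _ [sub _]]] := hE.
have sm (M : premanifold R) (S : set M) (f : M -> mpoint R) : @smooth_map R M (mpoint R) S (fun y => f (val y)).
 apply: smap_intro => x i j _ _ _; exists (fun=> 0); split; first exact: sm_cst.
 by apply: nearT => y _; split => //; exact: rV0.
have bs (f : mpoint R -> mpoint R) (A : set (mpoint R)) : submersion_to f A.
 by move=> x i j _ _ F _ _ v _; exists 0; exact: rV0.
split => //.
 split.
 - by split => //; exists k.
 - by [].
 - by split; [exact: sm|exact: sm|exact: bs|exact: bs].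
 - split; last by split; [exact: sm|split => //; exact: openT|exact: sm].
  exists setT; first by split => //; exact: openT.
  by apply/seteqP; split=> [p _|//]; split => //=; exact: rV0.
 - by exists setT; split; first (by split => //; exact: openT); move=> *; do ?split; exact: rV0.
have s3 : is_symplectic (sprod (sopp (sprod (spoint R) (spoint R))) (spoint R)).
 by exact: sprod3_valid.
apply: (@lagr_atI _ _ 0 _ s3) => // x _.
exists ((tt, tt), tt), 0%N, (fun _ => 0); split => //.
 split => //; first exact: sm_cst.
  by rewrite /row_full -leqn0 rank_leq_col.
 by apply: nearT => y; split => _; split => //; exact: rV0.
by apply: nearT => y _ u v _ _; rewrite !thinmx0 mul0mx.
Qed.
Lemma gr_mul_unit : gr_mul (gunit R) = micro_lunit (mfunit R).
Proof.
have [_ r e _ _] := isgraph_lunit hE.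
apply: (@micro_ext R (mfunit R):~(mfunit R) (mfunit R) _ _ _ _ (rep_gr_mul (gunit R)) r) => b.
 by rewrite e; congr pair; exact: rV0.
by apply: nearT => p; split => _; [exact: rV0|split => //; exact: rV0].
Qed.
(** Full faithfulness in elementary form. The laws of the category of microgroupoids are then proved
    as for monoids, [gr_mul_prod] and [gr_mul_unit] supplying the multiplications of tensor products
    and of the unit. *)
Lemma gpd_morE (G H : pregroupoid R) (f : G =>> H) : gp G -> gp H ->
 is_groupoid_mor f <-> is_micro f /\ f \o' gr_mul G = gr_mul H \o' (f \x f).
Proof.
move=> hG hH; split=> [m|[m e]]; last exact: monoid_mor_gpd e.
by have [mf _] := m; split => //; exact: gpd_mor_monoid.
Qed.
Lemma is_smc_Gpd : is_smc (SymplGpdMic R).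
Proof.
have [c1 c2 c3 c4] := is_smc_SymplMic R.
have mfd (G : pregroupoid R) : gp G -> is_mf G by exact: gpd_mf.
have mm (G : pregroupoid R) : gp G -> is_micro (gr_mul G) by exact: gr_mul_micro.
have hU := gunit_valid.
have isom (G H : pregroupoid R) (T : G =>> H) (S : H =>> G) : gp G -> gp H ->
  @inverses C (gmf G) (gmf H) T S -> T \o' gr_mul G = gr_mul H \o' (T \x T) -> @inverses (SymplGpdMic R) G H T S.
 move=> hG hH [/= mT mS e1 e2] e; split => //=; first exact/gpd_morE.
 by apply/gpd_morE => //; split => //; exact: (inverse_map (mfd _ hG) (mm _ hG) (mfd _ hH) (mm _ hH) mT mS e1 e2 e).
have mor_mic (X Y : pregroupoid R) (f : X =>> Y) : is_groupoid_mor f -> is_micro f by case.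
split.
- have [a1 a2 a3 a4] := c1; split.
 + move=> G hG; have oX := mfd _ hG; have mX := mm _ hG; have ix : is_micro (i_ G) by vm.
  apply/gpd_morE => //; split => //; rewrite tens_id //.
  by rewrite (micro_comp1 (mfprodP oX oX) oX mX).1 (micro_comp1 (mfprodP oX oX) oX mX).2.
 + move=> G H K g f hG hH hK /(gpd_morE _ hH hK)[mg eg] /(gpd_morE _ hG hH)[mf ef].
  have oX := mfd _ hG; have mX := mm _ hG; have oY := mfd _ hH; have mY := mm _ hH; have oZ := mfd _ hK; have mZ := mm _ hK.
  apply/gpd_morE => //=; split; first by vm.
  lA. rewrite ef micro_compA; try vm. rewrite eg micro_tensC; try vm.
  by rA.
 + by lower mfd mor_mic; exact: a3.
 + by lower mfd mor_mic; exact: a4.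
- have [a1 a2 a3 a4] := c2; split.
 + by split; [exact: gunit_valid|move=> G H hG hH; exact: gprod_valid].
 + move=> X Y X' Y' f f' hX hY hX' hY' /(gpd_morE _ hX hY)[m e] /(gpd_morE _ hX' hY')[m' e'].
  apply/(gpd_morE _ (gprod_valid hX hX') (gprod_valid hY hY')).
  split; first exact: (tens_micro (mfd _ hX) (mfd _ hY) (mfd _ hX') (mfd _ hY')).
  rewrite !gr_mul_prod //.
  exact: (mul2_map (mfd _ hX) (mfd _ hX') (mm _ hX) (mm _ hX') (mfd _ hY) (mfd _ hY') (mm _ hY) (mm _ hY') m m' e e').
 + by lower mfd mor_mic; exact: a3.
 + by lower mfd mor_mic; exact: a4.
- have [a1 [a2 a2'] a3 a4 a5] := c3; split.
 + move=> X Y Z hX hY hZ; have hXY := gprod_valid hX hY; have hYZ := gprod_valid hY hZ.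
  apply: isom; [exact: gprod_valid|exact: gprod_valid|by apply: a1; exact: mfd |].
  by rewrite !gr_mul_prod //; apply: mul2_assoc; solve [exact: mfd|exact: mm].
 + split.
   move=> X hX; have [l r] := a2 _ (mfd _ hX); split.
    apply: (isom _ _ _ _ (gprod_valid hU hX) hX l).
    by rewrite gr_mul_prod // gr_mul_unit; apply: mul2_lunit; solve [exact: mfd|exact: mm].
   apply: (isom _ _ _ _ (gprod_valid hX hU) hX r).
   by rewrite gr_mul_prod // gr_mul_unit; apply: mul2_runit; solve [exact: mfd|exact: mm].
  move=> X Y hX hY; apply: isom; [exact: gprod_valid|exact: gprod_valid|by apply: a2'; exact: mfd |].
  by rewrite !gr_mul_prod //; apply: mul2_braid; solve [exact: mfd|exact: mm].
 + by lower mfd mor_mic; exact: a3.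
 + by lower mfd mor_mic; exact: a4.
 + by lower mfd mor_mic; exact: a5.
- have [a1 a2 a3] := c4; split.
 + by lower mfd mor_mic; exact: a1.
 + by lower mfd mor_mic; exact: a2.
 + by lower mfd mor_mic; exact: a3.
Qed.
Lemma gpd_monoid_morE (G H : pregroupoid R) (f : G =>> H) : gp G -> gp H ->
 is_groupoid_mor f <-> is_monoid_mor (X := groupoid_monoid G) (Y := groupoid_monoid H) f.
Proof.
move=> hG hH; apply: iff_trans (gpd_morE _ hG hH) (iff_sym _).
exact: (monoid_morE _ (gpd_monoid hG) (gpd_monoid hH)).
Qed.
End GpdSMC.
(** * The microgroupoid of a monoid *)
Section Solve.
Variables (R : realType) (P N : premanifold R).
Hypotheses (hP : is_manifold P) (hN : is_manifold N).
Variables (i : mchart P) (j : mchart N) (p0 : P) (n0 : N).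
(** Near [(p0, n0)], [S] is the graph over [D] of a map with coordinate expression [zeta]; the third
    clause finds solutions arbitrarily close to [n0]. *)
Definition locsol (S : set (P * N)) (D : set P) (zeta : 'rV[R]_(mdim P) -> 'rV[R]_(mdim N)) :=
 [/\ mdom i p0 /\ mdom j n0, smooth_at i:@p0 zeta,
   forall B : N -> Prop, (\forall n \near n0, B n) -> \forall p \near p0, D p -> exists n, [/\ B n, S (p, n), mdom j n & j:@n = zeta i:@p] &
   \forall p \near (p0, n0), S p -> D p.1 /\ j:@p.2 = zeta i:@p.1].
Lemma solve q c (S : set (P * N)) (h : _ -> 'rV[R]_c) : c = (q + mdim N)%N -> @cut R (mprod P N) (i, j) (p0, n0) S c h -> S (p0, n0) ->
 (forall v : 'rV[R]_(mdim N), 0:|v *m jac h i:@p0:|j:@n0 = 0 -> v = 0) ->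
 exists D (h' : 'rV[R]_(mdim P) -> 'rV[R]_q) zeta, [/\ cut i p0 D h', D p0 & locsol S D zeta].
Proof.
move=> ec hc S0 inj; have [[/= ip jn] sh fh nS] := hc.
have hPN := mprodP hP hN.
have h0 : h i:@p0:|j:@n0 = 0 by exact: (cut_mem hc).1 S0.
have [h' [z [T [[sh' sz] [z0 h'0] fh' nT nu]]]] := project_zero_set ec sh h0 fh inj.
exists [set p | h' i:@p = 0], h', z.
split => //; first by split => //; apply: nearT.
split => //.
- move=> B nB; have [A1 [B1 [nA1 nB1 AB1]]] := unbox nS.
 have nj := chart_surj hN jn (nB &n nB1); rewrite -z0 in nj.
 have n1 := chart_cont hP ip (near_pre (sm_cont sz) nj).
 have n2 := chart_cont hP ip nT.
 apply: nearS (n1 &n n2 &n nA1) => p [[n [jn' [Bn B1n] en]] [eT A1p]] Dp.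
 exists n; split => //; apply/(AB1 _ _ A1p B1n); rewrite en eT.
 by rewrite [h' _]Dp mul0mx.
- have n1 := @chart_cont R (mprod P N) hPN (i, j) (p0, n0) _ (conj ip jn) nu.
 apply: nearS (n1 &n nS) => -[p n] [H1 H2] /H2 /H1.
 by rewrite row_mxKl row_mxKr.
Qed.
End Solve.
Section GlobFun.
Variables (R : realType) (P N : premanifold R).
Hypotheses (hP : is_manifold P).
(** Local uniqueness of the solution [n] of [Q n p] becomes uniqueness over a thin neighbourhood of
    the graph of [b]; [f] picks that solution where it exists and takes the default value [f0 p]
    elsewhere. *)
Lemma glob_fun (C : set P) (b : P -> N) (Q : N -> P -> Prop) (f0 : P -> N) :
 (forall c (A : N -> Prop), C c -> (\forall n \near b c, A n) -> \forall p \near c, C p -> A (b p)) ->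
 (forall c, C c -> exists2 N' : set N, \forall n \near b c, N' n & \forall p \near c, forall n n', N' n -> N' n' -> Q n p -> Q n' p -> n = n') ->
 exists f : P -> N, forall c, C c -> \forall q \near (b c, c), Q q.1 q.2 -> f q.2 = q.1.
Proof.
move=> cb H; pose Box (N' : set N) (P' : set P) := forall p n n', P' p -> N' n -> N' n' -> Q n p -> Q n' p -> n = n'.
have [[_ sc] _ _ _ _] := hP.
have [|U [[oU cU] HU _]] := @thin N P [set q | C q.2 /\ q.1 = b q.2] Box sc (manifold_regular hP).
 move=> n0 c [/= Cc en]; have [N' nN' nN] := H c Cc; exists (interior N'), [set p | forall n n', N' n -> N' n' -> Q n p -> Q n' p -> n = n'].
 split; [|exact: open_interior|].
  by move=> p n n' H1 /interior_subset N1 /interior_subset N2; exact: H1.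
 have nb := cb c _ Cc (open_near (@open_interior _ N') nN').
 by apply: nearS (nN &n nb) => p [H1 H2]; split => // n [Cp ->]; exact: H2.
exists (fun p => if pselect (exists n, U (n, p) /\ Q n p) is left e then proj1_sig (cid e) else f0 p) => c Cc.
have : U (b c, c) by apply: cU.
move=> /(open_near oU); apply: nearS => -[n p] Up Qp.
case: pselect => [e|[]]; last by exists n.
case: (cid e) => n' [Un' Qn']; have [N' [P' [bx P'p HN]]] := HU _ _ Up.
by apply: (bx p) => //; exact: HN.
Qed.
Hypothesis hN : is_manifold N.
(** One function, chosen without charts, agrees near each point of [C] with every local solution
    there, whatever the charts and [zeta] are. *)
Lemma glob_solve (C : set P) (b : P -> N) (S : set (P * N)) :
 (forall c (A : N -> Prop), C c -> (\forall n \near b c, A n) -> \forall p \near c, C p -> A (b p)) ->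
 (forall c, C c -> exists i j D zeta, locsol i j c (b c) S D zeta) ->
 exists f : P -> N, forall c i j D zeta, C c -> locsol i j c (b c) S D zeta ->
  (forall B : N -> Prop, (\forall n \near b c, B n) -> \forall p \near c, D p -> [/\ B (f p), S (p, f p), mdom j (f p) & j:@(f p) = zeta i:@p]) /\
  \forall p \near (c, b c), S p -> D p.1 /\ p.2 = f p.1.
Proof.
move=> cb H; have [|f Hf] := glob_fun (Q := fun n p => S (p, n)) b cb.
 move=> c Cc; have [i [j [D [z [[ic jb] sz ex un]]]]] := H c Cc.
 have [A [B [nA nB AB]]] := unbox un; exists (fun n => B n /\ mdom j n).
  by apply: nearI => //; exact: mdom_near.
 apply: nearS nA => p Ap n n' [Bn jn] [Bn' jn'] Sn Sn'.
 have [_ _ _ inj _] := hN; have [+ _ _] := inj j; apply; try exact: mem_set.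
 by rewrite (AB _ _ Ap Bn Sn).2 (AB _ _ Ap Bn' Sn').2.
exists f => c i j D z Cc [[ic jb] sz ex un].
have [A [B [nA nB AB]]] := unbox (Hf c Cc); split.
 move=> B' nB'; apply: nearS ((ex _ (nB' &n nA)) &n nB) => p [H1 Bp] /H1[n [[B'n An] Sn jn en]].
 by rewrite (AB _ _ An Bp Sn).
have n1 : \forall p \near (c, b c), B p.1 /\ A p.2 := near2 nB nA.
by apply: nearS (n1 &n un) => -[p n] [[Bp An] H1] Sn; rewrite (AB _ _ An Bp Sn); split; have [] := H1 Sn.
Qed.
End GlobFun.
Section Slice.
Variables (R : realType) (M N : presymplectic R).
Hypotheses (hM : is_symplectic M) (hN : is_symplectic N).
Variables (i : mchart M) (j : mchart N) (f : M -> N) (z : M) (E : 'M[R]_(mdim N, mdim M)) (eps : R).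
Hypotheses (cf : {for z, continuous f}) (fE : \forall y \near z, j:@(f y) = i:@y *m E^T)
 (eps0 : eps != 0) (EE : E *m form i z = eps *: (form j (f z) *m E)).
(** The part of a lagrangian [W] lying over a lagrangian [A] of one factor: [E] embeds the tangent
    space of that factor, [E^T] projects onto it, and [eps] compares the two forms. The duals of a
    covector killing the image are [r] tangent to [W] and [s] tangent to [A], with
    [eps *: r = - (s *m E)]; the injectivity hypothesis makes both vanish. *)
Lemma slice_cut k k' (W : set M) (A : set N) (hW : 'rV[R]_(mdim M) -> 'rV[R]_k) (hA : 'rV[R]_(mdim N) -> 'rV[R]_k') :
 lagr_cut i z W hW -> lagr_cut j (f z) A hA -> W z -> A (f z) ->
 (forall r : 'rV[R]_(mdim N), r *m jac hA j:@(f z) = 0 -> r *m E *m jac hW i:@z = 0 -> r = 0) ->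
 exists H, @cut R M i z [set y | W y /\ A (f y)] (k + k')%N H /\
  forall u : 'rV[R]_(mdim M), u *m jac H i:@z = 0 <-> u *m jac hW i:@z = 0 /\ u *m E^T *m jac hA j:@(f z) = 0.
Proof.
move=> [eW cW iW] [eA cA iA] W0 A0 inj.
have [[[iz sW fW nW] [jx sA fA nA]] c0E] := (cW, cA, esym (near_pt fE)).
pose H u := (hW u):|(hA (u *m E^T)).
have sAE : smooth_at i:@z (fun u => hA (u *m E^T)) by apply: (sm_comp' c0E (sm_mulmx i:@z E^T)).
have jH : jac H i:@z = (jac hW i:@z):|(E^T *m jac hA j:@(f z)).
 rewrite /H jac_row_mx //; congr row_mx.
 by have := jac_comp (sm_mulmx i:@z E^T); rewrite c0E jac_mulmx; apply.
exists H; split; last by move=> u; rewrite jH mul_mx_row mulmxA; exact: row_mx_eq0'.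
split => //; first exact: sm_row_mx.
 apply: row_fullI => t; rewrite jH -[t]vsubmxK mul_row_col => e.
 have [_ fM _ _] := hM; have [_ f1 _ _] := hN; have uM := (fM i z iz).2.
 have [r rk rw] := lag_dual eW uM fW (near_pt iW W0) (usubmx t).
 have [s sk sw] := lag_dual eA (f1 j _ jx).2 fA (near_pt iA A0) (dsubmx t).
 have rs : eps *: r = - (s *m E).
  suff : eps *: r *m form i z = - (s *m E) *m form i z.
   by move=> /(congr1 (mulmx^~ (invmx (form i z)))); rewrite -!mulmxA mulmxV // !mulmx1.
  rewrite mulNmx -mulmxA EE -scalemxAr mulmxA sw -scalemxAl rw -scalerN; congr (_ *: _).
  apply: trmx_inj; rewrite trmxK linearN /= trmx_mul trmxK; apply/eqP.
  by rewrite -addr_eq0 mulmxA; apply/eqP; exact: e.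
 have s0 : s = 0 by apply: inj => //; apply: oppr_inj; rewrite oppr0 -mulNmx -rs -scalemxAl rk scaler0.
 move: rs; rewrite s0 mul0mx oppr0 => /eqP; rewrite scaler_eq0 (negPf eps0) => /eqP rs.
 rewrite (row_fullE fW (l := usubmx t)); last by apply: trmx_inj; rewrite -rw rs mul0mx trmx0.
 rewrite (row_fullE fA (l := dsubmx t)); last by apply: trmx_inj; rewrite -sw s0 mul0mx trmx0.
 by rewrite col_mx0.
apply: nearS (nW &n fE &n (near_pre cf nA)) => y /= [H1 [H2 H3]].
by rewrite /H -H2 row_mx_eq0' H1 H3.
Qed.
End Slice.
Lemma near_diag2 {T : topT} (a : T) (P : T * T -> Prop) : (\forall p \near (a, a), P p) ->
 exists2 B : T -> Prop, \forall z \near a, B z & forall x y, B x -> B y -> P (x, y).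
Proof.
move=> /unbox[A [B [nA nB AB]]]; exists (fun z => A z /\ B z); first exact: nearI.
by move=> x y [? _] [_ ?]; exact: AB.
Qed.
Lemma near_diag3 {T : topT} (a : T) (P : (T * T) * T -> Prop) : (\forall p \near ((a, a), a), P p) ->
 exists2 B : T -> Prop, \forall z \near a, B z & forall x y z, B x -> B y -> B z -> P ((x, y), z).
Proof.
move=> /unbox[A [C [/near_diag2[B nB BA] nC AC]]]; exists (fun z => B z /\ C z); first exact: nearI.
by move=> x y z [? _] [? _] [_ ?]; apply: AC => //; exact: BA.
Qed.
Lemma near_diag3' {T : topT} (a : T) (P : T * (T * T) -> Prop) : (\forall p \near (a, (a, a)), P p) ->
 exists2 B : T -> Prop, \forall z \near a, B z & forall x y z, B x -> B y -> B z -> P (x, (y, z)).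
Proof.
move=> /unbox[C [A [nC /near_diag2[B nB BA] AC]]]; exists (fun z => B z /\ C z); first exact: nearI.
by move=> x y z [_ ?] [? _] [? _]; apply: AC => //; exact: BA.
Qed.
Local Notation is_mon mu e := (@is_monoid (SymplMic _) (@PreMonoid (SymplMic _) _ mu e)).
Lemma mon_mf (R : realType) X (mu : X:~X =>> X) e : is_mon mu e -> is_microfold (X : premicrofold R). Proof. by case. Qed.
Lemma mon_mic (R : realType) (X : premicrofold R) (mu : X:~X =>> X) e : is_mon mu e -> is_micro mu. Proof. by case. Qed.
Section MonoidLocal.
Variables (R : realType) (X : premicrofold R) (mu : X:~X =>> X) (e : (mfunit R) =>> X).
Hypothesis hmon : is_mon mu e.
Let hX := mon_mf hmon.
Let mm := mon_mic hmon.
Let hE := mfunitP R.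
Let hXX := mfprodP hX hX.
Let hXm := sympl_mfd (proj1 hX).
Let hXs := proj1 hX.
Lemma mon_one_e : e = micro_e X.
Proof. by have /monoidE[_ _ me _ _] := hmon; exact: micro_e_uniq. Qed.
Let unit_laws : mu \o' ((micro_e X) \x (i_ X)) = micro_lunit X /\
 mu \o' ((i_ X) \x (micro_e X)) = micro_runit X.
Proof. by rewrite -mon_one_e; have /monoidE[_ _ _ _] := hmon. Qed.
(** The core maps of the two unit laws, written out, determine the two components. *)
Lemma mon_diag (c : core X) : coremap mu c = core_pair c c.
Proof.
have [l r] := unit_laws; apply: val_inj.
have := congr1 (fun f : premicro (mfunit R):~X X => (val (coremap f c) : (mfunit R * X)%type).2) l; have := congr1 (fun f : premicro X:~(mfunit R) X => (val (coremap f c) : (X * mfunit R)%type).1) r.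
rewrite /micro_comp /micro_tens /micro_runit /micro_lunit /=; case: (coremap mu c) => -[x y] h /= er el.
by rewrite er el.
Qed.
Variable V : set ((X * X) * X).
Hypotheses (rV : rep mu V) (Vcore : V `&` ((core X `*` core X) `*` core X) = gr (coremap mu)) (lV : @is_lagrangian R (sprod (sopp (sprod X X)) X) V)
 (aV : forall b, micro_all (coremap mu) V b).
Section At.
Variable a : X.
Hypothesis ca : core X a.
Let c : core X := exist _ a (mem_set ca).
Let mi : is_micro (i_ X). Proof. by case: (isgraph_id hX). Qed.
Let me := micro_e_valid hX.
Lemma mon_mem : V ((a, a), a).
Proof. by have [+ _] := aV c; rewrite mon_diag. Qed.
(** The second half of [lcomp] for the left unit law: with a core point on the left, a product can
    only be the right factor. *)
Lemma unit_law_l : exists2 B : X -> Prop, \forall z \near a, B z & forall x g h, B x -> B g -> B h -> core X x -> V ((x, g), h) -> h = g.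
Proof.
have m1 : is_micro ((micro_e X) \x (i_ X)) by vm.
have [_ [K [rK lK]]] := comp_lcomp (mfprodP hE hX) hXX hX m1 mm (tens_rep (erefl : rep (micro_e X) (setT `*` core X)) (rep_id X)) rV.
have [l _] := unit_laws; rewrite l in rK; have [_ rl el _ _] := isgraph_lunit hX.
have n1 := rep_near rK rl c; rewrite el in n1.
have [_] := lK c; rewrite mon_diag => n2.
have [P [Q [nP nQ PQ]]] := unbox n1; have [P1 [P2 [nP1 nP2 P12]]] := unbox nP.
have [P' [Q' [nP' nQ' PQ']]] := unbox n2; have [A [A' [nA nA' AA']]] := unbox nP'.
have [A1 [A2 [nA1 nA2 A12]]] := unbox nA; have [A3 [A4 [nA3 nA4 A34]]] := unbox nA'.
exists (fun z => [/\ P2 z, Q z, Q' z, A2 z & A3 z /\ A4 z]).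
 by apply: nearS ((nP2 &n nQ) &n (nQ' &n nA2) &n (nA3 &n nA4)) => z [[? ?] [[? ?] [? ?]]]; split.
move=> x g h [_ _ _ _ [A3x _]] [P2g _ _ A2g [_ A4g]] [_ Qh Q'h _ _] cx v.
have k := PQ' ((0, g), (x, g)) h (AA' _ _ (A12 _ _ (near_pt nA1) A2g) (A34 _ _ A3x A4g)) Q'h (conj (conj I cx) erefl) v.
by have [/(_ k)] := PQ (0, g) h (P12 _ _ (near_pt nP1) P2g) Qh.
Qed.
Lemma unit_law_r : exists2 B : X -> Prop, \forall z \near a, B z & forall g y h, B g -> B y -> B h -> core X y -> V ((g, y), h) -> h = g.
Proof.
have m1 : is_micro ((i_ X) \x (micro_e X)) by vm.
have [_ [K [rK lK]]] := comp_lcomp (mfprodP hX hE) hXX hX m1 mm (tens_rep (rep_id X) (erefl : rep (micro_e X) (setT `*` core X))) rV.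
have [_ l] := unit_laws; rewrite l in rK; have [_ rl el _ _] := isgraph_runit hX.
have n1 := rep_near rK rl c; rewrite el in n1.
have [_] := lK c; rewrite mon_diag => n2.
have [P [Q [nP nQ PQ]]] := unbox n1; have [P1 [P2 [nP1 nP2 P12]]] := unbox nP.
have [P' [Q' [nP' nQ' PQ']]] := unbox n2; have [A [A' [nA nA' AA']]] := unbox nP'.
have [A1 [A2 [nA1 nA2 A12]]] := unbox nA; have [A3 [A4 [nA3 nA4 A34]]] := unbox nA'.
exists (fun z => [/\ P1 z, Q z, Q' z, A1 z & A3 z /\ A4 z]).
 by apply: nearS ((nP1 &n nQ) &n (nQ' &n nA1) &n (nA3 &n nA4)) => z [[? ?] [[? ?] [? ?]]]; split.
move=> g y h [P1g _ _ A1g [A3g _]] [_ _ _ _ [_ A4y]] [_ Qh Q'h _ _] cy v.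
have k := PQ' ((g, 0), (g, y)) h (AA' _ _ (A12 _ _ A1g (near_pt nA2)) (A34 _ _ A3g A4y)) Q'h (conj erefl (conj I cy)) v.
by have [/(_ k)] := PQ (g, 0) h (P12 _ _ P1g (near_pt nP2)) Qh.
Qed.
Lemma assoc_law (N : X -> Prop) : (\forall z \near a, N z) -> exists2 B : X -> Prop, \forall z \near a, B z &
 forall g h k l n, B g -> B h -> B k -> B l -> B n ->
  (V ((g, h), n) -> V ((n, k), l) -> exists n', [/\ N n', V ((h, k), n') & V ((g, n'), l)]) /\
  (V ((h, k), n) -> V ((g, n), l) -> exists n', [/\ N n', V ((g, h), n') & V ((n', k), l)]).
Proof.
move=> nN; have hX3 := mfprodP hXX hX; have hX3' := mfprodP hX hXX.
have m1 : is_micro (mu \x (i_ X)) by vm. have m2 : is_micro ((i_ X) \x mu) by vm.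
have [_ [K [rK lK]]] := comp_lcomp hX3 hXX hX m1 mm (tens_rep rV (rep_id X)) rV.
have [mr [L [rL lL]]] := comp_lcomp hX3' hXX hX m2 mm (tens_rep (rep_id X) rV) rV.
have rA := @comp_graphl R _ _ _ hX3 hX3' hX _ _ _ _ _ mr rL (isgraph_assoc hX hX hX).
have /monoidE[_ _ _ ea _] := hmon; change (mu \o' (mu \x (i_ X)) = (mu \o' ((i_ X) \x mu)) \o' (micro_assoc X X X)) in ea.
rewrite -ea in rA; have n1 := rep_near rK rA c.
have [f1 f2] : core_fst (core_pair c c) = c /\ core_snd (core_pair c c) = c by split; exact: val_inj.
have e1 : val (coremap (mu \x (i_ X)) (coremap mu c)) = ((a, a), a) by rewrite mon_diag /= mon_diag.
have e2 : val (coremap ((i_ X) \x mu) (coremap mu c)) = (a, (a, a)) by rewrite mon_diag /= mon_diag.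
have [lK1 lK2] := lK c; have [lL1 lL2] := lL c.
have e0 : val (coremap mu c) = (a, a) by rewrite mon_diag.
change (val (coremap (mu \o' (mu \x (i_ X))) c)) with (val (coremap (mu \x (i_ X)) (coremap mu c))) in n1.
rewrite e1 in n1.
rewrite e1 e0 in lK2; rewrite e2 e0 in lL2.
have := lK1 (fun p => N p.1 /\ N p.2); rewrite e1 e0 => /(_ (near2 nN nN)) n2.
have := lL1 (fun p => N p.1 /\ N p.2); rewrite e2 e0 => /(_ (near2 nN nN)) n3.
have [P1 [Q1 [/near_diag3[B1 m1' H1] q1 D1]]] := unbox n1; have [P2 [Q2 [/near_diag3[B2 m2' H2] q2 D2]]] := unbox n2.
have [P3 [Q3 [/near_diag3'[B3 m3' H3] q3 D3]]] := unbox n3.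
have [P4 [Q4 [p4 q4 D4]]] := unbox lK2; have [P5 [P6 [/near_diag3[B5 m5 H5] /near_diag2[B6 m6 H6] D5]]] := unbox p4.
have [P7 [Q7 [p7 q7 D7]]] := unbox lL2; have [P8 [P9 [/near_diag3'[B8 m8 H8] /near_diag2[B9 m9 H9] D8]]] := unbox p7.
exists (fun z => [/\ B1 z /\ B2 z, B3 z /\ B5 z, B6 z /\ B8 z, B9 z & [/\ Q1 z, Q2 z, Q3 z, Q4 z & Q7 z]]).
 apply: nearS (((m1' &n m2') &n m3' &n m5) &n (nearI ((m6 &n m8) &n m9)
  ((q1 &n q2) &n q3 &n (q4 &n q7)))).
 by move=> z [[? ?] [[? ?] [[? ?] [? [? ?]]]]].
move=> g h k l n [[g1 g2] [g3 g5] [g6 g8] g9 _] [[h1 h2] [h3 h5] [h6 h8] h9 _] [[k1 k2] [k3 k5] [k6 k8] k9 _].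
move=> [_ _ _ _ [l1 l2 l3 l4 l7]] [_ _ [n6 _] n9 _]; have kl := D1 _ _ (H1 _ _ _ g1 h1 k1) l1; split=> v1 v2.
 have K0 : K (((g, h), k), l) := D4 _ _ (D5 _ _ (H5 _ _ _ g5 h5 k5) (H6 _ _ n6 k6)) l4 (conj v1 erefl) v2.
 have [[g' n'] [[/= _ Nn] [/= eg v] w]] := D3 _ _ (H3 _ _ _ g3 h3 k3) l3 (kl.1 K0).
 by exists n'; split => //; rewrite eg.
have L0 : L ((g, (h, k)), l) := D7 _ _ (D8 _ _ (H8 _ _ _ g8 h8 k8) (H9 _ _ g9 n9)) l7 (conj erefl v1) v2.
have [[n' k'] [[/= Nn _] [/= v ek] w]] := D2 _ _ (H2 _ _ _ g2 h2 k2) l2 (kl.2 L0).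
by exists n'; split => //; rewrite ek.
Qed.
End At.
End MonoidLocal.

(** * Source and target of a monoid *)

Section Slots.
Variables (R : realType) (d : nat).
(** The slots embed the tangent space of [X] as the three factors of the threefold product; their
    transposes are the projections. The form has sign -1 on the first two and 1 on the third. *)
Definition slot1 : 'M[R]_(d, (d + d) + d) := 1%:M:|0:|0.
Definition slot2 : 'M[R]_(d, (d + d) + d) := 0:|1%:M:|0.
Definition slot3 : 'M[R]_(d, (d + d) + d) := 0:|1%:M.
Lemma mul_slot n (x : 'M[R]_(n, d)) : [/\ x *m slot1 = x:|0:|0, x *m slot2 = 0:|x:|0 & x *m slot3 = 0:|x].
Proof. by rewrite /slot1 /slot2 /slot3 !mul_mx_row !mulmx1 !mulmx0; split. Qed.
Lemma slot_tr n (x y z : 'M[R]_(n, d)) : [/\ x:|y:|z *m slot1^T = x, x:|y:|z *m slot2^T = y & x:|y:|z *m slot3^T = z].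
Proof. by rewrite /slot1 /slot2 /slot3 !tr_row_mx !trmx0 !trmx1 !mul_row_col !mulmx1 !mulmx0 !addr0 !add0r; split. Qed.
Lemma slot_form (om : 'M[R]_d) : let Om := block_mx (- block_mx om 0 0 om) 0 0 om in
 [/\ slot1 *m Om = (-1) *: (om *m slot1), slot2 *m Om = (-1) *: (om *m slot2) & slot3 *m Om = 1 *: (om *m slot3)].
Proof.
have [-> -> ->] := mul_slot om.
rewrite /slot1 /slot2 /slot3; do 3 rewrite ?mul_row_block ?mul0mx ?mulmxN ?mulmx0 ?mul1mx ?addr0 ?add0r ?oppr0 ?opp_row_mx ?scaleN1r ?scale1r.
by split.
Qed.
Lemma slot_sum : slot1^T *m slot1 + slot2^T *m slot2 + slot3^T *m slot3 = 1%:M.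
Proof.
apply: eq_rowmul => u; have [x [y [z ->]]] := row3L u.
have [e1 e2 e3] := slot_tr x y z; rewrite !mulmxDr !mulmxA e1 e2 e3 mulmx1.
have [-> _ _] := mul_slot x; have [_ -> _] := mul_slot y; have [_ _ ->] := mul_slot z.
by rewrite !add_row_mx !addr0 !add0r.
Qed.
End Slots.
Section MonoidFunctions.
Variables (R : realType) (X : premicrofold R) (mu : X:~X =>> X) (e : (mfunit R) =>> X).
Hypothesis hmon : is_mon mu e.
Let hX := mon_mf hmon.
Let mm := mon_mic hmon.
Let hXX := mfprodP hX hX.
Let hXs := proj1 hX.
Let hXm := sympl_mfd (proj1 hX).
Let hXXm := mprodP hXm hXm.
Let M3 := sprod (sopp (sprod X X)) X.
Let hM3 : is_symplectic M3 := sprodP (soppP (sprodP hXs hXs)) hXs.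
Let d := mdim X.
Variable V : set ((X * X) * X).
Hypotheses (rV : rep mu V) (lV : @is_lagrangian R M3 V) (aV : forall b, micro_all (coremap mu) V b).
(** The last clause is cleanness of the multiplication restricted to vectors with zero product
    component. *)
Lemma mon_local_data (a : X) (i : mchart X) : core X a -> mdom i a -> exists kV (hV : 'rV[R]_((d + d) + d) -> 'rV[R]_kV) kA (hA : 'rV[R]_d -> 'rV[R]_kA),
 [/\ @lagr_cut R M3 ((i, i), i) ((a, a), a) V _ hV, lagr_cut i a (core X) hA &
  forall u v : 'rV[R]_d, u:|v:|0 *m jac hV i:@a:|i:@a:|i:@a = 0 ->
   u *m jac hA i:@a = 0 -> v *m jac hA i:@a = 0 -> u = 0 /\ v = 0].
Proof.
move=> ca ia; pose c : core X := exist _ a (mem_set ca).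
have ec : val (coremap mu c) = (a, a) by rewrite (mon_diag hmon).
have [_ lA] := hX; have [kA [hA cA]] := lagr_atE hXs lA ca ia.
have [eA ccA iA] := cA; have ccore : core_cut i a hA by split => //; exact: near_pt iA ca.
have [sphi _] := mm; have id1 : @mdom R (mprod X X) (i, i) (val (coremap mu c)) by rewrite ec.
have cc2 : @core_cut R X:~X (i, i) (val (coremap mu c)) _ (fprodmx hA hA) by rewrite ec; exact: core_cut_prod.
have [kV [hV [F [[[eV V0 _] _ _ [cV iV] cl] _]]]] := micro_dataE hXX hX sphi aV id1 ia cc2 ccore.
rewrite ec in cV iV cl; exists kV, hV, kA, hA; split => // u v tV tu tv.
apply/row_mx_eq0'; rewrite (cl _ 0 tV) ?mul0mx //.
have [_ sA _ _] := ccA; exact/(fprod_ker _ _ sA sA).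
Qed.
Section At.
Variables (a : X) (i : mchart X).
Hypotheses (ca : core X a) (ia : mdom i a).
Let z0 : M3 := ((a, a), a).
Let V0 : V z0 := mon_mem hmon aV ca.
Let x0 := i:@a.
Variables (kV : nat) (hV : 'rV[R]_((d + d) + d) -> 'rV[R]_kV) (kA : nat) (hA : 'rV[R]_d -> 'rV[R]_kA).
Hypotheses (cV : @lagr_cut R M3 ((i, i), i) z0 V _ hV) (cA : lagr_cut i a (core X) hA).
Let TV (u : 'rV[R]_((d + d) + d)) := u *m jac hV x0:|x0:|x0 = 0.
Let TA (u : 'rV[R]_d) := u *m jac hA x0 = 0.
Section Slot.
Variables (pi : X * (X * X) -> M3) (f : M3 -> X) (E A B : 'M[R]_(d, (d + d) + d)) (eps : R).
Hypotheses (cpi : continuous pi) (pi0 : pi (a, (a, a)) = z0) (cf : continuous f) (f0 : f z0 = a) (eps0 : eps != 0)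
 (fE : forall y, i:@(f y) = @mcoord R M3 ((i, i), i) y *m E^T)
 (piE : forall q, @mcoord R M3 ((i, i), i) (pi q) = @mcoord R (mprod X (mprod X X)) (i, (i, i)) q *m col_mx A (col_mx E B))
 (EE : E *m @form R M3 ((i, i), i) z0 = eps *: (form i a *m E))
 (QP : row_mx A^T (row_mx E^T B^T) *m col_mx A (col_mx E B) = 1%:M)
 (inj1 : forall r : 'rV[R]_d, TA r -> TV (r *m E) -> r = 0)
 (inj2 : forall k H, @cut R M3 ((i, i), i) z0 [set y | V y /\ core X (f y)] k H -> mdim M3 = (d + k)%N ->
   (forall u : 'rV[R]_((d + d) + d), u *m jac H x0:|x0:|x0 = 0 <-> TV u /\ TA (u *m E^T)) ->
   forall v w : 'rV[R]_d, (v *m E + w *m B) *m jac H x0:|x0:|x0 = 0 -> v = 0 /\ w = 0).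
(** The common pattern for source, target and inverse: with one slot of [V], selected by [f],
    confined to the core, that slot and another one are smooth functions of the third. [pi] lists
    the known slot first; [A], [E], [B] embed the known, the confined and the remaining slot. *)
Lemma slot_sol : exists zeta, @locsol R X (mprod X X) i (i, i) a (a, a) [set q | V (pi q) /\ core X (f (pi q))] setT zeta.
Proof.
have fz : \forall y \near z0, i:@(f y) = @mcoord R M3 ((i, i), i) y *m E^T by apply: nearT => y; exact: fE.
have cA' : lagr_cut i (f z0) (core X) hA by rewrite f0.
have EE' : E *m @form R M3 ((i, i), i) z0 = eps *: (form i (f z0) *m E) by rewrite f0.
have [||H [cH kH]] := slice_cut hM3 hXs (@cf z0) fz eps0 EE' cV cA' V0; [by rewrite f0|by rewrite f0 |].
rewrite f0 in kH; have [eV _ _] := cV; have [eA _ _] := cA.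
have ek : mdim M3 = (d + (kV + kA))%N by move: eV eA; rewrite /= -/d; lia.
have hN := mprodP hXm hXXm.
have xd : @mdom R (mprod X (mprod X X)) (i, (i, i)) (a, (a, a)) by [].
have cH' : @cut R M3 ((i, i), i) (pi (a, (a, a))) [set y | V y /\ core X (f y)] _ H by rewrite pi0.
have cP := @cut_pull R (sprod X (sprod X X)) M3 (i, (i, i)) ((i, i), i) pi (a, (a, a)) _ _ _ _ _ hN xd (@cpi _) QP (nearT _ piE) cH'.
(* The count leaves no equation on the known slot, so the solution exists for all its values. *)
have q0 : (kV + kA = 0 + mdim (mprod X X))%N by move: eV eA; rewrite /= -/d; lia.
have S0 : (pi @^-1` [set y | V y /\ core X (f y)]) (a, (a, a)) by rewrite /= pi0 f0.
have [|D [h' [zeta [cD D0 [z1 z2 z3 z4]]]]] := solve hXm hXXm q0 cP S0.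
 move=> v; rewrite -[v]hsubmxK; move: (lsubmx v) (rsubmx v) => v1 v2.
 have cc : x0:|(x0:|x0) *m col_mx A (col_mx E B) = x0:|x0:|x0 by have := piE (a, (a, a)); rewrite pi0.
 have [_ sH _ _] := cH; rewrite jac_comp; [|exact: sm_mulmx|by rewrite cc].
 rewrite jac_mulmx cc mulmxA !mul_row_col mul0mx add0r => h0.
 by have [-> ->] := inj2 cH ek kH h0; rewrite row_mx0.
exists zeta; split => //.
 move=> B' nB'; have [_ _ _ nD] := cD.
 by apply: nearS (nD &n (z3 _ nB')) => p [HD H1] _; apply: H1; apply/HD; exact: thinmx0.
by apply: nearS z4 => q H1 /H1[].
Qed.
End Slot.
Lemma cont_slots : [/\ continuous (fun q : X * (X * X) => ((q.2.1, q.1), q.2.2) : M3), continuous (fun q : X * (X * X) => ((q.1, q.2.1), q.2.2) : M3) &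
 continuous (fun q : X * (X * X) => ((q.1, q.2.2), q.2.1) : M3)] /\ [/\ continuous (fun y : M3 => y.1.1 : X), continuous (fun y : M3 => y.1.2 : X) &
 continuous (fun y : M3 => y.2 : X)].
Proof.
have c1 : continuous (fun q : X * (X * X) => q.2.1) by move=> [p q]; exact: (@near_snd_cont X (X * X)%type X fst p q (@cont_fst X X q)).
have c2 : continuous (fun q : X * (X * X) => q.2.2) by move=> [p q]; exact: (@near_snd_cont X (X * X)%type X snd p q (@cont_snd X X q)).
have c0 : continuous (fun q : X * (X * X) => q.1) by move=> q; exact: cont_fst.
split; split.
- move=> q; exact: (@cont_pair _ _ _ (fun q : X * (X * X) => (q.2.1, q.1)) (fun q => q.2.2) q (@cont_pair _ _ _ _ _ q (@c1 q) (@c0 q)) (@c2 q)).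
- move=> q; exact: (@cont_pair _ _ _ (fun q : X * (X * X) => (q.1, q.2.1)) (fun q => q.2.2) q (@cont_pair _ _ _ _ _ q (@c0 q) (@c1 q)) (@c2 q)).
- move=> q; exact: (@cont_pair _ _ _ (fun q : X * (X * X) => (q.1, q.2.2)) (fun q => q.2.1) q (@cont_pair _ _ _ _ _ q (@c0 q) (@c2 q)) (@c1 q)).
- by move=> [p q]; exact: (@near_fst_cont (X * X)%type X X fst p q (@cont_fst X X p)).
- by move=> [p q]; exact: (@near_fst_cont (X * X)%type X X snd p q (@cont_snd X X p)).
- by move=> q; exact: cont_snd.
Qed.
Hypothesis clean : forall u v : 'rV[R]_d, TV u:|v:|0 -> TA u -> TA v -> u = 0 /\ v = 0.
Let TA0 : TA 0. Proof. by rewrite /TA mul0mx. Qed.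
Let kill_eq k H (S : set M3) (E1 E2 : 'M[R]_(d, (d + d) + d)) (f1 f2 : M3 -> X) (u : 'rV[R]_((d + d) + d)) : @cut R M3 ((i, i), i) z0 S k H -> mdim M3 = (d + k)%N -> S z0 ->
 (forall y, i:@(f1 y) = @mcoord R M3 ((i, i), i) y *m E1^T) -> (forall y, i:@(f2 y) = @mcoord R M3 ((i, i), i) y *m E2^T) ->
 (\forall y \near z0, S y -> f1 y = f2 y) -> u *m jac H x0:|x0:|x0 = 0 -> u *m E1^T = u *m E2^T.
Proof.
move=> cH ek S0 e1 e2 nf hu; have hMm : is_manifold M3 by case: hM3.
have sg : smooth_at (@mcoord R M3 ((i, i), i) z0) (fun u => u *m (E1^T - E2^T)) by exact: sm_mulmx.
have := cut_kill hMm ek cH S0 sg _ hu; rewrite jac_mulmx mulmxBr => H0; apply/eqP; rewrite -subr_eq0; apply/eqP; apply: H0.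
by apply: nearS nf => y H1 /H1 H2; rewrite mulmxBr -e1 -e2 H2 subrr.
Qed.
Let slots (u v w : 'rV[R]_d) : [/\ u *m slot1 R d + v *m slot2 R d + w *m slot3 R d = u:|v:|w,
 u:|v:|w *m (slot1 R d)^T = u, u:|v:|w *m (slot2 R d)^T = v & u:|v:|w *m (slot3 R d)^T = w].
Proof.
have [-> -> ->] := slot_tr u v w; have [-> _ _] := mul_slot u; have [_ -> _] := mul_slot v; have [_ _ ->] := mul_slot w.
by rewrite !add_row_mx !addr0 !add0r.
Qed.
(** By the left unit law the product slot equals the known one, so a tangent vector with zero known
    slot also has zero product component, and cleanness kills the rest. *)
Lemma src_sol : exists zeta, @locsol R X (mprod X X) i (i, i) a (a, a) [set q | V ((q.2.1, q.1), q.2.2) /\ core X q.2.1] setT zeta.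
Proof.
have [[c1 _ _] [c4 _ _]] := cont_slots; have [e1 _ _] := slot_form (@form R X i a).
apply: (@slot_sol _ (fun y : M3 => y.1.1) (slot1 R d) (slot2 R d) (slot3 R d) (-1) c1 erefl c4 erefl _ _ _ e1).
- by rewrite oppr_eq0 oner_eq0.
- by move=> y; have [_ -> _ _] := slots i:@y.1.1 i:@y.1.2 i:@y.2.
- move=> q; rewrite !mul_row_col; have [e0 _ _ _] := slots i:@q.2.1 i:@q.1 i:@q.2.2.
 by rewrite [RHS]addrCA addrA; exact: esym e0.
- by rewrite !mul_row_col -(slot_sum R d) addrA [X in X + _]addrC.
- by move=> r tr; have [-> _ _] := mul_slot r => tv; have [] := clean tv tr TA0.
move=> k H cH ek kH v w h0; have [B nB HB] := unit_law_l hmon rV ca.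
have ew : v *m slot1 R d + w *m slot3 R d = v:|0:|w by have [<- _ _ _] := slots v 0 w; rewrite mul0mx addr0.
rewrite ew in h0; have [_ E1 E2 E3] := slots v 0 w.
have w0 : w = 0.
 rewrite -E3 -[RHS]E2; apply: (kill_eq cH ek _ _ _ _ h0) => //.
 - by move=> y; have [_ _ _ ->] := slots i:@y.1.1 i:@y.1.2 i:@y.2.
 - by move=> y; have [_ _ -> _] := slots i:@y.1.1 i:@y.1.2 i:@y.2.
 - by apply: nearS (near2 (near2 nB nB) nB) => -[[x g] h] [[Bx Bg] Bh] [v' cx]; exact: HB v'.
by have [t1 t2] := iffLR (kH _) h0; rewrite E1 in t2; rewrite w0 in t1 *; have [-> _] := clean t1 t2 TA0.
Qed.
Lemma tgt_sol : exists zeta, @locsol R X (mprod X X) i (i, i) a (a, a) [set q | V ((q.1, q.2.1), q.2.2) /\ core X q.2.1] setT zeta.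
Proof.
have [[_ c1 _] [_ c4 _]] := cont_slots; have [_ e1 _] := slot_form (@form R X i a).
apply: (@slot_sol _ (fun y : M3 => y.1.2) (slot2 R d) (slot1 R d) (slot3 R d) (-1) c1 erefl c4 erefl _ _ _ e1).
- by rewrite oppr_eq0 oner_eq0.
- by move=> y; have [_ _ -> _] := slots i:@y.1.1 i:@y.1.2 i:@y.2.
- move=> q; rewrite !mul_row_col; have [e0 _ _ _] := slots i:@q.1 i:@q.2.1 i:@q.2.2.
 by rewrite addrA; exact: esym e0.
- by rewrite !mul_row_col -(slot_sum R d) addrA.
- by move=> r tr; have [_ -> _] := mul_slot r => tv; have [] := clean tv TA0 tr.
move=> k H cH ek kH v w h0; have [B nB HB] := unit_law_r hmon rV ca.
have ew : v *m slot2 R d + w *m slot3 R d = 0:|v:|w by have [<- _ _ _] := slots 0 v w; rewrite mul0mx add0r.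
rewrite ew in h0; have [_ E1 E2 E3] := slots 0 v w.
have w0 : w = 0.
 rewrite -E3 -[RHS]E1; apply: (kill_eq cH ek _ _ _ _ h0) => //.
 - by move=> y; have [_ _ _ ->] := slots i:@y.1.1 i:@y.1.2 i:@y.2.
 - by move=> y; have [_ -> _ _] := slots i:@y.1.1 i:@y.1.2 i:@y.2.
 - by apply: nearS (near2 (near2 nB nB) nB) => -[[x g] h] [[Bx Bg] Bh] [v' cx]; exact: HB v'.
by have [t1 t2] := iffLR (kH _) h0; rewrite E2 in t2; rewrite w0 in t1 *; have [_ ->] := clean t1 TA0 t2.
Qed.
End At.
(** [W x g h] stands for [x g = h] in the case of the source and for [g x = h] in that of the
    target, which treats both at once. *)
Lemma side_fun (W : X -> X -> X -> Prop) :
 (forall a, core X a -> W a a a /\ exists2 B : X -> Prop, \forall z \near a, B z & forall x g h, B x -> B g -> B h -> core X x -> W x g h -> h = g) ->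
 (forall a i, core X a -> mdom i a -> exists zeta, @locsol R X (mprod X X) i (i, i) a (a, a) [set q | W q.2.1 q.1 q.2.2 /\ core X q.2.1] setT zeta) ->
 exists f : X -> X, forall a, core X a -> [/\ f a = a,
  forall i, mdom i a -> exists2 zeta : 'rV[R]_d -> 'rV[R]_d, smooth_at i:@a zeta &
    \forall g \near a, mdom i (f g) /\ i:@(f g) = zeta i:@g,
  forall B : X -> Prop, (\forall z \near a, B z) -> \forall g \near a, [/\ B (f g), core X (f g) & W (f g) g g] &
  exists2 B : X -> Prop, \forall z \near a, B z & forall x g h, B x -> B g -> B h -> core X x -> W x g h -> x = f g /\ h = g].
Proof.
move=> law sol.
have [||F HF] := @glob_solve R X (mprod X X) hXm hXXm (core X) (fun a => (a, a)) [set q | W q.2.1 q.1 q.2.2 /\ core X q.2.1].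
- by move=> c A _ nA; have [B nB HB] := near_diag2 nA; apply: nearS nB => p Bp _; exact: HB.
- move=> c cc; have [_ /(_ c)[i ic] _ _ _] := hXm; have [z Hz] := sol c i cc ic.
 by exists i, (i, i), setT, z.
exists (fst \o F) => a ca; have [Wa [B nB HB]] := law a ca.
have uniq : exists2 B : X -> Prop, \forall z \near a, B z & forall x g h, B x -> B g -> B h -> core X x -> W x g h -> x = (F g).1 /\ h = g.
 have [_ /(_ a)[i ia] _ _ _] := hXm; have [z Hz] := sol a i ca ia; have [_ n2] := HF a i (i, i) _ z ca Hz.
 have [B' nB' HB'] := near_diag3' n2.
 exists (fun z => B z /\ B' z); first exact: nearI.
 move=> x g h [Bx B'x] [Bg B'g] [Bh B'h] cx w; split; last exact: HB w.
 by have [|_ <-] := HB' g x h B'g B'x B'h.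
have fa : (F a).1 = a.
 by have [B' nB' HB'] := uniq; have Ba := near_pt nB'; have [<- _] := HB' a a a Ba Ba Ba ca Wa.
split => //.
- move=> i ia; have [z Hz] := sol a i ca ia; have [n1 _] := HF a i (i, i) _ z ca Hz.
 have [_ sz _ _] := Hz; exists (fun u => lsubmx (z u)).
  by apply: (sm_comp) => //; exact: smooth_lsub.
 have := n1 (fun _ => True) (nearT _ _) => /(_ (fun _ => I)); apply: nearS => g /(_ I)[_ _ [/= m1 m2] e1].
 by split => //=; rewrite -e1 row_mxKl.
- move=> B' nB'; have [_ /(_ a)[i ia] _ _ _] := hXm; have [z Hz] := sol a i ca ia; have [n1 _] := HF a i (i, i) _ z ca Hz.
 have nBB := nearI nB nB'.
 have := n1 (fun n => (B n.1 /\ B' n.1) /\ (B n.2 /\ B' n.2)) (near2 nBB nBB) => n2.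
 apply: nearS (n2 &n nB) => g [/(_ I)[[[b1 b2] [b3 b4]] [/= w cw] _ _] Bg]; split => //.
 by have eh := HB _ _ _ b1 Bg b3 cw w; rewrite eh in w.
Qed.
End MonoidFunctions.
Lemma coord_cont (R : realType) (M N : premanifold R) (i : mchart M) (j : mchart N) (f : M -> N) x F : is_manifold M -> is_manifold N ->
 mdom i x -> smooth_at i:@x F -> (\forall z \near x, mdom j (f z) /\ j:@(f z) = F i:@z) -> {for x, continuous f}.
Proof.
move=> hM hN ix sF nF A nA; have [jx ex] := near_pt nF.
have := chart_surj hN jx nA; rewrite ex => n1.
have := chart_cont hM ix (near_pre (sm_cont sF) n1); move=> n2.
apply: nearS (n2 &n nF) => z [[y [jy Ay ey]] [jz ez]].
by rewrite /= (mcoord_inj hN jz jy) // ez ey.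
Qed.
(** [K] complements [h] to a chart and so gives linear coordinates on its zero set. Applied to the
    core, it turns an equation between core points, such as [t g = s h], into a regular equation
    with values in a vector space. *)
Lemma zero_set_proj (R : realType) n k c (h : 'rV[R]_n -> 'rV[R]_c) u0 : n = (k + c)%N -> smooth_at u0 h -> row_full (jac h u0) ->
 exists K : 'M[R]_(n, k), [/\ exists2 B : 'rV[R]_n -> Prop, \forall u \near u0, B u & forall u u', B u -> B u' -> h u = 0 -> h u' = 0 -> u *m K = u' *m K -> u = u',
  forall w : 'rV[R]_k, exists v : 'rV[R]_n, v *m K = w /\ v *m jac h u0 = 0 &
  \forall u \near u0, forall v : 'rV[R]_n, v *m K = 0 -> v *m jac h u = 0 -> v = 0].
Proof.
move=> e; subst n => sh fh; have [K [uK [G [sG GP PG jG]]]] := straighten sh fh.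
exists K; split.
- exists (fun u => G (u *m K):|(h u) = u) => // u u' e1 e2 z1 z2 eK.
 by rewrite -e1 -e2 z1 z2 eK.
- move=> w; exists (w:|0 *m invmx K:|(jac h u0)); apply/eq_row_mx.
 by rewrite -mul_mx_row -mulmxA mulVmx // mulmx1.
have sP : smooth_at u0 (fun u => (u *m K):|(h u)) by apply: sm_row_mx => //; exact: sm_mulmx.
have jP u : smooth_at u h -> jac (fun u => (u *m K):|(h u)) u = K:|(jac h u).
 by move=> su; rewrite jac_row_mx ?jac_mulmx //; exact: sm_mulmx.
have fP : row_full (jac (fun u => (u *m K):|(h u)) u0) by rewrite jP // row_full_unit.
apply: nearS ((surj_near sP fP) &n (sm_near sh)) => u [f su] v vK vh; move: f; rewrite jP // row_full_unit => f.
have : v *m K:|(jac h u) = 0 by rewrite mul_mx_row vK vh row_mx0.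
by move=> /(congr1 (mulmx^~ (invmx K:|(jac h u)))); rewrite -mulmxA mulmxV // mulmx1 mul0mx.
Qed.

(** * Product and inverse of a monoid *)

Section MonoidGroupoid.
Variables (R : realType) (X : premicrofold R) (mu : X:~X =>> X) (e : (mfunit R) =>> X).
Hypothesis hmon : is_mon mu e.
Let hX := mon_mf hmon.
Let mm := mon_mic hmon.
Let hXX := mfprodP hX hX.
Let hXs := proj1 hX.
Let hXm := sympl_mfd (proj1 hX).
Let hXXm := mprodP hXm hXm.
Let M3 := sprod (sopp (sprod X X)) X.
Let hM3 : is_symplectic M3 := sprodP (soppP (sprodP hXs hXs)) hXs.
Let hM3m : is_manifold M3. Proof. by case: hM3. Qed.
Let d := mdim X.
Variable V : set ((X * X) * X).
Hypotheses (rV : rep mu V) (lV : @is_lagrangian R M3 V) (aV : forall b, micro_all (coremap mu) V b).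
Definition side_at (W : X -> X -> X -> Prop) (f : X -> X) (a : X) := [/\ f a = a,
  forall i, mdom i a -> exists2 zeta : 'rV[R]_d -> 'rV[R]_d, smooth_at i:@a zeta &
    \forall g \near a, mdom i (f g) /\ i:@(f g) = zeta i:@g,
  forall B : X -> Prop, (\forall z \near a, B z) -> \forall g \near a, [/\ B (f g), core X (f g) & W (f g) g g] &
  exists2 B : X -> Prop, \forall z \near a, B z & forall x g h, B x -> B g -> B h -> core X x -> W x g h -> x = f g /\ h = g].
Variables s t : X -> X.
Hypotheses (hs : forall a, core X a -> side_at (fun x g h => V ((x, g), h)) s a) (ht : forall a, core X a -> side_at (fun y g h => V ((g, y), h)) t a).
Section At.
Variables (a : X).
Hypotheses (ca : core X a).
Let z0 : M3 := ((a, a), a).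
Let V0 : V z0 := mon_mem hmon aV ca.
(** Reassociate [(g t(g)) h]: the product [t(g) h] then exists, and uniqueness of the source of [h]
    gives [t(g) = s(h)]. *)
Lemma mon_src_tgt : exists2 B : X -> Prop, \forall z \near a, B z & forall g h k, B g -> B h -> B k -> V ((g, h), k) -> t g = s h.
Proof.
have [_ _ _ [B1 nB1 HB1]] := hs ca; have [_ _ nt _] := ht ca.
have [B nB HB] := assoc_law hmon rV ca nB1.
exists (fun z => [/\ B z, B1 z & [/\ B (t z) /\ B1 (t z), core X (t z) & V ((z, t z), z)]]).
 by apply: nearS ((nB &n nB1) &n (nt _ (nB &n nB1))) => z [[? ?] ?]; split.
move=> g h k [Bg _ [[Bt B1t] ct vt]] [Bh B1h _] [Bk _ _] v.
have [H _] := HB g (t g) h k g Bg Bt Bh Bk Bg.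
by have [n [Nn v1 v2]] := H vt v; have [] := HB1 _ _ _ B1t B1h Nn ct v1.
Qed.
Variable i : mchart X.
Hypothesis ia : mdom i a.
Let x0 := i:@a.
Variables (kV : nat) (hV : 'rV[R]_((d + d) + d) -> 'rV[R]_kV) (kA : nat) (hA : 'rV[R]_d -> 'rV[R]_kA).
Hypotheses (cV : @lagr_cut R M3 ((i, i), i) z0 V _ hV) (cA : lagr_cut i a (core X) hA).
Let TV (u v w : 'rV[R]_d) := u:|v:|w *m jac hV x0:|x0:|x0 = 0.
Let TA (u : 'rV[R]_d) := u *m jac hA x0 = 0.
Variables (zs zt : 'rV[R]_d -> 'rV[R]_d).
Hypotheses (szs : smooth_at x0 zs) (szt : smooth_at x0 zt)
 (nzs : \forall g \near a, mdom i (s g) /\ i:@(s g) = zs i:@g)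
 (nzt : \forall g \near a, mdom i (t g) /\ i:@(t g) = zt i:@g).
Lemma mon_tangent_unit (u : 'rV[R]_d) : TV (u *m jac zs x0) u u /\ TV u (u *m jac zt x0) u.
Proof.
have [eV cutV iV] := cV; have sid := @sm_id R _ x0.
have [sa _ ns _] := hs ca; have [ta _ nt _] := ht ca.
have cs : {for a, continuous s} by move=> A nA; rewrite sa in nA; apply: nearS (ns _ nA) => z [].
have ct : {for a, continuous t} by move=> A nA; rewrite ta in nA; apply: nearS (nt _ nA) => z [].
have ci : {for a, continuous (id : X -> X)} by exact: cont_id.
have H (f1 f2 : X -> X) (F1 F2 : 'rV[R]_d -> 'rV[R]_d) : {for a, continuous f1} -> {for a, continuous f2} -> f1 a = a -> f2 a = a ->
  smooth_at x0 F1 -> smooth_at x0 F2 -> (\forall z \near a, i:@(f1 z) = F1 i:@z) -> (\forall z \near a, i:@(f2 z) = F2 i:@z) ->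
  (\forall z \near a, V ((f1 z, f2 z), z)) -> TV (u *m jac F1 x0) (u *m jac F2 x0) u.
 move=> c1 c2 e1 e2 s1 s2 n1 n2 nV.
 have cf : {for a, continuous (fun g : X => ((f1 g, f2 g), g) : M3)}.
  by apply: (@cont_pair _ _ _ (fun g : X => (f1 g, f2 g)) id) => //; apply: cont_pair.
 have sK1 : smooth_at x0 (fun z => (F1 z):|(F2 z)) by apply: sm_row_mx.
 have sK : smooth_at x0 (fun z => (F1 z):|(F2 z):|z) by apply: sm_row_mx.
 have nK : \forall z \near a, @mcoord R M3 ((i, i), i) ((f1 z, f2 z), z) = (F1 i:@z):|(F2 i:@z):|i:@z.
  by apply: nearS (n1 &n n2) => z [E1 E2] /=; rewrite E1 E2.
 have cut' : @cut R M3 ((i, i), i) ((f1 a, f2 a), a) V kV hV by rewrite e1 e2.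
 have := @map_kill R M3 X hXm _ i ((i, i), i) a _ _ _ _ ia cf sK nK nV cut'.
 rewrite e1 e2 => /(congr1 (mulmx u)); rewrite mulmx0 mulmxA.
 by rewrite jac_row_mx // jac_row_mx // jac_id !mul_mx_row mulmx1.
have nid : \forall z \near a, i:@(id z) = id i:@z by exact: nearT.
split.
 have := H s id zs id cs ci sa erefl szs sid (nearS (fun _ => @proj2 _ _) nzs) nid.
 by rewrite jac_id mulmx1; apply; apply: nearS (ns _ (nearT _ (fun _ => I))) => z [].
have := H id t id zt ci ct erefl ta sid szt nid (nearS (fun _ => @proj2 _ _) nzt).
by rewrite jac_id mulmx1; apply; apply: nearS (nt _ (nearT _ (fun _ => I))) => z [].
Qed.
(** Isotropy of [V] against the infinitesimal left unit law makes [w] orthogonal to every [u]. *)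
Lemma mon_tangent_inj (w : 'rV[R]_d) : TV 0 0 w -> w = 0.
Proof.
move=> tw; have [eV cutV iV] := cV; have [_ fX _ _] := hXs; have uX := (fX i a ia).2.
have E (u : 'rV[R]_d) : w *m form i a *m u^T = 0.
 have [t1 _] := mon_tangent_unit u; have := near_pt iV V0 _ _ tw t1.
 rewrite block_form !row_mxKl !row_mxKr mulmxN mulNmx block_form !row_mxKl !row_mxKr.
 by rewrite !mul0mx !addr0 oppr0 add0r.
have w0 : w *m form i a = 0.
 apply: trmx_inj; rewrite trmx0; apply: eq_rowmul => u.
 by apply: trmx_inj; rewrite trmx_mul trmxK E mulmx0 trmx0.
by rewrite -[w]mulmx1 -(mulmxV uX) mulmxA w0 mul0mx.
Qed.
Lemma mon_tangent_st (u v w : 'rV[R]_d) : TV u v w -> u *m jac zt x0 = v *m jac zs x0.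
Proof.
move=> huv; have [eV cutV iV] := cV.
pose g (z : 'rV[R]_((d + d) + d)) := zt (z *m (slot1 R d)^T) + - zs (z *m (slot2 R d)^T).
have [z1 z2 _] := slot_tr x0 x0 x0; have [e1 e2 _] := slot_tr u v w.
set c0 := x0:|x0:|x0 in z1 z2.
have s1 : smooth_at c0 (fun z => zt (z *m (slot1 R d)^T)) by apply: (sm_comp' z1 (sm_mulmx c0 _)).
have s2 : smooth_at c0 (fun z => zs (z *m (slot2 R d)^T)) by apply: (sm_comp' z2 (sm_mulmx c0 _)).
have sg : smooth_at c0 g by apply: sm_add => //; exact: sm_opp.
have jt : jac (fun z => zt (z *m (slot1 R d)^T)) c0 = (slot1 R d)^T *m jac zt x0.
 by have := jac_comp (sm_mulmx c0 (slot1 R d)^T); rewrite z1 jac_mulmx; apply.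
have js : jac (fun z => zs (z *m (slot2 R d)^T)) c0 = (slot2 R d)^T *m jac zs x0.
 by have := jac_comp (sm_mulmx c0 (slot2 R d)^T); rewrite z2 jac_mulmx; apply.
have jg : jac g c0 = (slot1 R d)^T *m jac zt x0 - (slot2 R d)^T *m jac zs x0.
 by rewrite jac_add //; [rewrite jac_opp // jt js|exact: sm_opp].
have := cut_kill hM3m (etrans eV (esym (addnn kV))) cutV V0 sg _ huv.
rewrite -/c0 jg mulmxBr !mulmxA e1 e2 => H; apply/eqP; rewrite -subr_eq0; apply/eqP; apply: H.
have [B nB HB] := mon_src_tgt.
apply: nearS (near2 ((near2 nzt nzs) &n (near2 nB nB)) nB) => -[[x y] z] [[[[_ et] [_ es]] [Bx By]] Bz] v0.
by have [E1 E2 _] := slot_tr i:@x i:@y i:@z; rewrite /g E1 E2 -et -es (HB _ _ _ Bx By Bz v0) subrr.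
Qed.
Lemma mon_core_fix (v : 'rV[R]_d) : TA v -> v *m jac zs x0 = v /\ v *m jac zt x0 = v.
Proof.
move=> tv; have [eA cutA _] := cA.
have gk (F : 'rV[R]_d -> 'rV[R]_d) (f : X -> X) : (forall a, core X a -> f a = a) -> smooth_at x0 F ->
  (\forall z \near a, mdom i (f z) /\ i:@(f z) = F i:@z) -> v *m jac F x0 = v.
 move=> fix_ sF nF; have sF' : smooth_at x0 (fun z => F z + - id z) by apply: sm_add => //; apply: sm_opp; exact: sm_id.
 have := cut_kill hXm (etrans eA (esym (addnn kA))) cutA ca sF' _ tv.
 rewrite jac_add //; last by apply: sm_opp; exact: sm_id.
 rewrite jac_opp; last exact: sm_id.
 rewrite jac_id mulmxDr mulmxN mulmx1 => H.
 apply/eqP; rewrite -subr_eq0; apply/eqP; apply: H.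
 by apply: nearS nF => z [_ eF] cz; rewrite -eF fix_ // subrr.
by split; [apply: (gk zs s) => // b cb; have [] := hs cb|apply: (gk zt t) => // b cb; have [] := ht cb].
Qed.
(** [mon_tangent_inj] allows solving for the product slot. The domain so obtained lies in the set
    where [t g = s h] and has the same dimension, so the two coincide near the unit. *)
Lemma mul_sol : exists D zeta, @locsol R (mprod X X) X (i, i) i (a, a) a V D zeta /\ \forall p \near (a, a), D p <-> t p.1 = s p.2.
Proof.
have [[eV cutV _] [eA cutA _]] := (cV, cA).
have ec : kV = (kA + mdim X)%N by move: eV eA; rewrite /= -/d; lia.
have inj (v : 'rV[R]_(mdim X)) : 0:|v *m jac hV (@mcoord R (mprod X X) (i, i) (a, a)):|i:@a = 0 -> v = 0.
 by move=> h0; apply: mon_tangent_inj; rewrite /TV row_mx0.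
have [D [h' [zeta [cD D0 sol]]]] := solve hXXm hXm ec cutV V0 inj.
exists D, zeta; split => //.
have [_ sA fA nA] := cutA; have [K [[B nB HB] ontoK _]] := zero_set_proj (etrans eA (esym (addnn kA))) sA fA.
have [[sa _ ns _] [ta _ nt _]] := (hs ca, ht ca).
have zs0 : zs x0 = x0 by have [_ <-] := near_pt nzs; rewrite sa.
have zt0 : zt x0 = x0 by have [_ <-] := near_pt nzt; rewrite ta.
(* The difference of two core points in coordinates is not a regular equation; its projection by [K]
   is. *)
pose hc (u) := (zt (u *m col_mx 1%:M 0) + - zs (u *m col_mx 0 1%:M)) *m K.
have E1 (u v : 'rV[R]_d) : u:|v *m col_mx 1%:M 0 = u by rewrite mul_row_col mulmx1 mulmx0 addr0.
have E2 (u v : 'rV[R]_d) : u:|v *m col_mx 0 1%:M = v by rewrite mul_row_col mulmx1 mulmx0 add0r.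
set c0 := x0:|x0.
have s1 : smooth_at c0 (fun z => zt (z *m col_mx 1%:M 0)) by apply: (sm_comp' (E1 _ _) (sm_mulmx c0 _)).
have s2 : smooth_at c0 (fun z => zs (z *m col_mx 0 1%:M)) by apply: (sm_comp' (E2 _ _) (sm_mulmx c0 _)).
have s3 : smooth_at c0 (fun z => zt (z *m col_mx 1%:M 0) + - zs (z *m col_mx 0 1%:M)) by apply: sm_add => //; exact: sm_opp.
have s4 : smooth_at c0 hc by apply: (sm_comp (G := mulmx^~ K)) => //; exact: sm_mulmx.
have jt : jac (fun z => zt (z *m col_mx 1%:M 0)) c0 = col_mx 1%:M 0 *m jac zt x0.
 by have := jac_comp (sm_mulmx c0 (col_mx 1%:M 0)); rewrite E1 jac_mulmx; apply.
have js : jac (fun z => zs (z *m col_mx 0 1%:M)) c0 = col_mx 0 1%:M *m jac zs x0.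
 by have := jac_comp (sm_mulmx c0 (col_mx 0 1%:M)); rewrite E2 jac_mulmx; apply.
have jc : jac hc c0 = (col_mx 1%:M 0 *m jac zt x0 - col_mx 0 1%:M *m jac zs x0) *m K.
 have := jac_comp s3 (sm_mulmx _ K); rewrite jac_mulmx jac_add //; last exact: sm_opp.
 by rewrite jac_opp // jt js; exact.
have cutS : @cut R (mprod X X) (i, i) (a, a) [set p | t p.1 = s p.2] _ hc.
 split => //.
  apply: row_fullI => l; rewrite jc => e0.
  apply: trmx_inj; rewrite trmx0; apply/rowP => j; rewrite !mxE.
  have [v [vK tv]] := ontoK (delta_mx 0 j); have [_ fv] := mon_core_fix tv.
  have := congr1 (mulmx v:|0) e0; rewrite mulmx0 !mulmxA mulmxBr !mulmxA E1 E2 mul0mx subr0 fv vK.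
  by move=> /matrixP/(_ 0 0); rewrite -rowE !mxE.
 have nBc := chart_cont hXm ia nB.
 have nss := ns _ (nBc &n nA); have ntt := nt _ (nBc &n nA).
 apply: nearS (near2 (nzt &n ntt) (nzs &n nss)) => -[g h] [[[m1 e1] [[b1 n1] ct _]] [[m2 e2] [[b2 n2] cs _]]].
 rewrite /hc E1 E2 -e1 -e2; split=> [->|]; first by rewrite subrr mul0mx.
 rewrite mulmxBl => /eqP; rewrite subr_eq0 => /eqP eK.
 by apply: (mcoord_inj hXm m1 m2); apply: HB => //; [exact/n1|exact/n2].
have [_ _ ex un] := sol; have [B' nB' HB'] := mon_src_tgt.
have DS : \forall p \near (a, a), D p -> t p.1 = s p.2.
 apply: nearS ((ex _ nB') &n (near2 nB' nB')) => -[g h] [H [Bg Bh]] /H[k [Bk v _ _]].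
 exact: (HB' _ _ _ Bg Bh Bk v).
have dd : mdim (mprod X X) = ((d + kA) + kA)%N by move: eA; rewrite /= -/d; lia.
by apply: nearS (DS &n (same_dim_cut hXXm dd cD cutS D0 DS)) => p [].
Qed.
(** The slot pattern with the product confined to the core. Let [(0, w, v)] be tangent, [v] being
    tangent to the core, and let [S] be the derivative of [s]. Composability gives [w S = 0];
    comparison with the tangent vector [(w S, w, w)] gives [v = w]; hence [v = v S = w S = 0]. *)
Lemma inv_sol : exists zeta, @locsol R X (mprod X X) i (i, i) a (a, a) [set q | V ((q.1, q.2.2), q.2.1) /\ core X q.2.1] setT zeta.
Proof.
have [[_ _ c1] [_ _ c4]] := cont_slots X; have [_ _ e1] := slot_form (@form R X i a).
apply: (@slot_sol _ _ _ _ hmon V aV a i ca ia _ _ _ _ cV cA _ (fun y : M3 => y.2) (slot3 R d) (slot1 R d) (slot2 R d) 1 c1 erefl c4 erefl _ _ _ e1).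
- by rewrite oner_eq0.
- by move=> y; have [_ _ ->] := slot_tr i:@y.1.1 i:@y.1.2 i:@y.2.
- move=> q; rewrite !mul_row_col; have [-> _ _] := mul_slot i:@q.1; have [_ _ ->] := mul_slot i:@q.2.1; have [_ -> _] := mul_slot i:@q.2.2.
 by rewrite !add_row_mx !add0r !addr0 !add_row_mx !add0r !addr0.
- by rewrite !mul_row_col -(slot_sum R d) [X in _ + X]addrC addrA.
- by move=> r tr; have [_ _ ->] := mul_slot r; rewrite -[X in X:|_]row_mx0; exact: mon_tangent_inj.
move=> k H cH ek kH v w h0.
have ew : v *m slot3 R d + w *m slot2 R d = 0:|w:|v.
 by have [_ _ ->] := mul_slot v; have [_ -> _] := mul_slot w; rewrite !add_row_mx !addr0 !add0r.
rewrite ew in h0; have [_ _ E3] := slot_tr 0 w v.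
have [t1 t2] := iffLR (kH _) h0; rewrite E3 in t2.
have ws := mon_tangent_st t1; rewrite mul0mx in ws.
have [t3 _] := mon_tangent_unit w; rewrite -ws in t3.
have vw : v = w.
 apply/eqP; rewrite -subr_eq0; apply/eqP; apply: mon_tangent_inj; rewrite /TV row_mx0.
 have : (0:|w:|v - 0:|w:|w) *m jac hV x0:|x0:|x0 = 0 by rewrite mulmxBl t1 t3 subrr.
 by rewrite opp_row_mx add_row_mx subrr.
by have [fv _] := mon_core_fix t2; rewrite -vw -fv {2}vw -ws vw.
Qed.
(** Followed by [K], source and target are submersions at the core point and hence nearby;
    injectivity of [K] on tangent vectors of the core then removes [K]. *)
Lemma mon_submersion : \forall g \near a, (forall v : 'rV[R]_d, v *m jac hA (zs i:@g) = 0 -> exists u : 'rV[R]_d, u *m jac zs i:@g = v) /\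
 (forall v : 'rV[R]_d, v *m jac hA (zt i:@g) = 0 -> exists u : 'rV[R]_d, u *m jac zt i:@g = v).
Proof.
have [eA cutA _] := cA; have [_ sA fA nA] := cutA; have [K [_ ontoK injK]] := zero_set_proj (etrans eA (esym (addnn kA))) sA fA.
have H (f : X -> X) (F : 'rV[R]_d -> 'rV[R]_d) W : side_at W f a -> smooth_at x0 F ->
  (\forall g \near a, mdom i (f g) /\ i:@(f g) = F i:@g) -> (forall v, TA v -> v *m jac F x0 = v) ->
  \forall g \near a, forall v, v *m jac hA (F i:@g) = 0 -> exists u : 'rV[R]_d, u *m jac F i:@g = v.
 move=> [fa _ nf _] sF nF fixF.
 have F0 : F x0 = x0 by have [_ <-] := near_pt nF; rewrite fa.
 have sFK : smooth_at x0 (fun z => F z *m K) by apply: (sm_comp (G := mulmx^~ K)) => //; exact: sm_mulmx.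
 have jFK z : smooth_at z F -> jac (fun z => F z *m K) z = jac F z *m K.
  by move=> sz; have := jac_comp sz (sm_mulmx _ K); rewrite jac_mulmx; exact.
 have full : row_full (jac (fun z => F z *m K) x0).
  apply: row_fullI => l e0; apply: trmx_inj; rewrite trmx0; apply/rowP => j; rewrite !mxE.
  have [v [vK tv]] := ontoK (delta_mx 0 j).
  have := congr1 (mulmx v) e0; rewrite jFK // mulmx0 !mulmxA fixF // vK.
  by move=> /matrixP/(_ 0 0); rewrite -rowE !mxE.
 have n1 := chart_cont hXm ia ((surj_near sFK full) &n (sm_near sF)).
 have n2 := chart_cont hXm ia injK; have n3 := nf _ (n2 &n (cut_near hXm cutA)).
 apply: nearS ((mdom_near hXm ia) &n (n1 &n ((near_near nF) &n (n3 &n (near_near (nf _ (nearT _ (fun _ => I)))))))).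
 move=> g [ig [[fg sg] [nFg [[[ij cg] _ _] ncore]]]] v hv; have [mg eg] := near_pt nFg.
 rewrite -eg in hv; rewrite jFK // in fg.
 have [u uE] := row_full_onto (v *m K) fg.
 have cfg := coord_cont hXm hXm ig sg nFg.
 have kill := map_kill hXm ig cfg sg (nearS (fun _ => @proj2 _ _) nFg) (nearS (fun _ H => let: And3 _ b _ := H in b) ncore) cg.
 exists u; apply/eqP; rewrite -subr_eq0; apply/eqP; apply: ij; first by rewrite mulmxBl -mulmxA uE subrr.
 by rewrite mulmxBl -mulmxA kill hv mulmx0 subrr.
apply: nearI; [apply: (H s _ _ (hs ca)) => // v /mon_core_fix[] //|apply: (H t _ _ (ht ca)) => // v /mon_core_fix[] //].
Qed.
End At.
End MonoidGroupoid.
Section Pointwise.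
Variables (R : realType) (M N : premanifold R).
Hypotheses (hM : is_manifold M) (hN : is_manifold N).
(** Smoothness, and below submersivity, at a single point: the open set carrying the groupoid is
    later cut out by the points where these hold. *)
Definition smooth_pt (S : set M) (f : M -> N) (x : M) := forall i j, mdom i x -> mdom j (f x) ->
 exists F, smooth_at i:@x F /\ \forall z \near x, S z -> mdom j (f z) /\ j:@(f z) = F i:@z.
Lemma smooth_ptI (S : set M) (f : M -> N) x i j F : mdom i x -> S x -> smooth_at i:@x F ->
 (\forall z \near x, S z -> mdom j (f z) /\ j:@(f z) = F i:@z) -> smooth_pt S f x.
Proof.
move=> ix Sx sF nF i' j' ix' jx'; have [jx ex] := near_pt nF Sx.
have [T [sT nT T0 _]] := transition hM ix' ix; have [U [sU nU U0 _]] := transition hN jx jx'.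
exists (U \o (F \o T)); split.
 by apply: (sm_comp); [apply: sm_comp => //; rewrite T0|rewrite /= T0 -ex].
have := chart_surj hN jx (nU &n (mdom_near hN jx')); rewrite ex => n1.
have n2 := chart_cont hM ix (near_pre (sm_cont sF) n1).
apply: nearS (n2 &n nF &n nT) => z [[y [jy [Uy jy'] ey]] [H Tz]] /H[jz ez].
have e : f z = y by apply: (mcoord_inj hN jz jy); rewrite ez ey.
by split; rewrite e // Uy /= -Tz ey.
Qed.
Lemma smooth_pt_near (S : set M) (f : M -> N) x i j F : mdom i x -> smooth_at i:@x F ->
 (\forall z \near x, S z -> mdom j (f z) /\ j:@(f z) = F i:@z) -> \forall y \near x, S y -> smooth_pt S f y.
Proof.
move=> ix sF nF; have n1 := chart_cont hM ix (sm_near sF).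
apply: nearS (n1 &n (near_near nF) &n (mdom_near hM ix)) => y [sy [ny iy]] Sy.
exact: (smooth_ptI iy Sy sy ny).
Qed.
Definition submersive_at (f : M -> N) (A : set N) (x : M) := forall (i : mchart M) (j : mchart N), mdom i x -> mdom j (f x) ->
 forall F, smooth_at i:@x F -> (\forall y \near x, j:@(f y) = F i:@y) ->
 forall v, tangent j A (f x) v -> exists u, 'D_u F i:@x = v.
Lemma submersive_atI (f : M -> N) (A : set N) (x : M) i j F k c (h : _ -> 'rV[R]_c) : mdom i x -> smooth_at i:@x F ->
 (\forall z \near x, mdom j (f z) /\ j:@(f z) = F i:@z) -> mdim N = (k + c)%N -> cut j (f x) A h -> A (f x) ->
 (forall v : 'rV[R]_(mdim N), v *m jac h j:@(f x) = 0 -> exists u : 'rV[R]_(mdim M), u *m jac F i:@x = v) -> submersive_at f A x.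
Proof.
move=> ix sF nF ek hc Afx H i' j' ix' jx' F' sF' nF' v tv.
have [jx ex] := near_pt nF.
have [T [sT nT T0 _]] := transition hM ix ix'; have [U [sU nU U0 _]] := transition hN jx jx'.
have h0 := (cut_mem hc).1 Afx.
have [T2 [h' [[sT2 nT2] cut' _ jh']]] := cut_cut hN hc jx' h0.
have T20 : T2 j':@(f x) = j:@(f x) by rewrite (near_pt nT2).
have kv := iffLR (tangent_cut hN v ek cut' Afx) tv; rewrite jh' mulmxA in kv.
have [u uF] := H _ kv.
exists (u *m jac T i:@x); rewrite deriveJ //.
have cf := coord_cont hM hN ix sF nF.
have e1 : jac (F' \o T) i:@x = jac (U \o F) i:@x.
 apply: jac_ext; last by apply: sm_comp => //; rewrite T0.
 apply: (near_chart hM ix); apply: nearS (nT &n nF &n (nF' &n (near_pre cf nU))) => z [E1 [[_ E2] [E3 E4]]] /=.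
 by rewrite -E1 -E2 -E3.
rewrite jac_comp ?T0 // jac_comp -?ex // in e1.
have e2 : jac T2 j':@(f x) *m jac U j:@(f x) = 1%:M.
 rewrite -T20 -jac_comp ?T20 // -(jac_id j':@(f x)); apply: jac_ext; last by apply: sm_comp; rewrite ?T20.
 by apply: (near_chart hN jx'); apply: nearS (nT2 &n nU) => y [E1 E2] /=; rewrite -E1 -E2.
by rewrite -mulmxA e1 mulmxA uF -mulmxA e2 mulmx1.
Qed.
End Pointwise.
Section MonoidGlobal.
Variables (R : realType) (X : premicrofold R) (mu : X:~X =>> X) (e : (mfunit R) =>> X).
Hypothesis hmon : is_mon mu e.
Let hX := mon_mf hmon.
Let hXs := proj1 hX.
Let hXm := sympl_mfd (proj1 hX).
Let hXXm := mprodP hXm hXm.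
Variable V : set ((X * X) * X).
Hypotheses (rV : rep mu V) (lV : @is_lagrangian R (sprod (sopp (sprod X X)) X) V) (aV : forall b, micro_all (coremap mu) V b).
(** [s(g) (g h) = (s(g) g) h = g h], so [s(g)] is the source of [g h] by uniqueness; symmetrically
    for targets. *)
Lemma mon_src_mul s t (m : X * X -> X) a : core X a -> side_at (fun x g h => V ((x, g), h)) s a -> side_at (fun y g h => V ((g, y), h)) t a ->
 (\forall q \near ((a, a), a), V q -> t q.1.1 = s q.1.2 /\ q.2 = m q.1) ->
 exists2 B : X -> Prop, \forall z \near a, B z & forall g h k, B g -> B h -> B k -> V ((g, h), k) -> s k = s g /\ t k = t h.
Proof.
move=> ca [_ _ sn [B1 nB1 HB1]] [_ _ tn [B2 nB2 HB2]] /near_diag3[B3 nB3 HB3].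
have [B nB HB] := assoc_law hmon rV ca nB3.
have n0 := nearI (nB &n nB1) (nB2 &n nB3).
exists (fun z => ((B z /\ B1 z) /\ (B2 z /\ B3 z)) /\ [/\ (B (s z) /\ B1 (s z)) /\ (B2 (s z) /\ B3 (s z)), core X (s z) & V ((s z, z), z)] /\
 [/\ (B (t z) /\ B1 (t z)) /\ (B2 (t z) /\ B3 (t z)), core X (t z) & V ((z, t z), z)]).
 exact: nearI n0 ((sn _ n0) &n (tn _ n0)).
move=> g h k [[[Bg B1g] [B2g B3g]] [[[[Bs B1s] _] cs vs] _]] [[[Bh B1h] [B2h B3h]] [_ [[[Bt _] [B2t _]] ct vt]]] [[[Bk B1k] [B2k B3k]] _] v.
have ek := (HB3 _ _ _ B3g B3h B3k v).2; rewrite /= in ek; split.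
 have [/(_ vs v)[n [B3n v1 v2]] _] := HB (s g) g h k g Bs Bg Bh Bk Bg.
 have /= en := (HB3 _ _ _ B3g B3h B3n v1).2; rewrite en -ek in v2.
 by have [-> _] := HB1 _ _ _ B1s B1k B1k cs v2.
have [_ /(_ vt v)[n [B3n v1 v2]]] := HB g h (t h) k h Bg Bh Bt Bk Bh.
have /= en := (HB3 _ _ _ B3g B3h B3n v1).2; rewrite en -ek in v2.
by have [-> _] := HB2 _ _ _ B2t B2k B2k ct v2.
Qed.
(** What is known near a core point about the structure maps, stated for globally defined functions
    and without charts or equations of [V]. *)
Definition loc_gpd (s t : X -> X) (m : X * X -> X) (v : X -> X) (a : X) :=
 [/\ side_at (fun x g h => V ((x, g), h)) s a /\ side_at (fun y g h => V ((g, y), h)) t a,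
  forall B : X -> Prop, (\forall z \near a, B z) -> \forall p \near (a, a), t p.1 = s p.2 -> B (m p) /\ V (p, m p),
  \forall q \near ((a, a), a), V q -> t q.1.1 = s q.1.2 /\ q.2 = m q.1,
  forall B : X -> Prop, (\forall z \near a, B z) -> \forall g \near a, B (v g) /\ V ((g, v g), s g) &
  [/\ \forall g \near a, @smooth_pt R X X setT s g /\ @smooth_pt R X X setT t g,
   \forall g \near a, @submersive_at R X X s (core X) g /\ @submersive_at R X X t (core X) g,
   \forall p \near (a, a), t p.1 = s p.2 -> @smooth_pt R (mprod X X) X [set p | t p.1 = s p.2] m p &
   \forall g \near a, @smooth_pt R X X setT v g]].
Lemma mon_functions : exists s t m v, forall a, core X a -> loc_gpd s t m v a.
Proof.
have data a (ca : core X a) i (ia : mdom i a) := mon_local_data hmon aV ca ia.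
have [||s hs] := @side_fun _ X _ _ hmon (fun x g h => V ((x, g), h)).
- by move=> a ca; split; [exact: (mon_mem hmon aV ca)|exact: (unit_law_l hmon rV ca)].
- move=> a i ca ia; have [kV [hV [kA [hA [cV cA cl]]]]] := data a ca i ia.
 exact: (src_sol hmon rV aV ca ia cV cA cl).
have [||t ht] := @side_fun _ X _ _ hmon (fun y g h => V ((g, y), h)).
- move=> a ca; split; first exact: (mon_mem hmon aV ca).
 by have [B nB HB] := unit_law_r hmon rV ca; exists B => // x g h Bx Bg Bh cx; exact: HB.
- move=> a i ca ia; have [kV [hV [kA [hA [cV cA cl]]]]] := data a ca i ia.
 exact: (tgt_sol hmon rV aV ca ia cV cA cl).
have mul a (ca : core X a) i (ia : mdom i a) : exists D zeta, @locsol R (mprod X X) X (i, i) i (a, a) a V D zeta /\ \forall p \near (a, a), D p <-> t p.1 = s p.2.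
 have [kV [hV [kA [hA [cV cA cl]]]]] := data a ca i ia.
 have [_ /(_ i ia)[zs szs nzs] _ _] := hs a ca; have [_ /(_ i ia)[zt szt nzt] _ _] := ht a ca.
 exact: (mul_sol hmon rV aV hs ht ca ia cV cA szs szt nzs nzt).
have inv a (ca : core X a) i (ia : mdom i a) : exists zeta, @locsol R X (mprod X X) i (i, i) a (a, a) [set q | V ((q.1, q.2.2), q.2.1) /\ core X q.2.1] setT zeta.
 have [kV [hV [kA [hA [cV cA cl]]]]] := data a ca i ia.
 have [_ /(_ i ia)[zs szs nzs] _ _] := hs a ca; have [_ /(_ i ia)[zt szt nzt] _ _] := ht a ca.
 exact: (inv_sol hmon rV aV hs ht ca ia cV cA szs szt nzs nzt).
have [||m hm] := @glob_solve R (mprod X X) X hXXm hXm [set p | core X p.1 /\ p.2 = p.1] fst V.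
- by move=> [c c'] A [/= _ ->] nA; apply: nearS (near_fst c nA).
- move=> [c c'] [/= cc ->]; have [_ /(_ c)[i ic] _ _ _] := hXm; have [D [z [Hz _]]] := mul c cc i ic.
 by exists (i, i), i, D, z.
have [||F hF] := @glob_solve R X (mprod X X) hXm hXXm (core X) (fun a => (a, a)) [set q | V ((q.1, q.2.2), q.2.1) /\ core X q.2.1].
- by move=> c A _ nA; have [B nB HB] := near_diag2 nA; apply: nearS nB => p Bp _; exact: HB.
- move=> c cc; have [_ /(_ c)[i ic] _ _ _] := hXm; have [z Hz] := inv c cc i ic.
 by exists i, (i, i), setT, z.
exists s, t, m, (snd \o F) => a ca.
have [_ /(_ a)[i ia] _ _ _] := hXm.
have [D [zm [sol nD]]] := mul a ca i ia; have [m1 m2] := hm (a, a) (i, i) i D zm (conj ca erefl) sol.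
have [zv solv] := inv a ca i ia; have [v1 v2] := hF a i (i, i) _ zv ca solv.
have [sa sz sn _] := hs a ca; have [ta tz tn _] := ht a ca.
have [zs szs nzs] := sz i ia; have [zt szt nzt] := tz i ia.
have mdiag : \forall q \near ((a, a), a), V q -> t q.1.1 = s q.1.2 /\ q.2 = m q.1.
 by apply: nearS (m2 &n (near_fst a nD)) => q [H1 H2] /H1[/H2 ? ?].
split.
- by split; [exact: hs|exact: ht].
- by move=> B nB; apply: nearS ((m1 _ nB) &n nD) => p [H1 H2] /H2/H1[].
- exact: mdiag.
- move=> B nB; have [B1 nB1 HB1] := mon_src_mul ca (hs a ca) (ht a ca) mdiag; have n1 := nearI nB nB1.
 apply: nearS (nB1 &n (v1 (fun n => B1 n.1 /\ (B n.2 /\ B1 n.2)) (near2 nB1 n1))) => g [B1g /(_ I)[[B1k [Bh B1h]] [/= v0 ck] _ _]].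
 (* The product [k] of [g] and [v g] found by the solution is a core point, so [s g = s k = k]. *)
 split => //; have [<- _] := HB1 _ _ _ B1g B1h B1k v0.
 by have [-> _ _ _] := hs _ ck.
split.
- have n1 := smooth_pt_near (S := setT) hXm hXm ia szs (nearS (fun z H _ => H) nzs).
 have n2 := smooth_pt_near (S := setT) hXm hXm ia szt (nearS (fun z H _ => H) nzt).
 by apply: nearS (n1 &n n2) => g [H1 H2]; split; [exact: H1|exact: H2].
- have [kV [hV [kA [hA [cV cA cl]]]]] := data a ca i ia.
 have [eA cutA _] := cA.
 have sub := mon_submersion hmon hs ht ca ia cA szs szt nzs nzt.
 have H (f : X -> X) (z : 'rV[R]_(mdim X) -> 'rV[R]_(mdim X)) : f a = a -> (forall B : X -> Prop, (\forall z \near a, B z) -> \forall g \near a, B (f g) /\ core X (f g)) ->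
   smooth_at i:@a z -> (\forall g \near a, mdom i (f g) /\ i:@(f g) = z i:@g) ->
   (\forall g \near a, forall v, v *m jac hA (z i:@g) = 0 -> exists u : 'rV[R]_(mdim X), u *m jac z i:@g = v) ->
   \forall g \near a, @submersive_at R X X f (core X) g.
  move=> fa nf sz' nz nsub.
  have n3 := nf _ (cut_near hXm cutA).
  apply: nearS ((nsub &n n3) &n ((near_near nz) &n (mdom_near hXm ia) &n (chart_cont hXm ia (sm_near sz')))).
  move=> g [[H1 [cg cfg]] [ng [ig sg]]]; have [_ eg] := near_pt ng.
  by apply: (submersive_atI hXm hXm ig sg ng (etrans eA (esym (addnn kA))) cg cfg) => v; rewrite eg; exact: H1.
 apply: nearI; [apply: (H s zs) => //|apply: (H t zt) => //].
 + by move=> B nB; apply: nearS (sn _ nB) => g [].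
 + by apply: nearS sub => g [].
 + by move=> B nB; apply: nearS (tn _ nB) => g [].
 + by apply: nearS sub => g [].
- have [_ szm _ _] := sol.
 apply: (@smooth_pt_near R (mprod X X) X hXXm hXm [set p | t p.1 = s p.2] m (a, a) (i, i) i zm (conj ia ia) szm).
 by apply: nearS ((m1 _ (nearT _ (fun _ => I))) &n nD) => p [H1 H2] /H2/H1[].
- have [_ szv _ _] := solv.
 have n1 : \forall z \near a, setT z -> mdom i ((snd \o F) z) /\ i:@((snd \o F) z) = rsubmx (zv i:@z).
  by apply: nearS (v1 _ (nearT _ (fun _ => I))) => z H1 /H1[_ _ [_ ?] <-]; rewrite row_mxKr.
 have szr : smooth_at i:@a (fun u => rsubmx (zv u)).
  by apply: (sm_comp) => //; exact: smooth_rsub.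
 by apply: nearS (smooth_pt_near hXm hXm ia szr n1) => g; apply.
Qed.
End MonoidGlobal.

(** * Open submanifolds and their inclusions *)

Section OpenSub.
Variables (R : realType) (M : premanifold R) (U : set M).
Hypotheses (hM : is_manifold M) (oU : open U).
Definition msub : premanifold R :=
 @PreManifold R (set_type U) (mdim M) (mchart M) (fun i => [set x | mdom i (val x)]) (fun i x => i:@(val x)).
Definition subpt (y : M) (h : U y) : msub := exist _ y (mem_set h).
Lemma valU (x : msub) : U (val x). Proof. exact: set_mem (valP x). Qed.
Lemma cont_val : continuous (val : msub -> M).
Proof. exact: initial_continuous. Qed.
Lemma near_val (x : msub) (P : M -> Prop) : (\forall y \near val x, P y) -> \forall z \near x, P (val z).
Proof. by move=> nP; exact: (@cont_val x _ nP). Qed.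
Lemma near_sub (x : msub) (P : msub -> Prop) : (\forall z \near x, P z) -> \forall y \near val x, exists2 z : msub, val z = y & P z.
Proof.
move=> nP; have [W [oW Wx WP]] := nearO nP; case: oW => B oB eB.
have Bx : B (val x) by rewrite -eB in Wx.
apply: nearS ((open_near oB Bx) &n (open_near oU (valU x))) => y [By Uy].
exists (subpt Uy) => //; apply: WP; rewrite -eB; exact: By.
Qed.
Lemma msub_manifold : is_manifold msub.
Proof.
have [[hs [Bs cB [oB bB]]] cM oM chM tM] := hM; split.
- split.
  move=> x y c; apply: val_inj; apply: hs => A B nA nB.
  have [z [Az Bz]] := c _ _ (@near_val x A nA) (@near_val y B nB); by exists (val z).
 exists [set val @^-1` B | B in Bs]; first exact: card_le_trans (card_image_le _ _) cB.
 split; first by move=> _ [B BB <-]; exists B => //; exact: oB.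
 move=> x A nA; have [B [BB Bx] BA] := bB (val x) _ (near_sub nA).
 exists (val @^-1` B); first by split => //; exists B.
 by move=> z /BA[z' /val_inj <-].
- by move=> x; exact: cM.
- by move=> i; exists (@mdom R M i) => //; exact: oM.
- move=> i; have [inj co op] := chM i; split.
 + by move=> x y /set_mem ix /set_mem iy e; apply: val_inj; apply: inj => //; exact: mem_set.
 + by move=> x ix A nA; exact: (@near_val x (fun y : M => A (i : mchart M):@y) (co _ ix _ nA)).
 + move=> A [B oB' <-] AB.
  have -> : @mcoord R msub i @` (val @^-1` B : set msub) = @mcoord R M i @` (B `&` U).
   apply/seteqP; split=> [_ [x Bx <-]|_ [y [By Uy] <-]]; first by exists (val x); split => //; exact: valU.
   by exists (subpt Uy).
  apply: op; first exact: openI.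
  by move=> y [By Uy]; exact: (AB (subpt Uy) By).
- move=> i j x ix jx; have [T [sT nT]] := tM i j (val x) ix jx; exists T; split => //.
 exact: (near_val nT).
Qed.
End OpenSub.
Section OpenSympl.
Variables (R : realType) (X : premicrofold R) (U : set X).
Hypotheses (hX : is_mf X) (oU : open U) (cU : core X `<=` U).
Let hXs := proj1 hX.
Let hXm := sympl_mfd hXs.
Definition xsub : premicrofold R :=
 @PreMicrofold R (@PreSymplectic R (msub U) (fun i x => form i (val x))) [set x | core X (val x)].
Let hUm : is_manifold xsub := msub_manifold hXm oU.
Lemma xsub_sympl : is_symplectic xsub.
Proof.
have [_ fX iX cX] := hXs; split => //.
- by move=> i x ix; exact: fX.
- move=> i j x T ix jx sT nT; apply: iX => //.
 by apply: nearS (near_sub oU nT) => y [z <-].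
- move=> i x ix; have [w [sw nw cw]] := cX i (val x) ix; exists w; split => //.
 exact: near_val nw.
Qed.
Lemma xsub_lagr k (L : set X) i (x : xsub) (h : _ -> 'rV[R]_k) : lagr_cut i (val x) L h -> @lagr_cut R xsub i x (val @^-1` L) k h.
Proof.
move=> [e [ix sh fh nh] il]; split => //; first by split => //; exact: near_val nh.
exact: (near_val il).
Qed.
Lemma xsub_microfold : is_mf xsub.
Proof.
split; first exact: xsub_sympl.
have [_ lA] := hX; have [k ek _] := lA; apply: (@lagr_atI _ _ k _ xsub_sympl ek) => x cx.
have [_ /(_ (val x))[i ix] _ _ _] := hXm; have [k' [h lc]] := lagr_atE hXs lA cx ix.
by exists i, k', h; exact: xsub_lagr.
Qed.
Let hU := xsub_microfold.
Definition incl_core (c : core X) : core xsub := exist _ (subpt (cU (valcore c)) : xsub) (mem_set (valcore c)).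
Definition sub_core (c : core xsub) : core X := exist _ (val (val c)) (mem_set (valcore c)).
Definition incl : xsub =>> X := PreMicro incl_core (germ (gr incl_core) [set p | p.2 = val p.1]).
Definition incl_inv : X =>> xsub := PreMicro sub_core (germ (gr sub_core) [set p | p.1 = val p.2]).
(** A presentation of the diagonal at a core point; the inclusion and its inverse both look like it
    in charts. *)
Let data (b : X) (i : mchart X) (cb : core X b) (ib : mdom i b) : exists k (h : 'rV[R]_(mdim X) -> 'rV[R]_k) k' (hV : 'rV[R]_(mdim X + mdim X) -> 'rV[R]_k'),
 [/\ mdim (sprod (sopp X) X) = k'.*2, core_cut i b h, @cut R (sprod (sopp X) X) (i, i) (b, b) [set p | p.1 = p.2] _ hV,
  \forall y \near (b, b), y.1 = y.2 -> @isotropic R (sprod (sopp X) X) (i, i) y _ hV &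
  forall u v : 'rV[R]_(mdim X), u:|v *m jac hV i:@b:|i:@b = 0 -> u *m jac h i:@b = 0 -> v *m jac h i:@b = 0 -> u = v].
Proof.
have [mi _ _ _ _] := isgraph_id hX; have [si _] := mi.
pose c : core X := exist _ b (mem_set cb); have [k [h ch]] := core_cutE hX cb ib.
have [k' [hV [F [[[e V0 [sF nF]] cA cB [cV iV] ker] _]]]] := micro_dataE hX hX (b := c) si (micro_rep hX hX mi (rep_id X)) ib ib ch ch.
exists k, h, k', hV; split => // u v uv hu hv; rewrite (ker u v uv hu hv).
have [eh ccut _] := ch.
have sg : smooth_at i:@b (fun z => F z + - id z) by apply: sm_add => //; apply: sm_opp; exact: sm_id.
have := cut_kill hXm (etrans eh (esym (addnn k))) ccut cb sg _ hv.
rewrite jac_add //; last by apply: sm_opp; exact: sm_id.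
rewrite jac_opp ?jac_id; last exact: sm_id.
rewrite mulmxDr mulmxN mulmx1 => H; apply/eqP; rewrite -subr_eq0; apply/eqP; apply: H.
by apply: nearS nF => z H cz; have [_ <-] := H (exist _ z (mem_set cz)) erefl; rewrite subrr.
Qed.
Let near_l (x : xsub) (y : X) (P : X * X -> Prop) : (\forall q \near (val x, y), P q) -> \forall q \near (x, y), P (val q.1, q.2).
Proof. by move=> nP; have := @cont_prodmap xsub X X X val id (@cont_val R X U) (fun z => @cont_id X z) (x, y) _ nP. Qed.
Let near_r (x : X) (y : xsub) (P : X * X -> Prop) : (\forall q \near (x, val y), P q) -> \forall q \near (x, y), P (q.1, val q.2).
Proof. by move=> nP; have := @cont_prodmap X xsub X X id val (fun z => @cont_id X z) (@cont_val R X U) (x, y) _ nP. Qed.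
Lemma incl_micro : is_micro incl.
Proof.
have ex (b : core X) i : mdom i (val b) -> @ext_at R xsub X incl_core b i i id.
 by move=> ib; split; [exact: sm_id|apply: nearS (mdom_near hXm ib) => z iz b' eb; rewrite -eb in iz *].
apply: (is_microI hU hX).
 by apply: (smooth_mapI hU hX) => b; have [_ /(_ (val b))[i ib] _ _ _] := hXm; exists i, i, id; split => //; exact: ex.
move=> b; have [_ /(_ (val b))[i ib] _ _ _] := hXm.
have [k [h [k' [hV [eV ch [xd sV fV nV] iV ker]]]]] := data (valcore b) ib.
have [eh [_ sh fh nh] ih] := ch.
apply: (micro_dataI hU hX (i := i) (j := i) (hA := h) (hB := h) (hV := hV)); split => //.
- by split => //; exact: ex.
- by split => //; split => //; exact: (@near_val R X U (val (incl_core b)) _ nh).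
- split; first by split => //; apply: nearS (@near_l (val (incl_core b)) (val b) _ nV) => -[x y] [H1 H2]; split=> [/esym/H1|/H2/esym].
 by apply: nearS (@near_l (val (incl_core b)) (val b) _ iV) => -[x y] H /esym/H.
by move=> u v uv hu hv; rewrite jac_id mulmx1; exact: ker uv hu hv.
Qed.
Lemma incl_inv_micro : is_micro incl_inv.
Proof.
have ex (b : core xsub) i : mdom i (val b) -> @ext_at R X xsub sub_core b i i id.
 by move=> ib; split; [exact: sm_id|apply: nearS (mdom_near hUm ib) => z iz b' eb; rewrite -[z]eb in iz *].
apply: (is_microI hX hU).
 by apply: (smooth_mapI hX hU) => b; have [_ /(_ (val (val b)))[i ib] _ _ _] := hXm; exists i, i, id; split => //; exact: ex.
move=> b; have [_ /(_ (val (val b)))[i ib] _ _ _] := hXm.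
have [k [h [k' [hV [eV ch [xd sV fV nV] iV ker]]]]] := data (valcore b) ib.
have [eh [_ sh fh nh] ih] := ch.
apply: (micro_dataI hX hU (i := i) (j := i) (hA := h) (hB := h) (hV := hV)); split => //.
- by split => //; exact: ex.
- by split => //; split => //; exact: (near_val nh).
- split; first by split => //; exact: (near_r nV).
 exact: (near_r iV).
by move=> u v uv hu hv; rewrite jac_id mulmx1; exact: ker uv hu hv.
Qed.
Lemma incl_inverse : incl_inv \o' incl = i_ xsub /\ incl \o' incl_inv = i_ X.
Proof.
have [[s1 _] [s2 _]] := (incl_micro, incl_inv_micro); split.
 apply: (micro_ext (V := [set p | p.1 = p.2]) _ (rep_id xsub)); last by move=> b; exact: nearT.
  apply: (rep_comp hU hX hU s1 s2 (erefl : rep incl _) (erefl : rep incl_inv _)) => c; split.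
   move=> N nN; apply: nearS (near_snd _ (@near_val R X U (val c) _ nN)) => -[x y] Ny ->.
   by exists (val y).
  by apply: nearT => -[[x y] z] -> /val_inj.
 by move=> b; exact: val_inj.
apply: (micro_ext _ (rep_id X)); last by move=> b; exact: nearT.
 apply: (rep_comp hX hU hX s2 s1 (erefl : rep incl_inv _) (erefl : rep incl _)) => c; split.
  move=> N nN; apply: nearS (near_fst _ (near_sub oU nN)) => -[x y] /= [z zx Nz] xy.
  by exists z; split => //; rewrite -?xy zx.
 by apply: nearT => -[[x y] z] /= -> ->.
by [].
Qed.
End OpenSympl.

(** * Assembling the groupoid on an open set *)

Section Integrate.
Variables (R : realType) (X : premicrofold R) (mu : X:~X =>> X) (e : (mfunit R) =>> X).
Hypothesis hmon : is_mon mu e.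
Let hX := mon_mf hmon.
Let mm := mon_mic hmon.
Let hXs := proj1 hX.
Let hXm := sympl_mfd hXs.
Let hXX := mfprodP hX hX.
Variable V : set ((X * X) * X).
Hypotheses (rV : rep mu V) (lV : @is_lagrangian R (sprod (sopp (sprod X X)) X) V).
Variables (s t : X -> X) (m : X * X -> X) (v : X -> X).
Hypothesis loc : forall a, core X a -> loc_gpd V s t m v a.
Let stfix a : core X a -> s a = a /\ t a = a.
Proof. by move=> /loc[[[? _ _ _] [? _ _ _]] _ _ _ _]. Qed.
Let good (g : X) := (core X (s g) /\ core X (t g)) /\ ((@smooth_pt R X X setT s g /\ @smooth_pt R X X setT t g) /\
 (@submersive_at R X X s (core X) g /\ @submersive_at R X X t (core X) g)).
(** The carrier of the groupoid: source and target have to be smooth submersions to the core on all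
    of it, so it consists of interior points of the good set. *)
Let U : set X := interior good.
Let oU : open U. Proof. exact: open_interior. Qed.
Let Ugood g : U g -> good g. Proof. exact: interior_subset. Qed.
Let cU : core X `<=` U.
Proof.
move=> a ca; have [[[_ _ sn _] [_ _ tn _]] _ _ _ [n1 n2 _ _]] := loc ca.
have n3 := nearI (sn _ (nearT _ (fun _ => I))) (tn _ (nearT _ (fun _ => I))).
by apply: nearS (n3 &n n1 &n n2) => g [[[_ ? _] [_ ? _]] [? ?]].
Qed.
Let st_cont g : U g -> {for g, continuous s} /\ {for g, continuous t}.
Proof.
move=> /Ugood[_ [[p1 p2] _]]; have [_ cM _ _ _] := hXm; have [i ig] := cM g.
have H (f : X -> X) : @smooth_pt R X X setT f g -> {for g, continuous f}.
 move=> p; have [j jg] := cM (f g); have [F [sF nF]] := p i j ig jg.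
 by apply: (coord_cont hXm hXm ig sF); apply: nearS nF => z; apply.
by split; exact: H.
Qed.
(** Everything is conditional on composability, so that [ok] holds on a full neighbourhood of the
    unit pairs and [dom] is an open set intersected with the composable pairs. The clause on [V]
    makes the graph of the product locally equal to [V], hence lagrangian. *)
Let ok (q : X * X) := t q.1 = s q.2 -> (U (m q) /\ V (q, m q)) /\ (@smooth_pt R (mprod X X) X [set p | t p.1 = s p.2] m q /\
 \forall z \near (q, m q), V z <-> t z.1.1 = s z.1.2 /\ z.2 = m z.1).
Let dom (q : X * X) := interior ok q /\ t q.1 = s q.2.
Let idom (g : X) := interior [set g | U (v g) /\ @smooth_pt R X X setT v g] g.
Let near_ok a : core X a -> \forall q \near (a, a), interior ok q.
Proof.
move=> ca; have [_ n1 n2 _ [_ _ n3 _]] := loc ca.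
suff : \forall q \near (a, a), ok q by exact: near_near.
have n4 : \forall z \near ((a, a), a), V z <-> t z.1.1 = s z.1.2 /\ z.2 = m z.1.
 apply: nearS (n2 &n (near_fst a (n1 _ (nearT _ (fun _ => I))))) => -[q k] /= [H1 H2]; split=> // -[e1 ->].
 by have [] := H2 e1.
have [P [Q [nP nQ PQ]]] := unbox (near_near n4).
apply: nearS ((n1 _ (nQ &n (open_near oU (cU ca)))) &n n3 &n nP) => q [H1 [H2 Pq]] e1.
have [[Qm Um] vq] := H1 e1; split => //; split; [exact: H2|exact: PQ].
Qed.
Let ax3 (g h k : X) := [/\ [/\ dom (s g, g), m (s g, g) = g, dom (g, t g) & m (g, t g) = g],
 t g = s h -> [/\ dom (g, h), s (m (g, h)) = s g & t (m (g, h)) = t h] &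
 t g = s h -> t h = s k -> [/\ dom (m (g, h), k), dom (g, m (h, k)) & m (m (g, h), k) = m (g, m (h, k))]].
(** Every product must land where the next one is under control, whence the tower [nN0], [nN1],
    [nN2]. The equations then come from uniqueness of products and from [assoc_law]. *)
Let local_ax3 a : core X a -> exists2 B : X -> Prop, \forall z \near a, B z & forall g h k, B g -> B h -> B k -> ax3 g h k.
Proof.
move=> ca; have [[hs ht] n1 n2 _ _] := loc ca; have [_ _ sn _] := hs; have [_ _ tn _] := ht.
have [Bd nBd Hd] := near_diag2 (near_ok ca); have [B3 nB3 H3] := near_diag3 n2.
have [B4 nB4 H4] := mon_src_mul hmon rV ca hs ht n2; have [B5 nB5 H5] := assoc_law hmon rV ca nB3.
have nN0 := nearI (nBd &n nB3) (nB4 &n nB5).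
have [B6 nB6 H6] := near_diag2 (n1 _ nN0); have nN1 := nearI nN0 nB6.
have [B7 nB7 H7] := near_diag2 (n1 _ nN1); have nN2 := nearI nN1 nB7.
eexists; first exact: (nN2 &n (sn _ nN2) &n (tn _ nN2)).
move=> g h k [[[[[g0 g3] [g4 g5]] g6] g7] [[sg cs vs] [tg ct vt]]] [[[[[h0 h3] [h4 h5]] h6] h7] _] [[[[[k0 k3] [k4 k5]] k6] k7] _].
have [[[[[s0 s3] _] _] _] [[[[t0 t3] _] _] _]] := (sg, tg).
have mulE x y z : B3 x -> B3 y -> B3 z -> V ((x, y), z) -> t x = s y /\ z = m (x, y) by exact: H3.
split.
- have [e1 e2] := mulE _ _ _ s3 g3 g3 vs; have [e3 e4] := mulE _ _ _ g3 t3 g3 vt.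
 by split => //; split => //; exact: Hd.
- move=> e1; have [[[x0 x3] [x4 _]] vm] := H6 _ _ g6 h6 e1; have [e2 e3] := H4 _ _ _ g4 h4 x4 vm.
 by split => //; split => //; exact: Hd.
move=> e1 e2; have [[[[p0 p3] [p4 p5]] p6] vp] := H7 _ _ g7 h7 e1; have [_ tp] := H4 _ _ _ g4 h4 p4 vp.
have [[[q0 q3] [q4 _]] vq] := H6 _ _ h6 k6 e2; have [sq _] := H4 _ _ _ h4 k4 q4 vq.
have e3 : t (m (g, h)) = s k by rewrite tp.
have e4 : t g = s (m (h, k)) by rewrite sq.
have [[[l0 l3] [l4 l5]] vl] := H6 _ _ p6 k6 e3.
split; [by split => //; exact: Hd|by split => //; exact: Hd |].
have [/(_ vp vl)[n [n3 v1 v2]] _] := H5 g h k _ _ g5 h5 k5 l5 p5.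
have [_ en] := mulE _ _ _ h3 k3 n3 v1; have [_ el] := mulE _ _ _ g3 n3 l3 v2.
by rewrite -en -el.
Qed.
Let ax (g h k : X) := ax3 g h k /\ [/\ idom g, s (v g) = t g /\ t (v g) = s g, dom (g, v g) /\ m (g, v g) = s g & dom (v g, g) /\ m (v g, g) = t g].
(** [v] is a right inverse by construction. Associating [g v(g) v(v(g))] in two ways gives
    [v(v(g)) = g], so it is a left inverse too. *)
Let local_ax a : core X a -> exists2 B : X -> Prop, \forall z \near a, B z & forall g h k, B g -> B h -> B k -> ax g h k.
Proof.
move=> ca; have [[hs ht] n1 n2 nv [_ _ _ svn]] := loc ca; have [_ _ sn _] := hs.
have [B1 nB1 H1] := local_ax3 ca; have [B3 nB3 H3] := near_diag3 n2.
have [B4 nB4 H4] := mon_src_mul hmon rV ca hs ht n2; have [Bd nBd Hd] := near_diag2 (near_ok ca).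
have nN := nearI (nB1 &n nB3) (nB4 &n nBd).
have nN' := nearI nN ((sn _ nN) &n (nv _ nN)).
have nid : \forall g \near a, idom g.
 by apply: near_near; apply: nearS ((nv _ (open_near oU (cU ca))) &n svn) => g [[? _] ?].
eexists; first exact: (nid &n nN' &n (nv _ nN')).
move=> g h k [ig [[[[g1 g3] [g4 gd]] [[[[s1 s3] [s4 _]] cs _] [_ vg]]] [[[[i1 i3] [i4 idd]] [[[[si1 si3] [si4 _]] csi _] [[[j1 j3] [j4 _]] vj]]] _]]].
move=> [_ [[[[h1 _] _] _] _]] [_ [[[[k1 _] _] _] _]].
have inv x y z : B3 x -> B3 y -> B3 z -> B4 x -> B4 y -> B4 z -> V ((x, y), z) -> core X z -> [/\ t x = s y, m (x, y) = z & t y = z].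
 move=> x3 y3 z3 x4 y4 z4 v0 cz; have [e1 e2] := H3 _ _ _ x3 y3 z3 v0; have [_ e3] := H4 _ _ _ x4 y4 z4 v0.
 by split => //; rewrite -e3 (stfix cz).2.
have [e1 e2 e3] := inv _ _ _ g3 i3 s3 g4 i4 s4 vg cs.
have [f1 f2 f3] := inv _ _ _ i3 j3 si3 i4 j4 si4 vj csi.
split; first exact: H1.
have [_ _] := H1 g (v g) (v (v g)) g1 i1 j1 => /(_ e1 f1)[_ _].
rewrite e2 f2 -e1; have [[_ _ _ ->] _ _] := H1 g g g g1 g1 g1.
have [[_ ej _ _] _ _] := H1 (v (v g)) g g j1 g1 g1; rewrite -f1 e3 in ej; rewrite ej => eg.
rewrite eg in f2.
split; [exact: ig|by rewrite e1 e3|by split; split => //; exact: Hd|split; [split => //; exact: Hd|by rewrite f2 e1]].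
Qed.
Let core_thin (Bx : set X -> Prop) : (forall a, core X a -> exists2 B : X -> Prop, \forall z \near a, B z & Bx B) ->
 exists W : set (X * X), [/\ open W, forall a, core X a -> W (a, a) &
  forall n p, W (n, p) -> exists2 B, Bx B & forall n', W (n', p) -> B n'].
Proof.
move=> H; have [[hs sc] _ _ _ _] := hXm.
have [|U2 [[oU2 dU2] H2 _]] := @thin X X [set p | core X p.1 /\ p.2 = p.1] (fun N' _ => exists2 B, Bx B & N' `<=` B) sc (manifold_regular hXm).
 move=> n c [/= cn ->]; have [B nB hB] := H n cn; exists (interior B), setT; split; [by exists B => //; exact: interior_subset|exact: open_interior |].
 by apply: nearS (near_near nB) => p Bp; split => // n' [/= _ <-].
exists U2; split => // [a ca|n p Up]; first exact: dU2.
by have [N' [P' [[B hB NB] _ H']]] := H2 _ _ Up; exists B => // n' /H'/NB.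
Qed.
(** Composable [g], [h] share the point [t g = s h], over which thinness puts them in one box. For a
    third element, [U3] carries [k], controlled over [t h = s k], to the point [s h]. *)
Let global_ax : exists U' : set X, [/\ onbhd (core X) U', forall g, U' g -> ax g g g,
 forall g h, U' g -> U' h -> t g = s h -> ax g h h & forall g h k, U' g -> U' h -> U' k -> t g = s h -> t h = s k -> ax g h k].
Proof.
have [U2 [oU2 dU2 H2]] := core_thin local_ax.
have [|U3 [oU3 dU3 H3]] := core_thin (Bx := fun B => forall h k, B h -> B k -> U2 (k, s h)).
 move=> a ca; have [sc _] := st_cont (cU ca); have [sa _] := stfix ca.
 have n1 : \forall p \near (a, a), U2 (p.2, s p.1).
  have [P [Q [nP nQ PQ]]] := unbox (open_near oU2 (dU2 a ca)).
  rewrite -{1}sa in nQ; apply: nearS (near2 (near_pre sc nQ) nP) => p [? ?]; exact: PQ.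
 have [P [Q [nP nQ PQ]]] := unbox n1.
 by exists (fun z => P z /\ Q z); [exact: nearI|move=> h k [? _] [_ ?]; exact: (PQ h k)].
have ax2 p g h k : U2 (g, p) -> U2 (h, p) -> U2 (k, p) -> ax g h k.
 by move=> ug uh uk; have [B hB HB] := H2 _ _ ug; apply: hB; exact: HB.
have op (f : X -> X) (W : set (X * X)) : open W -> (forall g, U g -> {for g, continuous f}) -> open [set g | U g /\ W (g, f g)].
 move=> oW cf; apply: open_of_near => g [Ug Wg].
 exact: nearI (open_near oU Ug) (near_pre (cont_pair (@cont_id _ g) (cf g Ug)) (open_near oW Wg)).
pose W1 (W : set (X * X)) (f : X -> X) := [set g | U g /\ W (g, f g)].
exists ((W1 U2 s `&` W1 U2 t) `&` W1 U3 t `&` W1 U3 s); split.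
- split.
  have cs g (Ug : U g) := (st_cont Ug).1; have ct g (Ug : U g) := (st_cont Ug).2.
  exact: (openI (openI (openI (op _ _ oU2 cs) (op _ _ oU2 ct)) (op _ _ oU3 ct)) (op _ _ oU3 cs)).
 by move=> a ca; have [sa ta] := stfix ca; rewrite /W1 /setI /= sa ta; do !split; first [exact: cU|exact: dU2|exact: dU3].
- by move=> g [[[[_ h] _] _] _]; exact: (ax2 _ _ _ _ h h h).
- by move=> g h [[[_ [_ ug]] _] _] [[[[_ uh] _] _] _] e1; rewrite e1 in ug; exact: (ax2 _ _ _ _ ug uh uh).
move=> g h k [[[_ [_ ug]] _] _] [[[[_ uh] _] [_ uh3]] _] [_ [_ uk]] e1 e2; rewrite e1 in ug; rewrite -e2 in uk.
by have [B hB HB] := H3 _ _ uh3; exact: (ax2 _ _ _ _ ug uh (hB _ _ (HB _ uh3) (HB _ uk))).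
Qed.
Let Y := @xsub R X U.
Let hY : is_mf Y := xsub_microfold hX oU.
Let hYs := proj1 hY.
Let hYm := sympl_mfd hYs.
(** On the domains of product and inverse the values lie in [U]; the default [x] only makes the
    functions total. *)
Let lift (y : X) (x : Y) : Y := if pselect (U y) is left h then subpt h else x.
Let liftE y x : U y -> val (lift y x) = y. Proof. by rewrite /lift; case: pselect. Qed.
Let sU (x : Y) : Y := subpt (cU (Ugood (valU x)).1.1).
Let tU (x : Y) : Y := subpt (cU (Ugood (valU x)).1.2).
Let G : pregroupoid R := @PreGroupoid R Y sU tU [set p | dom (val p.1, val p.2)] (fun p => lift (m (val p.1, val p.2)) p.1)
 [set x | idom (val x)] (fun x => lift (v (val x)) x).
Let vv (p : Y * Y) : X * X := (val p.1, val p.2).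
Let near_vv (p : Y * Y) (P : X * X -> Prop) : (\forall q \near vv p, P q) -> \forall q \near p, P (vv q).
Proof. by case: p => x y nP; exact: (@cont_prodmap Y Y X X val val (@cont_val R X U) (@cont_val R X U) (x, y) _ nP). Qed.
Let domU p : dom p -> U (m p). Proof. by move=> [/interior_subset H e1]; have [[]] := H e1. Qed.
Let smooth_st (f : X -> X) (fU : Y -> Y) : (forall x, val (fU x) = f (val x)) -> (forall x, U x -> @smooth_pt R X X setT f x /\ @submersive_at R X X f (core X) x) ->
 @smooth_map R G G setT (fun x => fU (val x)) /\ @submersion_to R G G fU (core G).
Proof.
move=> eU H; split.
 apply: (@smap_intro R G G) => x i j _ ix jx; have [sp _] := H _ (valU x).
 rewrite /= eU in jx; have [F [sF nF]] := sp i j ix jx; exists F; split => //.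
 by apply: nearS (near_val nF) => z H' _; have [] := H' I; rewrite /= eU.
move=> x i j ix jx F sF nF w tw; have [_ su] := H _ (valU x).
rewrite /= eU in jx; apply: (su i j ix jx F sF).
 by apply: nearS (near_sub oU nF) => y [z <- /= <-]; rewrite eU.
have [c [sc c0 dc nc]] := tw; exists c; split => //; first by rewrite c0 /= eU.
by apply: nearS nc => r [y [? ? ?]]; exists (val y).
Qed.
Let gpdG : gp G.
Proof.
have [ss1 ss2] := @smooth_st s sU (fun _ => erefl) (fun x Ux => conj (Ugood Ux).2.1.1 (Ugood Ux).2.2.1).
have [st1 st2] := @smooth_st t tU (fun _ => erefl) (fun x Ux => conj (Ugood Ux).2.1.2 (Ugood Ux).2.2.2).
have [_ lA] := hY; have [k _ [sA _]] := lA.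
have oI : open [set p : Y * Y | interior ok (vv p)].
 by apply: open_of_near => p op; apply: near_vv; exact: open_near (@open_interior _ ok) op.
split => //.
- split => //.
 + by split => //; exists k.
 + split; first by move=> g; split; have [[] ] := Ugood (valU g).
  by move=> a ca; have [sa ta] := stfix ca; split; apply: val_inj.
 + split.
   exists [set p : Y * Y | interior ok (vv p)].
    by split => // -[a b] [/= ca ->]; exact: near_pt (near_ok ca).
   apply/seteqP; split => [p [? ?]|p [? /(congr1 val) ?]]; split => //; exact: val_inj.
  split.
  * apply: (@smap_intro R (mprod G G) G) => p i j dp ip jp; have mp := domU dp.
   have [/interior_subset H e1] := dp; have [_ [sm _]] := H e1.
   rewrite /= liftE // in jp; have [F [sF nF]] := sm i j ip jp; exists F; split => //.
   apply: nearS (@near_vv p _ nF) => q Hq dq; have [_ e2] := dq; have := Hq e2.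
   by rewrite /= liftE //; exact: domU dq.
  * split; first by apply: open_of_near => x ix; exact: (near_val (open_near (@open_interior _ _) ix)).
   by move=> a ca; have [B /near_pt Ba H] := local_ax ca; have [_ []] := H _ _ _ Ba Ba Ba.
  * apply: (@smap_intro R G G) => x i j dx ix jx; have [Uv sv] := interior_subset dx.
   rewrite /= liftE // in jx; have [F [sF nF]] := sv i j ix jx; exists F; split => //.
   by apply: nearS (near_val nF) => z Hz dz; have [Uz _] := interior_subset dz; have := Hz I; rewrite /= liftE.
 + have [U' [[oU' cU'] h1 h2 h3]] := global_ax; exists [set x | U' (val x)]; split.
  * split; first by exists U'.
   by move=> a /cU'.
  * move=> g ug; have [[[d1 e1 d2 e2] _ _] _] := h1 _ ug.
   by split => //; apply: val_inj; rewrite liftE //= (e1, e2); exact: valU.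
  * move=> g h ug uh /(congr1 val) e0; have [[_ /(_ e0)[d e1 e2] _] _] := h2 _ _ ug uh e0.
   by split => //; apply: val_inj; rewrite /= liftE //; exact: domU d.
  * move=> g h k' ug uh uk /(congr1 val) e0 /(congr1 val) /= e'; have [[_ _ /(_ e0 e')[d1 d2 e1]] _] := h3 _ _ _ ug uh uk e0 e'.
   have [[_ /(_ e0)[d3 _ _] _] _] := h2 _ _ ug uh e0; have [[_ /(_ e')[d4 _ _] _] _] := h2 _ _ uh uk e'.
   have [u3 u4] := (domU d3, domU d4).
   split; rewrite ?liftE //; apply: val_inj; rewrite !liftE //; exact: domU.
  * move=> g ug; have [_ [ig [e1 e2] [d1 e3] [d2 e4]]] := h1 _ ug; have [Uv _] := interior_subset ig.
   split => //; [split|split|split]; rewrite /= ?liftE //; apply: val_inj; rewrite /= !liftE //; exact: domU.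
 have [kV ek _] := lV.
apply: (@lagr_atI R (sprod (sopp (sprod G G)) G) kV) => //.
 by exact: sprod3_valid.
move=> [p k'] [dp /= ep]; have mp := domU dp; have [op e1] := dp.
have [[_ Vm] [_ nV]] := interior_subset op e1.
have ek' : val k' = m (vv p) by rewrite ep liftE.
rewrite -/(vv p) -ek' in Vm nV.
have hW : is_symplectic (sprod (sopp (sprod X X)) X).
 by exact: sprod3_valid.
have hWG : is_manifold (sprod (sopp (sprod G G)) G).
 by apply: mprodP => //; exact: mprodP.
have [_ cM _ _ _] : is_manifold (sprod (sopp (sprod X X)) X) by case: hW.
have [i iq] := cM (vv p, val k'); exists i.
have [k2 [h lc]] := lagr_atE hW lV Vm iq.
pose F (q : (Y * Y) * Y) : (X * X) * X := (vv q.1, val q.2).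
have cF : {for (p, k'), continuous F}.
 have c1 : continuous vv by move=> q A nA; exact: near_vv.
 exact: (@cont_prodmap (Y * Y)%type Y (X * X)%type X vv val c1 (@cont_val R X U) (p, k')).
have := @lagr_pull R (sprod (sopp (sprod G G)) G) (sprod (sopp (sprod X X)) X) i i F (p, k') 1%:M 1%:M V k2 h hWG.
have hWm : is_manifold (sprod (sopp (sprod X X)) X) by case: hW.
move=> /(_ hWm iq cF (mulmx1 _) erefl) lp.
have {}lp := lp (nearT _ (fun q => conj (esym (mulmx1 _)) (fun u v => esym (f_equal2 (fun a b => a *m _ *m b^T) (mulmx1 u) (mulmx1 v))))) lc.
(* Near [(p, k')] the graph of the product is the preimage of [V], by the last clause of [ok]. *)
apply: (@lagr_at_ext R (sprod (sopp (sprod G G)) G) i (p, k') (F @^-1` V)); first by eexists; eexists; exact: lp.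
have n1 : \forall q \near (p, k'), interior ok (vv q.1) by exact: near_fst (open_near oI op).
apply: nearS (n1 &n (near_pre cF nV)) => -[q y] [oq Vq].
split=> [/Vq[H1 H2]|[dq /= ey]].
 have dq : dom (vv q) by split.
 by split => //; apply: val_inj; rewrite liftE //; exact: domU.
apply: (iffRL Vq); split => /=; [by case: dq|by rewrite ey liftE //; exact: domU].
Qed.
(** Both sides are represented by the restriction of [V] to pairs of factors in the open set. *)
Let incl_mul : (incl cU) \o' (gr_mul G) = mu \o' ((incl cU) \x (incl cU)).
Proof.
have hG := gpd_monoid gpdG; have [_ [sm _] _ _ _] := hG.
have mi := incl_micro hX oU cU; have [si _] := mi.
have mt := tens_micro hY hX hY hX mi mi; have [sT _] := mt; have [smu _] := mm.
have diag (b : core X) : val (coremap mu b) = (val b, val b) by rewrite (mon_diag hmon).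
have ri : rep (incl cU) [set p | p.2 = val p.1] by [].
have rT := tens_rep ri ri.
have hYY := mfprodP hY hY.
apply: (@micro_ext R Y:~Y X _ _ [set q | V (vv q.1, q.2)] [set q | V (vv q.1, q.2)]).
- apply: (@rep_comp R Y:~Y Y X hYY hY hX (gr_mul G) (incl cU) _ _ _ sm si (rep_gr_mul G) ri) => c; split.
  move=> N nN; have cc := valcore c; have [_ _ n2 _ _] := loc cc.
  set p : Y := val (incl_core cU c).
  have n1 : \forall q \near ((p, p) : Y * Y, val c), interior ok (vv q.1) /\ (exists2 z : Y, val z = q.2 & N z).
   have nok : \forall q \near (p, p), interior ok (vv q) by exact: (@near_vv (p, p) _ (near_ok cc)).
   have nz : \forall y \near val c, exists2 z : Y, val z = y & N z by exact: (near_sub oU nN).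
   exact: nearI (near_fst (val c) nok) (near_snd ((p, p) : Y * Y) nz).
  have n3 : \forall q \near ((p, p) : Y * Y, val c), V (vv q.1, q.2) -> t (val q.1.1) = s (val q.1.2) /\ q.2 = m (vv q.1).
   have c1 : continuous vv by move=> q A nA; exact: near_vv.
   exact: (@cont_prodmap (Y * Y)%type X (X * X)%type X vv id c1 (fun z => @cont_id _ z) ((p, p), val c) _ n2).
  apply: nearS (n1 &n n3) => -[q y] [[oq [z zy Nz]] H] /H[e1 e2].
  have dq : dom (vv q) by split.
  exists z; split => //; split => //; apply: val_inj; rewrite liftE; last exact: domU.
  by rewrite -e2.
 apply: nearT => -[[q z] y] [dq ez] ey; rewrite /= in ez ey *; subst z y; have [/interior_subset H e1] := dq; have [[_ Vm] _] := H e1.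
 by rewrite liftE //; exact: domU.
- apply: (@rep_comp R Y:~Y X:~X X hYY (mfprodP hX hX) hX _ mu _ _ _ sT smu rT rV) => c; split.
  move=> N nN; have n1 : \forall q \near val (coremap ((incl cU) \x (incl cU)) (coremap mu c)), N (vv q).
   by apply: near_vv; move: nN; rewrite /vv /=; case: (val (coremap mu c)).
  by apply: nearS (near_fst _ n1) => -[q y] Nq Vq; exists (vv q).
 by apply: nearT => -[[[x y] [x' y']] z] [e1 e2]; rewrite /= in e1 e2 *; subst x' y'.
- by move=> b; rewrite /=; congr pair; apply: val_inj; rewrite /= (diag b).
- by move=> b; exact: nearT.
Qed.
Lemma monoid_integrates : exists (G : pregroupoid R) (f : G =>> X) (g : X =>> G),
 [/\ gp G, is_micro f /\ is_micro g, g \o' f = i_ G /\ f \o' g = i_ X &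
  f \o' (gr_mul G) = mu \o' (f \x f)].
Proof.
exists G, (incl cU), (incl_inv U); split; [exact: gpdG|split; [exact: incl_micro|exact: incl_inv_micro]|exact: incl_inverse|exact: incl_mul].
Qed.
End Integrate.
(** * The equivalence *)
Section Inverses.
Variable D : presmc.
Hypothesis hD : is_smc D.
Local Open Scope smc_scope.
Lemma inverses_sym (x y : ob D) (f : hom x y) (g : hom y x) : inverses f g -> inverses g f.
Proof. by case. Qed.
Lemma inverses_comp (x y z : ob D) (f : hom x y) (g : hom y x) (f' : hom y z) (g' : hom z y) : isob x -> isob y -> isob z ->
 inverses f g -> inverses f' g' -> inverses (f' \oc f) (g \oc g').
Proof.
have [[_ c2 c3 c4] _ _ _] := hD => hx hy hz [hf hg e1 e2] [hf' hg' e1' e2'].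
have hc := c2 _ _ _ _ _ hx hy hz hf' hf.
split; [exact: c2|exact: c2 | |].
 rewrite -(c4 _ _ _ _ g g' (f' \oc f)) ?(c4 _ _ _ _ g' f' f) // e1' (c3 _ _ f _ _ _).1 //.
have hc' := c2 _ _ _ _ _ hz hy hx hg hg'.
by rewrite -(c4 _ _ _ _ f' f (g \oc g')) ?(c4 _ _ _ _ f g g') // e2 (c3 _ _ g' _ _ _).1.
Qed.
Lemma inverses_tens (x y x' y' : ob D) (f : hom x y) (g : hom y x) (f' : hom x' y') (g' : hom y' x') : isob x -> isob y -> isob x' -> isob y' ->
 inverses f g -> inverses f' g' -> inverses (f \om f') (g \om g').
Proof.
have [_ [_ t2 t3 t4] _ _] := hD => hx hy hx' hy' [hf hg e1 e2] [hf' hg' e1' e2'].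
by split; [exact: t2|exact: t2|rewrite -t4 // e1 e1' t3|rewrite -t4 // e2 e2' t3].
Qed.
End Inverses.
Section Equivalence.
Variable (R : realType).
Let C := SymplMic R.
Local Notation gm := groupoid_monoid.
Lemma monoid_groupoid (Y : premonoid C) : is_monoid Y -> exists (G : pregroupoid R) (u : G =>> (mon_ob Y)) (v : (mon_ob Y) =>> G),
 gp G /\ @inverses (Mon C) (gm G) Y u v.
Proof.
case: Y => X mu e hY; have [/= hX mm _ _ _] := hY.
have [V [rV _ lV aV]] := is_micro_rep (mfprodP hX hX) hX mm.
have [s [t [m [v loc]]]] := mon_functions hY rV aV.
have [G [f [g [hG [m1 m2] [e1 e2] e3]]]] := monoid_integrates hY rV lV loc.
exists G, f, g; split => //.
have hM := gpd_monoid hG; have [hGm mG _ _ _] := hM.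
split=> //=; apply/monoid_morE => //; split => //.
exact: (inverse_map hGm mG hX mm m1 m2 e1 e2 e3).
Qed.
(** The comparison morphisms of the functor are identities of microfolds, but between monoids whose
    multiplications are equal only by a proved equation; hence the identity is shown to be an
    isomorphism instead of being an instance of [idm]. *)
Lemma id_inverses (X : premicrofold R) mul1 mul2 e1 e2 : @is_monoid C (PreMonoid (C := C) (mon_ob := X) mul1 e1) ->
 @is_monoid C (PreMonoid (C := C) (mon_ob := X) mul2 e2) -> mul1 = mul2 ->
 @inverses (Mon C) (PreMonoid (C := C) (mon_ob := X) mul1 e1) (PreMonoid (C := C) (mon_ob := X) mul2 e2) (i_ X) (i_ X).
Proof.
move=> h1 h2 e; have [/= hX m1 _ _ _] := h1.
have hXX := mfprodP hX hX; have mi : is_micro (i_ X) by vm.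
have [c1 c2] := micro_comp1 hXX hX m1; have [ci _] := micro_comp1 hX hX mi.
by split=> //=; apply/monoid_morE => //; split => //=; rewrite /mmul tens_id // -e c1 c2.
Qed.
Lemma functorM_tens (G H : pregroupoid R) : gp G -> gp H ->
 @inverses (Mon C) (mon_tens (gm G) (gm H)) (gm (gprod G H)) (i_ G:~H) (i_ G:~H).
Proof.
move=> hG hH; apply: id_inverses; first exact: (mtens_valid (gpd_monoid hG) (gpd_monoid hH)).
 exact: (gpd_monoid (gprod_valid hG hH)).
by rewrite gr_mul_prod //; exact: (mon_tensE (gm G) (gm H)).
Qed.
Lemma functorM_unit : @inverses (Mon C) (mon_unit C) (gm (gunit R)) (i_ (mfunit R)) (i_ (mfunit R)).
Proof.
apply: id_inverses; [exact: mon_unit_valid|exact: (gpd_monoid (gunit_valid R))|by rewrite gr_mul_unit].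
Qed.
Lemma functorM_sm : is_sm_functor (functorM R).
Proof.
have gmf (G : pregroupoid R) : gp G -> is_mf G := @gpd_mf R G.
have hE := mfunitP R.
split.
- by split=> //= [G /gpd_monoid//|G H f hG hH]; move=> hf; apply/(gpd_monoid_morE f hG hH).
- split; first by exists (i_ (mfunit R)); exact: functorM_unit.
 by move=> G H hG hH; exists (i_ G:~H); exact: functorM_tens.
- move=> G H G' H' f g /gmf hG /gmf hH /gmf hG' /gmf hH' [m1 _] [m2 _] /=.
 have m : is_micro (f \x g) by vm.
 by have [-> ->] := micro_comp1 (mfprodP hG hH) (mfprodP hG' hH') m.
- split.
  move=> G H K /gmf hG /gmf hH /gmf hK /=.
  have hGH := mfprodP hG hH; have hHK := mfprodP hH hK.
  have hl := mfprodP hGH hK; have hr := mfprodP hG hHK.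
  have m : is_micro (micro_assoc G H K) by vm.
  rewrite !tens_id //; have [e1 e2] := micro_comp1 hl hr m.
  have mi : is_micro (i_ G:~(H:~K)) by vm.
  rewrite !e2 (micro_comp1 hr hr mi).1; exact: esym.
 move=> G /gmf hG /=; rewrite !tens_id //.
 have hl := mfprodP hE hG; have hr := mfprodP hG hE.
 have ml : is_micro (micro_lunit G) by vm. have mr : is_micro (micro_runit G) by vm.
 by rewrite !(micro_comp1 hl hG ml).2 !(micro_comp1 hr hG mr).2.
- move=> G H /gmf hG /gmf hH /=.
 have m : is_micro (micro_braid G H) by vm.
 by have [-> ->] := micro_comp1 (mfprodP hG hH) (mfprodP hH hG) m.
Qed.
Definition iso_pair (A X : premicrofold R) (u : A =>> X) (v : X =>> A) :=
 [/\ is_mf A, is_mf X, is_micro u, is_micro v & v \o' u = i_ A /\ u \o' v = i_ X].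
Lemma iso_pairK A X (u : A =>> X) (v : X =>> A) W (f : W =>> X) : iso_pair u v -> is_mf W -> is_micro f -> u \o' (v \o' f) = f.
Proof. by move=> [hA hX mu mv [_ e]] hW m; rewrite micro_compA // e (micro_comp1 hW hX m).1. Qed.
Section Transport.
Variables (A X B Y P Q : premicrofold R).
Variables (uX : A =>> X) (vX : X =>> A) (uY : B =>> Y) (vY : Y =>> B).
Hypotheses (iX : iso_pair uX vX) (iY : iso_pair uY vY).
Section Pair.
Variables (uP : P =>> X:~Y) (vP : X:~Y =>> P).
Hypothesis (iP : iso_pair uP vP).
(** Between conjugates by the isomorphisms [u], [v], an equation reduces to one in the ambient
    category by cancelling adjacent pairs with [iso_pairK]. This lemma and the next ones are the
    axioms of a symmetric monoidal functor in that form. *)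
Lemma transport_tens A' X' B' Y' (uX' : A' =>> X') (vX' : X' =>> A') (uY' : B' =>> Y') (vY' : Y' =>> B')
  (uQ : Q =>> X':~Y') (vQ : X':~Y' =>> Q) (f : X =>> X') (g : Y =>> Y') :
 iso_pair uX' vX' -> iso_pair uY' vY' -> iso_pair uQ vQ -> is_micro f -> is_micro g ->
 vQ \o' (uX' \x uY') \o' ((vX' \o' (f \o' uX)) \x (vY' \o' (g \o' uY))) = vQ \o' ((f \x g) \o' uP) \o' (vP \o' (uX \x uY)).
Proof.
move=> iX' iY' iQ mf' mg; have [? ? ? ? _] := iX; have [? ? ? ? _] := iY; have [? ? ? ? _] := iP.
have [? ? ? ? _] := iX'; have [? ? ? ? _] := iY'; have [? ? ? ? _] := iQ.
lA. rewrite -micro_tensC; try vm.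
rewrite (iso_pairK iX'); try vm. rewrite (iso_pairK iY'); try vm. rewrite micro_tensC; try vm.
rewrite -(micro_compA); try vm. rewrite -(micro_compA); try vm.
by rewrite (iso_pairK iP); try vm.
Qed.
Lemma transport_braid (uQ : Q =>> Y:~X) (vQ : Y:~X =>> Q) : iso_pair uQ vQ ->
 vQ \o' (micro_braid X Y \o' uP) \o' (vP \o' (uX \x uY)) = vQ \o' (uY \x uX) \o' micro_braid A B.
Proof.
move=> iQ; have [? ? ? ? _] := iX; have [? ? ? ? _] := iY; have [? ? ? ? _] := iP; have [? ? ? ? _] := iQ.
rewrite -(micro_compA); try vm. rewrite -(micro_compA); try vm.
rewrite (iso_pairK iP); try vm. rewrite braid_natural; try vm.
by rA.
Qed.
Lemma transport_assoc D Z S T (uZ : D =>> Z) (vZ : Z =>> D) (uQ : Q =>> Y:~Z) (vQ : Y:~Z =>> Q)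
  (uS : S =>> X:~Y:~Z) (vS : X:~Y:~Z =>> S)
  (uT : T =>> X:~(Y:~Z)) (vT : X:~(Y:~Z) =>> T) :
 iso_pair uZ vZ -> iso_pair uQ vQ -> iso_pair uS vS -> iso_pair uT vT ->
 vT \o' (micro_assoc X Y Z \o' uS) \o' (vS \o' (uP \x uZ)) \o' ((vP \o' (uX \x uY)) \x i_ D) =
 vT \o' (uX \x uQ) \o' (i_ A \x (vQ \o' (uY \x uZ))) \o' micro_assoc A B D.
Proof.
move=> iZ iQ iS iT; have [? ? ? ? _] := iX; have [? ? ? ? _] := iY; have [? ? ? ? _] := iP.
have [hD ? mZ ? _] := iZ; have [? ? ? ? _] := iQ; have [? ? ? ? _] := iS; have [? ? ? ? _] := iT.
cA vT. cA (micro_assoc X Y Z).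
rewrite (iso_pairK iS); try vm. rewrite -(micro_compA); try vm.
rewrite -(micro_compA); try vm. rewrite -micro_tensC; try vm.
rewrite (iso_pairK iP); try vm. rewrite (micro_comp1 _ _ _).2; try vm.
rewrite assoc_natural; try vm.
rewrite -[X in _ = X \o' _](micro_compA); try vm. rewrite -micro_tensC; try vm.
rewrite (iso_pairK iQ); try vm. rewrite (micro_comp1 _ _ _).2; try vm.
by rA.
Qed.
End Pair.
Lemma transport_unit E (uE : E =>> (mfunit R)) (vE : (mfunit R) =>> E)
  (uP : P =>> (mfunit R):~X) (vP : (mfunit R):~X =>> P)
  (uQ : Q =>> X:~(mfunit R)) (vQ : X:~(mfunit R) =>> Q) :
 iso_pair uE vE -> iso_pair uP vP -> iso_pair uQ vQ ->
 vX \o' (micro_lunit X \o' uP) \o' (vP \o' (uE \x uX)) \o' (vE \x i_ A) = micro_lunit A /\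
 vX \o' (micro_runit X \o' uQ) \o' (vQ \o' (uX \x uE)) \o' (i_ A \x vE) = micro_runit A.
Proof.
move=> iE iP iQ; have [hA hX muX mvX [e1 _]] := iX; have [? ? ? ? [_ e2]] := iE; have [? ? ? ? _] := iP; have [? ? ? ? _] := iQ.
split.
 cA vX. cA (micro_lunit X).
 rewrite (iso_pairK iP); try vm. rewrite -(micro_compA); try vm.
 rewrite -(micro_compA); try vm. rewrite -micro_tensC; try vm.
 rewrite e2 (micro_comp1 _ _ _).2; try vm. rewrite (unitor_natural _ _ muX).1; try vm.
 rA. rewrite e1 (micro_comp1 _ _ _).1; by try vm.
cA vX. cA (micro_runit X).
rewrite (iso_pairK iQ); try vm. rewrite -(micro_compA); try vm.
rewrite -(micro_compA); try vm. rewrite -micro_tensC; try vm.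
rewrite e2 (micro_comp1 _ _ _).2; try vm. rewrite (unitor_natural _ _ muX).2; try vm.
rA. rewrite e1 (micro_comp1 _ _ _).1; by try vm.
Qed.
Lemma transport_comp Z D (uZ : D =>> Z) (vZ : Z =>> D) (g : Y =>> Z) (f : X =>> Y) : iso_pair uZ vZ -> is_micro f -> is_micro g ->
 vZ \o' ((g \o' f) \o' uX) = (vZ \o' (g \o' uY)) \o' (vY \o' (f \o' uX)).
Proof.
move=> iZ mf' mg; have [? ? ? ? _] := iX; have [? ? ? ? _] := iY; have [? ? ? ? _] := iZ.
rewrite -(micro_compA); try vm. rewrite -(micro_compA); try vm.
rewrite -(micro_compA); try vm. by rewrite (iso_pairK iY); try vm.
Qed.
End Transport.
Section QuasiInverse.
Variables (G : premonoid C -> pregroupoid R) (u : forall Y : premonoid C, premicro (G Y) (mon_ob Y)) (v : forall Y : premonoid C, premicro (mon_ob Y) (G Y)).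
Hypothesis hG : forall Y, is_monoid Y -> gp (G Y).
Hypothesis huv : forall Y, is_monoid Y -> @inverses (Mon C) (gm (G Y)) Y (u Y) (v Y).
Let iso Y : is_monoid Y -> iso_pair (u Y) (v Y).
Proof. by move=> hY; have [[m1 _ _] [m2 _ _] e1 e2] := huv hY; have [? _ _ _ _] := hY; split => //; exact: gpd_mf (hG hY). Qed.
(** Morphisms are conjugated by the chosen isomorphisms, and the comparison morphisms are the ones
    that make [u] monoidal. *)
Definition quasi_inverse : prefunctor (Mon C) (SymplGpdMic R) :=
 @PreFunctor (Mon C) (SymplGpdMic R) G (fun X Y f => v Y \o' (f \o' u X))
  (fun X Y => v (mon_tens X Y) \o' (u X \x u Y)) (v (mon_unit C)).
Let Gpd_inv (H K : pregroupoid R) (f : H =>> K) (g : K =>> H) : gp H -> gp K ->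
 @inverses (Mon C) (gm H) (gm K) f g -> @inverses (SymplGpdMic R) H K f g.
Proof.
by move=> hH hK [m1 m2 e1 e2]; split => //; [exact/(gpd_monoid_morE _ hH hK)|exact/(gpd_monoid_morE _ hK hH)].
Qed.
Let inv_unit : @inverses (SymplGpdMic R) (gunit R) (G (mon_unit C)) (v (mon_unit C)) (u (mon_unit C)).
Proof.
have h1 := mon_unit_valid R; have hE := gpd_monoid (gunit_valid R); have hD := is_smc_Mon R.
have i1 := huv h1; have [mE mG mu mv _] := iso h1; apply: Gpd_inv; [exact: gunit_valid|exact: hG |].
have ev : v (mon_unit C) \o' i_ (mfunit R) = v (mon_unit C) by exact: (micro_comp1 _ mE mv).2.
have eu : i_ (mfunit R) \o' u (mon_unit C) = u (mon_unit C) by exact: (micro_comp1 mE _ mu).1.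
rewrite -ev -eu; exact: (inverses_comp hD hE h1 (gpd_monoid (hG h1)) (inverses_sym functorM_unit) (inverses_sym i1)).
Qed.
Let inv_tens X Y : is_monoid X -> is_monoid Y ->
 @inverses (SymplGpdMic R) (gprod (G X) (G Y)) (G (mon_tens X Y)) (v (mon_tens X Y) \o' (u X \x u Y)) ((v X \x v Y) \o' u (mon_tens X Y)).
Proof.
move=> hX hY; have hXY := mtens_valid hX hY; have hD := is_smc_Mon R.
have [gX gY] := (gpd_monoid (hG hX), gpd_monoid (hG hY)); have gXY := mtens_valid gX gY.
have gp' := gprod_valid (hG hX) (hG hY).
have [? ? ? ? _] := iso hX; have [? ? ? ? _] := iso hY; have [? ? ? ? _] := iso hXY.
apply: Gpd_inv => //; first exact: hG.
have m1 : is_micro (v (mon_tens X Y) \o' (u X \x u Y)) by vm.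
have m2 : is_micro ((v X \x v Y) \o' u (mon_tens X Y)) by vm.
have i1 := inverses_tens hD gX hX gY hY (huv hX) (huv hY).
have i2 := inverses_comp hD gXY hXY (gpd_monoid (hG hXY)) i1 (inverses_sym (huv hXY)).
have := inverses_comp hD (gpd_monoid gp') gXY (gpd_monoid (hG hXY)) (inverses_sym (functorM_tens (hG hX) (hG hY))) i2.
have hGG : is_mf (G X):~(G Y) by vm.
rewrite /= (micro_comp1 _ _ _).2 // (micro_comp1 (f := (v X \x v Y) \o' _) _ _ _).1 //.
Qed.
Let is_hom (X Y : premonoid C) (f : (mon_ob X) =>> (mon_ob Y)) : is_monoid X -> is_monoid Y -> is_monoid_mor (X := X) (Y := Y) f ->
 is_groupoid_mor (v Y \o' (f \o' u X)).
Proof.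
move=> hX hY hf; apply/gpd_monoid_morE; [exact: hG|exact: hG |].
have [[_ c2 _ _] _ _ _] := is_smc_Mon R; have [m1 _ _ _] := huv hX; have [_ m2 _ _] := huv hY.
have [gX gY] := (gpd_monoid (hG hX), gpd_monoid (hG hY)).
exact: (c2 _ _ _ _ _ gX hY gY m2 (c2 _ _ _ _ _ gX hX hY hf m1)).
Qed.
Lemma quasi_inverse_sm : is_sm_functor quasi_inverse.
Proof.
split.
- split => //=.
 + by move=> X hX; have [h1 h2 mu mv [e _]] := iso hX; rewrite (micro_comp1 _ _ _).1.
 + by move=> X Y Z g f hX hY hZ [mg _ _] [mf' _ _]; exact: (transport_comp (iso hX) (iso hY) (iso hZ)).
- split; first by eexists; exact: inv_unit.
 by move=> X Y hX hY; eexists; exact: inv_tens.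
- move=> X Y X' Y' f g hX hY hX' hY' [mf' _ _] [mg _ _].
 exact: (transport_tens (iso hX) (iso hY) (iso (mtens_valid hX hY)) (iso hX') (iso hY') (iso (mtens_valid hX' hY'))).
- split.
  move=> X Y Z hX hY hZ; have [hXY hYZ] := (mtens_valid hX hY, mtens_valid hY hZ).
  exact: (transport_assoc (iso hX) (iso hY) (iso hXY) (iso hZ) (iso hYZ) (iso (mtens_valid hXY hZ)) (iso (mtens_valid hX hYZ))).
 move=> X hX; have h1 := mon_unit_valid R.
 exact: (transport_unit (iso hX) (iso h1) (iso (mtens_valid h1 hX)) (iso (mtens_valid hX h1))).
- move=> X Y hX hY; exact: (transport_braid (iso hX) (iso hY) (iso (mtens_valid hX hY)) (iso (mtens_valid hY hX))).
Qed.
Lemma quasi_inverse_eta : is_monoidal_natural_iso (F := functor_id (SymplGpdMic R)) (G := functor_comp quasi_inverse (functorM R)) (fun H : pregroupoid R => v (gm H)).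
Proof.
split.
- by move=> H hH; have hM := gpd_monoid hH; exists (u (gm H)); apply: Gpd_inv; [exact: hH|exact: hG|exact: (inverses_sym (huv hM))].
- move=> H K f hH hK [mf' _] /=; have [h1 ? ? ? _] := iso (gpd_monoid hH); have [? h2 ? ? _] := iso (gpd_monoid hK).
 have [_ _ _ _ [_ e]] := iso (gpd_monoid hH).
 rewrite -(micro_compA (h := v _)); try vm. cA f.
 by rewrite e (micro_comp1 _ _ mf').2.
- move=> H K hH hK; have [gH gK gHK] := And3 (gpd_monoid hH) (gpd_monoid hK) (gpd_monoid (gprod_valid hH hK)).
 have gT := mtens_valid gH gK; have iT := iso gT.
 have [h1 h2 m1 m2 [_ e1]] := iso gH; have [h3 h4 m3 m4 [_ e2]] := iso gK; have [h5 h6 m5 m6 _] := iT; have [h7 h8 m7 m8 _] := iso gHK.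
 have hHK : is_mf H:~K by [].
 have muu : is_micro (u (gm H) \x u (gm K)) by exact: (tens_micro h1 h2 h3 h4 m1 m3).
 have mvv : is_micro (v (gm H) \x v (gm K)) by exact: (tens_micro h2 h1 h4 h3 m2 m4).
 have hGG : is_mf (G (gm H)):~(G (gm K)) by exact: mfprodP.
 have euv : (u (gm H) \x u (gm K)) \o' (v (gm H) \x v (gm K)) = i_ H:~K.
  by rewrite -(micro_tensC h2 h1 h2 h4 h3 h4 m1 m2 m3 m4) e1 e2 tens_id.
 change (v (gm (gprod H K)) \o' i_ H:~K = (v (gm (gprod H K)) \o' (i_ H:~K \o' u (mon_tens (gm H) (gm K)))) \o'
  (v (mon_tens (gm H) (gm K)) \o' (u (gm H) \x u (gm K))) \o' (v (gm H) \x v (gm K))).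
 have -> : i_ H:~K \o' u (mon_tens (gm H) (gm K)) = u (mon_tens (gm H) (gm K)) := (micro_comp1 h5 h6 m5).1.
 have mvu : is_micro (v (mon_tens (gm H) (gm K)) \o' (u (gm H) \x u (gm K))) by exact: (comp_micro hGG hHK h5 muu m6).
 have -> : (v (gm (gprod H K)) \o' u (mon_tens (gm H) (gm K))) \o' (v (mon_tens (gm H) (gm K)) \o' (u (gm H) \x u (gm K))) = v (gm (gprod H K)) \o' (u (gm H) \x u (gm K)).
  by rewrite -(micro_compA hGG h5 hHK h7 m8 m5 mvu) (iso_pairK iT hGG muu).
 by rewrite -(micro_compA hHK hGG hHK h7 m8 muu mvv) euv.
have gU := gpd_monoid (gunit_valid R); have g1 := mon_unit_valid R; have i1 := iso g1.
have [h1 h2 m1 m2 [_ e1]] := i1; have [h3 h4 m3 m4 _] := iso gU.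
change (v (gm (gunit R)) \o' i_ (mfunit R) = (v (gm (gunit R)) \o' (i_ (mfunit R) \o' u (mon_unit C))) \o' v (mon_unit C)).
have -> : i_ (mfunit R) \o' u (mon_unit C) = u (mon_unit C) := (micro_comp1 h1 h2 m1).1.
have e1' : u (mon_unit C) \o' v (mon_unit C) = i_ (mfunit R) := e1.
by rewrite -(micro_compA h2 h1 h2 h3 m4 m1 m2) e1'.
Qed.
Lemma quasi_inverse_eps : is_monoidal_natural_iso (F := functor_comp (functorM R) quasi_inverse) (G := functor_id (Mon C)) u.
Proof.
split.
- by move=> Y hY; exists (v Y); exact: huv.
- move=> X Y f hX hY [mf' _ _]; have [? ? ? ? _] := iso hX; have [? ? ? ? _] := iso hY.
 by rewrite /= (iso_pairK (iso hY)); try vm.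
- move=> X Y hX hY; have hXY := mtens_valid hX hY; have [? ? ? ? _] := iso hX; have [? ? ? ? _] := iso hY; have [? ? ? ? _] := iso hXY.
 have muu : is_micro (u X \x u Y) by vm. have hGG : is_mf (G X):~(G Y) by vm.
 have m' : is_micro (v (mon_tens X Y) \o' (u X \x u Y)) by vm.
 change (u (mon_tens X Y) \o' ((v (mon_tens X Y) \o' (u X \x u Y)) \o' i_ (G X):~(G Y)) = i_ (mon_ob (mon_tens X Y)) \o' (u X \x u Y)).
 rewrite (micro_comp1 _ _ m').2 // (iso_pairK (iso hXY) hGG muu).
 by symmetry; exact: (micro_comp1 hGG _ muu).1.
have i1 := iso (mon_unit_valid R); have [h1 h2 m1 m2 [_ e1]] := i1.
change (u (mon_unit C) \o' (v (mon_unit C) \o' i_ (mon_ob (mon_unit C))) = i_ (mon_ob (mon_unit C))).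
by rewrite (micro_comp1 h2 h1 m2).2.
Qed.
End QuasiInverse.
Lemma functorM_equivalence : is_sm_equivalence (functorM R).
Proof.
have H (Y : premonoid C) : exists p : {G : pregroupoid R & (premicro G (mon_ob Y) * premicro (mon_ob Y) G)%type},
  is_monoid Y -> gp (tag p) /\ @inverses (Mon C) (gm (tag p)) Y (tagged p).1 (tagged p).2.
 have [hY|nY] := pselect (is_monoid Y).
  by have [G [u [v [hG huv]]]] := monoid_groupoid hY; exists (existT _ G (u, v)).
 (* Dummy data for premonoids that are not monoids, so that the choice is a total function. *)
 pose G0 := @PreGroupoid R (mon_ob Y) id id setT fst setT id.
 by exists (existT (fun G : pregroupoid R => (premicro G (mon_ob Y) * premicro (mon_ob Y) G)%type) G0 (i_ (mon_ob Y), i_ (mon_ob Y))).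
pose P Y := sval (cid (H Y)); have hP Y := svalP (cid (H Y)).
have hG Y (hY : is_monoid Y) := (hP Y hY).1; have huv Y (hY : is_monoid Y) := (hP Y hY).2.
split; [exact: is_smc_Gpd|exact: is_smc_Mon|exact: functorM_sm |].
exists (quasi_inverse (fun Y => (tagged (P Y)).1) (fun Y => (tagged (P Y)).2)); split; first exact: quasi_inverse_sm hG huv.
by split; eexists; [exact: quasi_inverse_eta hG huv|exact: quasi_inverse_eps hG huv].
Qed.
End Equivalence.
Theorem theorem9 (R : realType) :
 is_smc (SymplMic R) /\ is_sm_equivalence (functorM R).
Proof. by split; [exact: is_smc_SymplMic|exact: functorM_equivalence]. Qed.
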